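(* For every integer $d\ge 3$ there is a constant $\vartheta_d<2/d$ such that, for every $\varepsilon>0$ and for every pair $(F_1,F_2)$ of non-isomorphic forms of $\mathrm{Bin}(d,\mathbb{Z})$, one has, as $N\to\infty$, $$\mathcal{N}(F_1,F_2;N)=O_{F_1,F_2,\varepsilon}\left(N^{\vartheta_d+\varepsilon}\right).$$
   Context: For an integer $d\ge 3$, $\mathrm{Bin}(d,\mathbb{Z})$ is the set of binary forms $F(X,Y)$ of degree $d$ with integer coefficients and nonzero discriminant. For $\gamma=\begin{pmatrix} a_1 & a_2 \\ a_3 & a_4 \end{pmatrix}\in \mathrm{GL}(2,\mathbb{Q})$, put $(F\circ\gamma)(X_1,X_2)=F(a_1X_1+a_2X_2,\,a_3X_1+a_4X_2)$. Two forms $F_1,F_2\in \mathrm{Bin}(d,\mathbb{Z})$ are isomorphic if there is $\gamma\in\mathrm{GL}(2,\mathbb{Q})$ with $F_1\circ\gamma=F_2$. For an integer $N\ge1$, $$\mathcal{N}(F_1,F_2;N):=\sharp\left(F_1(\mathbb{Z}^2)\cap F_2(\mathbb{Z}^2)\cap[-N,N]\right),$$ the number of integers $m$ with $|m|\le N$ for which there is $(x_1,x_2,x_3,x_4)\in\mathbb{Z}^4$ with $m=F_1(x_1,x_2)=F_2(x_3,x_4)$. *)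

(* Defs.v *)
From HB Require Import structures.
From mathcomp Require Import all_boot all_order all_algebra finmap.
From mathcomp Require Import mpoly.
From mathcomp Require Import boolp classical_sets functions cardinality.

Set Implicit Arguments.
Unset Strict Implicit.
Unset Printing Implicit Defensive.

Import GRing.Theory.

Local Open Scope ring_scope.
Local Open Scope classical_set_scope.

(* The coefficient of X^(m-k) Y^k, where X = 'X_0 and Y = 'X_1. When F is
   homogeneous of degree m it vanishes for k > m, although m - k is truncated. *)
Definition form_coef (K : fieldType) (m : nat) (F : {mpoly K[2]}) (k : nat) : K :=
  F@_[multinom [tuple (m - k)%N; k]].

(* Resultant of binary forms F and G of degrees m and n: the determinant of
   their (m+n) x (m+n) Sylvester matrix. The degrees are explicit, since the
   resultant of the dehomogenized polynomials (mxpoly.resultant) is computed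
   from the actual degrees and so is wrong when a leading coefficient is 0. *)
Definition form_resultant (K : fieldType) (m n : nat) (F G : {mpoly K[2]}) : K :=
  \det (col_mx
    (\matrix_(i < n, j < n + m)
       if (i <= j)%N then form_coef m F (j - i) else 0)
    (\matrix_(i < m, j < n + m)
       if (i <= j)%N then form_coef n G (j - i) else 0)).

(* Discriminant of a binary form of degree d over a field of characteristic 0,
   normalized as the discriminant prod_(i<j) (a_i b_j - a_j b_i)^2 of
   prod_i (a_i X - b_i Y); for d = 2 this is b^2 - 4ac. *)
Definition form_disc (K : fieldType) (d : nat) (F : {mpoly K[2]}) : K :=
  (-1) ^+ 'C(d, 2) * form_resultant d.-1 d.-1 F^`M(0) F^`M(1)
    / d%:R ^+ (d - 2).

Definition form_rat (F : {mpoly int[2]}) : {mpoly rat[2]} := map_mpoly intr F.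

Definition Bin (d : nat) (F : {mpoly int[2]}) : bool :=
  (F \is d.-homog) && (form_disc d (form_rat F) != 0).

(* F o g = F(g_00 X + g_01 Y, g_10 X + g_11 Y) *)
Definition form_act (F : {mpoly rat[2]}) (g : 'M[rat]_2) : {mpoly rat[2]} :=
  F \mPo [tuple \sum_(j < 2) g i j *: 'X_j | i < 2].

Definition form_isomorphic (F1 F2 : {mpoly int[2]}) : Prop :=
  exists2 g : 'M[rat]_2,
    g \in unitmx & form_act (form_rat F1) g = form_rat F2.

Definition form_values (F : {mpoly int[2]}) : set int :=
  [set m | exists x y : int, m = F.@[tnth [tuple x; y]]].

(* fset_set is only meaningful on finite sets; this one lies in [-N, N]. *)
Definition calN (F1 F2 : {mpoly int[2]}) (N : nat) : nat :=
  #|` fset_set (form_values F1 `&` form_values F2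
                `&` [set m : int | (`|m| <= N%:Z)%R]) |.

(* Main.v *)
Require Import Defs.
From HB Require Import structures.
From mathcomp Require Import all_boot all_order all_algebra.
From mathcomp Require Import boolp.
From mathcomp Require Import perm.
From mathcomp Require Import zify ring lra.
Set Implicit Arguments.
Unset Strict Implicit.
Unset Printing Implicit Defensive.
Import Order.TTheory GRing.Theory Num.Theory.
Local Open Scope ring_scope.

(** Put B = t^M and N = t^(dM-a). A nonzero value m with |m| <= N common to F1
and F2 either has representations with all four coordinates at most B, or comes
from a point of one of the two forms in a cusp, that is with a coordinate above B.

Box. Up to a common factor the four coordinates form a primitive integral point
of the surface F1(x0,x1) = F2(x2,x3). As F1 and F2 are not isomorphic, m vanishes
on every rational line of this surface. By Siegel's lemma each such point lies on
a plane with small integral coefficients. On a plane section the p-adic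
determinant method (a pigeonhole construction of an auxiliary form for each
residue class modulo a prime power, the class being parametrised by Hensel's
lemma) leaves few points, since the section has no factor of low degree; planes
with large coefficients gain from an integral functional that is small on them.
The result is O(t^(2M-b)) values, a saving of a fixed power of t over B^2.

Cusps. A primitive point of a cusp gives a slope at which f(s) = F(s,1) is tiny.
There f is locally inverse Lipschitz, so the slopes cluster while distinct slopes
repel each other, and each scale contributes few points. Thue's method, applied
to A(X) - Y B(X) expanded at the better of two approximations instead of at the
root, bounds the height of all but finitely many points by a power of N, so only
boundedly many scales occur. *)

(** * Counting and the pigeonhole principle *)

(** All sizes are integral powers of one parameter [t], so every estimate is an inequality between
    natural exponents, and counting is by duplicate-free lists, which needs no decidability.
    Siegel's lemma yields about B^(4/3) planes, and a section without factors of degree below e in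
    its first coordinate carries about B^(2/e) points. For e = 3 the product is exactly B^2. Hence
    for d = 3, where a section without linear factor is irreducible, a saving has to come from the
    functionals on planes with large coefficients. For d >= 4 the value e = 4 would leave room, but
    a section may split into conics. So Siegel's lemma is asked for planes whose last two
    coefficients are divisible by a large power of a small prime p: modulo p the section becomes A
    X^d - F(Y) with F separable, and Eisenstein's criterion applies. This costs more planes, but
    still fewer than the room allows. Thue's theorem cannot be avoided by counting: a primitive
    point of bounded value might have any height, and the gap between slopes bounds only the points
    of one scale. *)

Definition atmost (T : eqType) (n : nat) (P : T -> Prop) :=
  forall s : seq T, uniq s -> (forall x, x \in s -> P x) -> (size s <= n)%N.

Lemma atmost_sub (T : eqType) n (P Q : T -> Prop) :
  (forall x, P x -> Q x) -> atmost n Q -> atmost n P.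
Proof. by move=> PQ hQ s us hs; apply: hQ => // x /hs /PQ. Qed.

Lemma atmost_leq (T : eqType) n n' (P : T -> Prop) :
  (n <= n')%N -> atmost n P -> atmost n' P.
Proof. by move=> le h s us hs; apply: leq_trans le; apply: h. Qed.

Lemma atmost_seq (T : eqType) (ks : seq T) (P : T -> Prop) :
  (forall x, P x -> x \in ks) -> atmost (size ks) P.
Proof. by move=> h s us hs; apply: uniq_leq_size => // x /hs /h. Qed.

Lemma atmost0 (T : eqType) n (P : T -> Prop) :
  (forall x, ~ P x) -> atmost n P.
Proof. by move=> h [|x s] // us hs; case: (h x); apply: hs; rewrite inE eqxx. Qed.

Lemma atmost_keys (T K : eqType) (ks : seq K) m (Q : K -> T -> Prop)
    (P : T -> Prop) :
  (forall x, P x -> exists2 k, k \in ks & Q k x) ->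
  (forall k, k \in ks -> atmost m (Q k)) -> atmost (size ks * m) P.
Proof.
elim: ks P => [|k ks IH] P cov hQ s us hs.
  by case: s us hs => // x s _ hs; have [] := cov x (hs x (mem_head _ _)).
rewrite -(count_predC (fun x => `[< Q k x >])) mulSn leq_add //.
  rewrite -size_filter; apply: (hQ k (mem_head _ _)); first exact: filter_uniq.
  by move=> x; rewrite mem_filter => /andP[/asboolP].
rewrite -size_filter.
apply: (IH (fun x => P x /\ ~ Q k x)); last 2 first.
- exact: filter_uniq.
- by move=> x; rewrite mem_filter => /andP[/= /asboolP nq /hs].
- move=> x [/cov[k']]; rewrite inE => /orP[/eqP -> //|k'ks] q _; by exists k'.
- by move=> k' hk'; apply: hQ; rewrite inE hk' orbT.
Qed.

Lemma atmostU (T : eqType) n m (P Q : T -> Prop) :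
  atmost n P -> atmost m Q -> atmost (n + m) (fun x => P x \/ Q x).
Proof.
move=> hP hQ s us hs; rewrite -(count_predC (fun x => `[< P x >])) leq_add //.
  rewrite -size_filter; apply: hP; first exact: filter_uniq.
  by move=> x; rewrite mem_filter => /andP[/asboolP].
rewrite -size_filter; apply: hQ; first exact: filter_uniq.
by move=> x; rewrite mem_filter => /andP[/= /asboolP nP /hs[]].
Qed.

Lemma atmost_image (T U : eqType) n (f : T -> U) (P : T -> Prop)
    (Q : U -> Prop) :
  (forall y, Q y -> exists2 x, P x & y = f x) -> atmost n P -> atmost n Q.
Proof.
move=> cov hP s us hs.
have [s' [es hs']] : exists s', map f s' = s /\ (forall x, x \in s' -> P x).
  elim: s {us} hs => [|y s IH] hs; first by exists [::].
  have [|s' [<- hs']] := IH; first by move=> x xs; apply: hs; rewrite inE xs orbT.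
  have [x Px ->] := cov y (hs _ (mem_head _ _)).
  by exists (x :: s'); split=> // z; rewrite inE => /orP[/eqP ->|/hs'].
by rewrite -es size_map; apply: hP => //; apply: (map_uniq (f := f)); rewrite es.
Qed.

Lemma atmost_fibers (T K : eqType) n m (f : T -> K) (P : T -> Prop)
    (R : K -> Prop) :
  atmost n R -> (forall x, P x -> R (f x)) ->
  (forall k, R k -> atmost m (fun x => P x /\ f x = k)) -> atmost (n * m) P.
Proof.
move=> hR PR hf s us hs; pose ks := undup (map f s).
have ksR k : k \in ks -> R k.
  by rewrite mem_undup => /mapP[x /hs /PR h ->].
apply: leq_trans (leq_mul (hR ks (undup_uniq _) ksR) (leqnn m)).
apply: (@atmost_keys _ _ ks m (fun k x => P x /\ f x = k)
          (fun x => P x /\ f x \in ks)) => //.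
- by move=> x [Px fx]; exists (f x).
- by move=> k /ksR /hf.
- by move=> x xs; split; [apply: hs | rewrite mem_undup map_f].
Qed.

Lemma atmost_prod (T U : eqType) n m (P : T -> Prop) (Q : U -> Prop) :
  atmost n P -> atmost m Q ->
  atmost (n * m) (fun x : T * U => P x.1 /\ Q x.2).
Proof.
move=> hP hQ; apply: (atmost_fibers (f := fst) hP) => [x []|k Pk] //.
apply: (@atmost_image _ _ _ (fun u => (k, u)) Q) => // -[a b] /= [[_ Qb] ->].
by exists b.
Qed.

Definition int_range (n : nat) : seq int :=
  [seq (i%:Z - n%:Z) | i <- iota 0 (2 * n).+1].

Lemma size_int_range n : size (int_range n) = (2 * n).+1.
Proof. by rewrite size_map size_iota. Qed.

Lemma mem_int_range n (x : int) : (x \in int_range n) = (`|x| <= n)%N.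
Proof.
apply/mapP/idP => [[i]|hx]; first by rewrite mem_iota => hi ->; lia.
exists (absz (x + n%:Z)%R); [rewrite mem_iota; lia | lia].
Qed.

Lemma atmost_int n : atmost (2 * n).+1 (fun x : int => (`|x| <= n)%N).
Proof.
by rewrite -size_int_range; apply: atmost_seq => x; rewrite mem_int_range.
Qed.

Lemma atmost_roots (R : idomainType) n (p : {poly R}) :
  p != 0 -> (size p <= n.+1)%N -> atmost n (fun x => p.[x] = 0).
Proof.
move=> p0 sp s us hs; rewrite -ltnS; apply: leq_trans sp.
by apply: max_poly_roots => //; apply/allP => x /hs /eqP.
Qed.

Lemma absz_sum (I : Type) (r : seq I) (P : pred I) (F : I -> int) :
  (`|(\sum_(i <- r | P i) F i)%R| <= \sum_(i <- r | P i) `|F i|)%N.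
Proof.
elim/big_ind2: _ => //= a b c e h1 h2; lia.
Qed.

(* Siegel's lemma in congruence form; exact equations are obtained from it by taking the moduli larger than the values of the linear forms. *)
Lemma small_solution (I J : finType) (m : J -> nat) (X : I -> nat)
    (L : J -> I -> int) :
  (forall j, 0 < m j)%N -> (\prod_j m j < \prod_i (X i).+1)%N ->
  exists q : I -> int, [/\ exists i, q i != 0, forall i, (`|q i| <= X i)%N &
    forall j, ((m j)%:Z %| \sum_i L j i * q i)%Z].
Proof.
move=> m0 lt.
pose D := {dffun forall i : I, 'I_(X i).+1}.
pose C := {dffun forall j : J, 'I_(m j).-1.+1}.
pose v (a : D) j := (\sum_i L j i * (a i)%:Z) : int.
have vlt a j : (`|(v a j %% (m j)%:Z)%Z| < (m j).-1.+1)%N.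
  have mp : 0 < (m j)%:Z by have := m0 j; lia.
  by have := ltz_pmod (v a j) mp; have := modz_ge0 (v a j) (lt0r_neq0 mp); lia.
pose f (a : D) : C := finfun (fun j => Ordinal (vlt a j)).
have ninj : ~ injective f.
  move=> /leq_card; rewrite !card_dep_ffun !foldrE !big_image /=.
  apply/negP; rewrite -ltnNge.
  under eq_bigr do rewrite card_ord prednK //.
  by under [X in (_ < X)%N]eq_bigr do rewrite card_ord.
have [a [b [ab fab]]] : exists a b, a <> b /\ f a = f b.
  apply/not_existsP => h; apply: ninj => a b fab.
  by apply/not_notP => ab; apply: (h a); exists b.
exists (fun i => (a i)%:Z - (b i)%:Z); split.
- apply/not_existsP => h; apply: ab; apply/ffunP => i; apply/val_inj => /=.
  by have := h i; rewrite subr_eq0 => /negP; rewrite negbK => /eqP; lia.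
- by move=> i; have := ltn_ord (a i); have := ltn_ord (b i); lia.
- move=> j; have /ffunP/(_ j) := fab; rewrite !ffunE => /(congr1 val) /= e.
  have -> : \sum_i L j i * ((a i)%:Z - (b i)%:Z) = v a j - v b j.
    by rewrite -sumrB; apply: eq_bigr => i _; rewrite mulrBr.
  have mz : (m j)%:Z != 0 by have := m0 j; lia.
  rewrite -eqz_mod_dvd; apply/eqP; move: e.
  by have := modz_ge0 (v a j) mz; have := modz_ge0 (v b j) mz; lia.
Qed.

(** * Binary forms with integral coefficients *)

Lemma leqXn m n k : (m <= n)%N -> (m ^ k <= n ^ k)%N.
Proof. by case: k => // k h; rewrite leq_exp2r. Qed.

Section BinaryForms.
Variable R : comNzRingType.
Implicit Types (f : {poly int}) (x y a b h : R).

(** A binary form is kept as its dehomogenisation [f] together with the degree [d], and is evaluated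
    in any commutative ring: the same [bf] serves over the integers, in characteristic p, and with
    polynomials as arguments. *)
Definition bf d f x y : R :=
  \sum_(i < d.+1) (f`_i)%:~R * (x ^+ i * y ^+ (d - i)).
Definition bfx d f x y : R :=
  \sum_(i < d.+1) (f`_i)%:~R * ((i%:R * x ^+ i.-1) * y ^+ (d - i)).
Definition bfy d f x y : R :=
  \sum_(i < d.+1) (f`_i)%:~R * (x ^+ i * ((d - i)%:R * y ^+ (d - i).-1)).

Lemma bf_hom d f c x y : bf d f (c * x) (c * y) = c ^+ d * bf d f x y.
Proof.
rewrite /bf mulr_sumr; apply: eq_bigr => i _; rewrite !exprMn.
have -> : c ^+ d = c ^+ i * c ^+ (d - i) by rewrite -exprD subnKC // -ltnS.
by ring.
Qed.

Lemma euler_bf d f x y : x * bfx d f x y + y * bfy d f x y = d%:R * bf d f x y.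
Proof.
rewrite /bf /bfx /bfy !mulr_sumr -big_split /=; apply: eq_bigr => i _.
have e z n : z * (n%:R * z ^+ n.-1) = n%:R * z ^+ n :> R.
  by case: n => [|n]; rewrite ?mul0r ?mulr0 // mulrCA -exprS.
have -> : d%:R = i%:R + (d - i)%:R :> R by rewrite -natrD subnKC // -ltnS.
set c := _%:~R; set p := (d - _)%N.
transitivity (c * ((x * (i%:R * x ^+ i.-1)) * y ^+ p + x ^+ i * (y * (p%:R * y ^+ p.-1)))).
  by ring.
by rewrite !e; ring.
Qed.

Lemma bfx_hom d f c x y :
  bfx d f (c * x) (c * y) = c ^+ d.-1 * bfx d f x y.
Proof.
rewrite /bfx mulr_sumr; apply: eq_bigr => -[[|i] /= hi] _; first by rewrite !mul0r !mulr0.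
rewrite !exprMn; have -> : c ^+ d.-1 = c ^+ i * c ^+ (d - i.+1).
  by rewrite -exprD; congr (_ ^+ _); lia.
by ring.
Qed.

Lemma bfy_hom d f c x y :
  bfy d f (c * x) (c * y) = c ^+ d.-1 * bfy d f x y.
Proof.
rewrite /bfy mulr_sumr; apply: eq_bigr => -[i /= hi] _.
case: (leqP d i) => hid.
  have -> : (d - i = 0)%N by lia.
  by rewrite !mul0r !mulr0.
rewrite !exprMn; have -> : c ^+ d.-1 = c ^+ i * c ^+ (d - i).-1.
  by rewrite -exprD; congr (_ ^+ _); lia.
by ring.
Qed.

(** A first-order Taylor expansion with unnamed remainder. In this division-free form it is closed
    under sums and products, so it passes from powers to [bf] in every commutative ring. *)
Definition agree2 h (A B C : R) := exists r, A = B + h * C + h ^+ 2 * r.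

Lemma agree2D h A B C A' B' C' :
  agree2 h A B C -> agree2 h A' B' C' -> agree2 h (A + A') (B + B') (C + C').
Proof. by move=> [r ->] [s ->]; exists (r + s); ring. Qed.

Lemma agree2M h A B C A' B' C' :
  agree2 h A B C -> agree2 h A' B' C' ->
  agree2 h (A * A') (B * B') (B * C' + C * B').
Proof.
move=> [r ->] [s ->].
by exists (B * s + C * C' + r * B' + h * C * s + h * r * C' + h ^+ 2 * r * s); ring.
Qed.

Lemma agree2X h x a n : agree2 h ((x + h * a) ^+ n) (x ^+ n) (n%:R * x ^+ n.-1 * a).
Proof.
elim: n => [|n IH]; first by exists 0; rewrite !expr0 mul0r; ring.
have h1 : agree2 h (x + h * a) x a by exists 0; ring.
have [r e] := agree2M h1 IH; exists r; rewrite exprS e -exprS.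
case: n {IH e} => [|n] /=; first by rewrite !expr0; ring.
by rewrite !exprS -[in RHS]addn1 natrD; ring.
Qed.

Lemma bf_taylor d f x y a b h :
  agree2 h (bf d f (x + h * a) (y + h * b)) (bf d f x y)
    (a * bfx d f x y + b * bfy d f x y).
Proof.
have -> : a * bfx d f x y + b * bfy d f x y = \sum_(i < d.+1) (f`_i)%:~R *
    (x ^+ i * ((d - i)%:R * y ^+ (d - i).-1 * b) + i%:R * x ^+ i.-1 * a * y ^+ (d - i)).
  by rewrite /bfx /bfy !mulr_sumr -big_split /=; apply: eq_bigr => i _; ring.
rewrite /bf; apply: (big_ind3 (fun A B C => agree2 h A B C)).
- by exists 0; ring.
- by move=> *; apply: agree2D.
- move=> i _; have [r e] := agree2M (agree2X h x a i) (agree2X h y b (d - i)).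
  by exists ((f`_i)%:~R * r); rewrite e; ring.
Qed.

Lemma bf_y1 d f x : (size f <= d.+1)%N -> bf d f x 1 = (map_poly intr f).[x].
Proof.
move=> sf; rewrite (horner_coef_wide (n := d.+1)); last first.
  by apply: leq_trans sf; apply: size_poly.
by apply: eq_bigr => i _; rewrite coef_map expr1n mulr1.
Qed.

Lemma bfx_y1 d f x :
  (size f <= d.+1)%N -> bfx d f x 1 = (map_poly intr f^`()).[x].
Proof.
move=> sf; rewrite (horner_coef_wide (n := d)); last first.
  apply: leq_trans (size_poly _ _) _; apply: leq_trans (size_poly _ _) _.
  by move: sf; lia.
rewrite /bfx big_ord_recl /= !mul0r mulr0 add0r; apply: eq_bigr => i _.
rewrite coef_map coef_deriv expr1n mulr1 /=.
by rewrite -[_ *+ i.+1]mulr_natr intrM natz -pmulrn mulrA.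
Qed.

Lemma bf_y0 d f x : bf d f x 0 = (f`_d)%:~R * x ^+ d.
Proof.
rewrite /bf big_ord_recr /= subnn expr0 mulr1 big1 ?add0r // => i _.
by rewrite expr0n subn_eq0 leqNgt ltn_ord /= !mulr0.
Qed.

Lemma bfx_y0 d f x : bfx d f x 0 = (f`_d)%:~R * (d%:R * x ^+ d.-1).
Proof.
rewrite /bfx big_ord_recr /= subnn expr0 mulr1 big1 ?add0r // => i _.
by rewrite expr0n subn_eq0 leqNgt ltn_ord /= !mulr0.
Qed.

End BinaryForms.

Section BinaryFormMorphism.
Variables (R S : comNzRingType) (phi : {rmorphism R -> S}).

Lemma rmorph_bf d f x y : phi (bf d f x y) = bf d f (phi x) (phi y).
Proof.
rewrite /bf rmorph_sum; apply: eq_bigr => i _.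
by rewrite !rmorphM !rmorphXn rmorph_int.
Qed.

Lemma rmorph_bfx d f x y : phi (bfx d f x y) = bfx d f (phi x) (phi y).
Proof.
rewrite /bfx rmorph_sum; apply: eq_bigr => i _.
by rewrite !rmorphM !rmorphXn rmorph_int rmorph_nat.
Qed.

Lemma rmorph_bfy d f x y : phi (bfy d f x y) = bfy d f (phi x) (phi y).
Proof.
rewrite /bfy rmorph_sum; apply: eq_bigr => i _.
by rewrite !rmorphM !rmorphXn rmorph_int rmorph_nat.
Qed.
End BinaryFormMorphism.

(* Separability is recorded by a Bezout identity over Z, so that it survives reduction modulo every prime not dividing the constant. *)
Definition sepform d (f : {poly int}) :=
  size f = d.+1 /\
  exists2 D : int, D != 0 & exists u v : {poly int}, u * f + v * f^`() = D%:P.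

Lemma sepform_lead d f : sepform d f -> f`_d != 0.
Proof.
case=> sf _; have : lead_coef f != 0 by rewrite lead_coef_eq0 -size_poly_eq0 sf.
by rewrite lead_coefE sf.
Qed.

(** At y = 0 the nonzero leading coefficient forces x = 0. Elsewhere the form vanishes too by
    Euler's identity, so x / y would be a common root of [f] and its derivative, against the Bezout
    identity. *)
Lemma sepform_smooth (K : fieldType) d f (x y : K) :
  (0 < d)%N -> [pchar K] =i pred0 -> sepform d f ->
  bfx d f x y = 0 -> bfy d f x y = 0 -> x = 0 /\ y = 0.
Proof.
move=> d0 ch sf hx hy; have intK (n : int) : n != 0 -> n%:~R != 0 :> K.
  have natK k : k != 0%N -> k%:R != 0 :> K.
    by move=> k0; move/pcharf0P: ch => ->.
  by case: n => n n0; rewrite ?NegzE ?rmorphN ?oppr_eq0; apply: natK.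
have natK (n : nat) : (0 < n)%N -> n%:R != 0 :> K by move=> n0; apply: (intK n%:Z); lia.
have ld := sepform_lead sf.
have [y0|yn0] := eqVneq y 0.
  move: hx; rewrite y0 bfx_y0 => /eqP; rewrite !mulf_eq0 (negPf (intK _ ld)).
  by rewrite (negPf (natK _ d0)) /= expf_eq0 => /andP[_ /eqP].
have [size_f [D D0 [u [v e]]]] := sf.
have ex : x = y * (x / y) by field.
have h1 : bf d f x y = 0.
  have := euler_bf d f x y; rewrite hx hy !mulr0 addr0 => /esym/eqP.
  by rewrite mulf_eq0 (negPf (natK _ d0)) => /eqP.
have {}h1 : bf d f (y * (x / y)) (y * 1) = 0 by rewrite -ex mulr1.
have {}hx : bfx d f (y * (x / y)) (y * 1) = 0 by rewrite -ex mulr1.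
move: h1; rewrite bf_hom => /eqP; rewrite mulf_eq0 expf_eq0 (negPf yn0) andbF /=.
rewrite bf_y1 ?size_f // => /eqP h1.
move: hx; rewrite bfx_hom => /eqP; rewrite mulf_eq0 expf_eq0 (negPf yn0) andbF /=.
rewrite bfx_y1 ?size_f // => /eqP h2.
have := congr1 (fun p : {poly int} => (map_poly intr p : {poly K}).[x / y]) e.
rewrite /= rmorphD !rmorphM /= hornerD !hornerM h1 h2 !mulr0 addr0.
by rewrite map_polyC hornerC /= => /esym/eqP; rewrite (negPf (intK _ D0)).
Qed.

Lemma sepform_smooth_int d f (x y : int) :
  (0 < d)%N -> sepform d f ->
  bfx d f x y = 0 -> bfy d f x y = 0 -> x = 0 /\ y = 0.
Proof.
move=> d0 sf hx hy.
have := @sepform_smooth rat d f x%:~R y%:~R d0 (pchar_num _) sf.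
rewrite -!rmorph_bfx -!rmorph_bfy hx hy => -[//|//|/eqP + /eqP].
by rewrite !intr_eq0 => /eqP -> /eqP ->.
Qed.

Definition bf_norm (f : {poly int}) : nat := (\sum_(i < size f) `|(f`_i)%R|)%N.

Lemma bf_bound d (f : {poly int}) (B : nat) (x y : int) :
  (size f <= d.+1)%N -> (`|x| <= B)%N -> (`|y| <= B)%N ->
  (`|bf d f x y| <= bf_norm f * B ^ d)%N.
Proof.
move=> sf hx hy; apply: leq_trans (absz_sum _ _ _) _.
have -> : bf_norm f = (\sum_(i < d.+1) `|(f`_i)%R|)%N.
  rewrite /bf_norm -!(big_mkord xpredT (fun i => `|(f`_i)%R|%N)) [in RHS](big_cat_nat (n := size f)) //=.
  rewrite [X in (_ + X)%N]big_nat_cond [X in (_ + X)%N]big1 ?addn0 // => i /andP[/andP[hi _] _].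
  by rewrite nth_default.
rewrite big_distrl /=; apply: leq_sum => i _; rewrite intz !abszM !abszX leq_mul //.
have -> : (B ^ d = B ^ i * B ^ (d - i))%N by rewrite -expnD subnKC // -ltnS.
by rewrite leq_mul // leqXn.
Qed.

(** * Small primes avoiding a given integer *)

Lemma pfactor_central_bin p n :
  prime p -> (0 < n)%N -> (p ^ logn p 'C(2 * n, n) <= 2 * n)%N.
Proof.
move=> pp n0; have p1 := prime_gt1 pp; have p0 := prime_gt0 pp.
have wide m : (m <= 2 * n)%N ->
    (logn p m`! = \sum_(1 <= k < (2 * n).+1) m %/ p ^ k)%N.
  move=> hm; rewrite logn_fact // [RHS](big_cat_nat (n := m.+1)) //=.
  rewrite [X in (_ + X)%N]big_nat_cond [X in (_ + X)%N]big1 ?addn0 // => k.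
  case/andP=> /andP[hk _] _; apply: divn_small.
  by apply: leq_trans (ltn_expl m p1) _; rewrite leq_exp2l // ltnW.
have e : ('C(2 * n, n) * (n`! * n`!) = (2 * n)`!)%N.
  by have := bin_fact (m := n) (n := (2 * n)%N); rewrite mul2n -addnn addnK; apply; lia.
have b0 : (0 < 'C(2 * n, n))%N by rewrite bin_gt0; lia.
have := congr1 (logn p) e; rewrite !lognM ?muln_gt0 ?fact_gt0 // !wide; [|lia..].
move=> {}e; have : (logn p 'C(2 * n, n) <= trunc_log p (2 * n))%N.
  (* In Legendre's formula the k-th term of (2n)! exceeds twice that of n! by at most 1, and only if
     p^k <= 2n. *)
  have le k : (1 <= k)%N -> ((2 * n) %/ p ^ k <= (k <= trunc_log p (2 * n)) +
      (n %/ p ^ k + n %/ p ^ k))%N.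
    move=> k1; case: (leqP k _) => hk.
      have q0 : (0 < p ^ k)%N by rewrite expn_gt0 p0.
      rewrite -ltnS ltn_divLR //; have := divn_eq n (p ^ k).
      by have := ltn_pmod n q0; nia.
    rewrite divn_small //; apply: leq_trans (trunc_log_ltn (2 * n) p1) _.
    by rewrite leq_exp2l.
  have : (\sum_(1 <= k < (2 * n).+1) (2 * n) %/ p ^ k <=
     \sum_(1 <= k < (2 * n).+1) ((k <= trunc_log p (2 * n)) : nat) +
     (\sum_(1 <= k < (2 * n).+1) n %/ p ^ k + \sum_(1 <= k < (2 * n).+1) n %/ p ^ k))%N.
    rewrite -!big_split /= big_nat_cond [X in (_ <= X)%N]big_nat_cond.
    by apply: leq_sum => k /andP[/andP[/le]].
  have tl : (trunc_log p (2 * n) <= 2 * n)%N.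
    apply: leq_trans (ltnW (ltn_expl _ p1)) _; apply: trunc_logP => //; lia.
  suff -> : (\sum_(1 <= k < (2 * n).+1) ((k <= trunc_log p (2 * n)) : nat) =
             trunc_log p (2 * n))%N by lia.
  rewrite -big_mkcond (big_cat_nat (n := (trunc_log p (2 * n)).+1)) //=.
  rewrite [X in (_ + X)%N]big_nat_cond [X in (_ + X)%N]big_pred0 => [|k]; last by lia.
  rewrite addn0 big_nat_cond (eq_bigl (fun k => (1 <= k < (trunc_log p (2 * n)).+1) && true)%N).
    by rewrite -big_nat_cond sum_nat_const_nat; lia.
  by move=> k /=; lia.
move=> h; apply: leq_trans (_ : p ^ trunc_log p (2 * n) <= _)%N.
  by rewrite leq_exp2l.
by apply: trunc_logP => //; lia.
Qed.

Lemma central_bin_lower n : (2 ^ n <= 'C(2 * n, n))%N.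
Proof.
elim: n => // n IH; rewrite expnS.
have h1 : ('C((2 * n).+1, n) = 'C((2 * n).+1, n.+1))%N.
  by rewrite -(bin_sub (m := n.+1)); [congr 'C(_, _) | ]; lia.
have h2 : ('C(2 * n, n) <= 'C((2 * n).+1, n.+1))%N by rewrite binS leq_addl.
have -> : (2 * n.+1 = (2 * n).+2)%N by lia.
by rewrite [X in (_ <= X)%N]binS h1; lia.
Qed.

Lemma leq_self_exp p e : (0 < p)%N -> (0 < e)%N -> (p <= p ^ e)%N.
Proof. by move=> p0; case: e => // e _; rewrite expnS leq_pmulr // expn_gt0 p0. Qed.

Lemma prod_primes_pow g : (0 < g)%N -> g = (\prod_(p <- primes g) p ^ logn p g)%N.
Proof. by move=> g0; rewrite {1}(prod_prime_decomp g0) prime_decompE big_map. Qed.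

Lemma leq_exp_prod (s : seq nat) (F : nat -> nat) a :
  (forall p, p \in s -> a <= F p)%N -> (a ^ size s <= \prod_(p <- s) F p)%N.
Proof.
elim: s => [|p s IH] h; first by rewrite big_nil.
rewrite big_cons expnS leq_mul ?h ?mem_head // IH // => q qs.
by apply: h; rewrite inE qs orbT.
Qed.

Lemma geq_exp_prod (s : seq nat) (F : nat -> nat) a :
  (forall p, p \in s -> F p <= a)%N -> (\prod_(p <- s) F p <= a ^ size s)%N.
Proof.
elim: s => [|p s IH] h; first by rewrite big_nil.
rewrite big_cons expnS leq_mul ?h ?mem_head // IH // => q qs.
by apply: h; rewrite inE qs orbT.
Qed.

Lemma exp2_gt_square K : exists L0, forall L, (L0 <= L -> 4 * K * L ^ 2 < 2 ^ L)%N.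
Proof.
exists (108 * K + 3)%N => L hL; pose m := (L %/ 3)%N.
have hm : (3 * m <= L < 3 * m.+1)%N by have := divn_eq L 3; have := ltn_pmod L (isT : 0 < 3)%N; rewrite -/m; lia.
apply: leq_trans (_ : 2 ^ (3 * m) <= _)%N; last by rewrite leq_exp2l //; lia.
rewrite (mulnC 3) expnM; apply: (@leq_trans (m.+1 ^ 3)); last by rewrite leqXn // ltn_expl.
have h1 : (L ^ 2 < (3 * m.+1) ^ 2)%N by rewrite ltn_exp2r //; lia.
have h2 : (36 * K < m.+1)%N by lia.
by rewrite !expnS !expn0 in h1 *; nia.
Qed.

(** Chebyshev's argument. If all primes up to [t] divided [g], there would be at most log2 g = O(log
    t) of them. Every prime power in the binomial coefficient of 2n over n, with 2n <= t, is at most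
    2n, so this coefficient would be at most exp(O((log t)^2)), while it is at least 2^n. *)
Lemma good_prime K : exists t0, forall t g, (t0 <= t)%N -> (0 < g <= t ^ K)%N ->
  exists p, [/\ prime p, (p <= t)%N & ~~ (p %| g)%N].
Proof.
have [L0 hL0] := exp2_gt_square (2 * K).
exists (2 ^ L0.+1)%N => t g ht /andP[g0 gt].
apply/not_existsP => /= all_dvd; pose n := t./2.
pose L := (trunc_log 2 t).+1.
have t2 : (1 < t)%N by apply: leq_trans ht; rewrite expnS; have := expn_gt0 2 L0; lia.
have n2 : (2 * n <= t <= (2 * n).+1)%N by rewrite /n; lia.
have n0 : (0 < n)%N by lia.
have Lt : (t < 2 ^ L)%N by apply: trunc_log_ltn.
have tL : (2 ^ L.-1 <= t)%N by apply: trunc_logP => //; lia.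
have L0L : (L0 <= L)%N.
  rewrite leqNgt; apply/negP => h; have := leq_trans ht (ltnW Lt).
  by rewrite leq_exp2l // ; lia.
have sub p : p \in primes 'C(2 * n, n) -> p \in primes g.
  rewrite !mem_primes g0 /= => /and3P[pp b0 pd]; rewrite pp /=.
  apply/negPn/negP => npg; apply: (all_dvd p); split=> //.
  apply: leq_trans (_ : 2 * n <= t)%N; last by lia.
  apply: leq_trans (pfactor_central_bin pp n0).
  by apply: leq_self_exp; [exact: prime_gt0 | rewrite logn_gt0 mem_primes pp b0].
have sz : (size (primes 'C(2 * n, n)) <= L * K)%N.
  apply: leq_trans (uniq_leq_size (primes_uniq _) sub) _.
  rewrite -(@leq_exp2l 2) //; apply: leq_trans (_ : t ^ K <= _)%N; last first.
    by rewrite expnM leqXn // ltnW.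
  apply: leq_trans gt; rewrite [X in (_ <= X)%N](prod_primes_pow g0).
  apply: leq_exp_prod => p pg; have pp : prime p by move: pg; rewrite mem_primes => /andP[].
  apply: leq_trans (prime_gt1 pp) _.
  by apply: leq_self_exp; [exact: prime_gt0 | rewrite logn_gt0].
have b0 : (0 < 'C(2 * n, n))%N by rewrite bin_gt0; lia.
have : (2 ^ n <= 2 ^ (L * (L * K)))%N.
  apply: leq_trans (central_bin_lower n) _; rewrite (prod_primes_pow b0).
  apply: leq_trans (_ : (2 ^ L) ^ size (primes 'C(2 * n, n)) <= _)%N.
    apply: geq_exp_prod => p; rewrite mem_primes => /andP[pp _].
    by apply: leq_trans (pfactor_central_bin pp n0) _; lia.
  by rewrite -expnM leq_exp2l // leq_mul2l sz orbT.
rewrite leq_exp2l // => le; have := hL0 L L0L.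
have : (2 ^ L = 2 * 2 ^ L.-1)%N by rewrite -expnS.
set m := (L * (L * K))%N in le; have -> : (4 * (2 * K) * L ^ 2 = 8 * m)%N by rewrite /m; ring.
by lia.
Qed.

Lemma dvdz_congM (m a b c e : int) :
  (m %| a - b)%Z -> (m %| c - e)%Z -> (m %| a * c - b * e)%Z.
Proof.
move=> h1 h2; have -> : a * c - b * e = (a - b) * c + b * (c - e) by ring.
by apply: rpredD; [apply: dvdz_mulr | apply: dvdz_mull].
Qed.

Lemma dvdz_congX (m a b : int) n :
  (m %| a - b)%Z -> (m %| a ^+ n - b ^+ n)%Z.
Proof.
move=> h; elim: n => [|n IH]; first by rewrite subrr dvdz0.
by rewrite !exprS; apply: dvdz_congM.
Qed.

Lemma dvdz_congr0 (m a b : int) : (m %| a - b)%Z -> (m %| a)%Z = (m %| b)%Z.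
Proof.
by move=> h; rewrite -{1}(subrK b a) rpredDl.
Qed.

Lemma dvdz_sub_sum (I : Type) (r : seq I) (P : pred I) (F G : I -> int) (m : int) :
  (forall i, P i -> (m %| F i - G i)%Z) ->
  (m %| \sum_(i <- r | P i) F i - \sum_(i <- r | P i) G i)%Z.
Proof. by move=> h; rewrite -sumrB; apply: rpred_sum => i /h. Qed.

(** * The determinant method on a plane section *)

Section BfCongruence.
Variables (m : int) (d : nat) (f : {poly int}) (x x' y y' : int).
Hypotheses (hx : (m %| x - x')%Z) (hy : (m %| y - y')%Z).

Lemma bf_cong : (m %| bf d f x y - bf d f x' y')%Z.
Proof.
apply: dvdz_sub_sum => i _; apply: dvdz_congM; first by rewrite subrr dvdz0.
by apply: dvdz_congM; apply: dvdz_congX.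
Qed.

Lemma bfx_cong : (m %| bfx d f x y - bfx d f x' y')%Z.
Proof.
apply: dvdz_sub_sum => i _; apply: dvdz_congM; first by rewrite subrr dvdz0.
apply: dvdz_congM; last exact: dvdz_congX.
by apply: dvdz_congM; [rewrite subrr dvdz0 | apply: dvdz_congX].
Qed.

Lemma bfy_cong : (m %| bfy d f x y - bfy d f x' y')%Z.
Proof.
apply: dvdz_sub_sum => i _; apply: dvdz_congM; first by rewrite subrr dvdz0.
apply: dvdz_congM; first exact: dvdz_congX.
by apply: dvdz_congM; [rewrite subrr dvdz0 | apply: dvdz_congX].
Qed.
End BfCongruence.

Definition o0 : 'I_4 := @Ordinal 4 0 isT.
Definition o1 : 'I_4 := @Ordinal 4 1 isT.
Definition o2 : 'I_4 := @Ordinal 4 2 isT.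
Definition o3 : 'I_4 := @Ordinal 4 3 isT.

(* The section of the surface f1(x0,x1) = f2(x2,x3) by the plane spanned by N1, N2, N3. *)
Section PlaneSection.
Variables (d : nat) (f1 f2 : {poly int}) (N1 N2 N3 : 'rV[int]_4).

Definition pcoord (A : comNzRingType) (a b c : A) (i : 'I_4) : A :=
  (N1 0 i)%:~R * a + (N2 0 i)%:~R * b + (N3 0 i)%:~R * c.
Definition psec (A : comNzRingType) (a b c : A) : A :=
  bf d f1 (pcoord a b c o0) (pcoord a b c o1) -
  bf d f2 (pcoord a b c o2) (pcoord a b c o3).
(** The derivative of [psec] in the direction [N]; for [N1], [N2], [N3] these are its three partial
    derivatives. *)
Definition pdir (A : comNzRingType) (N : 'rV[int]_4) (a b c : A) : A :=
  ((N 0 o0)%:~R * bfx d f1 (pcoord a b c o0) (pcoord a b c o1) +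
   (N 0 o1)%:~R * bfy d f1 (pcoord a b c o0) (pcoord a b c o1)) -
  ((N 0 o2)%:~R * bfx d f2 (pcoord a b c o2) (pcoord a b c o3) +
   (N 0 o3)%:~R * bfy d f2 (pcoord a b c o2) (pcoord a b c o3)).

Lemma rmorph_pcoord (A B : comNzRingType) (phi : {rmorphism A -> B}) a b c i :
  phi (pcoord a b c i) = pcoord (phi a) (phi b) (phi c) i.
Proof. by rewrite /pcoord !rmorphD !rmorphM !rmorph_int. Qed.

Lemma rmorph_psec (A B : comNzRingType) (phi : {rmorphism A -> B}) a b c :
  phi (psec a b c) = psec (phi a) (phi b) (phi c).
Proof. by rewrite /psec rmorphB !rmorph_bf !rmorph_pcoord. Qed.

Lemma pcoordZ (A : comNzRingType) (k a b c : A) i :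
  pcoord (k * a) (k * b) (k * c) i = k * pcoord a b c i.
Proof. by rewrite /pcoord; ring. Qed.

Lemma psec_hom (A : comNzRingType) (k a b c : A) :
  psec (k * a) (k * b) (k * c) = k ^+ d * psec a b c.
Proof. by rewrite /psec !pcoordZ !bf_hom mulrBr. Qed.

Lemma pdir_hom (A : comNzRingType) N (k a b c : A) :
  pdir N (k * a) (k * b) (k * c) = k ^+ d.-1 * pdir N a b c.
Proof. by rewrite /pdir !pcoordZ !bfx_hom !bfy_hom; ring. Qed.

Lemma psec_taylor (A : comNzRingType) (a b c h : A) :
  agree2 h (psec a b (c + h)) (psec a b c) (pdir N3 a b c).
Proof.
have e i : pcoord a b (c + h) i = pcoord a b c i + h * (N3 0 i)%:~R.
  by rewrite /pcoord; ring.
rewrite /psec /pdir !e.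
have [r1 ->] := bf_taylor d f1 (pcoord a b c o0) (pcoord a b c o1) (N3 0 o0)%:~R (N3 0 o1)%:~R h.
have [r2 ->] := bf_taylor d f2 (pcoord a b c o2) (pcoord a b c o3) (N3 0 o2)%:~R (N3 0 o3)%:~R h.
by exists (r1 - r2); ring.
Qed.

Lemma pcoord_cong (m a b c a' b' c' : int) i :
  (m %| a - a')%Z -> (m %| b - b')%Z -> (m %| c - c')%Z ->
  (m %| pcoord a b c i - pcoord a' b' c' i)%Z.
Proof.
move=> ha hb hc; rewrite /pcoord !intz.
have -> : forall x y z : int, x * a + y * b + z * c - (x * a' + y * b' + z * c') =
  x * (a - a') + y * (b - b') + z * (c - c') by move=> *; ring.
by rewrite !rpredD // dvdz_mull.
Qed.

Lemma psec_cong (m a b c a' b' c' : int) :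
  (m %| a - a')%Z -> (m %| b - b')%Z -> (m %| c - c')%Z ->
  (m %| psec a b c - psec a' b' c')%Z.
Proof.
move=> ha hb hc; rewrite /psec.
have := bf_cong d f1 (pcoord_cong o0 ha hb hc) (pcoord_cong o1 ha hb hc).
have := bf_cong d f2 (pcoord_cong o2 ha hb hc) (pcoord_cong o3 ha hb hc).
set x := bf _ _ _ _; set x' := bf _ _ _ _; set y := bf _ _ _ _; set y' := bf _ _ _ _.
move=> h1 h2; have -> : y - x - (y' - x') = (y - y') - (x - x') by ring.
by rewrite rpredB.
Qed.

Lemma pdir_cong N (m a b c a' b' c' : int) :
  (m %| a - a')%Z -> (m %| b - b')%Z -> (m %| c - c')%Z ->
  (m %| pdir N a b c - pdir N a' b' c')%Z.
Proof.
move=> ha hb hc; rewrite /pdir !intz.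
have := bfx_cong d f1 (pcoord_cong o0 ha hb hc) (pcoord_cong o1 ha hb hc).
have := bfy_cong d f1 (pcoord_cong o0 ha hb hc) (pcoord_cong o1 ha hb hc).
have := bfx_cong d f2 (pcoord_cong o2 ha hb hc) (pcoord_cong o3 ha hb hc).
have := bfy_cong d f2 (pcoord_cong o2 ha hb hc) (pcoord_cong o3 ha hb hc).
set x1 := bfy _ _ _ _; set x1' := bfy _ _ _ _; set x2 := bfx _ _ _ _; set x2' := bfx _ _ _ _.
set y1 := bfy _ _ _ _; set y1' := bfy _ _ _ _; set y2 := bfx _ _ _ _; set y2' := bfx _ _ _ _.
move=> h1 h2 h3 h4.
have -> : forall n0 n1 n2 n3 : int, n0 * y2 + n1 * y1 - (n2 * x2 + n3 * x1) -
   (n0 * y2' + n1 * y1' - (n2 * x2' + n3 * x1')) =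
   n0 * (y2 - y2') + n1 * (y1 - y1') - (n2 * (x2 - x2') + n3 * (x1 - x1')).
  by move=> *; ring.
by rewrite rpredB // rpredD // dvdz_mull.
Qed.

Lemma inverse_mod_pow (p n : nat) (a : int) : prime p -> ~~ (p%:Z %| a)%Z ->
  exists w : int, ((p ^ n)%:Z %| w * a - 1)%Z.
Proof.
move=> pp npa; have cop : coprimez (p ^ n)%:Z a.
  by rewrite coprimezE absz_nat coprimeXl // prime_coprime // ; move: npa; rewrite dvdzE absz_nat.
have /coprimezP[[u v] /= e] := cop; exists v.
have -> : v * a - 1 = - u * (p ^ n)%:Z by lia.
by rewrite dvdz_mull.
Qed.

(* Newton iteration, uniformly over the residue class: v is a polynomial in u - u0 modulo p^n. *)
Lemma hensel_branch (p : nat) (u0 v0 : int) (n : nat) :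
  prime p -> ~~ (p%:Z %| pdir N3 1 u0 v0)%Z ->
  exists phi : {poly int}, forall u v,
    (p%:Z %| u - u0)%Z -> (p%:Z %| v - v0)%Z -> ((p ^ n.+1)%:Z %| psec 1 u v)%Z ->
    ((p ^ n.+1)%:Z %| v - phi.[u - u0])%Z.
Proof.
move=> pp unit0; have [w hw] := inverse_mod_pow 1 pp unit0.
elim: n => [|n [phi IH]]; first by exists v0%:P => u v _ + _; rewrite hornerC expn1.
(* The multiplier [w] inverts the derivative only modulo p and is the same at every step, so
   convergence is linear: each step gains one factor p. *)
exists (phi - w%:P * psec 1 (u0%:P + 'X) phi) => u v hu hv hs.
have pdv k : ((p ^ k.+1)%:Z %| psec 1 u v)%Z -> ((p ^ k)%:Z %| psec 1 u v)%Z.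
  by apply: dvdz_trans; rewrite dvdzE !absz_nat expnS dvdn_mull.
have {}IH := IH u v hu hv (pdv _ hs).
have -> : (phi - w%:P * psec 1 (u0%:P + 'X) phi).[u - u0] =
    phi.[u - u0] - w * psec 1 u phi.[u - u0].
  rewrite hornerD hornerN hornerM hornerC; congr (_ - _ * _).
  rewrite -[LHS]/(horner_eval (u - u0) (psec 1 (u0%:P + 'X) phi)) rmorph_psec rmorph1.
  by rewrite /= /horner_eval /= hornerD hornerX hornerC subrKC.
set a := phi.[_] in IH *; pose h := a - v.
have {}IH : ((p ^ n.+1)%:Z %| h)%Z by rewrite /h -opprB rpredN.
have [r er] := psec_taylor 1 u v h.
have -> : v - (a - w * psec 1 u a) =
    h * ((w * pdir N3 1 u v - 1) + w * h * r) + w * psec 1 u v.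
  by have -> : a = v + h; [rewrite /h; ring | rewrite er; ring].
apply: rpredD; last by rewrite dvdz_mull.
rewrite expnSr PoszM dvdz_mul //; apply: rpredD; last first.
  rewrite dvdz_mulr // dvdz_mull //; apply: dvdz_trans IH.
  by rewrite dvdzE !absz_nat expnS dvdn_mulr.
rewrite expn1 in hw; rewrite (dvdz_congr0 (b := w * pdir N3 1 u0 v0 - 1)) //.
rewrite opprB addrA subrK -mulrBr dvdz_mull // pdir_cong // subrr dvdz0.
Qed.

End PlaneSection.

Definition mono (e : nat * nat * nat) (a b c : int) : int :=
  a ^+ e.1.1 * b ^+ e.1.2 * c ^+ e.2.

Lemma PoszXn (a b : nat) : (a ^ b)%N%:Z = a%:Z ^+ b.
Proof. by elim: b => // b IH; rewrite expnS exprS PoszM IH. Qed.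

Section ClassForm.
Variables (d : nat) (f1 f2 : {poly int}) (N1 N2 N3 : 'rV[int]_4).
Variables (I : finType) (e : I -> nat * nat * nat) (D : nat).
Hypothesis eD : forall i, ((e i).1.1 + (e i).1.2 + (e i).2 = D)%N.
Variables (p k R : nat) (X : I -> nat).
Hypotheses (pp : prime p) (k0 : (0 < k)%N) (R0 : (0 < R)%N).
Hypothesis caps : (\prod_(r < R) (p ^ k) ^ (R - r) < \prod_i (X i).+1)%N.

(** The determinant method as a pigeonhole argument. On the residue class the i-th monomial is,
    modulo a high power of p, a polynomial [psi i] in u - u0, and u - u0 is divisible by q = p^k. So
    it suffices that the r-th coefficient of the combination be divisible by q^(R - r) for r < R; by
    [caps] there are fewer residue patterns than candidates [h]. *)
Lemma class_form (u0 v0 : int) :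
  ~~ (p%:Z %| pdir d f1 f2 N1 N2 N3 N3 1 u0 v0)%Z ->
  exists h : I -> int, [/\ exists i, h i != 0, forall i, (`|h i| <= X i)%N &
   forall a b c : int, psec d f1 f2 N1 N2 N3 a b c = 0 -> ~~ (p%:Z %| a)%Z ->
     ((p ^ k)%:Z %| b - u0 * a)%Z -> (p%:Z %| c - v0 * a)%Z ->
     (((p ^ k) ^ R)%:Z %| \sum_i h i * mono (e i) a b c)%Z].
Proof.
move=> unit0; set q := (p ^ k)%N.
have q0 : (0 < q)%N by rewrite expn_gt0 prime_gt0.
have [phi hphi] := hensel_branch (k * R).-1 pp unit0.
have kR : (k * R).-1.+1 = (k * R)%N by rewrite prednK // muln_gt0 k0.
rewrite kR in hphi.
pose psi i : {poly int} := (u0%:P + 'X) ^+ (e i).1.2 * phi ^+ (e i).2.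
have qp0 (r : 'I_R) : (0 < q ^ (R - r))%N by rewrite expn_gt0 q0.
have [h [h0 hX hd]] := small_solution (I := I) (J := 'I_R)
  (m := fun r => (q ^ (R - r))%N) (fun r i => (psi i)`_r) qp0 caps.
exists h; split=> // a b c s0 npa hb hc; rewrite -/q.
have Qe : (q ^ R = p ^ (k * R))%N by rewrite /q -expnM.
(* Multiplying by an inverse [y] of [a] modulo q^R normalises the point to first coordinate 1. *)
have [y hy] := inverse_mod_pow (k * R) pp npa; rewrite -Qe in hphi hy *.
have qQ : (q%:Z %| (q ^ R)%N%:Z)%Z by rewrite dvdzE !absz_nat dvdn_exp.
have pq : (p%:Z %| q%:Z)%Z by rewrite dvdzE !absz_nat dvdn_exp.
pose u := y * b; pose v := y * c.
have hu : (q%:Z %| u - u0)%Z.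
  have -> : u - u0 = y * (b - u0 * a) + u0 * (y * a - 1) by rewrite /u; ring.
  by rewrite rpredD // dvdz_mull // (dvdz_trans qQ).
have hv : (p%:Z %| v - v0)%Z.
  have -> : v - v0 = y * (c - v0 * a) + v0 * (y * a - 1) by rewrite /v; ring.
  by rewrite rpredD // dvdz_mull // (dvdz_trans pq) // (dvdz_trans qQ).
have hs : ((q ^ R)%N%:Z %| psec d f1 f2 N1 N2 N3 1 u v)%Z.
  rewrite (dvdz_congr0 (b := psec d f1 f2 N1 N2 N3 (y * a) (y * b) (y * c))).
    by rewrite psec_hom s0 mulr0 dvdz0.
  by apply: psec_cong; rewrite ?subrr ?dvdz0 // -opprB rpredN.
have hvp := hphi _ _ (dvdz_trans pq hu) hv hs.
set S := \sum_i _.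
have h1 : ((q ^ R)%N%:Z %| y ^+ D * S)%Z.
  pose Psi := \sum_i h i *: psi i.
  rewrite (dvdz_congr0 (b := Psi.[u - u0])); last first.
    rewrite /Psi /S horner_sum mulr_sumr; apply: dvdz_sub_sum => i _.
    have -> : y ^+ D * (h i * mono (e i) a b c) =
        h i * ((y * a) ^+ (e i).1.1 * (u ^+ (e i).1.2 * v ^+ (e i).2)).
      rewrite -(eD i) /mono /u /v !exprMn !exprD; ring.
    rewrite hornerZ hornerM !horner_exp hornerD hornerC hornerX subrKC.
    apply: dvdz_congM; first by rewrite subrr dvdz0.
    rewrite -[X in _ - X]mul1r -(expr1n _ (e i).1.1); apply: dvdz_congM; first exact: dvdz_congX.
    by apply: dvdz_congM; [rewrite subrr dvdz0 | apply: dvdz_congX].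
  rewrite horner_coef; apply: rpred_sum => j _.
  have [hj|hj] := ltnP j R.
    have -> : (q ^ R = q ^ (R - j) * q ^ j)%N by rewrite -expnD subnK // ltnW.
    rewrite PoszM dvdz_mul //; last first.
      by rewrite PoszXn dvdz_exp2r.
    rewrite /Psi coef_sum; have := hd (Ordinal hj) => /=.
    by under eq_bigr do rewrite mulrC -coefZ.
  rewrite dvdz_mull // -(subnKC hj) exprD dvdz_mulr //.
  by rewrite PoszXn dvdz_exp2r.
rewrite (dvdz_congr0 (b := a ^+ D * (y ^+ D * S))); first by rewrite dvdz_mull.
have -> : S - a ^+ D * (y ^+ D * S) = - (S * ((y * a) ^+ D - 1 ^+ D)).
  by rewrite expr1n exprMn; ring.
by rewrite rpredN dvdz_mull // dvdz_congX.
Qed.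

(** The form of a residue class has values below q^R that are divisible by q^R, hence it vanishes at
    the points of the class. The second coordinate is fixed modulo p^k but the third only modulo p,
    because Hensel's lemma recovers it from the second. *)
Lemma chart_count (T : eqType) (r1 r2 r3 : T -> int) (P : T -> Prop)
    (W : I -> nat) (E : nat) :
  (\sum_i X i * W i < (p ^ k) ^ R)%N ->
  (forall x, P x -> [/\ psec d f1 f2 N1 N2 N3 (r1 x) (r2 x) (r3 x) = 0,
     ~~ (p%:Z %| r1 x)%Z,
     ~~ (p%:Z %| pdir d f1 f2 N1 N2 N3 N3 (r1 x) (r2 x) (r3 x))%Z &
     forall i, (`|mono (e i) (r1 x) (r2 x) (r3 x)| <= W i)%N]) ->
  (forall h : I -> int, (exists i, h i != 0) ->
    atmost E (fun x => P x /\ \sum_i h i * mono (e i) (r1 x) (r2 x) (r3 x) = 0)) ->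
  atmost (p ^ k * p * E) P.
Proof.
move=> hW hP hE; set q := (p ^ k)%N.
have q0 : (0 < q)%N by rewrite expn_gt0 prime_gt0.
pose ks := [seq (a, b) | a <- iota 0 q, b <- iota 0 p].
have <- : size ks = (q * p)%N by rewrite size_allpairs !size_iota.
pose Q (uv : nat * nat) x := [/\ P x, (q%:Z %| r2 x - uv.1%:Z * r1 x)%Z &
  (p%:Z %| r3 x - uv.2%:Z * r1 x)%Z].
apply: (@atmost_keys _ _ _ _ Q) => [x Px|[u0 v0] _].
  have [_ np1 _ _] := hP x Px.
  have [y hy] := inverse_mod_pow k pp np1.
  have [y' hy'] := inverse_mod_pow 1 pp np1; rewrite expn1 in hy'.
  have res (m : nat) (z w : int) : (0 < m)%N -> (m%:Z %| w * r1 x - 1)%Z ->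
      exists2 n : nat, (n < m)%N & (m%:Z %| z - n%:Z * r1 x)%Z.
    move=> m0 hw; have mz : m%:Z != 0 by lia.
    have := modz_ge0 (z * w) mz; have := ltz_pmod (z * w) (_ : 0 < m%:Z).
    case er : ((z * w) %% m%:Z)%Z => [n|n] // lt _; exists n; first by have := lt m0; lia.
    have -> : z - n%:Z * r1 x = (z * w - n%:Z) * r1 x - z * (w * r1 x - 1) by ring.
    apply: rpredB; [apply: dvdz_mulr | exact: dvdz_mull].
    by rewrite -eqz_mod_dvd -er modz_mod.
  have [n hn hn'] := res q (r2 x) y q0 hy.
  have [n' hm hm'] := res p (r3 x) y' (prime_gt0 pp) hy'.
  exists (n, n'); last by split.
  by apply/allpairsP; exists (n, n'); rewrite !mem_iota.
have [[x0 [Px0 hu0 hv0]]|no] := pselect (exists x, Q (u0, v0) x); last first.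
  by apply: atmost0 => x Qx; apply: no; exists x.
have [s0 np1 npd _] := hP x0 Px0.
have unit0 : ~~ (p%:Z %| pdir d f1 f2 N1 N2 N3 N3 1 u0%:Z v0%:Z)%Z.
  have pq : (p%:Z %| q%:Z)%Z by rewrite dvdzE !absz_nat dvdn_exp.
  move: npd; apply: contra => h.
  rewrite (dvdz_congr0 (b := pdir d f1 f2 N1 N2 N3 N3 (r1 x0 * 1) (r1 x0 * u0%:Z) (r1 x0 * v0%:Z))).
    by rewrite pdir_hom dvdz_mull.
  by apply: pdir_cong; rewrite ?mulr1 ?subrr ?dvdz0 // mulrC // (dvdz_trans pq).
have [h [h0 hX hd]] := class_form unit0.
apply: atmost_sub (hE h h0) => x [Px hu hv]; split=> //.
have [sx np1x _ hWx] := hP x Px.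
have := hd _ _ _ sx np1x hu hv; set S := \sum_i _ => hS.
have : (`|S| < (p ^ k) ^ R)%N.
  apply: leq_ltn_trans hW; apply: leq_trans (absz_sum _ _ _) _.
  by apply: leq_sum => i _; rewrite abszM leq_mul.
move: hS; rewrite dvdzE absz_nat => /dvdn_leq le lt; apply/eqP; rewrite -absz_eq0 -leqn0 leqNgt.
by apply/negP => /le; rewrite leqNgt lt.
Qed.
End ClassForm.

Lemma up_log_between p t pi : prime p -> (p <= t)%N -> (0 < pi)%N ->
  (0 < up_log p (t ^ pi))%N /\ (t ^ pi <= p ^ up_log p (t ^ pi) <= t ^ pi.+1)%N.
Proof.
move=> pp pt pi0; have p1 := prime_gt1 pp; have t1 : (1 < t)%N by apply: leq_trans pt.
have tp1 : (1 < t ^ pi)%N by rewrite -(exp1n pi) ltn_exp2r.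
have k0 : (0 < up_log p (t ^ pi))%N by rewrite up_log_gt0 p1.
split=> //; apply/andP; split; first exact: up_logP.
rewrite -(prednK k0) !expnS leq_mul // ltnW //.
by have /andP[] := up_log_bounds p1 tp1.
Qed.

Lemma prime_power_between p t pi : prime p -> (p <= t)%N -> (0 < pi)%N ->
  exists2 k, (0 < k)%N & (t ^ pi <= p ^ k <= t ^ pi.+1)%N.
Proof. by move=> pp pt pi0; have [] := up_log_between pp pt pi0; exists (up_log p (t ^ pi)). Qed.

Section PlaneCount.
Variables (d : nat) (f1 f2 : {poly int}).

Lemma pcoord_rot N1 N2 N3 (a b c : int) i :
  pcoord N1 N2 N3 a b c i = pcoord N2 N3 N1 b c a i.
Proof. by rewrite /pcoord; ring. Qed.

Lemma pcoord_swap N1 N2 N3 (a b c : int) i :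
  pcoord N1 N2 N3 a b c i = pcoord N1 N3 N2 a c b i.
Proof. by rewrite /pcoord; ring. Qed.

Lemma psec_rot N1 N2 N3 (a b c : int) :
  psec d f1 f2 N1 N2 N3 a b c = psec d f1 f2 N2 N3 N1 b c a.
Proof. by rewrite /psec !(pcoord_rot N1). Qed.

Lemma psec_swap N1 N2 N3 (a b c : int) :
  psec d f1 f2 N1 N2 N3 a b c = psec d f1 f2 N1 N3 N2 a c b.
Proof. by rewrite /psec !(pcoord_swap N1 N2). Qed.

Lemma pdir_rot N1 N2 N3 N (a b c : int) :
  pdir d f1 f2 N1 N2 N3 N a b c = pdir d f1 f2 N2 N3 N1 N b c a.
Proof. by rewrite /pdir !(pcoord_rot N1). Qed.

Lemma pdir_swap N1 N2 N3 N (a b c : int) :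
  pdir d f1 f2 N1 N2 N3 N a b c = pdir d f1 f2 N1 N3 N2 N a c b.
Proof. by rewrite /pdir !(pcoord_swap N1 N2). Qed.

Lemma euler_psec N1 N2 N3 (a b c : int) :
  a * pdir d f1 f2 N1 N2 N3 N1 a b c + b * pdir d f1 f2 N1 N2 N3 N2 a b c +
    c * pdir d f1 f2 N1 N2 N3 N3 a b c = d%:R * psec d f1 f2 N1 N2 N3 a b c.
Proof.
rewrite /pdir /psec [RHS]mulrBr -!euler_bf.
move: (bfx d f1 _ _) (bfy d f1 _ _) (bfx d f2 _ _) (bfy d f2 _ _) => X1 Y1 X2 Y2.
by rewrite /pcoord; ring.
Qed.

Definition mono_rot (e : nat * nat * nat) := (e.1.2, e.2, e.1.1).
Definition mono_swap (e : nat * nat * nat) := (e.1.1, e.2, e.1.2).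

Lemma monoE_rot e a b c : mono (mono_rot e) b c a = mono e a b c.
Proof. by rewrite /mono /=; ring. Qed.

Lemma monoE_swap e a b c : mono (mono_swap e) a c b = mono e a b c.
Proof. by rewrite /mono /=; ring. Qed.

(** Everything that does not depend on a chart, bundled so that it can be transported along
    permutations of the coordinates; the two units at p required by a chart are left to
    [chart_count1]. *)
Record chart_hyps (I : finType) (e : I -> nat * nat * nat) (D pk R : nat)
   (X W : I -> nat) (E : nat) (T : eqType) N1 N2 N3 (r1 r2 r3 : T -> int)
   (P : T -> Prop) : Prop := ChartHyps {
  chart_deg : forall i, ((e i).1.1 + (e i).1.2 + (e i).2 = D)%N;
  chart_caps : (\prod_(r < R) pk ^ (R - r) < \prod_i (X i).+1)%N;
  chart_small : (\sum_i X i * W i < pk ^ R)%N;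
  chart_on : forall x, P x -> psec d f1 f2 N1 N2 N3 (r1 x) (r2 x) (r3 x) = 0 ;
  chart_bound : forall x, P x -> forall i,
     (`|mono (e i) (r1 x) (r2 x) (r3 x)| <= W i)%N;
  chart_end : forall h : I -> int, (exists i, h i != 0) ->
    atmost E (fun x => P x /\ \sum_i h i * mono (e i) (r1 x) (r2 x) (r3 x) = 0) }.

Lemma chart_hyps_rot (I : finType) (e : I -> nat * nat * nat) D pk R X W E (T : eqType) N1 N2 N3 (r1 r2 r3 : T -> int) P :
  chart_hyps e D pk R X W E N1 N2 N3 r1 r2 r3 P ->
  chart_hyps (mono_rot \o e) D pk R X W E N2 N3 N1 r2 r3 r1 P.
Proof.
case=> h1 h2 h3 h4 h5 h6; split=> //= [i|x Px|x Px i|h hn].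
- by rewrite /= -(h1 i); lia.
- by rewrite -psec_rot h4.
- by rewrite monoE_rot h5.
- apply: atmost_sub (h6 h hn) => x [Px]; under eq_bigr do rewrite monoE_rot.
  by [].
Qed.

Lemma chart_hyps_swap (I : finType) (e : I -> nat * nat * nat) D pk R X W E (T : eqType) N1 N2 N3 (r1 r2 r3 : T -> int) P :
  chart_hyps e D pk R X W E N1 N2 N3 r1 r2 r3 P ->
  chart_hyps (mono_swap \o e) D pk R X W E N1 N3 N2 r1 r3 r2 P.
Proof.
case=> h1 h2 h3 h4 h5 h6; split=> //= [i|x Px|x Px i|h hn].
- by rewrite /= -(h1 i); lia.
- by rewrite -psec_swap h4.
- by rewrite monoE_swap h5.
- apply: atmost_sub (h6 h hn) => x [Px]; under eq_bigr do rewrite monoE_swap.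
  by [].
Qed.

Lemma chart_count1 p k (I : finType) (e : I -> nat * nat * nat) D R X W E (T : eqType) N1 N2 N3 (r1 r2 r3 : T -> int) P :
  prime p -> (0 < k)%N -> (0 < R)%N ->
  chart_hyps e D (p ^ k) R X W E N1 N2 N3 r1 r2 r3 P ->
  atmost (p ^ k * p * E) (fun x => [/\ P x, ~~ (p%:Z %| r1 x)%Z &
    ~~ (p%:Z %| pdir d f1 f2 N1 N2 N3 N3 (r1 x) (r2 x) (r3 x))%Z]).
Proof.
move=> pp k0 R0 [h1 h2 h3 h4 h5 h6].
apply: (chart_count (d := d) (f1 := f1) (f2 := f2) (N1 := N1) (N2 := N2) (N3 := N3)
  (e := e) (D := D) (r1 := r1) (r2 := r2) (r3 := r3) h1 pp k0 R0 h2 h3).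
  by move=> x [Px np nd]; split=> //; [apply: h4 | apply: h5].
by move=> h hn; apply: atmost_sub (h6 h hn) => x [[]].
Qed.

(* Summing over all six charts and all primes up to t spares choosing a common prime for the points. *)
Lemma plane_count K : exists t0, forall t pi (I : finType) (e : I -> nat * nat * nat)
    D R X W E (T : eqType) N1 N2 N3 (r1 r2 r3 : T -> int) (P : T -> Prop),
  (t0 <= t)%N -> (0 < pi)%N -> (0 < R)%N ->
  (forall p k, prime p -> (t ^ pi <= p ^ k <= t ^ pi.+1)%N ->
    chart_hyps e D (p ^ k) R X W E N1 N2 N3 r1 r2 r3 P) ->
  (forall x, P x -> [/\ (`|r1 x| <= t ^ K)%N, (`|r2 x| <= t ^ K)%N & (`|r3 x| <= t ^ K)%N]) ->
  (forall x N, P x -> N \in [:: N1; N2; N3] ->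
     (`|pdir d f1 f2 N1 N2 N3 N (r1 x) (r2 x) (r3 x)| <= t ^ K)%N) ->
  (forall x, P x -> ~ [/\ r1 x = 0, r2 x = 0 & r3 x = 0]) ->
  (forall x, P x -> ~ (forall N, N \in [:: N1; N2; N3] ->
     pdir d f1 f2 N1 N2 N3 N (r1 x) (r2 x) (r3 x) = 0)) ->
  atmost (12 * E * t ^ (pi + 3)) P.
Proof.
have [t0 ht0] := good_prime (2 * K); exists (t0 + 2)%N => t pi I e D R X W E T N1 N2 N3 r1 r2 r3 P.
move=> tt pi0 R0 hyps hr hd rn dn.
pose dir N x := pdir d f1 f2 N1 N2 N3 N (r1 x) (r2 x) (r3 x).
pose ch (c : nat) x : int * int := nth (0, 0)
  [:: (r1 x, dir N3 x); (r1 x, dir N2 x); (r2 x, dir N1 x); (r2 x, dir N3 x);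
      (r3 x, dir N2 x); (r3 x, dir N1 x)] c.
pose Q (pc : nat * nat) x := [/\ P x, prime pc.1, ~~ (pc.1%:Z %| (ch pc.2 x).1)%Z &
   ~~ (pc.1%:Z %| (ch pc.2 x).2)%Z].
pose ks := [seq (p, c) | p <- iota 0 t.+1, c <- iota 0 6].
have sks : size ks = (t.+1 * 6)%N by rewrite size_allpairs !size_iota.
(* A key is a number up to [t] and one of six charts, at most 12 t keys in all; each prime leaves at
   most t^(pi + 1) classes for one coordinate and t for the other. *)
apply: (@atmost_leq _ (size ks * (t ^ pi.+1 * t * E))).
  rewrite sks addn3 !expnS; have := leq_pmull (t ^ pi * t * E) (_ : 0 < t)%N.
  have : (t.+1 <= 2 * t)%N by lia.
  set x := (t ^ pi)%N => le _.
  apply: leq_trans (leq_mul (leq_mul le (leqnn 6)) (leqnn _)) _.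
  by rewrite leq_eqVlt; apply/orP; left; apply/eqP; ring.
apply: (@atmost_keys _ _ _ _ Q) => [x Px|[p c] hpc].
  (* A chart needs a nonzero coordinate and a nonzero derivative in another direction. If all six
     failed, Euler's identity on the section would make all three derivatives vanish. *)
  have [c c6 [n1 n2]] : exists2 c, (c < 6)%N & (ch c x).1 != 0 /\ (ch c x).2 != 0.
    have eu := euler_psec N1 N2 N3 (r1 x) (r2 x) (r3 x).
    have s0 : psec d f1 f2 N1 N2 N3 (r1 x) (r2 x) (r3 x) = 0.
      have tK : (0 < 1 <= t ^ (2 * K))%N by rewrite /= expn_gt0; lia.
      have [p [pp pt _]] := ht0 t 1%N (leq_trans (leq_addr _ _) tt) tK.
      have [k k0 hk] := prime_power_between pp pt pi0.
      by have [_ _ _ h _ _] := hyps p k pp hk; apply: h.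
    rewrite s0 mulr0 -!/(dir _ x) in eu.
    apply/not_exists2P => none.
    have prod0 c : (c < 6)%N -> (ch c x).1 * (ch c x).2 = 0.
      move=> lt; case: (none c) => // h; apply/eqP; rewrite mulf_eq0.
      by apply/norP => -[n1 n2]; apply: h.
    have := prod0 0%N isT; have := prod0 1%N isT; have := prod0 2%N isT.
    have := prod0 3%N isT; have := prod0 4%N isT; have := prod0 5%N isT.
    rewrite /ch /= => e5 e4 e3 e2 e1 e0.
    have z (a b : int) : a != 0 -> a * b = 0 -> b = 0.
      by move=> a0 /eqP; rewrite mulf_eq0 (negPf a0) => /eqP.
    have all0 : [/\ dir N1 x = 0, dir N2 x = 0 & dir N3 x = 0].
      have [z1|n1] := eqVneq (r1 x) 0; last first.
        have z2 := z _ _ n1 e1; have z3 := z _ _ n1 e0; split=> //.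
        by apply: (z _ _ n1); rewrite -eu z2 z3 !mulr0 !addr0.
      have [z2|n2] := eqVneq (r2 x) 0; last first.
        have y1 := z _ _ n2 e2; have y3 := z _ _ n2 e3; split=> //.
        by apply: (z _ _ n2); rewrite -eu y1 y3 !mulr0 add0r addr0.
      have [z3|n3] := eqVneq (r3 x) 0; first by case: (rn x Px).
      have y1 := z _ _ n3 e5; have y2 := z _ _ n3 e4; split=> //.
      by apply: (z _ _ n3); rewrite -eu y1 y2 !mulr0 !add0r.
    have [a1 a2 a3] := all0.
    apply: (dn x Px) => N; rewrite !inE => /or3P[] /eqP ->; [exact: a1 | exact: a2 | exact: a3].
  have [p [pp pt np]] : exists p, [/\ prime p, (p <= t)%N &
      ~~ (p %| `|((ch c x).1 * (ch c x).2)%R|)%N].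
    apply: ht0; first by lia.
    rewrite absz_gt0 mulf_neq0 //= abszM mulnC mul2n -addnn expnD.
    have [b1 b2 b3] := hr x Px.
    have d1 : (`|dir N1 x| <= t ^ K)%N by apply: hd; rewrite ?inE ?eqxx ?orbT.
    have d2 : (`|dir N2 x| <= t ^ K)%N by apply: hd; rewrite ?inE ?eqxx ?orbT.
    have d3 : (`|dir N3 x| <= t ^ K)%N by apply: hd; rewrite ?inE ?eqxx ?orbT.
    have bch c' : (c' < 6)%N -> (`|(ch c' x).1| <= t ^ K)%N /\ (`|(ch c' x).2| <= t ^ K)%N.
      by move: c' => [|[|[|[|[|[|c']]]]]].
    by have [? ?] := bch c c6; rewrite leq_mul.
  exists (p, c); first by apply/allpairsP; exists (p, c); rewrite !mem_iota /= ltnS pt.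
  split=> //=; apply: contra np => h; rewrite abszM; first by rewrite dvdn_mulr.
  by rewrite dvdn_mull.
have [[x0 [_ pp _ _]]|no] := pselect (exists x, Q (p, c) x); last first.
  by apply: atmost0 => x Qx; apply: no; exists x.
rewrite /= in pp; have [pt c6] : (p <= t)%N /\ (c < 6)%N.
  by move/allpairsP: hpc => [[a b] [+ + [-> ->]]]; rewrite !mem_iota /=; lia.
have [k k0 hk] := prime_power_between pp pt pi0.
apply: (@atmost_leq _ (p ^ k * p * E)).
  by rewrite leq_mul // leq_mul //; case/andP: hk.
have H := hyps p k pp hk.
have H' := chart_hyps_rot H; have H'' := chart_hyps_rot H'.
case: c c6 {hpc} => [|[|[|[|[|[|//]]]]]] _.
- by apply: atmost_sub (chart_count1 pp k0 R0 H) => x [].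
- apply: atmost_sub (chart_count1 pp k0 R0 (chart_hyps_swap H)) => x [].
  by rewrite /ch /= /dir pdir_swap.
- apply: atmost_sub (chart_count1 pp k0 R0 H') => x [].
  by rewrite /ch /= /dir pdir_rot.
- apply: atmost_sub (chart_count1 pp k0 R0 (chart_hyps_swap H')) => x [].
  by rewrite /ch /= /dir pdir_rot pdir_swap.
- apply: atmost_sub (chart_count1 pp k0 R0 H'') => x [].
  by rewrite /ch /= /dir pdir_rot pdir_rot.
- apply: atmost_sub (chart_count1 pp k0 R0 (chart_hyps_swap H'')) => x [].
  by rewrite /ch /= /dir pdir_rot pdir_rot pdir_swap.
Qed.
End PlaneCount.

(** * Coordinates on a plane in four-space *)

Lemma sum_ord4 (A : nmodType) (F : 'I_4 -> A) :
  \sum_i F i = F o0 + F o1 + F o2 + F o3.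
Proof.
rewrite !big_ord_recr big_ord0 /= add0r.
by congr (F _ + F _ + F _ + F _); apply/val_inj.
Qed.

Lemma ord4P (P : 'I_4 -> Prop) : P o0 -> P o1 -> P o2 -> P o3 -> forall i, P i.
Proof.
move=> h0 h1 h2 h3 [[|[|[|[|//]]]] hi].
- by have -> : Ordinal hi = o0 by apply/val_inj.
- by have -> : Ordinal hi = o1 by apply/val_inj.
- by have -> : Ordinal hi = o2 by apply/val_inj.
- by have -> : Ordinal hi = o3 by apply/val_inj.
Qed.

Lemma det_bound n (A : 'M[int]_n) (m : nat) :
  (forall i j, (`|A i j| <= m)%N) -> (`|(\det A)%R| <= n`! * m ^ n)%N.
Proof.
move=> hA; rewrite /determinant; apply: leq_trans (absz_sum _ _ _) _.
apply: leq_trans (_ : \sum_(s : 'S_n) m ^ n <= _)%N; last first.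
  by rewrite sum_nat_const card_Sn.
apply: leq_sum => s _; rewrite abszM abszX abszN absz1 exp1n mul1n.
have -> : (m ^ n = \prod_(i < n) m)%N by rewrite prod_nat_const card_ord.
by elim/big_ind2: _ => // a b c e h1 h2; rewrite abszM leq_mul.
Qed.

Definition dot (a x : 'rV[int]_4) : int := \sum_i a 0 i * x 0 i.

Lemma dotE a x : dot a x =
  a 0 o0 * x 0 o0 + a 0 o1 * x 0 o1 + a 0 o2 * x 0 o2 + a 0 o3 * x 0 o3.
Proof. by rewrite /dot sum_ord4. Qed.

Lemma dotDr a x y : dot a (x + y) = dot a x + dot a y.
Proof. by rewrite !dotE !mxE; ring. Qed.

Lemma dotZr a k x : dot a (k *: x) = k * dot a x.
Proof. by rewrite !dotE !mxE; ring. Qed.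

Lemma dot_bound (a x : 'rV[int]_4) (m B : nat) : (forall i, `|(a 0 i)%R| <= m)%N ->
  (forall i, `|(x 0 i)%R| <= B)%N -> (`|dot a x| <= 4 * (m * B))%N.
Proof.
move=> ha hx; apply: leq_trans (absz_sum _ _ _) _.
apply: leq_trans (_ : \sum_(i < 4) m * B <= _)%N.
  by apply: leq_sum => i _; rewrite abszM leq_mul.
by rewrite sum_nat_const card_ord.
Qed.

Definition mx4 (a b c e : 'rV[int]_4) : 'M[int]_4 :=
  \matrix_(i < 4) nth 0 [:: a; b; c; e] i.

(** Columns of the adjugate: up to the factor [\det M], the basis dual to the rows of [M], but with
    integral entries. *)
Definition adj_vec (M : 'M[int]_4) (j : 'I_4) : 'rV[int]_4 := \row_i (\adj M) i j.

Lemma adj_vec_expand a b c e x (M := mx4 a b c e) :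
  \det M *: x = dot a x *: adj_vec M o0 + dot b x *: adj_vec M o1 +
    dot c x *: adj_vec M o2 + dot e x *: adj_vec M o3.
Proof.
have := mul_adj_mx M; move/(congr1 (fun A => A *m x^T)).
rewrite mul_scalar_mx -mulmxA => h; apply: trmx_inj; rewrite linearZ /= -{}h.
apply/matrixP => i j; rewrite ord1 !mxE sum_ord4.
by rewrite !mxE /= !sum_ord4 /= !dotE !mxE /=; ring.
Qed.

Lemma adj_vec_span a b c e g (M := mx4 a b c e) :
  dot g (adj_vec M o1) = 0 -> dot g (adj_vec M o2) = 0 ->
  dot g (adj_vec M o3) = 0 -> \det M *: g = dot g (adj_vec M o0) *: a.
Proof.
move=> h1 h2 h3; have := mul_adj_mx M; move/(congr1 (fun A => g *m A)).
rewrite mul_mx_scalar mulmxA => <-; apply/matrixP => i j; rewrite ord1 mxE sum_ord4.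
have e0 k : (g *m \adj M) 0 k = dot g (adj_vec M k).
  by rewrite mxE /dot; apply: eq_bigr => l _; rewrite !mxE.
by rewrite !e0 h1 h2 h3 !mul0r !addr0 !mxE.
Qed.

Lemma adj_vec_dual a b c e (M := mx4 a b c e) i j :
  dot (row i M) (adj_vec M j) = if i == j then \det M else 0.
Proof.
have := mul_mx_adj M; move/matrixP/(_ i j); rewrite !mxE => h.
rewrite /dot -mulrb -[RHS]h; apply: eq_bigr => k _; rewrite !mxE //.
Qed.

Lemma adj_vec_bound (M : 'M[int]_4) j (m : nat) : (forall i k, `|M i k| <= m)%N ->
  forall i, (`|(adj_vec M j 0 i)%R| <= 6 * m ^ 3)%N.
Proof.
move=> hM i; rewrite !mxE /cofactor abszM abszX abszN absz1 exp1n mul1n.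
by apply: (@det_bound 3) => k l; rewrite !mxE.
Qed.

Lemma bfx_bound d (f : {poly int}) (B : nat) (x y : int) :
  (size f <= d.+1)%N -> (0 < B)%N -> (`|x| <= B)%N -> (`|y| <= B)%N ->
  (`|bfx d f x y| <= d * bf_norm f * B ^ d)%N /\
  (`|bfy d f x y| <= d * bf_norm f * B ^ d)%N.
Proof.
move=> sf B0 hx hy.
have e : bf_norm f = (\sum_(i < d.+1) `|(f`_i)%R|)%N.
  rewrite /bf_norm -!(big_mkord xpredT (fun i => `|(f`_i)%R|%N)) [in RHS](big_cat_nat (n := size f)) //=.
  rewrite [X in (_ + X)%N]big_nat_cond [X in (_ + X)%N]big1 ?addn0 // => i /andP[/andP[hi _] _].
  by rewrite nth_default.
split; apply: leq_trans (absz_sum _ _ _) _; rewrite mulnAC e big_distrr /=;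
  apply: leq_sum => i _; rewrite intz !abszM !abszX mulnC leq_mul // natz absz_nat.
- have -> : (d * B ^ d = d * B ^ i * B ^ (d - i))%N.
    by rewrite -mulnA -expnD subnKC // -ltnS.
  rewrite leq_mul // ?leqXn // leq_mul //; first by rewrite -ltnS.
  by apply: leq_trans (leqXn _ hx) _; rewrite leq_pexp2l // leq_pred.
- have -> : (d * B ^ d = B ^ i * (d * B ^ (d - i)))%N.
    by rewrite mulnCA -expnD subnKC // -ltnS.
  rewrite leq_mul // ?leqXn // leq_mul ?leq_subr //.
  by apply: leq_trans (leqXn _ hy) _; rewrite leq_pexp2l // leq_pred.
Qed.

Section Surface.
Variables (d : nat) (f1 f2 : {poly int}).
Implicit Types (x a : 'rV[int]_4).

Definition surf x : int := bf d f1 (x 0 o0) (x 0 o1) - bf d f2 (x 0 o2) (x 0 o3).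

Definition grad x : 'rV[int]_4 := \row_i
  nth 0 [:: bfx d f1 (x 0 o0) (x 0 o1); bfy d f1 (x 0 o0) (x 0 o1);
           - bfx d f2 (x 0 o2) (x 0 o3); - bfy d f2 (x 0 o2) (x 0 o3)] i.

Lemma surfZ k x : surf (k *: x) = k ^+ d * surf x.
Proof. by rewrite /surf !mxE !bf_hom mulrBr. Qed.

Lemma gradZ k x : grad (k *: x) = k ^+ d.-1 *: grad x.
Proof.
by apply/rowP; apply: ord4P; rewrite !mxE /= ?bfx_hom ?bfy_hom ?mulrN.
Qed.

Lemma psec_surf N1 N2 N3 (a b c : int) :
  psec d f1 f2 N1 N2 N3 a b c = surf (a *: N1 + b *: N2 + c *: N3).
Proof.
rewrite /psec /surf; have e i : pcoord N1 N2 N3 a b c i = (a *: N1 + b *: N2 + c *: N3) 0 i.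
  by rewrite /pcoord !mxE !intz; ring.
by rewrite !e.
Qed.

Lemma pdir_grad N1 N2 N3 N (a b c : int) :
  pdir d f1 f2 N1 N2 N3 N a b c = dot N (grad (a *: N1 + b *: N2 + c *: N3)).
Proof.
rewrite dotE /pdir; have e i : pcoord N1 N2 N3 a b c i = (a *: N1 + b *: N2 + c *: N3) 0 i.
  by rewrite /pcoord !mxE !intz; ring.
by rewrite !e !mxE /= !intz; ring.
Qed.

Definition parallel (a b : 'rV[int]_4) := forall i j, a 0 i * b 0 j = a 0 j * b 0 i.

Lemma grad_bound (B : nat) (x : 'rV[int]_4) : (size f1 <= d.+1)%N -> (size f2 <= d.+1)%N ->
  (0 < B)%N -> (forall i, `|(x 0 i)%R| <= B)%N ->
  forall i, (`|(grad x 0 i)%R| <= d * (bf_norm f1 + bf_norm f2) * B ^ d)%N.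
Proof.
move=> s1 s2 B0 hx.
have [h1 h2] := bfx_bound s1 B0 (hx o0) (hx o1).
have [h3 h4] := bfx_bound s2 B0 (hx o2) (hx o3).
by apply: ord4P; rewrite mxE /= ?abszN mulnDr mulnDl; lia.
Qed.

End Surface.

Section CoordsCount.
Variables (d : nat) (f1 f2 : {poly int}).
Hypotheses (sf1 : (size f1 <= d.+1)%N) (sf2 : (size f2 <= d.+1)%N).

(** On the plane [dot a x = 0] the integers [dot r1 x], [dot r2 x], [dot r3 x] are the coordinates
    of [\det M *: x], which by homogeneity lies on the surface with [x]. The three derivatives of
    the section vanish together only where the gradient is proportional to [a]; such singular points
    are excluded here and counted apart. *)
Lemma coords_count K : exists t0, forall t pi (I : finType) (e : I -> nat * nat * nat)
    D R X W E (a r1 r2 r3 : 'rV[int]_4) (P : 'rV[int]_4 -> Prop),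
  (t0 <= t)%N -> (0 < pi)%N -> (0 < R)%N ->
  \det (mx4 a r1 r2 r3) != 0 ->
  (forall b i, b \in [:: a; r1; r2; r3] -> (`|(b 0 i)%R| <= t ^ K)%N) ->
  (forall x, P x -> [/\ x != 0, dot a x = 0, surf d f1 f2 x = 0,
     forall i, (`|(x 0 i)%R| <= t ^ K)%N & ~ parallel (grad d f1 f2 x) a]) ->
  (forall i, ((e i).1.1 + (e i).1.2 + (e i).2 = D)%N) ->
  (forall q, (t ^ pi <= q <= t ^ pi.+1)%N ->
     (\prod_(r < R) q ^ (R - r) < \prod_i (X i).+1)%N /\
     (\sum_i X i * W i < q ^ R)%N) ->
  (forall x, P x -> forall i, (`|mono (e i) (dot r1 x) (dot r2 x) (dot r3 x)| <= W i)%N) ->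
  (forall h : I -> int, (exists i, h i != 0) -> atmost E (fun x => P x /\
     \sum_i h i * mono (e i) (dot r1 x) (dot r2 x) (dot r3 x) = 0)) ->
  atmost (12 * E * t ^ (pi + 3)) P.
Proof.
pose C := (d * (bf_norm f1 + bf_norm f2))%N.
pose K' := ((4 * K + 1) * d + 3 * K + K * d + 3 + 2 * K + 1)%N.
have [t0 ht0] := plane_count d f1 f2 K'.
exists (t0 + C + 24)%N => t pi I e D R X W E a r1 r2 r3 P tt pi0 R0 det0 hb hP eD hq hW hE.
have t1 : (0 < t)%N by lia.
have up c n m : (c <= t)%N -> (n < m)%N -> (c * t ^ n <= t ^ m)%N.
  move=> ct nm; apply: leq_trans (_ : t ^ n.+1 <= _)%N; first by rewrite expnS leq_mul.
  by rewrite leq_pexp2l.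
pose M := mx4 a r1 r2 r3.
have hM i k : (`|(M i k)%R| <= t ^ K)%N.
  rewrite mxE; apply: hb; case: i => -[|[|[|[|//]]]] hi /=; rewrite !inE eqxx ?orbT //.
have hN j i : (`|(adj_vec M j 0 i)%R| <= t ^ (3 * K + 1))%N.
  apply: leq_trans (adj_vec_bound j hM i) _; rewrite -expnM mulnC.
  by rewrite mulnC; apply: up; lia.
have hD : (`|(\det M)%R| <= t ^ (4 * K + 1))%N.
  apply: leq_trans (det_bound hM) _; rewrite -expnM; apply: up; [|lia].
  by rewrite !factS fact0; lia.
have exp x : dot a x = 0 -> dot r1 x *: adj_vec M o1 + dot r2 x *: adj_vec M o2 +
    dot r3 x *: adj_vec M o3 = \det M *: x.
  by move=> ax; rewrite adj_vec_expand ax scale0r add0r.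
have t4 : (4 <= t)%N by lia.
apply: (ht0 t pi I e D R X W E _ (adj_vec M o1) (adj_vec M o2) (adj_vec M o3)
          (dot r1) (dot r2) (dot r3) P) => //.
- by lia.
- move=> p k pp /hq[h1 h2]; split=> // x /hP[_ ax sx _ _].
  by rewrite psec_surf exp // surfZ sx mulr0.
- move=> x /hP[_ _ _ bx _].
  have bd b : b \in [:: a; r1; r2; r3] -> (`|dot b x| <= t ^ K')%N.
    move=> bin; apply: leq_trans (dot_bound (fun i => hb b i bin) bx) _.
    by rewrite -expnD; apply: up; rewrite /K' //; lia.
  by split; apply: bd; rewrite !inE eqxx ?orbT.
- move=> x N /hP[_ ax _ bx _] hNin; rewrite pdir_grad exp // gradZ dotZr abszM abszX.
  have hN' i : (`|(N 0 i)%R| <= t ^ (3 * K + 1))%N.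
    by move: hNin; rewrite !inE => /or3P[] /eqP ->; apply: hN.
  have tK : (0 < t ^ K)%N by rewrite expn_gt0 t1.
  have hg i : (`|(grad d f1 f2 x 0 i)%R| <= t ^ (K * d + 1))%N.
    apply: leq_trans (grad_bound sf1 sf2 tK bx i) _; rewrite -expnM.
    by apply: up; rewrite ?addn1 // -/C; lia.
  apply: leq_trans (leq_mul (leqXn d.-1 hD) (dot_bound hN' hg)) _.
  rewrite -expnM -expnD mulnCA -expnD; apply: up => //; rewrite /K'.
  by case: (d) => [|d'] /=; nia.
- move=> x /hP[x0 ax _ _ _] [h1 h2 h3]; move/eqP: x0; apply.
  have := exp x ax; rewrite h1 h2 h3 !scale0r !addr0 => /esym/rowP e0.
  apply/rowP => i; have := e0 i; rewrite !mxE => /eqP.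
  by rewrite mulf_eq0 (negPf det0) => /eqP.
- move=> x /hP[_ ax _ _ npar] h; apply: npar => i j.
  have D0 : \det M ^+ d.-1 != 0 by rewrite expf_neq0.
  have z k : adj_vec M k \in [:: adj_vec M o1; adj_vec M o2; adj_vec M o3] ->
      dot (grad d f1 f2 x) (adj_vec M k) = 0.
    move=> /h; rewrite pdir_grad exp // gradZ dotZr => /eqP.
    rewrite mulf_eq0 (negPf D0) /= => /eqP <-.
    by rewrite /dot; apply: eq_bigr => l _; rewrite mulrC.
  have := adj_vec_span (z o1 _) (z o2 _) (z o3 _).
  rewrite !inE !eqxx !orbT => /(_ isT isT isT) /rowP eg.
  have := eg i; have := eg j; rewrite !mxE => ej ei.
  by apply: (mulfI det0); rewrite mulrA ei mulrA ej; ring.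
Qed.
End CoordsCount.

(** * Rational lines on the surface *)

Definition noniso d (f1 f2 : {poly int}) := forall a b c e : rat,
  a * e - b * c != 0 ->
  ~ (forall x y : rat, bf d f1 (a * x + b * y) (c * x + e * y) = bf d f2 x y).

Lemma dependent2 (p0 p1 q0 q1 : int) : p0 * q1 - p1 * q0 = 0 ->
  exists s r : int, [/\ s * p0 + r * q0 = 0, s * p1 + r * q1 = 0 & s != 0 \/ r != 0].
Proof.
move=> D0; have [h0|h0] := eqVneq q0 0; last first.
  by exists q0, (- p0); split; [ring | rewrite -[RHS]oppr0 -[in RHS]D0; ring | left].
have [h1|h1] := eqVneq p0 0; last first.
  by exists q0, (- p0); split; [ring | rewrite -[RHS]oppr0 -[in RHS]D0; ring | right; rewrite oppr_eq0].
have [h2|h2] := eqVneq q1 0.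
  have [h3|h3] := eqVneq p1 0.
    by exists 1, 0; rewrite h1 h3; split; [ring | ring | left].
  by exists 0, 1; rewrite h0 h2; split; [ring | ring | right].
by exists q1, (- p1); rewrite h0 h1; split; [ring | ring | left].
Qed.

Lemma bf00 (A : comNzRingType) d f : (0 < d)%N -> bf d f 0 0 = 0 :> A.
Proof. by move=> d0; rewrite bf_y0 expr0n gtn_eqF // mulr0. Qed.

(* On a line of this shape f1 would have a double zero. *)
Lemma no_semidegenerate_line d (f1 f2 : {poly int}) (p0 p1 p2 p3 q0 q1 q2 q3 : int) :
  (2 <= d)%N -> sepform d f1 -> p0 * q1 - p1 * q0 != 0 -> p2 * q3 - p3 * q2 = 0 ->
  ~ (forall s r : int, bf d f1 (s * p0 + r * q0) (s * p1 + r * q1) =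
                     bf d f2 (s * p2 + r * q2) (s * p3 + r * q3)).
Proof.
move=> d2 sf D12 /dependent2[s [r [e2 e3 nz]]] H.
pose w0 := s * p0 + r * q0; pose w1 := s * p1 + r * q1.
have Fw : bf d f1 w0 w1 = 0.
  by rewrite /w0 /w1 H e2 e3 bf00 // ltnW.
have dir (s' r' : int) : (s' * p0 + r' * q0) * bfx d f1 w0 w1 +
     (s' * p1 + r' * q1) * bfy d f1 w0 w1 = 0.
  set v0 := s' * p0 + _; set v1 := s' * p1 + _; set c := _ + _.
  (* The side of [f2] is divisible by (h + 1)^d with d >= 2, so the first-order coefficient [c] on
     the side of [f1] is divisible by h + 1. An integer with all positive divisors is 0. *)
  have dvd (h : nat) : (h.+1%:Z %| c)%Z.
    have [rr] := bf_taylor d f1 w0 w1 v0 v1 h.+1%:Z.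
    have -> : w0 + h.+1%:Z * v0 = (s + h.+1%:Z * s') * p0 + (r + h.+1%:Z * r') * q0.
      by rewrite /w0 /v0; ring.
    have -> : w1 + h.+1%:Z * v1 = (s + h.+1%:Z * s') * p1 + (r + h.+1%:Z * r') * q1.
      by rewrite /w1 /v1; ring.
    rewrite H; set x := _ * p2 + _; set y := _ * p3 + _.
    have -> : x = h.+1%:Z * (s' * p2 + r' * q2) by rewrite /x -[RHS]add0r -e2; ring.
    have -> : y = h.+1%:Z * (s' * p3 + r' * q3) by rewrite /y -[RHS]add0r -e3; ring.
    rewrite bf_hom Fw add0r -/c => e.
    have -> : c = h.+1%:Z * (h.+1%:Z ^+ (d - 2) * bf d f2 (s' * p2 + r' * q2) (s' * p3 + r' * q3) - rr).
      apply: (mulfI (_ : h.+1%:Z != 0)) => //.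
      have ed : h.+1%:Z ^+ d = h.+1%:Z ^+ 2 * h.+1%:Z ^+ (d - 2) by rewrite -exprD subnKC.
      apply: (addIr (h.+1%:Z ^+ 2 * rr)); rewrite -e ed; ring.
    by rewrite dvdz_mulr.
  apply/eqP; rewrite -absz_eq0 -leqn0 leqNgt; apply/negP => c0.
  by have := dvd `|c|%N; rewrite dvdzE absz_nat => /(dvdn_leq c0); rewrite ltnn.
have [X0 Y0] : bfx d f1 w0 w1 = 0 /\ bfy d f1 w0 w1 = 0.
  have := dir 1 0; have := dir 0 1; rewrite !mul0r !mul1r !addr0 !add0r.
  set X := bfx _ _ _ _; set Y := bfy _ _ _ _ => a1 a2.
  split; apply: (mulfI D12); rewrite mulr0.
    have -> : (p0 * q1 - p1 * q0) * X = q1 * (p0 * X + p1 * Y) - p1 * (q0 * X + q1 * Y) by ring.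
    by rewrite a1 a2 !mulr0 subr0.
  have -> : (p0 * q1 - p1 * q0) * Y = p0 * (q0 * X + q1 * Y) - q0 * (p0 * X + p1 * Y) by ring.
  by rewrite a1 a2 !mulr0 subr0.
have [w00 w10] := sepform_smooth_int (ltnW d2) sf X0 Y0.
have s0 : s * (p0 * q1 - p1 * q0) = 0.
  have -> : s * (p0 * q1 - p1 * q0) = q1 * w0 - q0 * w1 by rewrite /w0 /w1; ring.
  by rewrite w00 w10 !mulr0 subr0.
have r0 : r * (p0 * q1 - p1 * q0) = 0.
  have -> : r * (p0 * q1 - p1 * q0) = p0 * w1 - p1 * w0 by rewrite /w0 /w1; ring.
  by rewrite w00 w10 !mulr0 subr0.
move/eqP: s0; move/eqP: r0; rewrite !mulf_eq0 (negPf D12) !orbF => r0 s0.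
by case: nz; rewrite ?r0 ?s0.
Qed.

Lemma bf_parallel d (f : {poly int}) (u0 u1 p0 p1 : int) :
  u0 != 0 \/ u1 != 0 -> u0 * p1 = u1 * p0 -> bf d f u0 u1 = 0 -> bf d f p0 p1 = 0.
Proof.
move=> nz e F0; case: nz => n0; apply: (mulfI (expf_neq0 d n0)); rewrite mulr0 -bf_hom.
  by rewrite e (mulrC u0) (mulrC u1) bf_hom F0 mulr0.
by rewrite -e (mulrC u0) (mulrC u1) bf_hom F0 mulr0.
Qed.

(** If both minors were nonzero, the line would be the graph of a rational linear bijection, that is
    an isomorphism of the forms; if exactly one were nonzero, [no_semidegenerate_line] would apply
    to one of the two sides. *)
Lemma degenerate_lines d (f1 f2 : {poly int}) (P Q : 'rV[int]_4) :
  (2 <= d)%N -> sepform d f1 -> sepform d f2 -> noniso d f1 f2 ->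
  (forall s r, surf d f1 f2 (s *: P + r *: Q) = 0) ->
  P 0 o0 * Q 0 o1 - P 0 o1 * Q 0 o0 = 0 /\ P 0 o2 * Q 0 o3 - P 0 o3 * Q 0 o2 = 0.
Proof.
move=> d2 sf1 sf2 niso H0.
have H (s r : int) : bf d f1 (s * P 0 o0 + r * Q 0 o0) (s * P 0 o1 + r * Q 0 o1) =
   bf d f2 (s * P 0 o2 + r * Q 0 o2) (s * P 0 o3 + r * Q 0 o3).
  by have /eqP := H0 s r; rewrite /surf !mxE subr_eq0 => /eqP.
have [D12|D12] := eqVneq (P 0 o0 * Q 0 o1 - P 0 o1 * Q 0 o0) 0; last first.
  have [D34|D34] := eqVneq (P 0 o2 * Q 0 o3 - P 0 o3 * Q 0 o2) 0.
    by case: (no_semidegenerate_line d2 sf1 D12 D34 H).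
  pose q (z : int) : rat := z%:~R.
  have HQ (s r : rat) : bf d f1 (s * q (P 0 o0) + r * q (Q 0 o0)) (s * q (P 0 o1) + r * q (Q 0 o1)) =
     bf d f2 (s * q (P 0 o2) + r * q (Q 0 o2)) (s * q (P 0 o3) + r * q (Q 0 o3)).
    pose k := denq s * denq r; pose kq := q k.
    have k0 : kq != 0 by rewrite intr_eq0 mulf_neq0 ?denq_neq0.
    have es : kq * s = q (numq s * denq r).
      by rewrite /kq /q !intrM -{2}[s]divq_num_den; field; rewrite intr_eq0 denq_neq0.
    have er : kq * r = q (denq s * numq r).
      by rewrite /kq /q !intrM -{2}[r]divq_num_den; field; rewrite intr_eq0 denq_neq0.
    apply: (mulfI (expf_neq0 d k0)); rewrite -!bf_hom !mulrDr !mulrA es er.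
    rewrite /q -!intrM -!intrD -!(rmorph_bf (intr : {rmorphism int -> rat})).
    by congr (_%:~R); apply: H.
  exfalso; pose D := q (P 0 o2 * Q 0 o3 - P 0 o3 * Q 0 o2).
  have D0 : D != 0 by rewrite intr_eq0.
  apply: (niso ((q (P 0 o0) * q (Q 0 o3) - q (Q 0 o0) * q (P 0 o3)) / D)
    ((q (Q 0 o0) * q (P 0 o2) - q (P 0 o0) * q (Q 0 o2)) / D)
    ((q (P 0 o1) * q (Q 0 o3) - q (Q 0 o1) * q (P 0 o3)) / D)
    ((q (Q 0 o1) * q (P 0 o2) - q (P 0 o1) * q (Q 0 o2)) / D)).
    set z := _ - _; have -> : z = q (P 0 o0 * Q 0 o1 - P 0 o1 * Q 0 o0) / D.
      have eD : D = q (P 0 o2) * q (Q 0 o3) - q (P 0 o3) * q (Q 0 o2).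
        by rewrite /D /q intrB !intrM.
      rewrite /z; move: D0; rewrite [q (_ - _)]/q intrB !intrM -!/(q _) eD => D0.
      by field.
    by rewrite mulf_neq0 ?invr_neq0 // intr_eq0.
  move=> x y.
  have eD : D = q (P 0 o2) * q (Q 0 o3) - q (P 0 o3) * q (Q 0 o2).
    by rewrite /D /q intrB !intrM.
  have := HQ ((x * q (Q 0 o3) - y * q (Q 0 o2)) / D) ((y * q (P 0 o2) - x * q (P 0 o3)) / D).
  move: D0; rewrite eD => D0.
  set u0 := _ + _; set u1 := _ + _; set u2 := _ + _; set u3 := _ + _ => e.
  have e2 : u2 = x by rewrite /u2; field.
  have e3 : u3 = y by rewrite /u3; field.
  transitivity (bf d f2 u2 u3); last by rewrite e2 e3.
  by rewrite -e; congr (bf d f1 _ _); rewrite /u0 /u1; field.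
have [D34|D34] := eqVneq (P 0 o2 * Q 0 o3 - P 0 o3 * Q 0 o2) 0; last first.
  by case: (no_semidegenerate_line d2 sf2 D34 D12 (fun s r => esym (H s r))).
by [].
Qed.

Lemma surf_line d (f1 f2 : {poly int}) (P Q : 'rV[int]_4) :
  (forall s r, surf d f1 f2 (s *: P + r *: Q) = 0) -> forall s r : int,
  bf d f1 (s * P 0 o0 + r * Q 0 o0) (s * P 0 o1 + r * Q 0 o1) =
  bf d f2 (s * P 0 o2 + r * Q 0 o2) (s * P 0 o3 + r * Q 0 o3).
Proof.
by move=> H0 s r; have /eqP := H0 s r; rewrite /surf !mxE subr_eq0 => /eqP.
Qed.

Lemma combination_parallel (P Q : 'rV[int]_4) (s r : int) : s != 0 \/ r != 0 ->
  (forall i, s * P 0 i + r * Q 0 i = 0) -> parallel P Q.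
Proof.
move=> nz ek i j; have [s0|s0] := eqVneq s 0.
  have r0 : r != 0 by case: nz; rewrite ?s0.
  apply: (mulfI r0); have := ek i; have := ek j; rewrite s0 !mul0r !add0r.
  move/eqP; rewrite mulf_eq0 (negPf r0) => /eqP -> /eqP.
  by rewrite mulf_eq0 (negPf r0) => /eqP ->; ring.
apply: (mulfI s0).
have -> : s * (P 0 i * Q 0 j) = (s * P 0 i + r * Q 0 i) * Q 0 j - r * Q 0 i * Q 0 j by ring.
have -> : s * (P 0 j * Q 0 i) = (s * P 0 j + r * Q 0 j) * Q 0 i - r * Q 0 i * Q 0 j by ring.
by rewrite !ek !mul0r.
Qed.

(** Since (x0, x1) stays on one line through 0, some nonzero point of the span has x0 = x1 = 0, and
    [f2] vanishes at its last two coordinates. These are not both 0 and are proportional to those of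
    [P], so [f2], and with it [f1], vanishes at [P]. *)
Lemma trivial_lines d (f1 f2 : {poly int}) (P Q : 'rV[int]_4) :
  (2 <= d)%N -> sepform d f1 -> sepform d f2 -> noniso d f1 f2 ->
  ~ parallel P Q -> (forall s r, surf d f1 f2 (s *: P + r *: Q) = 0) ->
  bf d f1 (P 0 o0) (P 0 o1) = 0.
Proof.
move=> d2 sf1 sf2 niso npar H0; have H := surf_line H0.
have [D12 D34] := degenerate_lines d2 sf1 sf2 niso H0.
have [s [r [e0 e1 nz]]] := dependent2 D12.
have F2u : bf d f2 (s * P 0 o2 + r * Q 0 o2) (s * P 0 o3 + r * Q 0 o3) = 0.
  by rewrite -H e0 e1 bf00 // ltnW.
have := H 1 0; rewrite !mul1r !mul0r !addr0 => ->.
apply: bf_parallel F2u; last first.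
  by apply/eqP; rewrite -subr_eq0; apply/eqP; rewrite -[RHS](mulr0 (- r)) -[in RHS]D34; ring.
have [e2|] := eqVneq (s * P 0 o2 + r * Q 0 o2) 0; last by left.
have [e3|] := eqVneq (s * P 0 o3 + r * Q 0 o3) 0; last by right.
by case: npar; apply: (combination_parallel nz); apply: ord4P.
Qed.

(** A point of the line with x2 = x3 = 0 satisfies a0 x0 + a1 x1 = 0, so its zero (x0, x1) of [f1]
    is proportional to (a1, -a0); likewise for [f2]. These two equations are what makes the planes
    through a line of the surface rare. *)
Lemma plane_of_line d (f1 f2 : {poly int}) (P Q a : 'rV[int]_4) :
  (2 <= d)%N -> sepform d f1 -> sepform d f2 -> noniso d f1 f2 ->
  ~ parallel P Q -> (forall s r, surf d f1 f2 (s *: P + r *: Q) = 0) ->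
  dot a P = 0 -> dot a Q = 0 ->
  bf d f1 (a 0 o1) (- a 0 o0) = 0 /\ bf d f2 (a 0 o3) (- a 0 o2) = 0.
Proof.
move=> d2 sf1 sf2 niso npar H0 aP aQ; have H := surf_line H0.
have [D12 D34] := degenerate_lines d2 sf1 sf2 niso H0.
have comb (s r : int) : a 0 o0 * (s * P 0 o0 + r * Q 0 o0) + a 0 o1 * (s * P 0 o1 + r * Q 0 o1) +
   (a 0 o2 * (s * P 0 o2 + r * Q 0 o2) + a 0 o3 * (s * P 0 o3 + r * Q 0 o3)) = 0.
  by transitivity (s * dot a P + r * dot a Q); [rewrite !dotE; ring | rewrite aP aQ !mulr0].
split.
- have [s [r [e2 e3 nz]]] := dependent2 D34.
  have F1u := H s r; rewrite e2 e3 bf00 ?(ltnW d2) // in F1u.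
  apply: bf_parallel F1u; last first.
    have := comb s r; rewrite e2 e3 !mulr0 !addr0 => /eqP.
    by rewrite addr_eq0 => /eqP h; rewrite mulrN [_ * a 0 o0]mulrC h opprK mulrC.
  have [e0|] := eqVneq (s * P 0 o0 + r * Q 0 o0) 0; last by left.
  have [e1|] := eqVneq (s * P 0 o1 + r * Q 0 o1) 0; last by right.
  by case: npar; apply: (combination_parallel nz); apply: ord4P.
- have [s [r [e0 e1 nz]]] := dependent2 D12.
  have F2u := esym (H s r); rewrite e0 e1 bf00 ?(ltnW d2) // in F2u.
  apply: bf_parallel F2u; last first.
    have := comb s r; rewrite e0 e1 !mulr0 !add0r => /eqP.
    by rewrite addr_eq0 => /eqP h; rewrite mulrN [_ * a 0 o2]mulrC h opprK mulrC.
  have [e2|] := eqVneq (s * P 0 o2 + r * Q 0 o2) 0; last by left.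
  have [e3|] := eqVneq (s * P 0 o3 + r * Q 0 o3) 0; last by right.
  by case: npar; apply: (combination_parallel nz); apply: ord4P.
Qed.

Lemma atmost_rel (T K : eqType) n m (R : K -> Prop) (Q : K -> T -> Prop)
    (P : T -> Prop) :
  atmost n R -> (forall x, P x -> exists2 k, R k & Q k x) ->
  (forall k, R k -> atmost m (fun x => P x /\ Q k x)) -> atmost (n * m) P.
Proof.
move=> hR cov hQ; have [[x0 Px0]|no] := pselect (exists x, P x); last first.
  by apply: atmost0 => x Px; apply: no; exists x.
have [k0 _ _] := cov x0 Px0.
have /choice[f hf] : forall x, exists k, P x -> R k /\ Q k x.
  move=> x; have [Px|nP] := pselect (P x); last by exists k0.
  by have [k Rk Qk] := cov x Px; exists k.
apply: (atmost_fibers (f := f) hR) => [x /hf[]|k Rk] //.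
by apply: atmost_sub (hQ k Rk) => x [Px <-]; split=> //; have [] := hf x Px.
Qed.

(** [None] is the point at infinity of the projective line. *)
Lemma atmost_roots_opt (F : fieldType) n (p : {poly F}) :
  p != 0 -> (size p <= n.+1)%N ->
  atmost n.+1 (fun k : option F => if k is Some u then p.[u] = 0 else true).
Proof.
move=> p0 sp; rewrite -[n.+1]add1n.
apply: (@atmost_sub _ _ _ (fun k => k = None \/ exists2 u, p.[u] = 0 & k = Some u)).
  by case=> [u hu|_]; [right; exists u | left].
apply: atmostU.
  by apply: (@atmost_seq _ [:: None]) => k ->; rewrite inE.
by apply: (atmost_image (f := Some)) (atmost_roots p0 sp) => k [u h ->]; exists u.
Qed.

(** * Primitive vectors and spans *)

Definition prim (x : 'rV[int]_4) :=
  forall k : int, (forall i, (k %| x 0%R i)%Z) -> `|k|%N = 1%N.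

Lemma prim_neq0 x : prim x -> x != 0.
Proof.
move=> px; apply/eqP => x0; have : `|(0 : int)|%N = 1%N; last by [].
by apply: px => i; rewrite x0 mxE.
Qed.

Lemma prim_parallel x y : prim x -> prim y -> parallel x y -> y = x \/ y = - x.
Proof.
move=> px py par; have [i xi] : exists i, x 0 i != 0.
  apply/not_existsP => h; move/eqP: (prim_neq0 px); apply.
  by apply/rowP => i; rewrite mxE; apply/eqP; apply/negPn/negP/h.
have yi : y 0 i != 0.
  apply/eqP => yi0; move/eqP: (prim_neq0 py); apply; apply/rowP => j; rewrite mxE.
  by apply: (mulfI xi); rewrite par yi0 !mulr0.
pose g := gcdz (x 0 i) (y 0 i).
have g0 : g != 0 by rewrite gcdz_eq0 negb_and xi.
have /dvdzP[u eu] : (g %| x 0%R i)%Z by rewrite dvdz_gcdl.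
have /dvdzP[v ev] : (g %| y 0%R i)%Z by rewrite dvdz_gcdr.
have cop : coprimez u v.
  rewrite /coprimez; have := mulz_gcdl u v g; rewrite -eu -ev -/g.
  have -> : `|g|%N%:Z = g by [].
  by rewrite -[RHS]mul1r => /(mulIf g0) ->.
have euv j : u * y 0 j = v * x 0 j.
  by apply: (mulIf g0); rewrite -mulrAC -eu [RHS]mulrAC -ev par mulrC.
have u1 : `|u|%N = 1%N.
  by apply: px => j; rewrite -(Gauss_dvdzr (x 0 j) cop) -euv dvdz_mulr.
have v1 : `|v|%N = 1%N.
  rewrite coprimez_sym in cop.
  by apply: py => j; rewrite -(Gauss_dvdzr (y 0 j) cop) euv dvdz_mulr.
have [eu'|eu'] : u = 1 \/ u = -1 by lia.
- have [ev'|ev'] : v = 1 \/ v = -1 by lia.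
    by left; apply/rowP => j; have := euv j; rewrite eu' ev' !mul1r.
  by right; apply/rowP => j; have := euv j; rewrite eu' ev' mul1r mulN1r mxE.
- have [ev'|ev'] : v = 1 \/ v = -1 by lia.
    by right; apply/rowP => j; have := euv j; rewrite eu' ev' mul1r mulN1r mxE => <-; rewrite opprK.
  by left; apply/rowP => j; have := euv j; rewrite eu' ev' !mulN1r => /oppr_inj.
Qed.

Lemma atmost_parallel (P : 'rV[int]_4 -> Prop) :
  (forall x, P x -> prim x) -> (forall x y, P x -> P y -> parallel x y) -> atmost 2 P.
Proof.
move=> hp hpar; have [[x0 Px0]|no] := pselect (exists x, P x); last first.
  by apply: atmost0 => x Px; apply: no; exists x.
apply: (@atmost_seq _ [:: x0; - x0]) => y Py; rewrite !inE.
by have [->|->] := prim_parallel (hp _ Px0) (hp _ Py) (hpar _ _ Px0 Py); rewrite eqxx ?orbT.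
Qed.

Lemma parallel_linear (a b x y : 'rV[rat]_4) (s r s' r' : rat) :
  x = s *: a + r *: b -> y = s' *: a + r' *: b -> s * r' = s' * r ->
  forall i j, x 0 i * y 0 j = x 0 j * y 0 i.
Proof.
move=> -> -> e i j; rewrite !mxE.
apply/eqP; rewrite -subr_eq0; apply/eqP.
have -> : forall a0 a1 b0 b1 : rat, (s * a0 + r * b0) * (s' * a1 + r' * b1) -
   (s * a1 + r * b1) * (s' * a0 + r' * b0) = (s * r' - s' * r) * (a0 * b1 - a1 * b0).
  by move=> *; ring.
by rewrite e subrr mul0r.
Qed.

Definition toQ (x : 'rV[int]_4) : 'rV[rat]_4 := map_mx intr x.

Lemma row_free_nonparallel (P Q : 'rV[int]_4) : ~ parallel P Q ->
  row_free (col_mx (toQ P) (toQ Q)).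
Proof.
move=> npar; apply: inj_row_free => v hv.
have hv' i : v 0 (lshift 1 0) * (P 0 i)%:~R + v 0 (rshift 1 0) * (Q 0 i)%:~R = 0.
  have := congr1 (fun A : 'rV_4 => A 0 i) hv.
  rewrite -{1}[v]hsubmxK mul_row_col !mxE !big_ord1 !mxE => <-.
  by congr (v _ _ * _ + v _ _ * _); rewrite ?ord1; apply/val_inj.
have key i j : v 0 (lshift 1 0) * (P 0 i * Q 0 j - P 0 j * Q 0 i)%:~R = 0 /\
   v 0 (rshift 1 0) * (P 0 i * Q 0 j - P 0 j * Q 0 i)%:~R = 0.
  have := hv' i; have := hv' j; rewrite intrB !intrM.
  move: (v 0 (lshift 1 0)) (v 0 (rshift 1 0)) => s r ej ei; split.
    have -> : s * ((P 0 i)%:~R * (Q 0 j)%:~R - (P 0 j)%:~R * (Q 0 i)%:~R) =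
      (s * (P 0 i)%:~R + r * (Q 0 i)%:~R) * (Q 0 j)%:~R -
      (s * (P 0 j)%:~R + r * (Q 0 j)%:~R) * (Q 0 i)%:~R by ring.
    by rewrite ei ej !mul0r subrr.
  have -> : r * ((P 0 i)%:~R * (Q 0 j)%:~R - (P 0 j)%:~R * (Q 0 i)%:~R) =
      (s * (P 0 j)%:~R + r * (Q 0 j)%:~R) * (P 0 i)%:~R -
      (s * (P 0 i)%:~R + r * (Q 0 i)%:~R) * (P 0 j)%:~R by ring.
  by rewrite ei ej !mul0r subrr.
have [i [j nz]] : exists i j, P 0 i * Q 0 j - P 0 j * Q 0 i != 0.
  apply: contrapT => h; apply: npar => i j; apply/eqP; rewrite -subr_eq0.
  by apply/negPn/negP => nz; apply: h; exists i, j.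
have [/eqP + /eqP] := key i j.
rewrite !mulf_eq0 intr_eq0 (negPf nz) !orbF => /eqP v0 /eqP v1.
apply/rowP => k; rewrite mxE; case: (split_ordP k) => k' ->; rewrite ord1 //.
Qed.

Lemma line_span (a b P Q x : 'rV[int]_4) : ~ parallel a b -> ~ parallel P Q ->
  dot a P = 0 -> dot b P = 0 -> dot a Q = 0 -> dot b Q = 0 -> dot a x = 0 -> dot b x = 0 ->
  exists s r : rat, toQ x = s *: toQ P + r *: toQ Q.
Proof.
move=> nab nPQ aP bP aQ bQ ax bx.
pose A := (col_mx (toQ a) (toQ b))^T.
have rA : \rank A = 2%N by rewrite mxrank_tr; apply/eqP/row_free_nonparallel.
have ker y : dot a y = 0 -> dot b y = 0 -> (toQ y <= kermx A)%MS.
  move=> ay yb; apply/sub_kermxP; rewrite /A tr_col_mx mul_mx_row.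
  have e c : dot c y = 0 -> toQ y *m (toQ c)^T = 0.
    move=> h; apply/matrixP => i j; rewrite !ord1 !mxE.
    under eq_bigr do rewrite !mxE mulrC -intrM.
    by rewrite -rmorph_sum /= -/(dot c y) h.
  by rewrite !e // row_mx0.
have sub : (col_mx (toQ P) (toQ Q) <= kermx A)%MS by rewrite col_mx_sub !ker.
have : (toQ x <= col_mx (toQ P) (toQ Q))%MS.
  apply: submx_trans (ker x ax bx) _.
  have := mxrank_leqif_sup sub => -[_ <-].
  by rewrite mxrank_ker rA; apply/eqP; apply/eqP; rewrite (eqP (row_free_nonparallel nPQ)).
move/submxP => [D e]; exists (D 0 (lshift 1 0)), (D 0 (rshift 1 0)).
rewrite e -{1}[D]hsubmxK mul_row_col; congr (_ + _).
  by rewrite [lsubmx D]mx11_scalar mul_scalar_mx mxE.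
by rewrite [rsubmx D]mx11_scalar mul_scalar_mx mxE.
Qed.

Lemma size_bf_lin (R : idomainType) d f (p q : {poly R}) :
  (size p <= 2)%N -> (size q <= 2)%N -> (size (bf d f p q) <= d.+1)%N.
Proof.
move=> sp sq; apply: leq_trans (size_sum _ _ _) _; apply/bigmax_leqP => i _.
have hX (u : {poly R}) n : (size u <= 2 -> size (u ^+ n) <= n.+1)%N.
  by move=> su; apply: leq_trans (size_poly_exp_leq _ _) _; rewrite ltnS; nia.
rewrite -(rmorph_int polyC) mul_polyC; apply: leq_trans (size_scale_leq _ _) _.
apply: leq_trans (size_polyMleq _ _) _.
have := hX p i sp; have := hX q (d - i)%N sq; have := ltn_ord i.
move: (size (p ^+ i)) (size (q ^+ (d - i))) => m n.
by case: i => i /= _; lia.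
Qed.

Lemma poly_zero_inf (F : numFieldType) (p : {poly F}) :
  (forall n : nat, p.[n.+1%:R] = 0) -> p = 0.
Proof.
move=> h; apply/eqP; apply: contraT => p0.
pose s : seq F := [seq (n.+1)%:R | n <- iota 0 (size p).+1].
have us : uniq s.
  by rewrite map_inj_uniq ?iota_uniq // => m n /eqP; rewrite eqr_nat eqSS => /eqP.
have := atmost_roots p0 (leqnSn _) us; rewrite size_map size_iota ltnn; apply.
by move=> x /mapP[n _ ->].
Qed.

(** * Lines and singular points *)

Section Lines.
Variables (d : nat) (f1 f2 : {poly int}).

Lemma psec_toQ P Q x (s r : rat) : toQ x = s *: toQ P + r *: toQ Q ->
  psec d f1 f2 P Q 0 s r 0 = (surf d f1 f2 x)%:~R.
Proof.
move=> /rowP e; rewrite /psec /surf intrB.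
have ei i : pcoord P Q 0 s r 0 i = (x 0 i)%:~R.
  by have := e i; rewrite !mxE => ->; rewrite /pcoord mulr0 addr0 mulrC [r * _]mulrC.
by rewrite !ei -!(rmorph_bf (intr : {rmorphism int -> rat})).
Qed.

Lemma psec_line_poly (N1 N2 N3 : 'rV[int]_4) (p q r : {poly rat}) z :
  (psec d f1 f2 N1 N2 N3 p q r).[z] = psec d f1 f2 N1 N2 N3 p.[z] q.[z] r.[z].
Proof. exact: (rmorph_psec d f1 f2 N1 N2 N3 (horner_eval z)). Qed.

Lemma line_identically_zero P Q : psec d f1 f2 P Q 0 'X 1 0 = 0 :> {poly rat} ->
  forall s r, surf d f1 f2 (s *: P + r *: Q) = 0.
Proof.
move=> g0 s r.
have on (s' r' : rat) : r' != 0 -> psec d f1 f2 P Q 0 s' r' 0 = 0.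
  move=> r0; have := congr1 (fun p => p.[s' / r']) g0.
  rewrite /= psec_line_poly !hornerE => h.
  have := psec_hom d f1 f2 P Q 0 r' (s' / r') 1 0.
  by rewrite h !mulr0 mulr1 mulrC divfK.
have toQE : toQ (s *: P + r *: Q) = s%:~R *: toQ P + r%:~R *: toQ Q.
  by apply/rowP => i; rewrite !mxE intrD !intrM.
apply/eqP; rewrite -(intr_eq0 rat) -(psec_toQ toQE); apply/eqP.
have [r0|r0] := eqVneq r 0; last by rewrite on // intr_eq0.
have h1 : psec d f1 f2 P Q 0 1 'X 0 = 0 :> {poly rat}.
  apply: poly_zero_inf => n.
  by rewrite psec_line_poly !hornerE on // pnatr_eq0.
have := congr1 (fun p => p.[0]) h1; rewrite /= psec_line_poly !hornerE => h.
by have := psec_hom d f1 f2 P Q 0 (s%:~R : rat) 1 0 0; rewrite h !mulr0 mulr1 r0.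
Qed.

Definition onS (x : 'rV[int]_4) :=
  [/\ prim x, surf d f1 f2 x = 0 & bf d f1 (x 0 o0) (x 0 o1) != 0].

Hypotheses (d2 : (2 <= d)%N) (sf1 : sepform d f1) (sf2 : sepform d f2).

(** Along the line the equation of the surface is a binary form of degree d, nonzero because m does
    not vanish at [P]. Its roots and the point at infinity give d + 1 projective points at most,
    each with two primitive representatives. *)
Lemma line_count (a b : 'rV[int]_4) : noniso d f1 f2 -> ~ parallel a b ->
  atmost (d.+1 * 2) (fun x => [/\ onS x, dot a x = 0 & dot b x = 0]).
Proof.
move=> niso nab; set Z := fun x => _.
have [[P [Q [ZP ZQ nPQ]]]|all_par] := pselect (exists P Q, [/\ Z P, Z Q & ~ parallel P Q]); last first.
  apply: (@atmost_leq _ 2); first by rewrite leq_pmull.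
  apply: atmost_parallel => [x [[] //]|x y Zx Zy].
  by apply: contrapT => npar; apply: all_par; exists x, y.
have [[pP sP mP] aP bP] := ZP; have [[pQ sQ mQ] aQ bQ] := ZQ.
pose g : {poly rat} := psec d f1 f2 P Q 0 'X 1 0.
have g0 : g != 0.
  apply/eqP => g0; move/eqP: mP; apply.
  exact: (trivial_lines d2 sf1 sf2 niso nPQ (line_identically_zero g0)).
have sg : (size g <= d.+1)%N.
  have spc i : (size (pcoord P Q 0 'X 1 0 i : {poly rat}) <= 2)%N.
    rewrite /pcoord mulr0 addr0 mulr1 -!(rmorph_int polyC) mul_polyC.
    apply: leq_trans (size_polyD _ _) _; rewrite geq_max.
    rewrite (leq_trans (size_scale_leq _ _)) ?size_polyX //=.
    by rewrite (leq_trans (size_polyC_leq1 _)).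
  apply: leq_trans (size_polyD _ _) _; rewrite size_polyN geq_max.
  by rewrite !size_bf_lin.
apply: (@atmost_rel _ _ _ _ _ (fun k x => exists s r : rat,
   toQ x = s *: toQ P + r *: toQ Q /\ (if k is Some u then r != 0 /\ s = u * r else r = 0))
   _ (atmost_roots_opt g0 sg)) => [x Zx|k hk].
  have [[px sx mx] ax bx] := Zx.
  have [s [r e]] := line_span nab nPQ aP bP aQ bQ ax bx.
  have [r0|r0] := eqVneq r 0; first by exists None => //; exists s, r.
  exists (Some (s / r)); last by exists s, r; split=> //; split=> //; field.
  rewrite /g psec_line_poly !hornerE.
  apply: (mulfI (expf_neq0 d r0)); rewrite -psec_hom !mulr0 mulr1.
  by rewrite mulrCA divff // mulr1 (psec_toQ e) sx.
apply: atmost_parallel => [x [[[]]]|x y [_ [s [r [ex hx]]]] [_ [s' [r' [ey hy]]]]] // i j.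
have := parallel_linear ex ey _ i j; rewrite !mxE -!intrM => h.
apply: (@intr_inj rat); apply: h.
by case: k hk hx hy => [u|] _ => [[_ ->] [_ ->]|-> ->]; ring.
Qed.

End Lines.

Lemma comb_not_parallel (a r1 r2 r3 : 'rV[int]_4) (h1 h2 h3 : int) :
  \det (mx4 a r1 r2 r3) != 0 -> [|| h1 != 0, h2 != 0 | h3 != 0] ->
  ~ parallel a (h1 *: r1 + h2 *: r2 + h3 *: r3).
Proof.
move=> D0 hn par; set b := _ + _ in par; pose M := mx4 a r1 r2 r3.
have dual := @adj_vec_dual a r1 r2 r3.
have rw (i : 'I_4) : row i M = nth 0 [:: a; r1; r2; r3] i by rewrite rowK.
have [da d1 d2 d3] : [/\ forall j, dot a (adj_vec M j) = if o0 == j then \det M else 0,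
  forall j, dot r1 (adj_vec M j) = if o1 == j then \det M else 0,
  forall j, dot r2 (adj_vec M j) = if o2 == j then \det M else 0 &
  forall j, dot r3 (adj_vec M j) = if o3 == j then \det M else 0].
  by split=> j; rewrite -dual rw.
have db j : dot b (adj_vec M j) = h1 * dot r1 (adj_vec M j) +
    h2 * dot r2 (adj_vec M j) + h3 * dot r3 (adj_vec M j).
  by rewrite !dotE !mxE; ring.
have [i ai] : exists i, a 0 i != 0.
  apply: contrapT => h; move/eqP: D0; apply.
  rewrite -/M -[LHS](da o0) /dot big1 // => k _.
  have [->|k0] := eqVneq (a 0 k) 0; first by rewrite mul0r.
  by case: h; exists k.
have z j : o0 != j -> dot b (adj_vec M j) = 0.
  move=> oj; apply: (mulfI ai); rewrite mulr0.
  have -> : a 0 i * dot b (adj_vec M j) = b 0 i * dot a (adj_vec M j).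
    by rewrite /dot !mulr_sumr; apply: eq_bigr => k _; rewrite !mulrA par [b 0 i * _]mulrC.
  by rewrite da (negPf oj) mulr0.
have := z o1 isT; rewrite db d1 d2 d3 /= !mulr0 !addr0 => /eqP.
have := z o2 isT; rewrite db d1 d2 d3 /= !mulr0 !addr0 add0r => /eqP.
have := z o3 isT; rewrite db d1 d2 d3 /= !mulr0 !add0r => /eqP.
rewrite !mulf_eq0 (negPf D0) !orbF => /eqP e3 /eqP e2 /eqP e1.
by move: hn; rewrite e1 e2 e3 eqxx.
Qed.

Section Singular.
Variables (d : nat).
Hypothesis d2 : (2 <= d)%N.

(** The dehomogenisation of a1 F_x - a0 F_y, with F_y eliminated by Euler's identity. *)
Definition polar (f : {poly int}) (a0 a1 : int) : {poly int} :=
  a1 *: f^`() - a0 *: (d%:R * f - 'X * f^`()).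

Lemma size_deriv_int (f : {poly int}) : (1 < size f)%N -> size f^`() = (size f).-1.
Proof.
move=> f1; apply: size_poly_eq; rewrite mulrn_eq0.
have -> : ((size f).-1.-1.+1 = (size f).-1)%N by lia.
rewrite -lead_coefE lead_coef_eq0 -size_poly_eq0.
by case: (size f) f1 => [|[|n]].
Qed.

(** If it vanished with a0 nonzero, (a1 + a0 X) f' would equal d a0 f, and by the Bezout identity f'
    would divide a nonzero constant. *)
Lemma polar_neq0 f a0 a1 : sepform d f -> a0 != 0 \/ a1 != 0 -> polar f a0 a1 != 0.
Proof.
move=> [sf [D D0 [u [v e]]]] nz; apply/eqP => p0.
have sf' : size f^`() = d.
  by rewrite size_deriv_int sf //; lia.
have f'0 : f^`() != 0 by rewrite -size_poly_eq0 sf'; lia.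
have e1 : (a1%:P + a0 *: 'X) * f^`() = (a0 * d%:R) *: f.
  move: p0; rewrite /polar => p0; apply/eqP; rewrite -subr_eq0; apply/eqP.
  rewrite -{}p0 -!mul_polyC polyCM rmorph_nat; ring.
have [a00|a00] := eqVneq a0 0.
  move: e1; rewrite a00 scale0r addr0 mul0r scale0r => /eqP.
  rewrite mulf_eq0 (negPf f'0) orbF polyC_eq0 => /eqP a10.
  by case: nz; rewrite ?a00 ?a10.
have c0 : D * (a0 * d%:R) != 0 by rewrite !mulf_neq0 // pnatr_eq0; lia.
have e2 : f^`() * (u * (a1%:P + a0 *: 'X) + (a0 * d%:R) *: v) = (D * (a0 * d%:R))%:P.
  rewrite polyCM -e -!mul_polyC in e1 *.
  by rewrite mulrDl -[u * f * _]mulrA [f * _]mulrC -e1; ring.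
have := congr1 (fun p : {poly int} => size p) e2; rewrite /= size_polyC c0.
set w := u * _ + _; have [->|w0] := eqVneq w 0; first by rewrite mulr0 size_poly0.
rewrite size_mul // sf' /=; have := w0; rewrite -size_poly_gt0.
by case: (size w) => // n _; move: d2; case: (d) => [|[|d']] // _; rewrite addnS.
Qed.

Definition slope (s r : int) : option rat := if r == 0 then None else Some (s%:~R / r%:~R).

Lemma slope_cross s r s' r' : slope s r = slope s' r' -> s * r' = s' * r.
Proof.
rewrite /slope; case: eqVneq => [->|r0]; case: eqVneq => [->|r0'] //.
  by rewrite !mulr0.
case=> e; apply: (@intr_inj rat); rewrite !intrM.
have n0 : r%:~R != 0 :> rat by rewrite intr_eq0.
have n0' : r'%:~R != 0 :> rat by rewrite intr_eq0.
have -> : s%:~R = s%:~R / r%:~R * r%:~R :> rat by field.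
by rewrite e; field.
Qed.

Lemma polar_slope (f : {poly int}) a0 a1 x0 x1 : size f = d.+1 ->
  a1 * bfx d f x0 x1 = a0 * bfy d f x0 x1 ->
  if slope x0 x1 is Some u then (map_poly intr (polar f a0 a1) : {poly rat}).[u] = 0 else true.
Proof.
move=> sf; rewrite /slope; case: eqVneq => // x1n e; set u := _ / _.
pose q (z : int) : rat := z%:~R.
have x1q : q x1 != 0 by rewrite intr_eq0.
have eu : q x0 = q x1 * u by rewrite /u mulrC divfK.
have hx : q (bfx d f x0 x1) = q x1 ^+ d.-1 * bfx d f u 1.
  by rewrite /q (rmorph_bfx (intr : {rmorphism int -> rat})) -!/(q _) -bfx_hom mulr1 -eu.
have hy : q (bfy d f x0 x1) = q x1 ^+ d.-1 * bfy d f u 1.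
  by rewrite /q (rmorph_bfy (intr : {rmorphism int -> rat})) -!/(q _) -bfy_hom mulr1 -eu.
have := congr1 q e; rewrite /q !intrM -!/(q _) hx hy => {}e.
have {}e : q a1 * bfx d f u 1 = q a0 * bfy d f u 1.
  by apply: (mulfI (expf_neq0 d.-1 x1q)); rewrite mulrCA e mulrCA.
have := euler_bf d f u (1 : rat); rewrite mul1r => eul.
have ey : bfy d f u 1 = d%:R * bf d f u 1 - u * bfx d f u 1 by rewrite -eul; ring.
move: e; rewrite ey bfx_y1 ?bf_y1 ?sf // => e.
rewrite /polar rmorphB /= !map_polyZ rmorphB !rmorphM /= map_polyX rmorph_nat.
rewrite hornerD hornerN !hornerZ hornerD hornerN !hornerM hornerX -!/(q _) e.
by rewrite -polyC_natr hornerC subrr.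
Qed.

Variables (f1 f2 : {poly int}).
Hypotheses (sf1 : sepform d f1) (sf2 : sepform d f2).

(** Where the gradient is proportional to [a], the slopes of (x0, x1) and of (x2, x3) are roots of
    two polars or infinite. The slopes fix both halves of the point up to scaling, and [dot a x = 0]
    fixes the ratio of the two scalings. *)
Lemma singular_count (a : 'rV[int]_4) : a != 0 ->
  atmost (d.+1 * d.+1 * 2) (fun x => [/\ onS d f1 f2 x, dot a x = 0 & parallel (grad d f1 f2 x) a]).
Proof.
move=> a0; set Z := fun x => _.
have [j aj] : exists j, a 0 j != 0.
  apply: contrapT => h; move/eqP: a0; apply; apply/rowP => k; rewrite mxE; apply/eqP.
  by apply/negPn/negP => k0; apply: h; exists k.
have sd1 : (0 < d)%N by apply: ltnW.
have val2 x : Z x -> bf d f2 (x 0 o2) (x 0 o3) != 0.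
  by case=> [[_ sx mx] _ _]; move: sx mx => /eqP; rewrite /surf subr_eq0 => /eqP ->.
(* Otherwise Euler's identity would give f1(x0, x1) = 0. Because this number is nonzero,
   [dot a x = 0] does tie the two halves together. *)
have alpha x : Z x -> a 0 o0 * x 0 o0 + a 0 o1 * x 0 o1 != 0.
  move=> [[_ sx mx] ax par]; apply/eqP => h.
  have := euler_bf d f1 (x 0 o0) (x 0 o1) => eul.
  have : a 0 j * (d%:R * bf d f1 (x 0 o0) (x 0 o1)) = 0.
    rewrite -eul mulrDr; have := par o0 j; have := par o1 j; rewrite !mxE /= => p1 p0.
    rewrite [x 0 o0 * _]mulrC [x 0 o1 * _]mulrC !mulrA ![a 0 j * _]mulrC p0 p1.
    by rewrite -!mulrA -mulrDr h mulr0.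
  move/eqP; rewrite !mulf_eq0 (negPf aj) (negPf mx) pnatr_eq0; lia.
have [nz1|z1] := pselect (a 0 o0 != 0 \/ a 0 o1 != 0); last first.
  apply: atmost0 => x Zx; move/negP: (alpha x Zx); apply.
  have [-> ->] : a 0 o0 = 0 /\ a 0 o1 = 0.
    by split; apply/eqP; apply: contraT => h; case: z1; tauto.
  by rewrite !mul0r.
have alpha2 x : Z x -> a 0 o2 * x 0 o2 + a 0 o3 * x 0 o3 != 0.
  move=> Zx; have := alpha x Zx; have [_ ax _] := Zx; move: ax; rewrite dotE => ax.
  by apply: contra => /eqP e2; rewrite -ax -addrA e2 addr0.
have [nz2|z2] := pselect (a 0 o2 != 0 \/ a 0 o3 != 0); last first.
  apply: atmost0 => x Zx; move/negP: (alpha2 x Zx); apply.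
  have [-> ->] : a 0 o2 = 0 /\ a 0 o3 = 0.
    by split; apply/eqP; apply: contraT => h; case: z2; tauto.
  by rewrite !mul0r.
have roots f c0 c1 : sepform d f -> c0 != 0 \/ c1 != 0 -> atmost d.+1 (fun k : option rat =>
     if k is Some u then (map_poly intr (polar f c0 c1) : {poly rat}).[u] = 0 else true).
  move=> sf nz; apply: atmost_roots_opt.
    by rewrite map_poly_eq0_id0 ?polar_neq0 // intr_eq0 lead_coef_eq0 polar_neq0.
  apply: leq_trans (size_poly _ _) _; have [s _] := sf.
  apply: leq_trans (size_polyD _ _) _; rewrite size_polyN geq_max.
  have sd : (size f^`() <= d)%N by apply: leq_trans (size_poly _ _) _; rewrite s.
  rewrite (leq_trans (size_scale_leq _ _)) ?(leq_trans sd) //=.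
  apply: leq_trans (size_scale_leq _ _) _; apply: leq_trans (size_polyD _ _) _.
  rewrite size_polyN geq_max -[d%:R]polyC_natr mul_polyC (leq_trans (size_scale_leq _ _)) ?s //=.
  apply: leq_trans (size_polyMleq _ _) _; rewrite size_polyX.
  by move: sd; move: (size _) => n; rewrite add2n.
have HR := atmost_prod (roots _ _ _ sf1 nz1) (roots _ _ _ sf2 nz2).
pose Q (k : option rat * option rat) (x : 'rV[int]_4) :=
  k = (slope (x 0 o0) (x 0 o1), slope (x 0 o2) (x 0 o3)).
apply: (@atmost_rel _ _ _ _ _ Q Z HR) => [x [_ _ par]|k _].
  exists (slope (x 0 o0) (x 0 o1), slope (x 0 o2) (x 0 o3)) => //=; split; apply: polar_slope.
  - by case: sf1.
  - by have := par o0 o1; rewrite !mxE /= mulrC => ->; rewrite mulrC.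
  - by case: sf2.
  - have := par o2 o3; rewrite !mxE /= !mulNr => /oppr_inj; rewrite mulrC => ->; rewrite mulrC //.
apply: atmost_parallel => [x [[[]]]|x y [Zx ->] [Zy [e1 e2]]] //.
have c1 := slope_cross e1; have c2 := slope_cross e2.
have [_ ax _] := Zx; have [_ ay _] := Zy; rewrite !dotE in ax ay.
have Ax := alpha x Zx; have Ay := alpha y Zy.
set A := _ + _ in Ax; set B := _ + _ in Ay.
have hB : a 0 o2 * y 0 o2 + a 0 o3 * y 0 o3 = - B by apply/eqP; rewrite -addr_eq0 addrC addrA ay.
have hA : a 0 o2 * x 0 o2 + a 0 o3 * x 0 o3 = - A by apply/eqP; rewrite -addr_eq0 addrC addrA ax.
have key : forall i, x 0 i * B = A * y 0 i.
  apply: ord4P.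
  - have -> : x 0 o0 * B = a 0 o0 * x 0 o0 * y 0 o0 + a 0 o1 * (x 0 o0 * y 0 o1) by rewrite /B; ring.
    by rewrite c1 /A; ring.
  - have -> : x 0 o1 * B = a 0 o0 * (y 0 o0 * x 0 o1) + a 0 o1 * x 0 o1 * y 0 o1 by rewrite /B; ring.
    by rewrite -c1 /A; ring.
  - rewrite -[B]opprK -hB -[A]opprK -hA.
    have -> : x 0 o2 * - (a 0 o2 * y 0 o2 + a 0 o3 * y 0 o3) =
      - (a 0 o2 * x 0 o2 * y 0 o2 + a 0 o3 * (x 0 o2 * y 0 o3)) by ring.
    by rewrite c2; ring.
  - rewrite -[B]opprK -hB -[A]opprK -hA.
    have -> : x 0 o3 * - (a 0 o2 * y 0 o2 + a 0 o3 * y 0 o3) =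
      - (a 0 o2 * (y 0 o2 * x 0 o3) + a 0 o3 * x 0 o3 * y 0 o3) by ring.
    by rewrite -c2; ring.
move=> i l; apply: (mulfI Ax).
by rewrite [LHS]mulrCA -key [RHS]mulrCA -key; ring.
Qed.
End Singular.

(** * Auxiliary forms on a plane section *)

Definition in_box (B : nat) (x : 'rV[int]_4) := forall i, (`|(x 0%R i)%R| <= B)%N.

Lemma det_mx4_neq0 a r1 r2 r3 : \det (mx4 a r1 r2 r3) != 0 -> a != 0.
Proof.
apply: contra => /eqP ->; rewrite (expand_det_row _ o0) big1 // => j _.
by rewrite !mxE /= ?mxE mul0r.
Qed.

Lemma leq_const_pow c t n m : (c <= t)%N -> (n < m)%N -> (c * t ^ n <= t ^ m)%N.
Proof.
move=> ct nm; have [t0|t0] := posnP t.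
  by move: ct; rewrite t0 leqn0 => /eqP ->; rewrite mul0n.
apply: leq_trans (_ : t ^ n.+1 <= _)%N; first by rewrite expnS leq_mul.
by rewrite leq_pexp2l.
Qed.

Section PlaneLines.
Variables (d : nat) (f1 f2 : {poly int}).
Hypotheses (d2 : (2 <= d)%N) (sf1 : sepform d f1) (sf2 : sepform d f2).
Hypothesis niso : noniso d f1 f2.

Lemma surf_split K : exists t0, forall t pi (I : finType) (e : I -> nat * nat * nat)
    D R X W E B (a r1 r2 r3 : 'rV[int]_4),
  (t0 <= t)%N -> (0 < pi)%N -> (0 < R)%N -> (B <= t ^ K)%N ->
  \det (mx4 a r1 r2 r3) != 0 ->
  (forall b i, b \in [:: a; r1; r2; r3] -> (`|(b 0%R i)%R| <= t ^ K)%N) ->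
  (forall i, ((e i).1.1 + (e i).1.2 + (e i).2 = D)%N) ->
  (forall q, (t ^ pi <= q <= t ^ pi.+1)%N ->
     (\prod_(r < R) q ^ (R - r) < \prod_i (X i).+1)%N /\
     (\sum_i X i * W i < q ^ R)%N) ->
  (forall x, in_box B x -> dot a x = 0 ->
     forall i, (`|mono (e i) (dot r1 x) (dot r2 x) (dot r3 x)| <= W i)%N) ->
  (forall h : I -> int, (exists i, h i != 0) ->
     atmost E (fun x => [/\ onS d f1 f2 x, dot a x = 0 &
     \sum_i h i * mono (e i) (dot r1 x) (dot r2 x) (dot r3 x) = 0])) ->
  atmost ((12 * E + d.+1 * d.+1 * 2) * t ^ (pi + 3))
    (fun x => [/\ onS d f1 f2 x, dot a x = 0 & in_box B x]).
Proof.
have [s1 _] := sf1; have [s2 _] := sf2.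
have [t0 ht0] := @coords_count d f1 f2 (eq_leq s1) (eq_leq s2) K.
exists (t0 + 1)%N => t pi I e D R X W E B a r1 r2 r3 tt pi0 R0 BK det0 hb eD hq hW hE.
apply: (@atmost_leq _ (12 * E * t ^ (pi + 3) + d.+1 * d.+1 * 2)).
  by rewrite mulnDl leq_add2l leq_pmulr // expn_gt0; lia.
pose sing x := parallel (grad d f1 f2 x) a.
apply: (@atmost_sub _ _ _ (fun x => [/\ onS d f1 f2 x, dot a x = 0 & in_box B x] /\ ~ sing x
   \/ [/\ onS d f1 f2 x, dot a x = 0 & sing x])).
  by move=> x [h1 h2 h3]; have [s|ns] := pselect (sing x); [right | left].
apply: atmostU; last exact: singular_count (det_mx4_neq0 det0).
apply: (ht0 t pi I e D R X W E a r1 r2 r3) => //.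
- by lia.
- move=> x [[[px sx mx] ax bx] ns]; split=> //; first exact: prim_neq0.
  by move=> i; apply: leq_trans (bx i) BK.
- by move=> x [[_ ax bx] _]; apply: hW.
- move=> h hn; apply: atmost_sub (hE h hn) => x [[[o ax bx] _] e0]; split=> //.
Qed.

Definition lin_mono (i : 'I_3) : nat * nat * nat :=
  nth (0, 0, 0)%N [:: (1, 0, 0); (0, 1, 0); (0, 0, 1)]%N i.

(** Auxiliary forms of degree one cut the plane in a line, where [line_count] applies. The
    conditions have total weight q^3 for three coefficients, which allows [pi] near M, or near M -
    tau / 3 if the third coordinate is smaller by t^tau and its coefficient is allowed to be larger
    by that factor. *)
Lemma plane_lines K : exists t0, forall t pi xi tau M (a r1 r2 r3 : 'rV[int]_4),
  (t0 <= t)%N -> (0 < pi)%N -> (M <= K)%N -> (tau <= M)%N ->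
  (3 * pi.+1 <= 3 * xi + tau)%N -> (xi + M + 1 <= 2 * pi)%N ->
  \det (mx4 a r1 r2 r3) != 0 ->
  (forall b i, b \in [:: a; r1; r2; r3] -> (`|(b 0%R i)%R| <= t ^ K)%N) ->
  (forall x, in_box (t ^ M) x -> dot a x = 0 ->
     [/\ (`|dot r1 x| <= t ^ M)%N, (`|dot r2 x| <= t ^ M)%N &
      (`|dot r3 x| <= 3 * t ^ (M - tau))%N]) ->
  atmost ((12 * (d.+1 * 2) + d.+1 * d.+1 * 2) * t ^ (pi + 3))
    (fun x => [/\ onS d f1 f2 x, dot a x = 0 & in_box (t ^ M) x]).
Proof.
have [t0 ht0] := surf_split K; exists (t0 + 6)%N.
move=> t pi xi tau M a r1 r2 r3 tt pi0 MK tauM h1 h2 det0 hb hr.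
have t1 : (0 < t)%N by lia.
pose X (i : 'I_3) := nth 0%N [:: t ^ xi; t ^ xi; t ^ (xi + tau)]%N i.
pose W (i : 'I_3) := nth 0%N [:: t ^ M; t ^ M; 3 * t ^ (M - tau)]%N i.
apply: (ht0 t pi _ lin_mono 1%N 2 X W _ (t ^ M)%N a r1 r2 r3) => //.
- by lia.
- by rewrite leq_pexp2l.
- by case=> -[|[|[|//]]] hi.
- move=> q /andP[q1 q2].
  rewrite !big_ord_recr !big_ord0 /= /X /W /= !mul1n add0n.
  split.
    rewrite subn0 expn1 -expnSr; apply: leq_ltn_trans (leqXn 3 q2) _.
    rewrite -expnM; apply: leq_ltn_trans (_ : t ^ xi * t ^ xi * t ^ (xi + tau) < _)%N.
      by rewrite -!expnD leq_pexp2l //; lia.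
    by rewrite ltn_mul // ltn_mul.
  apply: leq_trans (leqXn 2 q1); rewrite -expnM -expnD.
  have -> : (t ^ (xi + tau) * (3 * t ^ (M - tau)) = 3 * t ^ (xi + M))%N.
    by rewrite mulnCA -expnD; congr (_ * _ ^ _)%N; lia.
  apply: leq_trans (_ : 6 * t ^ (xi + M) <= _)%N.
    by have : (0 < t ^ (xi + M))%N; [rewrite expn_gt0 t1 | lia].
  by apply: leq_const_pow; lia.
- move=> x bx ax; have [b1 b2 b3] := hr x bx ax.
  by case=> -[|[|[|//]]] hi; rewrite /mono /W /= !expr0 ?expr1 ?mul1r ?mulr1.
move=> h [i hi].
pose k0 := @Ordinal 3 0 isT; pose k1 := @Ordinal 3 1 isT; pose k2 := @Ordinal 3 2 isT.
pose b := h k0 *: r1 + h k1 *: r2 + h k2 *: r3.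
have npar : ~ parallel a b.
  apply: comb_not_parallel => //; move: hi; case: i => -[|[|[|//]]] hi h0; apply/or3P.
  - by constructor 1; rewrite (_ : k0 = Ordinal hi) //; apply/val_inj.
  - by constructor 2; rewrite (_ : k1 = Ordinal hi) //; apply/val_inj.
  - by constructor 3; rewrite (_ : k2 = Ordinal hi) //; apply/val_inj.
apply: atmost_sub (line_count d2 sf1 sf2 niso npar) => x [o ax e]; split=> //.
rewrite -e (_ : \sum_i _ = h k0 * mono (lin_mono k0) (dot r1 x) (dot r2 x) (dot r3 x) +
  h k1 * mono (lin_mono k1) (dot r1 x) (dot r2 x) (dot r3 x) +
  h k2 * mono (lin_mono k2) (dot r1 x) (dot r2 x) (dot r3 x)).
  by rewrite /mono /= !expr0 !expr1 !mul1r !mulr1 /b !dotE !mxE; ring.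
rewrite !big_ord_recr big_ord0 /= add0r.
by congr (h _ * mono (lin_mono _) _ _ _ + h _ * mono (lin_mono _) _ _ _ +
  h _ * mono (lin_mono _) _ _ _); apply/val_inj.
Qed.

End PlaneLines.

Lemma sum_ord_double n : (2 * \sum_(i < n) (i : nat) = n * n.-1)%N.
Proof.
elim: n => [|n IH]; first by rewrite big_ord0.
by rewrite big_ord_recr /= mulnDr IH; case: n {IH} => // n /=; lia.
Qed.

Lemma sum_rev_ord_double R : (2 * \sum_(r < R) (R - r) = R * R.+1)%N.
Proof.
elim: R => [|R IH]; first by rewrite big_ord0.
rewrite big_ord_recl /= subn0 mulnDr.
under eq_bigr => i _ do rewrite /bump /= add1n subSS.
by rewrite IH; lia.
Qed.

Section GridExponents.
Variables (e D' : nat).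
Hypotheses (e0 : (0 < e)%N) (D0 : (0 < D')%N).
Let D := (e.-1 + D'.-1)%N.

(** Exponents of the first two coordinates range over a grid and the third makes the degree
    constant. The degree in the first coordinate stays below [e], so a form in these monomials can
    share with the section only factors of low degree. *)
Definition grid_mono (p : 'I_e * 'I_D') : nat * nat * nat :=
  (p.1 : nat, p.2 : nat, (e.-1 + D'.-1 - p.1 - p.2)%N).

Lemma grid_mono_deg p :
  ((grid_mono p).1.1 + (grid_mono p).1.2 + (grid_mono p).2 = D)%N.
Proof. by case: p => -[i hi] [j hj] /=; rewrite /D; lia. Qed.

(** The first two exponents are (e - 1) / 2 and (D' - 1) / 2 on average, which leaves D / 2 for the
    last one. *)
Lemma sum_grid_last : (2 * \sum_p (grid_mono p).2 = e * D' * D)%N.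
Proof.
have h : (\sum_p (grid_mono p).2 + \sum_p (grid_mono p).1.1 + \sum_p (grid_mono p).1.2 =
   e * D' * D)%N.
  rewrite -!big_split /= (eq_bigr (fun _ => D)) => [|p _]; last first.
    by have := grid_mono_deg p; rewrite /=; lia.
  by rewrite sum_nat_const card_prod !card_ord.
have h1 : (\sum_p (grid_mono p).1.1 = D' * \sum_(i < e) (i : nat))%N.
  rewrite -(pair_bigA _ (fun (i : 'I_e) (j : 'I_D') => (i : nat))) /= big_distrr /=.
  by apply: eq_bigr => i _; rewrite sum_nat_const card_ord.
have h2 : (\sum_p (grid_mono p).1.2 = e * \sum_(j < D') (j : nat))%N.
  by rewrite -(pair_bigA _ (fun (i : 'I_e) (j : 'I_D') => (j : nat))) /= sum_nat_const card_ord.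
have := sum_ord_double e; have := sum_ord_double D'.
move: h; rewrite h1 h2; move: (\sum_p _)%N (\sum_(i < e) _)%N (\sum_(j < D') _)%N => s u v.
move=> h hv hu.
have : (2 * s + D' * (2 * u) + e * (2 * v) = 2 * (e * D' * D))%N by rewrite -h; ring.
rewrite hu hv /D => hh.
have e1 : (D' * (e * e.-1) = e * D' * e.-1)%N by ring.
have e2 : (e * (D' * D'.-1) = e * D' * D'.-1)%N by ring.
by move: hh; rewrite e1 e2 !mulnDr; lia.
Qed.
End GridExponents.

Section PlaneAux.
Variables (d : nat) (f1 f2 : {poly int}).
Hypotheses (d2 : (2 <= d)%N) (sf1 : sepform d f1) (sf2 : sepform d f2).

(** With s monomials and s conditions, the two inequalities on [pi] and [xi] balance for [tau] = 0
    near pi = 2 M D / (s - 1), which tends to 2 M / e as D' grows. The bound t^(M + 1) on the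
    coordinates leaves room for a sheared one. *)
Lemma plane_aux K e D' : exists t0, forall t pi xi tau M E (a r1 r2 r3 : 'rV[int]_4),
  let s := (e * D')%N in let D := (e.-1 + D'.-1)%N in
  (0 < e)%N -> (0 < D')%N -> (t0 <= t)%N -> (0 < pi)%N -> (M <= K)%N -> (tau <= M)%N ->
  (pi.+1 * s.+1 < 2 * xi + tau * D)%N -> (xi + M.+1 * D + 1 <= pi * s)%N ->
  \det (mx4 a r1 r2 r3) != 0 ->
  (forall b i, b \in [:: a; r1; r2; r3] -> (`|(b 0%R i)%R| <= t ^ K)%N) ->
  (forall x, in_box (t ^ M) x -> dot a x = 0 ->
     [/\ (`|dot r1 x| <= t ^ M.+1)%N, (`|dot r2 x| <= t ^ M.+1)%N &
      (`|dot r3 x| <= t ^ (M.+1 - tau))%N]) ->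
  (forall h : 'I_e * 'I_D' -> int, (exists i, h i != 0) ->
     atmost E (fun x => [/\ onS d f1 f2 x, dot a x = 0 &
     \sum_i h i * mono (grid_mono i) (dot r1 x) (dot r2 x) (dot r3 x) = 0])) ->
  atmost ((12 * E + d.+1 * d.+1 * 2) * t ^ (pi + 3))
    (fun x => [/\ onS d f1 f2 x, dot a x = 0 & in_box (t ^ M) x]).
Proof.
have [t0 ht0] := surf_split d2 sf1 sf2 K; exists (t0 + e * D' + 2)%N.
move=> t pi xi tau M E a r1 r2 r3 s D e0 D0 tt pi0 MK tauM h1 h2 det0 hb hr hE.
have t1 : (1 < t)%N by lia.
have t0' : (0 < t)%N by lia.
pose X (i : 'I_e * 'I_D') := (t ^ (xi + tau * (grid_mono i).2))%N.
pose W (i : 'I_e * 'I_D') := (t ^ (M.+1 * ((grid_mono i).1.1 + (grid_mono i).1.2) +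
   (M.+1 - tau) * (grid_mono i).2))%N.
have s0 : (0 < s)%N by rewrite muln_gt0 e0.
have deg := grid_mono_deg e0 D0.
apply: (ht0 t pi _ (@grid_mono e D') D s X W E (t ^ M)%N a r1 r2 r3) => //.
- by lia.
- by rewrite leq_pexp2l.
- move=> q /andP[q1 q2]; split.
    apply: (@leq_ltn_trans (\prod_(r < s) (t ^ pi.+1) ^ (s - r))).
      by apply: leq_prod => r _; apply: leqXn.
    apply: (@leq_trans (\prod_i X i)); last by apply: leq_prod => i _.
    rewrite /X -!expn_sum -expnM ltn_exp2l //.
    rewrite big_split /= -big_distrr /= sum_nat_const card_prod !card_ord -/s.
    have e1 := sum_rev_ord_double s; have e2 := sum_grid_last e0 D0; rewrite -/s -/D in e2.
    rewrite -(@ltn_pmul2l 2) // mulnCA e1 mulnDr [(2 * (tau * _))%N]mulnCA e2.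
    have -> : (pi.+1 * (s * s.+1) = s * (pi.+1 * s.+1))%N by ring.
    have -> : (2 * (s * xi) + tau * (s * D) = s * (2 * xi + tau * D))%N by ring.
    by rewrite ltn_pmul2l.
  apply: (@leq_ltn_trans (\sum_(i : 'I_e * 'I_D') t ^ (xi + M.+1 * D))).
    apply: leq_sum => i _; rewrite /X /W -expnD leq_pexp2l //.
    have := deg i; rewrite -/D; move: (grid_mono i) => [[u v] w] /= <-.
    have -> : (xi + M.+1 * (u + v + w) = xi + M.+1 * (u + v) + M.+1 * w)%N by ring.
    have -> : (M.+1 * w = (M.+1 - tau) * w + tau * w)%N.
      by rewrite -mulnDl subnK // leqW.
    by lia.
  rewrite sum_nat_const card_prod !card_ord -/s.
  apply: leq_trans (leqXn s q1); rewrite -expnM.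
  apply: leq_trans (_ : t * t ^ (xi + M.+1 * D) <= _)%N.
    by rewrite ltn_pmul2r ?expn_gt0 ?t0' //; rewrite /s; lia.
  by rewrite -expnS leq_pexp2l //; lia.
- move=> x bx ax i; have [b1 b2 b3] := hr x bx ax.
  have -> : W i = ((t ^ M.+1) ^ (grid_mono i).1.1 * (t ^ M.+1) ^ (grid_mono i).1.2 *
      (t ^ (M.+1 - tau)) ^ (grid_mono i).2)%N.
    by rewrite -!expnM -!expnD /W; congr (_ ^ _)%N; ring.
  rewrite /mono !abszM !abszX.
  by apply: leq_mul; [apply: leq_mul|]; apply: leqXn.
Qed.
End PlaneAux.

Lemma size_prod_leq_const (R : idomainType) (I : Type) (r : seq I) (F : I -> {poly R}) m :
  (forall i, size (F i) <= m.+1)%N -> (size (\prod_(i <- r) F i)%R <= (size r * m).+1)%N.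
Proof.
move=> hF; elim: r => [|i r IH]; first by rewrite big_nil size_poly1.
rewrite big_cons /=; apply: leq_trans (size_polyMleq _ _) _.
by have := hF i; move: IH; move: (size _) (size _) => u v; lia.
Qed.

Lemma size_det_leq (R : idomainType) n (A : 'M[{poly R}]_n) m :
  (forall i j, size (A i j) <= m.+1)%N -> (size (\det A)%R <= (n * m).+1)%N.
Proof.
move=> hA; apply: leq_trans (size_sum _ _ _) _; apply/bigmax_leqP => s _.
rewrite -signr_odd; set p := \prod_i _.
have -> : size ((-1) ^+ odd s * p)%R = size p.
  by case: (odd s); rewrite ?expr0 ?mul1r // expr1 mulN1r size_polyN.
have -> : p = \prod_(i <- enum 'I_n) A i (s i) by rewrite /p big_enum.
have := size_prod_leq_const (enum 'I_n) (fun i => hA i (s i)).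
by rewrite size_enum_ord.
Qed.

Lemma size_resultant_leq (R : idomainType) (p q : {poly {poly R}}) m e d :
  (size p <= d.+1)%N -> (size q <= e.+1)%N ->
  (forall i, size (p`_i)%R <= m.+1)%N -> (forall i, size (q`_i)%R <= m.+1)%N ->
  (size (resultant p q) <= ((e + d) * m).+1)%N.
Proof.
move=> sp sq cp cq; apply: leq_trans (size_det_leq (m := m) _) _.
  move=> i j; rewrite Sylvester_mxE.
  have hn (x : {poly R}) (b : bool) : (size x <= m.+1)%N -> (size (x *+ b) <= m.+1)%N.
    by case: b; rewrite ?mulr0n ?size_poly0.
  by case: (split i) => k; apply: hn.
rewrite ltnS leq_mul //; move: sp sq; move: (size p) (size q) => u v hu hv.
by apply: leq_add; [case: v hv | case: u hu].
Qed.

(** * Elimination on a section *)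

Section SectionEnd.
Variables (d : nat) (f1 f2 : {poly int}) (N1 N2 N3 : 'rV[int]_4) (e D' : nat).
Hypotheses (d0 : (0 < d)%N) (e0 : (0 < e)%N) (D0 : (0 < D')%N).

(* The section dehomogenised at its third coordinate, as a polynomial in the first coordinate over Z['X] ('X being the second one). *)
Definition sec_poly : {poly {poly int}} := psec d f1 f2 N1 N2 N3 'X ('X%:P) 1.

(** The scalar [c] clears denominators: what is excluded are factors over the rational functions of
    the second coordinate, of degree 1 to e - 1 in the first. *)
Definition no_low_factor := forall (c : {poly int}) (k k' : {poly {poly int}}),
  c != 0 -> c *: sec_poly = k' * k -> (1 < size k <= e)%N -> False.

Definition grid_poly (h : 'I_e * 'I_D' -> int) : {poly {poly int}} :=
  \sum_p (h p *: 'X^(p.2))%:P * 'X^(p.1).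

Lemma grid_poly_coef h (p : 'I_e * 'I_D') : (grid_poly h)`_(p.1)`_(p.2) = h p.
Proof.
rewrite /grid_poly coef_sum coef_sum (bigD1 p) //= big1 => [|q qp].
  by rewrite coefCM coefXn eqxx mulr1 coefZ coefXn eqxx mulr1 addr0.
rewrite coefCM coefXn; case: eqVneq => e1; last by rewrite mulr0 coef0.
rewrite mulr1 coefZ coefXn; case: eqVneq => e2; last by rewrite mulr0.
by case/eqP: qp; case: p q e1 e2 => p1 p2 [q1 q2] /= /val_inj -> /val_inj ->.
Qed.

Lemma size_grid_poly h : (size (grid_poly h) <= e)%N.
Proof.
apply: leq_trans (size_sum _ _ _) _; apply/bigmax_leqP => p _.
rewrite mul_polyC; apply: leq_trans (size_scale_leq _ _) _.
by rewrite size_polyXn.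
Qed.

Lemma size_grid_poly_coef h i : (size ((grid_poly h)`_i)%R <= D')%N.
Proof.
rewrite /grid_poly coef_sum; apply: leq_trans (size_sum _ _ _) _.
apply/bigmax_leqP => p _; rewrite coefCM coefXn mulr_natr.
case: (_ == _); rewrite ?mulr0n ?size_poly0 // mulr1n.
by apply: leq_trans (size_scale_leq _ _) _; rewrite size_polyXn.
Qed.

Lemma size_pcoord_lin (A : idomainType) (p q : {poly A}) i :
  (size p <= 2)%N -> (size q <= 2)%N ->
  (size (pcoord N1 N2 N3 p q 1 i) <= 2)%N.
Proof.
move=> sp sq; rewrite /pcoord -!(rmorph_int polyC) !mul_polyC.
apply: leq_trans (size_polyD _ _) _; rewrite geq_max; apply/andP; split.
  apply: leq_trans (size_polyD _ _) _; rewrite geq_max.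
  by rewrite !(leq_trans (size_scale_leq _ _)).
by apply: leq_trans (size_scale_leq _ _) _; rewrite size_poly1.
Qed.

Lemma size_psec_lin (A : idomainType) (p q : {poly A}) :
  (size p <= 2)%N -> (size q <= 2)%N -> (size (psec d f1 f2 N1 N2 N3 p q 1) <= d.+1)%N.
Proof.
move=> sp sq; apply: leq_trans (size_polyD _ _) _; rewrite size_polyN geq_max.
by rewrite !size_bf_lin // size_pcoord_lin.
Qed.

Lemma size_sec_poly : (size sec_poly <= d.+1)%N.
Proof. by rewrite size_psec_lin ?size_polyX // (leq_trans (size_polyC_leq1 _)). Qed.

Lemma size_sec_poly_coef i : (size (sec_poly`_i)%R <= d.+1)%N.
Proof.
have : (size (swapXY sec_poly) <= d.+1)%N.
  have := rmorph_psec d f1 f2 N1 N2 N3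
    (@swapXY int : {rmorphism {poly {poly int}} -> {poly {poly int}}}) 'X 'X%:P 1.
  rewrite /= swapXY_X swapXY_Y rmorph1 -/sec_poly => ->.
  by rewrite size_psec_lin ?size_polyX // (leq_trans (size_polyC_leq1 _)).
move=> h; apply/leq_sizeP => j hj; rewrite -coef_swapXY.
by rewrite (leq_sizeP _ _ h) // coef0.
Qed.

Definition ev2 (z y : rat) (p : {poly {poly int}}) : rat :=
  (map_poly (horner_eval z \o map_poly intr) p).[y].

Lemma ev2_psec z y : ev2 z y sec_poly = psec d f1 f2 N1 N2 N3 y z 1.
Proof.
pose phi : {rmorphism {poly int} -> rat} := horner_eval z \o map_poly intr.
pose Phi : {rmorphism {poly {poly int}} -> rat} := horner_eval y \o map_poly phi.
rewrite -[LHS]/(Phi sec_poly) rmorph_psec; congr (psec _ _ _ _ _ _ _ _ _).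
- by rewrite /Phi /= map_polyX /horner_eval hornerX.
- by rewrite /Phi /= map_polyC /horner_eval hornerC /phi /= map_polyX /horner_eval hornerX.
- by rewrite rmorph1.
Qed.

Lemma ev2_grid h z y : ev2 z y (grid_poly h) = \sum_p (h p)%:~R * (y ^+ p.1 * z ^+ p.2).
Proof.
pose phi : {rmorphism {poly int} -> rat} := horner_eval z \o map_poly intr.
pose Phi : {rmorphism {poly {poly int}} -> rat} := horner_eval y \o map_poly phi.
have eX : Phi 'X = y by rewrite /Phi /= map_polyX /horner_eval hornerX.
have eC c : Phi c%:P = phi c by rewrite /Phi /= map_polyC /horner_eval hornerC.
have ephi c n : phi (c *: 'X^n) = c%:~R * z ^+ n.
  by rewrite /phi /= map_polyZ map_polyXn /horner_eval hornerZ hornerXn.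
rewrite -[LHS]/(Phi (grid_poly h)) rmorph_sum; apply: eq_bigr => p _.
by rewrite rmorphM rmorphXn eX eC ephi mulrAC -mulrA.
Qed.

Hypothesis gamma0 : surf d f1 f2 N1 != 0.

Lemma psec_lead (A : comNzRingType) (y : A) : psec d f1 f2 N1 N2 N3 y 0 0 =
  y ^+ d * (surf d f1 f2 N1)%:~R.
Proof.
have -> : (surf d f1 f2 N1)%:~R = psec d f1 f2 N1 N2 N3 (1 : A) 0 0.
  have := rmorph_psec d f1 f2 N1 N2 N3 (intr : {rmorphism int -> A}) 1 0 0.
  rewrite rmorph1 rmorph0 => <-; congr (_%:~R).
  by rewrite psec_surf scale1r !scale0r !addr0.
by rewrite -psec_hom mulr1 mulr0.
Qed.
End SectionEnd.

Lemma mono_grid_homog e D' (p : 'I_e * 'I_D') (y z w : rat) :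
  w != 0 -> (y * w) ^+ (grid_mono p).1.1 * (z * w) ^+ (grid_mono p).1.2 * w ^+ (grid_mono p).2 =
   w ^+ (e.-1 + D'.-1) * (y ^+ p.1 * z ^+ p.2).
Proof.
move=> w0; have -> : (e.-1 + D'.-1 = (grid_mono p).1.1 + (grid_mono p).1.2 + (grid_mono p).2)%N.
  by rewrite grid_mono_deg //; case: p => -[i hi] [j hj] /=; lia.
by rewrite !exprD !exprMn /=; ring.
Qed.

Section SectionEndCount.
Variables (d : nat) (f1 f2 : {poly int}) (a r1 r2 r3 : 'rV[int]_4) (e D' : nat).
Hypotheses (d0 : (0 < d)%N) (e0 : (0 < e)%N) (D0 : (0 < D')%N).
Let M := mx4 a r1 r2 r3.
Let N1 := adj_vec M o1.
Let N2 := adj_vec M o2.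
Let N3 := adj_vec M o3.
Hypothesis det0 : \det M != 0.
Hypothesis gamma0 : surf d f1 f2 N1 != 0.
Hypothesis nlf : no_low_factor d f1 f2 N1 N2 N3 e.

Lemma size_psec_univ (z w : rat) (g : {poly rat} := psec d f1 f2 N1 N2 N3 'X z%:P w%:P) :
  g != 0 /\ (size g <= d.+1)%N.
Proof.
have sp : (size g <= d.+1)%N.
  have spc i : (size (pcoord N1 N2 N3 ('X : {poly rat}) z%:P w%:P i) <= 2)%N.
    rewrite /pcoord -!(rmorph_int polyC) -!polyCM mul_polyC -addrA -polyCD.
    apply: leq_trans (size_polyD _ _) _; rewrite geq_max.
    rewrite (leq_trans (size_scale_leq _ _)) ?size_polyX //=.
    by rewrite (leq_trans (size_polyC_leq1 _)).
  apply: leq_trans (size_polyD _ _) _; rewrite size_polyN geq_max.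
  by rewrite !size_bf_lin // !spc.
split=> //; apply/eqP => g0.
(* Homogenise: Y^d g(X/Y) at Y = 0 would be the leading term. *)
pose g' : {poly rat} := psec d f1 f2 N1 N2 N3 1 (z *: 'X) (w *: 'X).
have : g' = 0.
  apply: poly_zero_inf => n; rewrite psec_line_poly !hornerE.
  set m := n.+1%:R; have m0 : m != 0 by rewrite pnatr_eq0.
  have := congr1 (fun p => p.[m^-1]) g0; rewrite /= /g psec_line_poly !hornerE => h.
  have := psec_hom d f1 f2 N1 N2 N3 m m^-1 z w.
  by rewrite h mulr0 divff // mulrC [m * w]mulrC.
move/(congr1 (fun p => p.[0])); rewrite /= psec_line_poly !hornerE ?mulr0.
have := psec_lead d f1 f2 N1 N2 N3 (1 : rat); rewrite expr1n mul1r => -> /eqP.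
by rewrite intr_eq0 (negPf gamma0).
Qed.

Lemma det_expand x : dot a x = 0 ->
  \det M *: x = dot r1 x *: N1 + dot r2 x *: N2 + dot r3 x *: N3.
Proof. by move=> ax; rewrite adj_vec_expand ax scale0r add0r. Qed.

Lemma toQ_expand x : dot a x = 0 -> toQ x = (\det M)%:~R^-1 *:
  ((dot r1 x)%:~R *: toQ N1 + (dot r2 x)%:~R *: toQ N2 + (dot r3 x)%:~R *: toQ N3).
Proof.
move=> ax; have /rowP h := det_expand ax.
have D1 : (\det M)%:~R != 0 :> rat by rewrite intr_eq0.
apply/rowP => i; have := congr1 (fun z : int => z%:~R : rat) (h i).
rewrite !mxE /= !intrD !intrM => e1; apply: (mulfI D1).
by rewrite [RHS]mulrA divff // mul1r e1 ?mxE.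
Qed.

Lemma psec_at x : dot a x = 0 -> surf d f1 f2 x = 0 ->
  psec d f1 f2 N1 N2 N3 (dot r1 x)%:~R (dot r2 x)%:~R (dot r3 x)%:~R = 0 :> rat.
Proof.
move=> ax sx; rewrite -(rmorph_psec d f1 f2 N1 N2 N3 (intr : {rmorphism int -> rat})).
by rewrite psec_surf -det_expand // surfZ sx mulr0.
Qed.

Lemma same_direction x y (v : 'rV[rat]_4) (k k' : rat) :
  toQ x = k *: v -> toQ y = k' *: v -> parallel x y.
Proof.
move=> ex ey i j; apply: (@intr_inj rat); rewrite !intrM.
have ex' : toQ x = k *: v + 0 *: v by rewrite scale0r addr0.
have ey' : toQ y = k' *: v + 0 *: v by rewrite scale0r addr0.
by have := parallel_linear ex' ey' _ i j; rewrite !mxE; apply; rewrite !mulr0.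
Qed.

Definition section_end_bound := ((((d + e) * (d + D')).+1 * (d.+1 * 2)) + d.+1 * 2)%N.

(** Without a common factor, the resultant of the section and the auxiliary form is a nonzero
    polynomial in the second coordinate of bounded degree. Each of its roots leaves boundedly many
    first coordinates because [N1] is off the surface, and a projective point has two primitive
    representatives. Points with third coordinate 0 are treated apart. *)
Lemma section_end_count (h : 'I_e * 'I_D' -> int) : (exists p, h p != 0) ->
  atmost section_end_bound (fun x => [/\ onS d f1 f2 x, dot a x = 0 &
    \sum_p h p * mono (grid_mono p) (dot r1 x) (dot r2 x) (dot r3 x) = 0]).
Proof.
move=> [p0 hp0]; set Z := fun x => _.
have [r [r0 sr root]] : exists r : {poly int}, [/\ r != 0, (size r <= ((d + e) * (d + D')).+1)%N &
   forall x, Z x -> dot r3 x != 0 ->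
     (map_poly intr r : {poly rat}).[(dot r2 x)%:~R / (dot r3 x)%:~R] = 0].
  pose g := sec_poly d f1 f2 N1 N2 N3; pose gh := grid_poly h.
  have gh0 : gh != 0.
    apply/eqP => e1; move/eqP: hp0; apply.
    by rewrite -(grid_poly_coef h p0) -/gh e1 !coef0.
  have van x : Z x -> dot r3 x != 0 ->
     ev2 ((dot r2 x)%:~R / (dot r3 x)%:~R) ((dot r1 x)%:~R / (dot r3 x)%:~R) g = 0 /\
     ev2 ((dot r2 x)%:~R / (dot r3 x)%:~R) ((dot r1 x)%:~R / (dot r3 x)%:~R) gh = 0.
    move=> [[px sx mx] ax hx] w0; set z := _ / _; set y := _ / _.
    set w : rat := (dot r3 x)%:~R; have wq : w != 0 by rewrite intr_eq0.
    have ey : (dot r1 x)%:~R = y * w by rewrite /y divfK.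
    have ez : (dot r2 x)%:~R = z * w by rewrite /z divfK.
    split.
      rewrite /g ev2_psec; apply: (mulfI (expf_neq0 d wq)); rewrite -psec_hom mulr0.
      by rewrite -(psec_at ax sx) ey ez mulr1 ![w * _]mulrC.
    rewrite /gh ev2_grid; apply: (mulfI (expf_neq0 (e.-1 + D'.-1) wq)); rewrite mulr0.
    rewrite -[RHS](rmorph0 (intr : {rmorphism int -> rat})) -hx rmorph_sum /=.
    rewrite mulr_sumr; apply: eq_bigr => p _.
    by rewrite intrM /mono !intrM !rmorphXn /= ey ez -/w mono_grid_homog // mulrCA.
  (* An auxiliary form free of the first coordinate is its own eliminant. *)
  have [sg1|sg1] := leqP (size gh) 1.
    exists (gh`_0); split.
    - by move: gh0; rewrite [gh]size1_polyC // polyC_eq0 coefC.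
    - by apply: leq_trans (size_grid_poly_coef _ _) _; nia.
    - move=> x Zx w0; have [_] := van x Zx w0.
      by rewrite [gh]size1_polyC // /ev2 map_polyC hornerC coefC.
  (* If the section were free of the first coordinate, its coefficient at the d-th power of that
     coordinate, which is [surf d f1 f2 N1], would vanish. *)
  have sgg : (1 < size g)%N.
    rewrite ltnNge; apply/negP => s1.
    have gc : g = (g`_0)%:P by apply: size1_polyC.
    have cst y : psec d f1 f2 N1 N2 N3 y 0 1 = (map_poly intr g`_0 : {poly rat}).[0].
      by rewrite -ev2_psec -/g gc /ev2 map_polyC hornerC coefC.
    set c := _.[0] in cst.
    have : psec d f1 f2 N1 N2 N3 1 0 'X - c *: 'X^d = 0 :> {poly rat}.
      apply: poly_zero_inf => n; rewrite hornerD hornerN psec_line_poly !hornerE.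
      set m := n.+1%:R; have m0 : m != 0 by rewrite pnatr_eq0.
      have := psec_hom d f1 f2 N1 N2 N3 m m^-1 0 1.
      by rewrite cst divff // mulr0 mulr1 => ->; rewrite ?hornerXn mulrC subrr.
    move/(congr1 (fun p => p.[0])); rewrite /= hornerD hornerN psec_line_poly !hornerE.
    have := psec_lead d f1 f2 N1 N2 N3 (1 : rat); rewrite expr1n mul1r => ->.
    rewrite ?hornerXn expr0n gtn_eqF // mulr0 subr0 => /eqP.
    by rewrite intr_eq0 (negPf gamma0).
  exists (resultant g gh); split.
  - rewrite resultant_eq0 -leqNgt leqNgt; apply/negP => s1.
    have /Pdiv.Idomain.dvdpP [[c k'] /= c0 ec] := dvdp_gcdl g gh.
    apply: (nlf c0 ec); rewrite s1 /=.
    by apply: leq_trans (size_grid_poly h); apply: dvdp_leq => //; apply: dvdp_gcdr.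
  - rewrite [(d + e)%N]addnC; apply: (@size_resultant_leq int g gh (d + D') e d).
    + exact: size_sec_poly.
    + by apply: leq_trans (size_grid_poly _) _.
    + by move=> i; apply: leq_trans (size_sec_poly_coef _ _ _ _ _ _ _) _; lia.
    + by move=> i; apply: leq_trans (size_grid_poly_coef _ _) _; lia.
  - move=> x Zx w0; have [e1 e2] := van x Zx w0.
    have [[u v] _ euv] := resultant_in_ideal sgg sg1.
    move: e1 e2; rewrite /ev2; set z := _ / _; set y := _ / _ => e1 e2.
    have := congr1 (ev2 z y) euv; rewrite /ev2 /= rmorphD !rmorphM /= hornerD !hornerM e1 e2.
    by rewrite !mulr0 addr0 map_polyC hornerC.
have key x y z w : dot a x = 0 -> (dot r1 x)%:~R = y * w -> (dot r2 x)%:~R = z * w ->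
    (dot r3 x)%:~R = (dot r3 x)%:~R / w * w -> w != 0 :> rat ->
    toQ x = (w / (\det M)%:~R) *: (y *: toQ N1 + z *: toQ N2 + ((dot r3 x)%:~R / w) *: toQ N3).
  move=> ax e1 e2 e3 w0; rewrite (toQ_expand ax) e1 e2 {1}e3.
  by apply/rowP => i; rewrite !mxE; ring.
apply: (@atmost_sub _ _ _ (fun x => (Z x /\ dot r3 x != 0) \/ (Z x /\ dot r3 x = 0))).
  by move=> x Zx; have [w0|w0] := eqVneq (dot r3 x) 0; [right | left].
apply: atmostU.
  pose rq : {poly rat} := map_poly intr r.
  have rq0 : rq != 0 by rewrite map_poly_eq0_id0 // intr_eq0 lead_coef_eq0.
  have srq : (size rq <= ((d + e) * (d + D')).+2)%N.
    by apply: leq_trans (size_poly _ _) _; apply: leqW.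
  apply: (@atmost_rel _ _ _ _ _ (fun z x => z = (dot r2 x)%:~R / (dot r3 x)%:~R)
     _ (atmost_roots rq0 srq)) => [x [Zx w0]|z _].
    by eexists; [exact: root Zx w0 | ].
  have [g0 sg] := size_psec_univ z 1.
  apply: (@atmost_rel _ _ _ _ _ (fun y x => y = (dot r1 x)%:~R / (dot r3 x)%:~R)
     _ (atmost_roots g0 (leqW sg))) => [x [[Zx w0] ez]|y _].
    exists ((dot r1 x)%:~R / (dot r3 x)%:~R) => //; rewrite psec_line_poly !hornerE.
    have wq : (dot r3 x)%:~R != 0 :> rat by rewrite intr_eq0.
    have [[px sx mx] ax _] := Zx.
    apply: (mulfI (expf_neq0 d wq)); rewrite -psec_hom mulr0 -(psec_at ax sx) ez mulr1.
    by rewrite ![(dot r3 x)%:~R * _]mulrC !divfK.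
  apply: atmost_parallel => [x [[[[[]]]]]|x x' [[[Zx w0] ez] ey] [[[Zx' w0'] ez'] ey']] //.
  have [_ ax _] := Zx; have [_ ax' _] := Zx'.
  have wq : (dot r3 x)%:~R != 0 :> rat by rewrite intr_eq0.
  have wq' : (dot r3 x')%:~R != 0 :> rat by rewrite intr_eq0.
  apply: same_direction (y *: toQ N1 + z *: toQ N2 + 1 *: toQ N3) _ _ _ _.
    have := key x y z (dot r3 x)%:~R ax _ _ _ wq; rewrite divff //; apply.
    - by rewrite ey divfK.
    - by rewrite ez divfK.
    - by rewrite mul1r.
  have := key x' y z (dot r3 x')%:~R ax' _ _ _ wq'; rewrite divff //; apply.
  - by rewrite ey' divfK.
  - by rewrite ez' divfK.
  - by rewrite mul1r.
have [g0 sg] := size_psec_univ 1 0.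
have z0 x : Z x -> dot r3 x = 0 -> (dot r2 x)%:~R != 0 :> rat.
  move=> [[px sx mx] ax _] w0; rewrite intr_eq0; apply/eqP => z0.
  have := psec_at ax sx; rewrite w0 z0 psec_lead => /eqP.
  rewrite mulf_eq0 intr_eq0 (negPf gamma0) orbF expf_eq0 intr_eq0 => /andP[_ /eqP y0].
  move/eqP: mx; apply; have := toQ_expand ax; rewrite w0 z0 y0 !scale0r !addr0 scaler0.
  have xi0 i : toQ x = 0 -> x 0 i = 0.
    by move/rowP/(_ i); rewrite !mxE => /eqP; rewrite intr_eq0 => /eqP.
  by move=> x0; rewrite !xi0 // bf00.
apply: (@atmost_rel _ _ _ _ _ (fun y x => y = (dot r1 x)%:~R / (dot r2 x)%:~R)
     _ (atmost_roots g0 (leqW sg))) => [x [Zx w0]|y _].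
  exists ((dot r1 x)%:~R / (dot r2 x)%:~R) => //; rewrite psec_line_poly !hornerE.
  have zq := z0 x Zx w0; have [[px sx mx] ax _] := Zx.
  apply: (mulfI (expf_neq0 d zq)); rewrite -psec_hom [RHS]mulr0 -[RHS](psec_at ax sx) w0.
  by rewrite mulr1 mulr0 [(dot r2 x)%:~R * _]mulrC divfK.
apply: atmost_parallel => [x [[[[]]]]|x x' [[Zx w0] ey] [[Zx' w0'] ey']] //.
have [_ ax _] := Zx; have [_ ax' _] := Zx'.
have zq := z0 x Zx w0; have zq' := z0 x' Zx' w0'.
apply: same_direction (y *: toQ N1 + 1 *: toQ N2 + 0 *: toQ N3) _ _ _ _.
  have := key x y 1 (dot r2 x)%:~R ax _ _ _ zq; rewrite w0 mul0r; apply.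
  - by rewrite ey divfK.
  - by rewrite mul1r.
  - by rewrite mul0r.
have := key x' y 1 (dot r2 x')%:~R ax' _ _ _ zq'; rewrite w0' mul0r; apply.
- by rewrite ey' divfK.
- by rewrite mul1r.
- by rewrite mul0r.
Qed.
End SectionEndCount.

From mathcomp Require Import closed_field.

(** * Excluding factors of low degree *)

Section StripContent.
Variables (A B : idomainType) (chi : {rmorphism A -> B}) (pi : A).
Hypothesis ker : forall x, chi x = 0 -> exists y, x = pi * y.
Hypothesis pi0 : pi != 0.

Lemma poly_ker (k : {poly A}) : map_poly chi k = 0 -> exists k1, k = pi *: k1.
Proof.
move=> k0; have /choice[q hq] : forall i : nat, exists y, k`_i = pi * y.
  by move=> i; apply: ker; rewrite -coef_map k0 coef0.
exists (\poly_(i < size k) q i); apply/polyP => i; rewrite coefZ coef_poly.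
by case: ltnP => hi; [rewrite hq | rewrite nth_default // mulr0].
Qed.

(** Gauss's lemma. What [chi] kills is a multiple of [pi], and since [B] is a domain a product
    killed by [chi] has a killed factor, from which [pi] is cancelled. The bound [n] on the
    multiplicity of [pi] in [c] makes this stop. *)
Lemma strip_content (g : {poly A}) n : forall (c : A) (k k' : {poly A}),
  c *: g = k' * k -> ~ (exists y, c = pi ^+ n * y) ->
  exists c1 k1 k1', [/\ chi c1 != 0, c1 *: g = k1' * k1, size k1 = size k & size k1' = size k'].
Proof.
elim: n => [|n IH] c k k' e nc.
  by case: nc; exists c; rewrite expr0 mul1r.
have [c0|c0] := eqVneq (chi c) 0; last by exists c, k, k'.
have [c1 ec] := ker c0.
have nc1 : ~ (exists y, c1 = pi ^+ n * y).
  by move=> [y ey]; apply: nc; exists y; rewrite ec ey exprS mulrA.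
have : map_poly chi (k' * k) = 0 by rewrite -e map_polyZ c0 scale0r.
rewrite rmorphM /= => /eqP; rewrite mulf_eq0 => /orP[] /eqP /poly_ker[k1 ek].
- have e1 : c1 *: g = k1 * k.
    apply: (@mulfI _ pi%:P); first by rewrite polyC_eq0.
    by rewrite [LHS]mul_polyC scalerA -ec e {1}ek -mul_polyC mulrA.
  have [c2 [k2 [k2' [h1 h2 h3 h4]]]] := IH c1 k k1 e1 nc1.
  by exists c2, k2, k2'; split=> //; rewrite h4 ek -mul_polyC size_Cmul.
- have e1 : c1 *: g = k' * k1.
    apply: (@mulfI _ pi%:P); first by rewrite polyC_eq0.
    by rewrite [LHS]mul_polyC scalerA -ec e {1}ek -mul_polyC mulrCA.
  have [c2 [k2 [k2' [h1 h2 h3 h4]]]] := IH c1 k1 k' e1 nc1.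
  by exists c2, k2, k2'; split=> //; rewrite h3 ek -mul_polyC size_Cmul.
Qed.
End StripContent.

Lemma poly_pow_bound (K : fieldType) (b : K) (c : {poly K}) : c != 0 ->
  ~ (exists y, c = ('X - b%:P) ^+ (size c) * y).
Proof.
move=> c0 [y ey]; have y0 : y != 0 by apply: contraNneq c0 => y0; rewrite ey y0 mulr0.
have := congr1 (fun p : {poly K} => size p) ey.
rewrite /= size_mul ?expf_neq0 ?polyXsubC_eq0 // size_exp_XsubC.
by move: y0; rewrite -size_poly_gt0; move: (size y) (size c) => u v; lia.
Qed.

Lemma size_coprime_X (K : fieldType) (k k' : {poly K}) d a :
  a != 0 -> k' * k = a *: 'X^d -> (size k' <= d)%N -> k`_0 = 0.
Proof.
move=> a0 e sk'; apply/eqP; apply: contraT => k0.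
have cop : coprimep ('X^d) k.
  rewrite coprimep_expl // coprimep_sym -['X]subr0 -polyC0 coprimep_XsubC /root.
  by rewrite horner_coef0.
have : 'X^d %| k' by rewrite -(Gauss_dvdpl k' cop) e dvdpZr // dvdpp.
move/dvdp_leq; rewrite size_polyXn.
have k'0 : k' != 0.
  apply/eqP => k'0; move/eqP: e; rewrite k'0 mul0r eq_sym scaler_eq0 (negPf a0).
  by rewrite expf_eq0 polyX_eq0 andbF.
by move/(_ k'0); rewrite leqNgt ltnS sk'.
Qed.

(* Eisenstein's criterion at the simple zero b of F. *)
Lemma eisenstein_simple_root (K : fieldType) d (a b : K) (F : {poly K})
    (c : {poly K}) (k k' : {poly {poly K}}) :
  (0 < d)%N -> a != 0 -> F.[b] = 0 -> F^`().[b] != 0 -> c != 0 ->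
  c *: (a%:P *: 'X^d - F%:P) = k' * k -> (size k <= d)%N -> (size k' <= d)%N -> False.
Proof.
move=> d0 a0 Fb F'b c0 e sk sk'.
have ker x : (horner_eval b : {rmorphism {poly K} -> K}) x = 0 -> exists y, x = ('X - b%:P) * y.
  rewrite /= /horner_eval => /rootP; rewrite -dvdp_XsubCl => /dvdpP[y ->].
  by exists y; rewrite mulrC.
have X0 : 'X - b%:P != 0 by rewrite polyXsubC_eq0.
have [c1 [k1 [k1' [h1 h2 s1 s1']]]] := strip_content ker X0 e (poly_pow_bound (b := b) c0).
rewrite -s1 in sk; rewrite -s1' in sk'.
have e2 := congr1 (map_poly (horner_eval b)) h2.
rewrite map_polyZ rmorphM rmorphB /= map_polyZ map_polyXn map_polyC /= in e2.
rewrite {2 3}/horner_eval hornerC Fb subr0 scalerA in e2.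
have a1 : c1.[b] * a != 0 by rewrite mulf_neq0.
have sm (p : {poly {poly K}}) : (size (map_poly (horner_eval b) p) <= size p)%N by apply: size_poly.
have z1 : (k1`_0).[b] = 0.
  have := size_coprime_X a1 (esym e2) (leq_trans (sm _) sk').
  by rewrite coef_map.
have z2 : (k1'`_0).[b] = 0.
  rewrite [RHS]mulrC in e2.
  have := size_coprime_X a1 (esym e2) (leq_trans (sm _) sk).
  by rewrite coef_map.
(* The constant coefficients of both factors vanish at [b], so their product has a double zero
   there, whereas that of [F] is simple. *)
have := congr1 (fun p : {poly {poly K}} => (p`_0)^`().[b]) h2.
rewrite coefZ coefB coefZ coefXn coefC coef0M /= eq_sym (gtn_eqF d0) mulr0 sub0r.
rewrite !derivM derivN !hornerE z1 z2 Fb !mulr0 !mul0r !addr0 ?oppr0 ?mulr0 ?add0r.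
move/eqP; rewrite mulf_eq0 oppr_eq0 (negPf F'b) orbF; exact/negP.
Qed.

Lemma finite_char_closure (p : nat) : prime p ->
  exists (K : closedFieldType) (psi : {rmorphism int -> K}), forall n, (psi n == 0) = (p%:Z %| n)%Z.
Proof.
move=> pp; have [K [FK _]] := countable_algebraic_closure 'F_p.
exists K, (FK \o (intr : {rmorphism int -> 'F_p})) => n /=.
by rewrite fmorph_eq0 (dvdz_pcharf (pchar_Fp pp)).
Qed.

Lemma strip_prime (p : nat) (K : fieldType) (psi : {rmorphism int -> K})
    (g : {poly {poly int}}) c k k' : prime p ->
  (forall n, (psi n == 0) = (p%:Z %| n)%Z) -> c != 0 -> c *: g = k' * k ->
  exists c1 k1 k1', [/\ map_poly psi c1 != 0, c1 *: g = k1' * k1,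
    size k1 = size k & size k1' = size k'].
Proof.
move=> pp hpsi c0 e.
have ker (x : {poly int}) : map_poly psi x = 0 -> exists y, x = p%:Z%:P * y.
  move=> x0; have /choice[q hq] : forall i : nat, exists y, x`_i = p%:Z * y.
    move=> i; have : psi x`_i == 0 by rewrite -coef_map x0 coef0.
    by rewrite hpsi => /dvdzP[y ->]; exists y; rewrite mulrC.
  exists (\poly_(i < size x) q i); apply/polyP => i; rewrite coefCM coef_poly.
  by case: ltnP => hi; [rewrite hq | rewrite nth_default // mulr0].
have p0 : p%:Z%:P != 0 :> {poly int} by rewrite polyC_eq0; have := prime_gt0 pp; lia.
apply: (strip_content (chi := map_poly psi) (n := `|lead_coef c|%N) ker p0 e).
move=> [y ey]; have lc : lead_coef c != 0 by rewrite lead_coef_eq0.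
have : (p ^ `|lead_coef c| %| `|lead_coef c|)%N.
  rewrite {2}ey -polyC_exp mul_polyC lead_coefZ abszM abszX absz_nat dvdn_mulr //.
move/dvdn_leq; rewrite absz_gt0 lc => /(_ isT); rewrite leqNgt ltn_expl //.
exact: prime_gt1.
Qed.

Definition unitv (k : 'I_4) : 'rV[int]_4 := delta_mx 0 k.

Lemma dot_unitv k x : dot (unitv k) x = x 0 k.
Proof.
rewrite /dot (bigD1 k) //= big1 => [|i ik]; first by rewrite mxE !eqxx mul1r addr0.
by rewrite mxE (negPf ik) andbF mul0r.
Qed.

Lemma det_units (a : 'rV[int]_4) : \det (mx4 a (unitv o1) (unitv o2) (unitv o3)) = a 0 o0.
Proof.
rewrite -det_tr det_trig.
  rewrite (bigD1 o0) //= !mxE /= big1 ?mulr1 // => i i0; rewrite !mxE.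
  by case: i i0 => -[|[|[|[|//]]]] hi // _; rewrite /= mxE.
apply/is_trig_mxP => i j ij; rewrite !mxE.
by case: j ij => -[|[|[|[|//]]]] hj //= ij; rewrite mxE eqxx /=;
   case: eqVneq => // ei; move: ij; rewrite ei.
Qed.

Lemma bf_poly (K : comNzRingType) d (f : {poly int}) : (size f <= d.+1)%N ->
  bf d f ('X : {poly K}) 1 = map_poly intr f.
Proof.
move=> sf; transitivity (\poly_(i < d.+1) ((f`_i)%:~R : K)).
  rewrite poly_def; apply: eq_bigr => i _.
  by rewrite expr1n mulr1 -(rmorph_int polyC) mul_polyC.
apply/polyP => i; rewrite coef_poly coef_map /=; case: ltnP => // hi.
by rewrite nth_default // (leq_trans sf).
Qed.

Lemma leq_cofactor_size x y m : (1 < x)%N -> ((y + x).-1 <= m.+1)%N -> (y <= m)%N.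
Proof. lia. Qed.

(** The coordinates are x1, x2, x3. Modulo p the coefficients a2 and a3 disappear, and the section
    becomes A X^d - a0^d f2(Y) with A = f1(-a1, a0). In an algebraic closure [f2] has a root, simple
    by the Bezout identity, at which Eisenstein's criterion excludes two factors of degree below
    d. *)
Lemma no_low_factor_mod (p d e : nat) (f1 f2 u v : {poly int}) (D : int) (a : 'rV[int]_4)
    (M := mx4 a (unitv o1) (unitv o2) (unitv o3)) :
  prime p -> (0 < d)%N -> (e <= d)%N -> size f2 = d.+1 ->
  u * f2 + v * f2^`() = D%:P -> ~~ (p%:Z %| D)%Z -> ~~ (p%:Z %| f2`_d)%Z ->
  (p%:Z %| a 0%R o2)%Z -> (p%:Z %| a 0%R o3)%Z -> ~~ (p%:Z %| a 0%R o0)%Z ->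
  ~~ (p%:Z %| bf d f1 (- a 0%R o1) (a 0%R o0))%Z ->
  surf d f1 f2 (adj_vec M o1) != 0 /\
  no_low_factor d f1 f2 (adj_vec M o1) (adj_vec M o2) (adj_vec M o3) e.
Proof.
move=> pp d0 ed sf2 bez nD nl pa2 pa3 na0 nc.
have detM : \det M = a 0 o0 by apply: det_units.
have dual := @adj_vec_dual a (unitv o1) (unitv o2) (unitv o3).
have rw (i : 'I_4) : row i M = nth 0 [:: a; unitv o1; unitv o2; unitv o3] i by rewrite rowK.
have Nk j : [/\ dot a (adj_vec M j) = if o0 == j then a 0 o0 else 0,
    adj_vec M j 0 o1 = if o1 == j then a 0 o0 else 0,
    adj_vec M j 0 o2 = if o2 == j then a 0 o0 else 0 &
    adj_vec M j 0 o3 = if o3 == j then a 0 o0 else 0].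
  by rewrite -detM -!dual !rw /= !dot_unitv.
have a0n : a 0 o0 != 0 by apply: contraNneq na0 => ->; rewrite dvdz0.
have N10 : adj_vec M o1 0 o0 = - a 0 o1.
  have [h e1 e2 e3] := Nk o1; move: h; rewrite dotE e1 e2 e3 /= !mulr0 !addr0 => /eqP.
  by rewrite [a 0 o1 * _]mulrC -mulrDr mulf_eq0 (negPf a0n) addr_eq0 => /eqP.
have N20 : adj_vec M o2 0 o0 = - a 0 o2.
  have [h e1 e2 e3] := Nk o2; move: h; rewrite dotE e1 e2 e3 /= !mulr0 !addr0 => /eqP.
  by rewrite [a 0 o2 * _]mulrC -mulrDr mulf_eq0 (negPf a0n) addr_eq0 => /eqP.
have N30 : adj_vec M o3 0 o0 = - a 0 o3.
  have [h e1 e2 e3] := Nk o3; move: h; rewrite dotE e1 e2 e3 /= !mulr0 !addr0 => /eqP.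
  by rewrite [a 0 o3 * _]mulrC -mulrDr mulf_eq0 (negPf a0n) addr_eq0 => /eqP.
have [_ N11 N12 N13] := Nk o1; have [_ N21 N22 N23] := Nk o2; have [_ N31 N32 N33] := Nk o3.
rewrite /= in N11 N12 N13 N21 N22 N23 N31 N32 N33.
split.
  rewrite /surf N10 N11 N12 N13 bf00 // subr0.
  by apply: contraNneq nc => ->; rewrite dvdz0.
move=> c k k' c0 ec /andP[k1 ke].
have [K [psi hpsi]] := finite_char_closure pp.
have psiE n : psi n = n%:~R by rewrite -{1}[n]intz rmorph_int.
have [c1 [k2 [k2' [h1 h2 s2 s2']]]] := strip_prime pp hpsi c0 ec.
have sk' : (size k' <= d)%N.
  have [->|k'0] := eqVneq k' 0; first by rewrite size_poly0.
  have k0 : k != 0 by rewrite -size_poly_gt0 ltnW.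
  have := size_sec_poly d f1 f2 (adj_vec M o1) (adj_vec M o2) (adj_vec M o3).
  have := congr1 (fun q : {poly {poly int}} => size q) ec.
  rewrite /= size_mul // -mul_polyC size_Cmul // => ->.
  exact: leq_cofactor_size.
have kk (n : int) : n%:~R = ((n%:~R)%:P)%:P :> {poly {poly K}} by rewrite !rmorph_int.
have z (n : int) : (p%:Z %| n)%Z -> n%:~R = 0 :> K by rewrite -hpsi psiE => /eqP.
pose G : {poly {poly K}} := map_poly (map_poly psi) (sec_poly d f1 f2 (adj_vec M o1) (adj_vec M o2) (adj_vec M o3)).
pose F : {poly K} := ((a 0 o0)%:~R ^+ d) *: map_poly intr f2.
pose A : K := (bf d f1 (- a 0 o1) (a 0 o0))%:~R.
have eG : G = A%:P *: 'X^d - F%:P.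
  have := rmorph_psec d f1 f2 (adj_vec M o1) (adj_vec M o2) (adj_vec M o3)
    (map_poly (map_poly psi) : {rmorphism {poly {poly int}} -> {poly {poly K}}}) 'X 'X%:P 1.
  rewrite rmorph1 /= map_polyX map_polyC /= map_polyX => eG; rewrite /G /sec_poly eG.
  rewrite /psec /pcoord N10 N11 N12 N13 N20 N21 N22 N23 N30 N31 N32 N33.
  have [z2 z3] : (- a 0 o2)%:~R = 0 :> {poly {poly K}} /\ (- a 0 o3)%:~R = 0 :> {poly {poly K}}.
    by rewrite !kk !z ?rpredN //; split.
  rewrite z2 z3 mulr0z !mul0r !addr0 !add0r.
  congr (_ - _).
    rewrite [_ * 'X]mulrC [X in bf _ _ _ X]mulrC bf_hom mulrC.
    rewrite -(rmorph_bf (intr : {rmorphism int -> {poly {poly K}}})) /=.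
    by rewrite kk mul_polyC.
  rewrite bf_hom /F -mul_polyC polyCM.
  have -> : bf d f2 ('X%:P : {poly {poly K}}) 1 = (map_poly intr f2)%:P.
    by rewrite -(@bf_poly K d) ?sf2 // (rmorph_bf polyC) /= polyC1.
  by congr (_ * _); rewrite polyC_exp [(_%:P ^+ d)%:P]polyC_exp -kk.
have lead0 : (f2`_d)%:~R != 0 :> K by rewrite -psiE hpsi.
have [b rb] : exists b, root (map_poly intr f2 : {poly K}) b.
  apply/closed_rootP; rewrite size_map_poly_id0 ?sf2 ?lead_coefE ?sf2 //.
  by case: (d) d0.
have ak0 : (a 0 o0)%:~R ^+ d != 0 :> K by rewrite expf_neq0 // -psiE hpsi.
apply: (@eisenstein_simple_root K d A b F (map_poly psi c1) (map_poly (map_poly psi) k2)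
   (map_poly (map_poly psi) k2')) => //.
- by rewrite /A -psiE hpsi.
- by rewrite /F hornerZ (rootP rb) mulr0.
- rewrite /F derivZ hornerZ mulf_neq0 // deriv_map.
  apply/eqP => h; move/negP: nD; apply; rewrite -hpsi psiE.
  have := congr1 (fun q : {poly int} => (map_poly intr q : {poly K}).[b]) bez.
  rewrite /= rmorphD !rmorphM /= hornerD !hornerM (rootP rb) h !mulr0 addr0.
  by rewrite map_polyC hornerC => <-.
- by rewrite -eG /G -rmorphM -h2 /= map_polyZ.
- by apply: leq_trans (size_poly _ _) _; rewrite s2 (leq_trans ke).
- by apply: leq_trans (size_poly _ _) _; rewrite s2'.
Qed.

Lemma coefM_top (R : nzRingType) (u v : {poly R}) m n :
  (size u <= m.+1)%N -> (size v <= n.+1)%N -> (u * v)`_(m + n) = u`_m * v`_n.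
Proof.
move=> su sv; have hm : (m < (m + n).+1)%N by rewrite ltnS leq_addr.
rewrite coefM (bigD1 (Ordinal hm)) //= addKn big1 ?addr0 // => -[i hi] /= ne.
have [lt|] := ltnP i m.
  by rewrite [v`_(_ - _)]nth_default ?mulr0 // (leq_trans sv) //; lia.
rewrite leq_eqVlt => /orP[/eqP e|lt]; first by case/eqP: ne; apply/val_inj.
by rewrite nth_default ?mul0r // (leq_trans su).
Qed.

Lemma coefX_top (R : idomainType) (u : {poly R}) n i : (size u <= n.+1)%N ->
  (size (u ^+ i) <= (n * i).+1)%N /\ (u ^+ i)`_(n * i) = u`_n ^+ i.
Proof.
move=> su; elim: i => [|i [s e]]; first by rewrite expr0 muln0 size_poly1 coef1.
rewrite !exprS mulnS coefM_top // e; split=> //.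
apply: leq_trans (size_polyMleq _ _) _.
by move: su s; move: (size u) (size (u ^+ i)) => x y; lia.
Qed.

Lemma coef_bf_top (R : idomainType) d f (p q : {poly R}) n :
  (size p <= n.+1)%N -> (size q <= n.+1)%N -> (bf d f p q)`_(n * d) = bf d f p`_n q`_n.
Proof.
move=> sp sq; rewrite /bf coef_sum; apply: eq_bigr => i _.
rewrite -(rmorph_int polyC) coefCM; congr (_ * _).
have [s1 e1] := coefX_top i sp; have [s2 e2] := coefX_top (d - i) sq.
have -> : (n * d = n * i + n * (d - i))%N by rewrite -mulnDr subnKC // -ltnS.
by rewrite coefM_top // e1 e2.
Qed.

Lemma linear_root_eq (F : fieldType) (u v w : F) :
  v != 0 -> v * w * (- u / v) + u * w = 0.
Proof. by move=> v0; field. Qed.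

Section Cubic.
Variables (d : nat) (f1 f2 : {poly int}) (a r1 r2 r3 : 'rV[int]_4).
Let M := mx4 a r1 r2 r3.
Let N1 := adj_vec M o1.
Let N2 := adj_vec M o2.
Let N3 := adj_vec M o3.
Hypotheses (d0 : (0 < d)%N) (det0 : \det M != 0) (gamma0 : surf d f1 f2 N1 != 0).
Hypothesis noline : forall P Q, ~ parallel P Q -> dot a P = 0 -> dot a Q = 0 ->
  ~ (forall s r, surf d f1 f2 (s *: P + r *: Q) = 0).

(** If [rho] has degree at least 2, the top coefficient is a nonzero d-th power times
    [surf d f1 f2 N1]. Otherwise X = rho(Y) is a line of the surface inside the plane. *)
Lemma no_linear_section (rho : {poly rat}) : psec d f1 f2 N1 N2 N3 rho 'X 1 <> 0.
Proof.
move=> e0; have [s2|s2] := ltnP 2 (size rho).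
  pose n := (size rho).-1.
  have sn : size rho = n.+1 by rewrite /n; lia.
  have n2 : (1 < n)%N by rewrite /n; lia.
  have ei i : (size (pcoord N1 N2 N3 rho 'X 1 i) <= n.+1)%N /\
     (pcoord N1 N2 N3 rho 'X 1 i)`_n = lead_coef rho * (N1 0 i)%:~R.
    rewrite /pcoord mulr1 -!(rmorph_int polyC) !mul_polyC; split.
      apply: leq_trans (size_polyD _ _) _; rewrite geq_max.
      rewrite (leq_trans (size_polyC_leq1 _)) // andbT.
      apply: leq_trans (size_polyD _ _) _; rewrite geq_max.
      rewrite (leq_trans (size_scale_leq _ _)) ?sn //=.
      by apply: leq_trans (size_scale_leq _ _) _; rewrite size_polyX leqW.
    rewrite !coefD !coefZ coefX coefC lead_coefE sn mulrC.
    have -> : (n == 1)%N = false by lia.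
    have -> : (n == 0)%N = false by lia.
    by rewrite mulr0 !addr0.
  have := congr1 (fun p : {poly rat} => p`_(n * d)) e0.
  have [s0 c0] := ei o0; have [s1 c1] := ei o1; have [s2' c2] := ei o2; have [s3 c3] := ei o3.
  rewrite /psec coefB !coef_bf_top // c0 c1 c2 c3 !bf_hom -mulrBr coef0 => /eqP.
  rewrite -!(rmorph_bf (intr : {rmorphism int -> rat})) -intrB mulf_eq0 intr_eq0.
  rewrite -/(surf d f1 f2 N1) (negPf gamma0) orbF expf_eq0 lead_coef_eq0 -size_poly_eq0 sn.
  by rewrite andbF.
pose al := rho`_1; pose be := rho`_0.
have er : rho = al *: 'X + be%:P.
  apply/polyP => i; rewrite coefD coefZ coefX coefC.
  case: i => [|[|i]]; rewrite /= ?mulr0 ?mulr1 ?add0r ?addr0 //.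
  by rewrite nth_default // (leq_trans s2).
pose m := denq al * denq be; pose A := numq al * denq be; pose B := numq be * denq al.
have m0 : m != 0 by rewrite mulf_neq0 // denq_neq0.
have eA : A%:~R = m%:~R * al.
  have n0 : (denq al)%:~R != 0 :> rat by rewrite intr_eq0 denq_neq0.
  by rewrite /A /m !intrM -{3}(divq_num_den al); field.
have eB : B%:~R = m%:~R * be.
  have n0 : (denq be)%:~R != 0 :> rat by rewrite intr_eq0 denq_neq0.
  by rewrite /B /m !intrM -{3}(divq_num_den be); field.
clearbody m A B.
pose P := A *: N1 + m *: N2; pose Q := B *: N1 + m *: N3.
have dual := @adj_vec_dual a r1 r2 r3.
have rw (i : 'I_4) : row i M = nth 0 [:: a; r1; r2; r3] i by rewrite rowK.
have da j : dot a (adj_vec M j) = if o0 == j then \det M else 0 by rewrite -dual rw.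
have d2 j : dot r2 (adj_vec M j) = if o2 == j then \det M else 0 by rewrite -dual rw.
have d3 j : dot r3 (adj_vec M j) = if o3 == j then \det M else 0 by rewrite -dual rw.
have par_dot x y u v : parallel x y -> dot u x * dot v y = dot v x * dot u y.
  move=> par; rewrite /dot !mulr_suml; under eq_bigr do rewrite mulr_sumr.
  under [RHS]eq_bigr do rewrite mulr_sumr.
  rewrite exchange_big /=; apply: eq_bigr => i _; apply: eq_bigr => j _.
  by rewrite mulrACA [RHS]mulrACA par [v 0 i * _]mulrC.
apply: (noline (P := P) (Q := Q)).
- move/(par_dot _ _ r2 r3).
  rewrite /P /Q !dotDr !dotZr /N1 /N2 /N3 !d2 !d3 /= !(mulr0, add0r, addr0, mul0r) => /eqP.
  by apply/negP; rewrite mulf_neq0 ?(mulf_neq0 m0 det0).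
- by rewrite /P dotDr !dotZr /N1 /N2 !da /= !mulr0 addr0.
- by rewrite /Q dotDr !dotZr /N1 /N3 !da /= !mulr0 addr0.
apply: line_identically_zero.
have e i : pcoord P Q 0 ('X : {poly rat}) 1 0 i = (m%:~R)%:P * pcoord N1 N2 N3 rho 'X 1 i.
  rewrite /pcoord !mxE !intrD !intrM er mulr0 addr0.
  have eA' : A%:~R = (m%:~R)%:P * al%:P :> {poly rat} by rewrite -polyCM -eA rmorph_int.
  have eB' : B%:~R = (m%:~R)%:P * be%:P :> {poly rat} by rewrite -polyCM -eB rmorph_int.
  have em : m%:~R = (m%:~R)%:P :> {poly rat} by rewrite rmorph_int.
  by rewrite eA' eB' em -mul_polyC; ring.
by move: e0; rewrite /psec !e !bf_hom -mulrBr => ->; rewrite mulr0.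
Qed.

Lemma sec_poly_lead : (sec_poly d f1 f2 N1 N2 N3)`_d = (surf d f1 f2 N1)%:~R.
Proof.
have ei i : (size (pcoord N1 N2 N3 ('X : {poly {poly int}}) 'X%:P 1 i) <= 2)%N /\
     (pcoord N1 N2 N3 ('X : {poly {poly int}}) 'X%:P 1 i)`_1 = (N1 0 i)%:~R.
  split; first by rewrite size_pcoord_lin ?size_polyX // (leq_trans (size_polyC_leq1 _)).
  rewrite /pcoord mulr1 -!(rmorph_int polyC) -polyCM !mul_polyC !coefD coefZ coefX !coefC.
  by rewrite mulr1 !addr0.
have [s0 c0] := ei o0; have [s1 c1] := ei o1; have [s2 c2] := ei o2; have [s3 c3] := ei o3.
have := coef_bf_top d f1 s0 s1; have := coef_bf_top d f2 s2 s3.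
rewrite !mul1n c0 c1 c2 c3 => h2 h1; rewrite /sec_poly /psec coefB h1 h2.
by rewrite -!(rmorph_bf (intr : {rmorphism int -> {poly int}})) -intrB.
Qed.

(** A linear factor gives a root that is a rational function of Y. The leading coefficient of the
    section is constant, so by the rational root theorem this root is a polynomial, against
    [no_linear_section]. *)
Lemma no_linear_factor (c : {poly int}) (k k' : {poly {poly int}}) :
  c != 0 -> c *: sec_poly d f1 f2 N1 N2 N3 = k' * k -> size k <> 2.
Proof.
move=> c0 ec sk.
pose iq : {rmorphism {poly int} -> {poly rat}} := map_poly intr.
have iq_neq0 x : x != 0 -> iq x != 0.
  by move=> x0; rewrite /iq /= map_poly_eq0_id0 // intr_eq0 lead_coef_eq0.
pose k0 := iq k`_0; pose k1 := iq k`_1.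
have k10 : k1 != 0.
  by apply: iq_neq0; have := lead_coef_eq0 k; rewrite lead_coefE sk /= -size_poly_eq0 sk => ->.
pose g0 := gcdp k0 k1; pose x0 := k0 %/ g0; pose x1 := k1 %/ g0.
have g00 : g0 != 0 by rewrite gcdp_eq0 negb_and k10 orbT.
have e0 : k0 = x0 * g0 by rewrite divpK // dvdp_gcdl.
have e1 : k1 = x1 * g0 by rewrite divpK // dvdp_gcdr.
have cop : coprimep x0 x1 by rewrite /x0 /x1 coprimep_div_gcd // k10 orbT.
have x10 : x1 != 0 by apply: contraNneq k10 => z; rewrite e1 z mul0r.
have E1 : psec d f1 f2 N1 N2 N3 (- x0) (x1 * 'X) x1 = 0.
  pose F := {fraction {poly rat}}.
  pose fr : {rmorphism {poly int} -> F} := @tofrac _ \o iq.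
  pose y0 : F := - tofrac x0 / tofrac x1.
  have fx1 : tofrac x1 != 0 by rewrite tofrac_eq0.
  pose Phi : {rmorphism {poly {poly int}} -> F} := horner_eval y0 \o map_poly fr.
  have eX : Phi 'X = y0 by rewrite /Phi /= map_polyX /horner_eval hornerX.
  have eC z : Phi z%:P = fr z by rewrite /Phi /= map_polyC /horner_eval hornerC.
  have Phik : Phi k = 0.
    have -> : k = (k`_1)%:P * 'X + (k`_0)%:P.
      apply/polyP => i; rewrite coefD coefCM coefX coefC.
      case: i => [|[|i]]; rewrite /= ?mulr0 ?mulr1 ?add0r ?addr0 //.
      by rewrite nth_default // sk.
    rewrite rmorphD rmorphM eX !eC -[fr k`_1]/(tofrac k1) -[fr k`_0]/(tofrac k0).
    rewrite e0 e1 !tofracM; exact: linear_root_eq.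
  have := congr1 Phi ec; rewrite -mul_polyC !rmorphM Phik mulr0 eC => /eqP.
  rewrite mulf_eq0 => /orP[|/eqP h].
    by rewrite /fr /= tofrac_eq0 (negPf (iq_neq0 _ c0)).
  have hp : psec d f1 f2 N1 N2 N3 (tofrac x1 * y0) (tofrac x1 * tofrac 'X) (tofrac x1 * 1) = 0.
    rewrite psec_hom; suff -> : psec d f1 f2 N1 N2 N3 y0 (tofrac 'X) 1 = 0 by rewrite mulr0.
    rewrite -h /sec_poly (rmorph_psec d f1 f2 N1 N2 N3 Phi) eX eC rmorph1.
    by rewrite /fr /= /iq /= map_polyX.
  apply/eqP; rewrite -tofrac_eq0; apply/eqP; rewrite -[RHS]hp.
  rewrite (rmorph_psec d f1 f2 N1 N2 N3 (@tofrac {poly rat})) /=.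
  congr (psec _ _ _ _ _ _ _ _ _); last by rewrite mulr1.
    by rewrite rmorphN [RHS]mulrC divfK.
  by rewrite tofracM.
(* At a zero of the denominator [x1] only the leading term survives, so the numerator [x0] would
   vanish there as well. *)
have sx1 : size x1 = 1%N.
  apply/eqP; apply: contraT => sx.
  have [K [FK _]] := countable_algebraic_closure rat.
  have /closed_rootP[b rb] : size (map_poly FK x1) != 1%N by rewrite size_map_poly.
  have cop' : coprimep (map_poly FK x1) (map_poly FK x0) by rewrite coprimep_map coprimep_sym.
  have := coprimep_root cop' rb; apply: contraNT => _.
  pose Psi : {rmorphism {poly rat} -> K} := horner_eval b \o map_poly FK.
  have := congr1 Psi E1; rewrite (rmorph_psec d f1 f2 N1 N2 N3 Psi) rmorph0 rmorphM.
  have -> : Psi x1 = 0 by apply/eqP: rb.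
  have sn : (surf d f1 f2 N1)%:~R != 0 :> K.
    by rewrite -(rmorph_int FK) fmorph_eq0 intr_eq0.
  rewrite mul0r psec_lead => /eqP; rewrite mulf_eq0 (negPf sn) orbF expf_eq0 d0 /=.
  by rewrite /= !rmorphN /= ?oppr_eq0 /horner_eval ?hornerN ?oppr_eq0.
have [m [m0 em]] : exists m, m != 0 /\ x1 = m%:P.
  exists x1`_0; have e2 : x1 = (x1`_0)%:P by apply: size1_polyC; rewrite sx1.
  by split=> //; move: x10; rewrite {1}e2 polyC_eq0.
apply: (@no_linear_section (- (m^-1 *: x0))).
have := psec_hom d f1 f2 N1 N2 N3 (m^-1)%:P (- x0) (x1 * 'X) x1.
rewrite E1 mulr0 em mulrA -polyCM mulVf // mul1r => <-; congr (psec _ _ _ _ _ _ _ _ _).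
by rewrite mulrN mul_polyC.
Qed.

(** A reducible cubic has a linear factor, possibly the cofactor. *)
Lemma no_low_factor_cubic : d = 3 -> no_low_factor d f1 f2 N1 N2 N3 3.
Proof.
move=> d3 c k k' c0 ec /andP[k1 k3].
have sg : size (sec_poly d f1 f2 N1 N2 N3) = 4.
  apply/eqP; rewrite eqn_leq; apply/andP; split.
    by apply: leq_trans (size_sec_poly _ _ _ _ _ _) _; rewrite d3.
  rewrite ltnNge; apply/negP => s3.
  have := sec_poly_lead; rewrite nth_default => [/esym/eqP|]; last by rewrite [X in (_ <= X)%N]d3.
  by rewrite -(rmorph_int polyC) polyC_eq0 intr_eq0 (negPf gamma0).
have k'0 : k' != 0.
  apply: contraTneq (isT) => k'0; move/eqP: ec; rewrite k'0 mul0r -mul_polyC mulf_eq0 polyC_eq0 (negPf c0) /=.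
  by rewrite -size_poly_eq0 sg.
have k0 : k != 0 by rewrite -size_poly_gt0 ltnW.
have := congr1 (fun q : {poly {poly int}} => size q) ec.
rewrite /= size_mul // -mul_polyC size_Cmul // sg.
have [s2|s2] := eqVneq (size k) 2; first by case: (no_linear_factor c0 ec s2).
have sk : size k = 3 by apply/eqP; rewrite eqn_leq k3 ltn_neqAle eq_sym s2.
rewrite sk => s4; rewrite [RHS]mulrC in ec; apply: (no_linear_factor c0 ec).
by move: s4; case: (size k') => [|[|[|n]]] //; rewrite ?addn3.
Qed.
End Cubic.

(** * Functionals that are small on a plane *)

Lemma prim_dvdz (a : 'rV[int]_4) (x y : int) : prim a -> x != 0 ->
  (forall i, (x %| y * a 0%R i)%Z) -> (x %| y)%Z.
Proof.
move=> pa x0 h; pose g := gcdz x y.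
have g0 : g != 0 by rewrite gcdz_eq0 negb_and x0.
have /dvdzP[u eu] : (g %| x)%Z by rewrite dvdz_gcdl.
have /dvdzP[v ev] : (g %| y)%Z by rewrite dvdz_gcdr.
have cop : coprimez u v.
  rewrite /coprimez; have := mulz_gcdl u v g; rewrite -eu -ev -/g.
  have -> : `|g|%N%:Z = g by [].
  by rewrite -[RHS]mul1r => /(mulIf g0) ->.
have u1 : `|u|%N = 1%N.
  apply: pa => i; rewrite -(Gauss_dvdzr (a 0 i) cop).
  by have := h i; rewrite eu ev mulrAC dvdz_mul2r.
by rewrite eu dvdzE abszM u1 mul1n -dvdzE dvdz_gcdr.
Qed.

(** Dirichlet's simultaneous approximation. With H the largest coefficient, two of the T^3 + 1
    multiples of a / H agree modulo 1 up to 1 / T in the three other coordinates. Their difference,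
    q0 a / H, is that close to an integral vector [c], and on the plane [dot c x] sees only the
    error. Since q0 <= T^3 < H and [a] is primitive, [c] is not parallel to [a]. *)
Lemma short_functional (a : 'rV[int]_4) (m : 'I_4) (T B : nat) :
  prim a -> (forall i, `|(a 0%R i)%R| <= `|(a 0%R m)%R|)%N -> (0 < T)%N ->
  (T ^ 3 < `|(a 0%R m)%R|)%N ->
  exists c : 'rV[int]_4, [/\ ~ parallel a c, forall i, (`|(c 0%R i)%R| <= `|(a 0%R m)%R|)%N &
    forall x, dot a x = 0 -> in_box B x -> (T * `|dot c x| <= 3 * B)%N].
Proof.
move=> pa amax T0 TH; set H := `|(a 0 m)%R|%N in amax TH *.
have H0 : (0 < H)%N by apply: leq_ltn_trans TH.
have Hz : H%:Z != 0 by lia.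
pose r (q : nat) (i : 'I_4) : int := modz (q%:Z * a 0 i) H%:Z.
have r_bd q i : 0 <= r q i < H%:Z by rewrite modz_ge0 // ltz_pmod //; lia.
have b_lt q i : (`|((T%:Z * r q i) %/ H%:Z)%Z| < T)%N.
  have /andP[r0 r1] := r_bd q i.
  have h0 : 0 <= ((T%:Z * r q i) %/ H%:Z)%Z by rewrite divz_ge0; [rewrite mulr_ge0 |]; lia.
  have : ((T%:Z * r q i) %/ H%:Z)%Z < T%:Z by rewrite ltz_divLR; [nia | lia].
  lia.
pose f (q : 'I_(T ^ 3).+1) : {ffun 'I_3 -> 'I_T} := [ffun j => Ordinal (b_lt q (lift m j))].
have ninj : ~ injective f.
  move=> /leq_card; rewrite card_ord card_ffun !card_ord.
  by apply/negP; rewrite -ltnNge.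
have [q [q' [lt fq]]] : exists q q' : 'I_(T ^ 3).+1, (q < q')%N /\ f q = f q'.
  apply: contrapT => h; apply: ninj => q q' fq; apply/val_inj => /=.
  have [lt|lt|//] := ltngtP q q'; case: h; first by exists q, q'.
  by exists q', q.
pose q0 := (q' - q)%N; have q00 : (0 < q0)%N by rewrite /q0; lia.
have q0T : (q0 <= T ^ 3)%N by rewrite /q0; have := ltn_ord q'; lia.
pose dl i := r q' i - r q i.
have dlm : dl m = 0.
  have z k : r k m = 0.
    by apply/dvdz_mod0P; rewrite dvdz_mull // dvdzE absz_nat.
  by rewrite /dl !z.
have dlT i : (T * `|dl i| < H)%N \/ dl i = 0.
  have [->|[j ->]] : i = m \/ exists j, i = lift m j.
    by case: (unliftP m i) => [j ->|->]; [right; exists j | left].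
    by right.
  left; have /ffunP/(_ j) := fq; rewrite !ffunE => /(congr1 val) /=.
  have /andP[x0 x1] := r_bd q (lift m j); have /andP[y0 y1] := r_bd q' (lift m j).
  rewrite /dl; move: (r q _) (r q' _) x0 x1 y0 y1 => x y x0 x1 y0 y1 e.
  have p1 : 0 <= ((T%:Z * x) %/ H%:Z)%Z by rewrite divz_ge0; [rewrite mulr_ge0 |]; lia.
  have p2 : 0 <= ((T%:Z * y) %/ H%:Z)%Z by rewrite divz_ge0; [rewrite mulr_ge0 |]; lia.
  have ee : ((T%:Z * x) %/ H%:Z)%Z = ((T%:Z * y) %/ H%:Z)%Z by lia.
  have := divz_eq (T%:Z * x) H%:Z; have := divz_eq (T%:Z * y) H%:Z.
  have := modz_ge0 (T%:Z * x) Hz; have := modz_ge0 (T%:Z * y) Hz.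
  have Hp : 0 < H%:Z by lia.
  have := ltz_pmod (T%:Z * x) Hp; have := ltz_pmod (T%:Z * y) Hp; rewrite ee.
  move: (_ %/ _)%Z (_ %% _)%Z (_ %% _)%Z => k u v h1 h2 h3 h4 h5 h6.
  have : `|T%:Z * (y - x)| < H%:Z by rewrite mulrBr h5 h6; lia.
  by rewrite normrM; lia.
pose c : 'rV[int]_4 := \row_i divz (q0%:Z * a 0 i - dl i) H%:Z.
have hc i : H%:Z * c 0 i = q0%:Z * a 0 i - dl i.
  rewrite mxE mulrC divzK // /dl /r.
  have -> : q0%:Z * a 0 i = q'%:Z * a 0 i - q%:Z * a 0 i by rewrite /q0; lia.
  have -> : q'%:Z * a 0 i - q%:Z * a 0 i - (modz (q'%:Z * a 0 i) H - modz (q%:Z * a 0 i) H) =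
    (q'%:Z * a 0 i - modz (q'%:Z * a 0 i) H) - (q%:Z * a 0 i - modz (q%:Z * a 0 i) H) by ring.
  have hd z : (H%:Z %| z - (z %% H)%Z)%Z by rewrite -eqz_mod_dvd modz_mod.
  by apply: rpredB.
exists c; split.
- move=> par; have : (a 0%R m %| q0%:Z)%Z.
    apply: (@prim_dvdz a) => [//||i]; first by rewrite -absz_gt0.
    have cm : H%:Z * c 0 m = q0%:Z * a 0 m by rewrite hc dlm subr0.
    have := par m i; move/(congr1 (fun z => H%:Z * z)).
    rewrite mulrCA [RHS]mulrCA cm => e.
    have am : a 0 m != 0 by rewrite -absz_gt0.
    have e2 : H%:Z * c 0 i = q0%:Z * a 0 i by apply: (mulfI am); rewrite e; ring.
    have aH : (a 0%R m %| H%:Z)%Z by rewrite dvdzE absz_nat.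
    by rewrite -e2 dvdz_mulr.
  rewrite dvdzE absz_nat => /(dvdn_leq q00); rewrite -/H; lia.
- move=> i; have := hc i; have := amax i; have dd : (`|dl i| < H)%N.
    by case: (dlT i) => [|->]; [nia | lia].
  move=> ai e.
  have : (H * `|(c 0 i)%R| <= q0 * `|(a 0 i)%R| + `|dl i|)%N.
    have -> : (H * `|(c 0 i)%R|)%N = `|(H%:Z * c 0 i)%R|%N by rewrite abszM absz_nat.
    rewrite e; have -> : (q0 * `|(a 0 i)%R|)%N = `|(q0%:Z * a 0 i)%R|%N by rewrite abszM absz_nat.
    lia.
  move=> h; have : (H * `|(c 0 i)%R| < (q0.+1) * H)%N by nia.
  by rewrite mulnC ltn_pmul2r // ltnS => h2; apply: leq_trans h2 _; lia.
- move=> x ax bx; rewrite -(@leq_pmul2l H) //.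
  have e : H%:Z * dot c x = - \sum_i dl i * x 0 i.
    transitivity (q0%:Z * dot a x - \sum_i dl i * x 0 i); last by rewrite ax mulr0 sub0r.
    rewrite /dot !mulr_sumr -sumrB; apply: eq_bigr => i _.
    by rewrite mulrA hc; ring.
  have -> : (H * (T * `|dot c x|) = T * `|(H%:Z * dot c x)%R|)%N by rewrite abszM absz_nat mulnCA.
  rewrite e abszN (bigD1 m) //= dlm mul0r add0r.
  apply: leq_trans (leq_mul (leqnn T) (absz_sum _ _ _)) _.
  rewrite big_distrr /=; apply: leq_trans (_ : \sum_(i | i != m) H * B <= _)%N.
    apply: leq_sum => i _; rewrite abszM mulnA leq_mul //.
    by case: (dlT i) => [/ltnW|->]; rewrite ?muln0.
  rewrite sum_nat_const mulnCA leq_mul //.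
  by rewrite (eq_card (B := predC1 m)) // cardC1 card_ord.
Qed.

Definition dotq (a : 'rV[int]_4) (v : 'rV[rat]_4) : rat := \sum_i (a 0 i)%:~R * v 0 i.

Lemma det_mx4_kernel (a b c e : 'rV[int]_4) :
  (forall v, dotq a v = 0 -> dotq b v = 0 -> dotq c v = 0 -> dotq e v = 0 -> v = 0) ->
  \det (mx4 a b c e) != 0.
Proof.
move=> h; rewrite -(intr_eq0 rat) -det_map_mx -det_tr.
apply/det0P => -[v v0 /rowP hv]; move/eqP: v0; apply.
have hv' j : \sum_i v 0 i * (mx4 a b c e j i)%:~R = 0.
  by have := hv j; rewrite !mxE => e0; rewrite -[RHS]e0; apply: eq_bigr => i _; rewrite !mxE.
by apply: h; rewrite /dotq; [have := hv' o0 | have := hv' o1 | have := hv' o2 | have := hv' o3];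
   move=> e0; rewrite -[RHS]e0; apply: eq_bigr => i _; rewrite mxE mulrC.
Qed.

Lemma kernel_det_mx4 (a b c e : 'rV[int]_4) v : \det (mx4 a b c e) != 0 ->
  dotq a v = 0 -> dotq b v = 0 -> dotq c v = 0 -> dotq e v = 0 -> v = 0.
Proof.
move=> D0 ha hb hc he; apply/eqP; apply: contraT => v0.
move: D0; rewrite -(intr_eq0 rat) -det_map_mx -det_tr => /det0P; case; exists v => //.
apply/rowP => j; rewrite !mxE.
have -> : \sum_i v 0 i * (map_mx intr (mx4 a b c e))^T i j = dotq (row j (mx4 a b c e)) v.
  by apply: eq_bigr => i _; rewrite !mxE mulrC.
by rewrite rowK; move: j; apply: ord4P.
Qed.

Lemma dotq_unitv k v : dotq (unitv k) v = v 0 k.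
Proof.
rewrite /dotq (bigD1 k) //= big1 => [|i ik]; first by rewrite mxE !eqxx mul1r addr0.
by rewrite mxE (negPf ik) andbF mul0r.
Qed.

Lemma complement4 (k l : 'I_4) : k != l ->
  exists i j, forall x : 'I_4, [|| x == k, x == l, x == i | x == j].
Proof.
by move: k l; apply: ord4P; apply: ord4P => // _;
  first [ by exists o0, o1; apply: ord4P | by exists o0, o2; apply: ord4P
        | by exists o0, o3; apply: ord4P | by exists o1, o2; apply: ord4P
        | by exists o1, o3; apply: ord4P | by exists o2, o3; apply: ord4P ].
Qed.

(** The unit vectors are those complementary to a nonzero 2 by 2 minor of [a] and [c]. *)
Lemma unit_coordinates (a c : 'rV[int]_4) : ~ parallel a c ->
  exists i j, \det (mx4 a (unitv j) (unitv i) c) != 0.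
Proof.
move=> npar; have [k [l nz]] : exists k l, a 0 k * c 0 l - a 0 l * c 0 k != 0.
  apply: contrapT => h; apply: npar => i j; apply/eqP; rewrite -subr_eq0.
  by apply/negPn/negP => nz; apply: h; exists i, j.
have kl : k != l by apply: contraNneq nz => ->; rewrite subrr.
have [i [j cov]] := complement4 kl; exists i, j.
apply: det_mx4_kernel => v; rewrite !dotq_unitv => av vj vi cv.
have two b : dotq b v = (b 0 k)%:~R * v 0 k + (b 0 l)%:~R * v 0 l.
  rewrite /dotq (bigD1 k) //= (bigD1 l) 1?eq_sym //= big1 ?addr0 // => x /andP[xk xl].
  have := cov x; rewrite (negPf xk) (negPf xl) /= => /orP[] /eqP ->.
    by rewrite vi mulr0.
  by rewrite vj mulr0.
rewrite two in av; rewrite two in cv.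
have nzq : (a 0 k * c 0 l - a 0 l * c 0 k)%:~R != 0 :> rat by rewrite intr_eq0.
rewrite intrB !intrM in nzq.
have vk : v 0 k = 0.
  apply: (mulfI nzq); rewrite mulr0.
  move: av cv; move: (a 0 k)%:~R (a 0 l)%:~R (c 0 k)%:~R (c 0 l)%:~R (v 0 k) (v 0 l) => x y z w s r e1 e2.
  by transitivity (w * (x * s + y * r) - y * (z * s + w * r)); [ring | rewrite e1 e2; ring].
have vl : v 0 l = 0.
  apply: (mulfI nzq); rewrite mulr0.
  move: av cv; move: (a 0 k)%:~R (a 0 l)%:~R (c 0 k)%:~R (c 0 l)%:~R (v 0 k) (v 0 l) => x y z w s r e1 e2.
  by transitivity (x * (z * s + w * r) - z * (x * s + y * r)); [ring | rewrite e1 e2; ring].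
by apply/rowP => x; rewrite mxE; have := cov x; case/or4P => /eqP ->.
Qed.

Lemma nonparallel_unit (a : 'rV[int]_4) : a != 0 -> exists l, ~ parallel a (unitv l).
Proof.
move=> a0; have [k ak] : exists k, a 0 k != 0.
  apply: contrapT => h; move/eqP: a0; apply; apply/rowP => i; rewrite mxE.
  by apply/eqP/negPn/negP => ai; apply: h; exists i.
have [l kl] : exists l : 'I_4, k != l.
  by have [->|k0] := eqVneq k o0; [exists o1 | exists o0].
exists l => par; have := par k l; rewrite !mxE !eqxx (negPf kl) /= mulr1 mulr0 => /eqP.
by rewrite (negPf ak).
Qed.

Section AvoidSurface.
Variables (d : nat) (f1 f2 : {poly int}) (a c : 'rV[int]_4) (i j : 'I_4).
Hypothesis det0 : \det (mx4 a (unitv j) (unitv i) c) != 0.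
Hypothesis noline : forall P Q, ~ parallel P Q -> dot a P = 0 -> dot a Q = 0 ->
  ~ (forall s r, surf d f1 f2 (s *: P + r *: Q) = 0).

Definition sheared (k : nat) : 'rV[int]_4 := unitv i + k%:Z *: unitv j.

Lemma det_sheared k : \det (mx4 a (unitv j) (sheared k) c) != 0.
Proof.
apply: det_mx4_kernel => v av bv ev cv; apply: (kernel_det_mx4 det0) => //.
have : dotq (sheared k) v = dotq (unitv i) v + k%:R * dotq (unitv j) v.
  rewrite /dotq mulr_sumr -big_split /=; apply: eq_bigr => x _.
  by rewrite !mxE intrD intrM -pmulrn; ring.
by rewrite ev bv mulr0 addr0 => <-.
Qed.

(** Replacing [unitv i] by [sheared k] moves the vector dual to [unitv j], up to scaling, along the
    points N1 - k N2 of a line in the plane. If d + 1 of these lay on the surface, so would the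
    whole line. *)
Lemma avoid_surface : exists2 k, (k <= d)%N &
  surf d f1 f2 (adj_vec (mx4 a (unitv j) (sheared k) c) o1) != 0.
Proof.
apply: contrapT => h; pose M := mx4 a (unitv j) (unitv i) c.
pose N1 := adj_vec M o1; pose N2 := adj_vec M o2.
have dual := @adj_vec_dual a (unitv j) (unitv i) c.
have rw (x : 'I_4) : row x M = nth 0 [:: a; unitv j; unitv i; c] x by rewrite rowK.
have zero k : (k <= d)%N -> surf d f1 f2 (N1 - k%:Z *: N2) = 0.
  move=> kd; pose Mk := mx4 a (unitv j) (sheared k) c; pose w := adj_vec Mk o1.
  have sw : surf d f1 f2 w = 0.
    by apply/eqP; apply: contraT => nz; case: h; exists k.
  have dualk := @adj_vec_dual a (unitv j) (sheared k) c.
  have rwk (x : 'I_4) : row x Mk = nth 0 [:: a; unitv j; sheared k; c] x by rewrite rowK.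
  have aw : dot a w = 0 by have := dualk o0 o1; rewrite rwk.
  have jw : dot (unitv j) w = \det Mk by have := dualk o1 o1; rewrite rwk.
  have sw2 : dot (sheared k) w = 0 by have := dualk o2 o1; rewrite rwk.
  have cw : dot c w = 0 by have := dualk o3 o1; rewrite rwk.
  have iw : dot (unitv i) w = - (k%:Z * \det Mk).
    have : dot (sheared k) w = dot (unitv i) w + k%:Z * dot (unitv j) w.
      by rewrite !dotE !mxE; ring.
    by rewrite sw2 jw => /esym/eqP; rewrite addr_eq0 => /eqP.
  have := adj_vec_expand a (unitv j) (unitv i) c w; rewrite aw jw iw cw.
  move=> ew; have e2 : \det M *: w = \det Mk *: (N1 - k%:Z *: N2).
    rewrite ew; apply/rowP => x; rewrite !mxE; ring.
  have := surfZ d f1 f2 (\det Mk) (N1 - k%:Z *: N2).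
  rewrite -e2 surfZ sw mulr0 => /esym/eqP; rewrite mulf_eq0 expf_eq0.
  by rewrite (negPf (det_sheared k)) andbF => /eqP.
pose g : {poly rat} := psec d f1 f2 N2 N1 0 'X 1 0.
have g0 : g = 0.
  apply/eqP; apply: contraT => gn.
  have sg : (size g <= d.+1)%N.
    have spc x : (size (pcoord N2 N1 0 'X 1 0 x : {poly rat}) <= 2)%N.
      rewrite /pcoord mulr0 addr0 mulr1 -!(rmorph_int polyC) mul_polyC.
      apply: leq_trans (size_polyD _ _) _; rewrite geq_max.
      rewrite (leq_trans (size_scale_leq _ _)) ?size_polyX //=.
      by rewrite (leq_trans (size_polyC_leq1 _)).
    apply: leq_trans (size_polyD _ _) _; rewrite size_polyN geq_max.
    by rewrite !size_bf_lin.
  pose s : seq rat := [seq - k%:R | k <- iota 0 d.+1].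
  have us : uniq s.
    by rewrite map_inj_uniq ?iota_uniq // => x y /oppr_inj/eqP; rewrite eqr_nat => /eqP.
  have := atmost_roots gn sg us; rewrite size_map size_iota ltnn; apply.
  move=> x /mapP[k]; rewrite mem_iota add0n ltnS => kd ->.
  rewrite /g psec_line_poly !hornerE.
  have e : toQ (N1 - k%:Z *: N2) = (- k%:R) *: toQ N2 + 1 *: toQ N1.
    by apply/rowP => x'; rewrite !mxE intrB intrM -pmulrn; ring.
  by rewrite (psec_toQ d f1 f2 e) zero.
have aN x : x != o0 -> dot a (adj_vec M x) = 0.
  by move=> x0; have := dual o0 x; rewrite rw eq_sym (negPf x0).
apply: (noline (P := N2) (Q := N1)).
- move=> par; have e1 : dot (unitv j) N1 = \det M by have := dual o1 o1; rewrite rw.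
  have e2 : dot (unitv j) N2 = 0 by have := dual o1 o2; rewrite rw.
  have e3 : dot (unitv i) N1 = 0 by have := dual o2 o1; rewrite rw.
  have e4 : dot (unitv i) N2 = \det M by have := dual o2 o2; rewrite rw.
  rewrite !dot_unitv in e1 e2 e3 e4.
  have := par i j; rewrite e1 e2 e3 e4 mul0r => /eqP.
  by rewrite mulf_eq0 (negPf det0).
- exact: aN.
- exact: aN.
- exact: line_identically_zero.
Qed.
End AvoidSurface.

Lemma max_coordinate (a : 'rV[int]_4) :
  exists m, forall i, (`|(a 0%R i)%R| <= `|(a 0%R m)%R|)%N.
Proof.
by case: (@arg_maxnP _ o0 xpredT (fun i => `|(a 0 i)%R|%N) isT) => m _ hm; exists m => i; apply: hm.
Qed.

Lemma unitv_bound k i : (`|(unitv k 0%R i)%R| <= 1)%N.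
Proof. by rewrite mxE; case: (_ && _). Qed.

Lemma plane_functional (t K M tau : nat) (a : 'rV[int]_4) :
  prim a -> (0 < t)%N -> (forall i, `|(a 0%R i)%R| <= t ^ K)%N -> (tau <= M)%N ->
  tau = 0%N \/ (exists m, t ^ (3 * tau) < `|(a 0%R m)%R|)%N ->
  exists c : 'rV[int]_4, [/\ ~ parallel a c, forall i, (`|(c 0%R i)%R| <= t ^ K)%N &
    forall x, in_box (t ^ M) x -> dot a x = 0 -> (`|dot c x| <= 3 * t ^ (M - tau))%N].
Proof.
move=> pa t0 ha tM [->|[m' hm']].
  have [l nl] := nonparallel_unit (prim_neq0 pa); exists (unitv l); split=> //.
    by move=> i; apply: leq_trans (unitv_bound _ _) _; rewrite expn_gt0 t0.
  by move=> x bx _; rewrite dot_unitv subn0; apply: leq_trans (bx l) _; rewrite leq_pmull.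
have [m hm] := max_coordinate a.
have T0 : (0 < t ^ tau)%N by rewrite expn_gt0 t0.
have TH : ((t ^ tau) ^ 3 < `|(a 0 m)%R|)%N.
  by rewrite -expnM mulnC; apply: leq_trans hm' (hm m').
have [c [nc bc hc]] := short_functional (t ^ M) pa hm T0 TH.
exists c; split=> // [i|x bx ax]; first exact: leq_trans (bc i) (ha m).
have h := hc x ax bx.
have e : (t ^ M = t ^ tau * t ^ (M - tau))%N by rewrite -expnD subnKC.
by rewrite e mulnCA leq_pmul2l in h.
Qed.

Lemma shear_bound (u v : int) (k w t : nat) :
  (`|u| <= w)%N -> (`|v| <= w)%N -> (k < t)%N -> (`|(u + k%:Z * v)%R| <= t * w)%N.
Proof.
move=> hu hv kt; have : (`|(k%:Z * v)%R| <= k * w)%N by rewrite abszM absz_nat leq_mul.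
have : (k.+1 * w <= t * w)%N by rewrite leq_mul.
by rewrite mulSn; move: (k%:Z * v) (k * w)%N (t * w)%N => z m n; lia.
Qed.

(** * Points on one plane *)

Section PlaneBounds.
Variables (d : nat) (f1 f2 : {poly int}).
Hypotheses (d2 : (2 <= d)%N) (sf1 : sepform d f1) (sf2 : sepform d f2).
Hypothesis niso : noniso d f1 f2.

Definition lines_const := (12 * (d.+1 * 2) + d.+1 * d.+1 * 2)%N.

Lemma plane_lines_bound K : exists t0, forall t pi xi tau M (a : 'rV[int]_4),
  (t0 <= t)%N -> (0 < pi)%N -> (M <= K)%N -> (tau <= M)%N ->
  (3 * pi.+1 <= 3 * xi + tau)%N -> (xi + M + 1 <= 2 * pi)%N ->
  prim a -> (forall i, `|(a 0%R i)%R| <= t ^ K)%N ->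
  tau = 0%N \/ (exists m, t ^ (3 * tau) < `|(a 0%R m)%R|)%N ->
  atmost (lines_const * t ^ (pi + 3))
    (fun x => [/\ onS d f1 f2 x, dot a x = 0 & in_box (t ^ M) x]).
Proof.
have [t0 ht0] := plane_lines d2 sf1 sf2 niso K; exists (t0 + 1)%N.
move=> t pi xi tau M a tt pi0 MK tM h1 h2 pa ha ht.
have t1 : (0 < t)%N by lia.
have [c [nc bc hc]] := plane_functional pa t1 ha tM ht.
have [i [j det0]] := unit_coordinates nc.
apply: (ht0 t pi xi tau M a (unitv j) (unitv i) c) => //; first by lia.
- move=> b k; rewrite !inE => /or4P[] /eqP -> //.
    by apply: leq_trans (unitv_bound _ _) _; rewrite expn_gt0 t1.
  by apply: leq_trans (unitv_bound _ _) _; rewrite expn_gt0 t1.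
- by move=> x bx ax; rewrite !dot_unitv; split=> //; apply: hc.
Qed.

Definition aux_const e D' := (12 * section_end_bound d e D' + d.+1 * d.+1 * 2)%N.

(** A plane outside the shape of [plane_of_line] contains no line of the surface, so its section has
    no linear factor. A shear moves [N1] off the surface at the cost of one power of [t] in the
    coordinates. *)
Lemma plane_cubic_bound K D' : d = 3 -> (0 < D')%N ->
  exists t0, forall t pi xi tau M (a : 'rV[int]_4),
  let s := (3 * D')%N in let D := (2 + D'.-1)%N in
  (t0 <= t)%N -> (0 < pi)%N -> (M <= K)%N -> (tau <= M)%N ->
  (pi.+1 * s.+1 < 2 * xi + tau * D)%N -> (xi + M.+1 * D + 1 <= pi * s)%N ->
  prim a -> (forall i, `|(a 0%R i)%R| <= t ^ K)%N ->
  tau = 0%N \/ (exists m, t ^ (3 * tau) < `|(a 0%R m)%R|)%N ->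
  ~ (bf d f1 (a 0 o1) (- a 0 o0) = 0 /\ bf d f2 (a 0 o3) (- a 0 o2) = 0) ->
  atmost (aux_const 3 D' * t ^ (pi + 3))
    (fun x => [/\ onS d f1 f2 x, dot a x = 0 & in_box (t ^ M) x]).
Proof.
move=> d3 D0; have [t0 ht0] := plane_aux d2 sf1 sf2 K.+1 3 D'; exists (t0 + d + 3)%N.
move=> t pi xi tau M a s D tt pi0 MK tM h1 h2 pa ha ht nline.
have t1 : (0 < t)%N by lia.
have [c [nc bc hc]] := plane_functional pa t1 ha tM ht.
have [i [j det0]] := unit_coordinates nc.
have noline P Q : ~ parallel P Q -> dot a P = 0 -> dot a Q = 0 ->
    ~ (forall s r, surf d f1 f2 (s *: P + r *: Q) = 0).
  by move=> nPQ aP aQ H; apply: nline; apply: plane_of_line nPQ H aP aQ.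
have [k kd gamma0] := avoid_surface det0 noline.
have detk := det_sheared det0 k.
have K1 : (t ^ K <= t ^ K.+1)%N by rewrite leq_pexp2l.
have d0 : (0 < d)%N by apply: ltnW.
apply: (ht0 t pi xi tau M _ a (unitv j) (sheared i j k) c) => //.
- by lia.
- exact: leqW.
- have ub : (1 <= t ^ K.+1)%N by rewrite expn_gt0 t1.
  move=> b l; rewrite !inE => /or4P[] /eqP ->.
  + exact: leq_trans (ha l) K1.
  + exact: leq_trans (unitv_bound _ _) ub.
  + have -> : sheared i j k 0 l = unitv i 0 l + k%:Z * unitv j 0 l by rewrite !mxE.
    have tk : (t <= t ^ K.+1)%N by rewrite expnS leq_pmulr // expn_gt0 t1.
    apply: leq_trans (shear_bound (unitv_bound i l) (unitv_bound j l) _) _; last first.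
      by rewrite muln1; exact: tk.
    by lia.
  + exact: leq_trans (bc l) K1.
- move=> x bx ax; have tS : (t ^ M.+1 = t * t ^ M)%N by rewrite expnS.
  have e : dot (sheared i j k) x = x 0 i + k%:Z * x 0 j.
    by rewrite -!dot_unitv !dotE !mxE; ring.
  split.
  + by rewrite dot_unitv; apply: leq_trans (bx j) _; rewrite leq_pexp2l.
  + by rewrite e tS; apply: shear_bound (bx i) (bx j) _; lia.
  + apply: leq_trans (hc x bx ax) _; rewrite subSn // expnS leq_mul2r; lia.
- move=> h hn; apply: (@section_end_count d f1 f2 a (unitv j) (sheared i j k) c 3 D') => //.
  exact: no_low_factor_cubic.
Qed.

Lemma plane_good_bound K D' (u v : {poly int}) (Dz : int) : (4 <= d)%N -> (0 < D')%N ->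
  u * f2 + v * f2^`() = Dz%:P ->
  exists t0, forall t pi xi M p (a : 'rV[int]_4),
  let s := (4 * D')%N in let D := (3 + D'.-1)%N in
  (t0 <= t)%N -> (0 < pi)%N -> (M <= K)%N ->
  (pi.+1 * s.+1 < 2 * xi)%N -> (xi + M.+1 * D + 1 <= pi * s)%N ->
  (forall i, `|(a 0%R i)%R| <= t ^ K)%N -> prime p ->
  ~~ (p%:Z %| Dz)%Z -> ~~ (p%:Z %| f2`_d)%Z ->
  (p%:Z %| a 0%R o2)%Z -> (p%:Z %| a 0%R o3)%Z -> ~~ (p%:Z %| a 0%R o0)%Z ->
  ~~ (p%:Z %| bf d f1 (- a 0%R o1) (a 0%R o0))%Z ->
  atmost (aux_const 4 D' * t ^ (pi + 3))
    (fun x => [/\ onS d f1 f2 x, dot a x = 0 & in_box (t ^ M) x]).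
Proof.
move=> d4 D0 bez; have [t0 ht0] := plane_aux d2 sf1 sf2 K 4 D'; exists (t0 + 1)%N.
move=> t pi xi M p a s D tt pi0 MK h1 h2 ha pp nD nl pa2 pa3 na0 nc.
have t1 : (0 < t)%N by apply: leq_trans tt; rewrite addn1.
have d0 : (0 < d)%N by apply: ltnW.
have [gamma0 nlf] := no_low_factor_mod pp d0 d4 (proj1 sf2) bez nD nl pa2 pa3 na0 nc.
have det0 : \det (mx4 a (unitv o1) (unitv o2) (unitv o3)) != 0.
  by rewrite det_units; apply: contraNneq na0 => ->; rewrite dvdz0.
apply: (ht0 t pi xi 0%N M _ a (unitv o1) (unitv o2) (unitv o3)) => //.
- exact: leq_trans (leq_addr _ _) tt.
- by rewrite mul0n addn0.
- move=> b l; rewrite !inE => /or4P[] /eqP -> //;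
    by apply: leq_trans (unitv_bound _ _) _; rewrite expn_gt0 t1.
- have tS : (t ^ M <= t ^ M.+1)%N by rewrite leq_pexp2l.
  by move=> x bx ax; rewrite !dot_unitv subn0; split; apply: leq_trans (bx _) tS.
- by move=> h hn; apply: section_end_count.
Qed.
End PlaneBounds.

Definition row4 (x0 x1 x2 x3 : int) : 'rV[int]_4 := \row_i nth 0 [:: x0; x1; x2; x3] i.

Lemma row4_eta (a : 'rV[int]_4) : a = row4 (a 0 o0) (a 0 o1) (a 0 o2) (a 0 o3).
Proof. by apply/rowP; apply: ord4P; rewrite mxE. Qed.

Lemma atmost_vectors A : atmost ((2 * A).+1 ^ 4)
  (fun a : 'rV[int]_4 => forall i, (`|(a 0%R i)%R| <= A)%N).
Proof.
have h := @atmost_int A.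
have -> : ((2 * A).+1 ^ 4 = (2 * A).+1 * (2 * A).+1 * ((2 * A).+1 * (2 * A).+1))%N by ring.
apply: (atmost_image (f := fun q : (int * int) * (int * int) => row4 q.1.1 q.1.2 q.2.1 q.2.2))
  (atmost_prod (atmost_prod h h) (atmost_prod h h)) => a ha.
exists ((a 0 o0, a 0 o1), (a 0 o2, a 0 o3)); last exact: row4_eta.
by split; split; apply: ha.
Qed.

Lemma primitive_part (a : 'rV[int]_4) : a != 0 ->
  exists g a', [/\ g != 0, a = g *: a', prim a' & forall i, (`|(a' 0%R i)%R| <= `|(a 0%R i)%R|)%N].
Proof.
move=> a0; pose g := gcdz (gcdz (a 0 o0) (a 0 o1)) (gcdz (a 0 o2) (a 0 o3)).
have gd i : (g %| a 0%R i)%Z.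
  move: i; apply: ord4P; rewrite /g.
  - by apply: dvdz_trans (dvdz_gcdl _ _) (dvdz_gcdl _ _).
  - by apply: dvdz_trans (dvdz_gcdl _ _) (dvdz_gcdr _ _).
  - by apply: dvdz_trans (dvdz_gcdr _ _) (dvdz_gcdl _ _).
  - by apply: dvdz_trans (dvdz_gcdr _ _) (dvdz_gcdr _ _).
have g0 : g != 0.
  apply: contraNneq a0 => g0; apply/eqP/rowP => i; rewrite mxE; apply/eqP.
  by have := gd i; rewrite g0 dvd0z.
pose a' : 'rV[int]_4 := \row_i divz (a 0 i) g.
have e i : a 0 i = g * a' 0 i by rewrite mxE mulrC divzK.
exists g, a'; split=> //.
- by apply/rowP => i; rewrite mxE.
- move=> k hk; have : (k * g %| g)%Z.
    have hg i : (k * g %| a 0%R i)%Z by rewrite e [g * _]mulrC dvdz_mul2r.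
    by rewrite {2}/g !dvdz_gcd !hg.
  move=> /dvdzP[y ey]; have yk : y * k = 1 by apply: (mulIf g0); rewrite mul1r -mulrA -ey.
  by have /eqP := congr1 absz yk; rewrite abszM muln_eq1 => /andP[_ /eqP].
- move=> i; rewrite e abszM leq_pmull // absz_gt0 //.
Qed.

Lemma vectors_pow t A : (1 <= t)%N -> ((2 * t ^ A).+1 ^ 4 <= 81 * t ^ (4 * A))%N.
Proof.
move=> t1; have t0 : (0 < t ^ A)%N by rewrite expn_gt0 t1.
rewrite [(4 * A)%N]mulnC expnM -[X in (_ <= X * _)%N]/(3 ^ 4)%N -expnMn.
by apply: leqXn; lia.
Qed.

(** * Points in a box *)

Section SmallPlanes.
Variables (d : nat) (f1 f2 : {poly int}).
Hypotheses (d2 : (2 <= d)%N) (sf1 : sepform d f1) (sf2 : sepform d f2).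
Hypothesis niso : noniso d f1 f2.

(* Planes with a coefficient above t^(3 tau) gain from a short functional. *)
Lemma small_planes_count K : exists t0, forall t M gam tau pi0 xi0 pi xi,
  (t0 <= t)%N -> (M <= K)%N -> (gam <= K)%N -> (tau <= M)%N -> (0 < pi0)%N -> (0 < pi)%N ->
  (3 * tau <= K)%N ->
  (3 * pi0.+1 <= 3 * xi0)%N -> (xi0 + M + 1 <= 2 * pi0)%N ->
  (3 * pi.+1 <= 3 * xi + tau)%N -> (xi + M + 1 <= 2 * pi)%N ->
  atmost (81 * lines_const d * (t ^ (12 * tau + pi0 + 3) + t ^ (4 * gam + pi + 3)))
    (fun x => [/\ onS d f1 f2 x, in_box (t ^ M) x & exists a, [/\ prim a,
       forall i, (`|(a 0%R i)%R| <= t ^ gam)%N & dot a x = 0]]).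
Proof.
have [t0 ht0] := plane_lines_bound d2 sf1 sf2 niso K; exists (t0 + 1)%N.
move=> t M gam tau pi0 xi0 pi xi tt MK gK tM p0 p1 tK h1 h2 h3 h4.
have t1 : (1 <= t)%N by lia.
have tt0 : (t0 <= t)%N by lia.
have up A B : (A <= B)%N -> (t ^ A <= t ^ B)%N by move=> AB; rewrite leq_pexp2l.
rewrite mulnDr; apply: (@atmost_sub _ _ _ (fun x =>
   [/\ onS d f1 f2 x, in_box (t ^ M) x & exists a, [/\ prim a,
       forall i, (`|(a 0%R i)%R| <= t ^ (3 * tau))%N & dot a x = 0]] \/
   [/\ onS d f1 f2 x, in_box (t ^ M) x & exists a, [/\ prim a,
       forall i, (`|(a 0%R i)%R| <= t ^ gam)%N, exists m, (t ^ (3 * tau) < `|(a 0%R m)%R|)%N & dot a x = 0]])).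
  move=> x [ox bx [a [pa ha ax]]].
  have [hm|nm] := pselect (exists m, (t ^ (3 * tau) < `|(a 0%R m)%R|)%N).
    by right; split=> //; exists a.
  left; split=> //; exists a; split=> // i; rewrite leqNgt; apply/negP => hi.
  by apply: nm; exists i.
apply: atmostU.
- apply: (@atmost_leq _ ((2 * t ^ (3 * tau)).+1 ^ 4 * (lines_const d * t ^ (pi0 + 3)))).
    apply: leq_trans (leq_mul (vectors_pow _ t1) (leqnn _)) _.
    have -> : (12 * tau + pi0 + 3 = 4 * (3 * tau) + (pi0 + 3))%N by lia.
    rewrite (expnD t (4 * (3 * tau))).
    by move: (t ^ (4 * (3 * tau)))%N (t ^ (pi0 + 3))%N (lines_const d) => u v w; apply: eq_leq; ring.
  apply: (atmost_rel (@atmost_vectors _) (Q := fun a x => [/\ prim a, (forall i, (`|(a 0%R i)%R| <= t ^ (3 * tau))%N) & dot a x = 0])).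
    by move=> x [_ _ [a [pa ha ax]]]; exists a.
  move=> a ha; have [pa|npa] := pselect (prim a); last by apply: atmost0 => x [_ []].
  apply: atmost_sub (ht0 t pi0 xi0 0%N M a tt0 p0 MK _ _ h2 pa _ _) => //.
  + by move=> x [[ox bx _] [_ _ ax]].
  + by rewrite addn0.
  + by move=> i; apply: leq_trans (ha i) _; apply: up.
  + by left.
- apply: (@atmost_leq _ ((2 * t ^ gam).+1 ^ 4 * (lines_const d * t ^ (pi + 3)))).
    apply: leq_trans (leq_mul (vectors_pow _ t1) (leqnn _)) _.
    rewrite -addnA (expnD t (4 * gam)).
    by move: (t ^ (4 * gam))%N (t ^ (pi + 3))%N (lines_const d) => u v w; apply: eq_leq; ring.
  apply: (atmost_rel (@atmost_vectors _) (Q := fun a x => [/\ prim a, exists m, (t ^ (3 * tau) < `|(a 0%R m)%R|)%N & dot a x = 0])).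
    by move=> x [_ _ [a [pa ha hm ax]]]; exists a.
  move=> a ha; have [pa|npa] := pselect (prim a); last by apply: atmost0 => x [_ []].
  have [hm|nm] := pselect (exists m, (t ^ (3 * tau) < `|(a 0%R m)%R|)%N); last by apply: atmost0 => x [_ []].
  apply: atmost_sub (ht0 t pi xi tau M a tt0 p1 MK tM h3 h4 pa _ _) => //.
  + by move=> x [[ox bx _] [_ _ ax]].
  + by move=> i; apply: leq_trans (ha i) _; apply: up.
  + by right.
Qed.

End SmallPlanes.

(** Siegel's lemma for one equation in unequal boxes: the factor [q] of the last two coefficients is
    paid for by a larger [A]. As [m] exceeds 4 A B, divisibility by [m] means vanishing. *)
Lemma siegel_plane (q A C m B : nat) (x : 'rV[int]_4) :
  (m < A.+1 ^ 2 * C.+1 ^ 2)%N -> (q * C <= A)%N -> (4 * (A * B) < m)%N -> (0 < q)%N ->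
  in_box B x ->
  exists a0 a1 b2 b3 : int, let a := row4 a0 a1 (q%:Z * b2) (q%:Z * b3) in
    [/\ a != 0, (`|a0| <= A)%N /\ (`|a1| <= A)%N, (`|b2| <= C)%N /\ (`|b3| <= C)%N & dot a x = 0].
Proof.
move=> hm qC hB q0 bx.
pose L (_ : 'I_1) (i : 'I_4) : int := nth 0 [:: x 0 o0; x 0 o1; q%:Z * x 0 o2; q%:Z * x 0 o3] i.
pose X (i : 'I_4) := nth 0%N [:: A; A; C; C] i.
have m0 (j : 'I_1) : (0 < m)%N by apply: leq_ltn_trans hB.
have caps : (\prod_(j < 1) m < \prod_i (X i).+1)%N.
  rewrite big_ord1 !big_ord_recr big_ord0 /= /X /= mul1n.
  by apply: leq_trans hm _; rewrite !expnS !expn0; nia.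
have [v [[i vi] vX vd]] := small_solution L m0 caps.
exists (v o0), (v o1), (v o2), (v o3) => a.
have b0 := vX o0; have b1 := vX o1; have b2 := vX o2; have b3 := vX o3; rewrite /X /= in b0 b1 b2 b3.
have qz : q%:Z != 0 by lia.
split=> //.
- apply: contraNneq vi => /rowP az.
  have := az o0; have := az o1; have := az o2; have := az o3; rewrite !mxE /=.
  move=> /eqP + /eqP + z1 z0; rewrite !mulf_eq0 (negPf qz) /= => /eqP z3 /eqP z2.
  by move: i; apply: ord4P; apply/eqP.
- have e : \sum_i L ord0 i * v i = dot a x.
    by rewrite sum_ord4 dotE !mxE /L /=; ring.
  have := vd ord0; rewrite e dvdzE absz_nat => dv.
  apply/eqP; rewrite -absz_eq0 -leqn0 leqNgt; apply/negP => pos.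
  have := dvdn_leq pos dv; rewrite leqNgt => /negP; apply.
  apply: leq_ltn_trans hB; apply: dot_bound => // {i vi}.
  by apply: ord4P; rewrite mxE /= ?abszM ?absz_nat //; apply: leq_trans qC; rewrite leq_mul.
Qed.

Lemma zeros_in_range d (f : {poly int}) A : size f = d.+1 -> (0 < d)%N ->
  atmost ((2 * A).+1 * d) (fun p : int * int => [/\ (`|p.1| <= A)%N, (`|p.2| <= A)%N &
    bf d f p.1 (- p.2) = 0]).
Proof.
move=> sf d0; apply: (atmost_rel (@atmost_int A) (Q := fun y p => p.2 = y)).
  by move=> p [h1 h2 h3]; exists p.2.
move=> y hy; pose g : {poly int} := bf d f 'X (- y)%:P.
have sX : (size ('X : {poly int}) <= 2)%N by rewrite size_polyX.
have sy : (size (- y)%:P <= 2)%N by apply: leq_trans (size_polyC_leq1 _) _.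
have g0 : g != 0.
  have := coef_bf_top d f sX sy; rewrite mul1n coefX coefC /= bf_y0 expr1n mulr1 intz => e.
  apply/eqP => g0; move: e; rewrite -/g g0 coef0 => /esym/eqP.
  have : lead_coef f != 0 by rewrite lead_coef_eq0 -size_poly_eq0 sf.
  by rewrite lead_coefE sf => /negPf ->.
have sg : (size g <= d.+1)%N by apply: size_bf_lin.
apply: (atmost_image (f := fun x => (x, y))) (atmost_roots g0 sg) => -[x y'] [[_ _ h] /= e].
exists x; last by rewrite e.
have -> : g.[x] = bf d f x (- y).
  rewrite -[LHS]/(horner_eval x g) /g (rmorph_bf (horner_eval x)) /= /horner_eval.
  by rewrite hornerX hornerC.
by rewrite -e.
Qed.

Section CubicBox.
Variables (f1 f2 : {poly int}).
Hypotheses (sf1 : sepform 3 f1) (sf2 : sepform 3 f2) (niso : noniso 3 f1 f2).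

(** With M = 75 w there are about t^(100 w) planes, with coefficients up to t^(25 w + 1). At about
    t^(52 w) points each this just exceeds t^(2 M). Coefficients above t^(24 w) give a functional
    with tau = 8 w, which lowers the exponent to 49 w, and below that size there are only about
    t^(96 w) planes. Planes through a line of the surface are few enough for [plane_lines_bound]. *)
Lemma cubic_box b (M := (75 * (b + 20))%N) : exists C t0, forall t, (t0 <= t)%N ->
  atmost (C * t ^ (2 * M - b)) (fun x => onS 3 f1 f2 x /\ in_box (t ^ M) x).
Proof.
rewrite {}/M; pose w := (b + 20)%N; pose M := (75 * w)%N.
have [tA hA] := @plane_lines_bound 3 f1 f2 isT sf1 sf2 niso M.
(* The value 40 makes 2 D / (s - 1) = 82 / 119 smaller than 52 / 75. *)
have [tB hB] := @plane_cubic_bound 3 f1 f2 isT sf1 sf2 niso M 40 erefl isT.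
set cA := lines_const 3 in hA; set cB := aux_const 3 3 40 in hB.
clearbody cA cB.
exists (49 * 9 * cA + 81 * cB + 81 * cB)%N, (tA + tB + 10)%N.
rewrite -/w -/M => t tt; have t1 : (1 <= t)%N by lia.
have ttA : (tA <= t)%N by lia.
have ttB : (tB <= t)%N by lia.
have up A B : (A <= B)%N -> (t ^ A <= t ^ B)%N by move=> AB; rewrite leq_pexp2l.
pose al := (25 * w + 1)%N.
pose pl (g : nat) (a x : 'rV[int]_4) := [/\ prim a, forall i, (`|(a 0%R i)%R| <= t ^ g)%N & dot a x = 0].
pose triv (a : 'rV[int]_4) := bf 3 f1 (a 0 o1) (- a 0 o0) = 0 /\ bf 3 f2 (a 0 o3) (- a 0 o2) = 0.
pose P1 x := exists2 a, triv a & pl al a x.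
pose P2 x := exists2 a, ~ triv a & pl (24 * w)%N a x.
pose P3 x := exists2 a, ~ triv a & pl al a x /\ exists m, (t ^ (24 * w) < `|(a 0%R m)%R|)%N.
pose S x := onS 3 f1 f2 x /\ in_box (t ^ M) x.
have cover x : S x -> (P1 x \/ P2 x) \/ P3 x.
  move=> [ox bx].
  have [|||a0 [a1 [b2 [b3 [an [ha0 ha1] [hb2 hb3] ax]]]]] :=
      @siegel_plane 1 (t ^ al) (t ^ al) (t ^ (al + M + 1)) (t ^ M) x _ _ _ isT bx.
  - apply: leq_ltn_trans (_ : (t ^ al) ^ 2 * (t ^ al) ^ 2 < _)%N.
      by rewrite -!expnM -expnD; apply: up; rewrite /al /M; lia.
    by rewrite ltn_mul // ltn_exp2r.
  - by rewrite mul1n.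
  - rewrite -expnD addn1 expnS ltn_pmul2r ?expn_gt0 ?t1 //; lia.
  rewrite !mul1r in an ax; set a := row4 _ _ _ _ in an ax.
  have ba i : (`|(a 0%R i)%R| <= t ^ al)%N by move: i; apply: ord4P; rewrite mxE.
  have [g [a' [g0 ea pa' ba']]] := primitive_part an.
  have ax' : dot a' x = 0.
    have : g * dot a' x = 0 by rewrite -ax ea !dotE !mxE; ring.
    by move/eqP; rewrite mulf_eq0 (negPf g0) => /eqP.
  have pl' : pl al a' x by split=> // i; apply: leq_trans (ba' i) (ba i).
  have [tr|ntr] := pselect (triv a'); first by left; left; exists a'.
  have [hm|nm] := pselect (exists m, (t ^ (24 * w) < `|(a' 0%R m)%R|)%N).
    by right; exists a'.
  left; right; exists a' => //; split=> // i; rewrite leqNgt; apply/negP => hi.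
  by apply: nm; exists i.
have fin A B c : (A + B <= 2 * M - b)%N -> (c * t ^ A * t ^ B <= c * t ^ (2 * M - b))%N.
  by move=> le; rewrite -mulnA -expnD leq_mul // up.
have MM : (2 * M - b = 149 * w + 20)%N by rewrite /M /w; lia.
rewrite (mulnDl (49 * 9 * cA + 81 * cB)) (mulnDl (49 * 9 * cA)).
apply: (@atmost_sub _ _ _ (fun x => ((S x /\ P1 x) \/ (S x /\ P2 x)) \/ (S x /\ P3 x))).
  move=> x Sx; case: (cover x Sx) => [[h|h]|h]; [left; left | left; right | right]; by split.
apply: atmostU; first apply: atmostU.
- pose R (a : 'rV[int]_4) := triv a /\ forall i, (`|(a 0%R i)%R| <= t ^ al)%N.
  (* Such a plane consists of a zero of [f1] and a zero of [f2], each with one free coordinate: of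
     order t^(2 al) planes instead of t^(4 al). *)
  have hR : atmost ((3 * t ^ al * 3) * (3 * t ^ al * 3)) R.
    have z (f : {poly int}) : size f = 4 -> atmost (3 * t ^ al * 3) (fun p : int * int =>
       [/\ (`|p.1| <= t ^ al)%N, (`|p.2| <= t ^ al)%N & bf 3 f p.1 (- p.2) = 0]).
      move=> sf; apply: atmost_leq (@zeros_in_range 3 f (t ^ al) sf isT).
      by rewrite leq_mul //; have := expn_gt0 t al; rewrite t1; lia.
    apply: (atmost_image (f := fun q : (int * int) * (int * int) => row4 q.1.2 q.1.1 q.2.2 q.2.1))
       (atmost_prod (z f1 (proj1 sf1)) (z f2 (proj1 sf2))) => a [[h1 h2] ha].
    exists ((a 0 o1, a 0 o0), (a 0 o3, a 0 o2)); last exact: row4_eta.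
    by split; split=> //=; apply: ha.
  apply: (@atmost_leq _ ((3 * t ^ al * 3) * (3 * t ^ al * 3) * (cA * t ^ (M + 3 + 3)))).
    apply: leq_trans (_ : 49 * 9 * cA * t ^ (2 * al) * t ^ (M + 3 + 3) <= _)%N.
      have -> : (t ^ (2 * al) = t ^ al * t ^ al)%N by rewrite -expnD addnn mul2n.
      move: (t ^ al)%N (t ^ (M + 3 + 3))%N => u v.
      apply: (@leq_trans (81 * cA * (u * u) * v)); first by apply: eq_leq; ring.
      by rewrite !leq_mul.
    by apply: fin; rewrite MM /al /M; lia.
  apply: (atmost_rel hR (Q := pl al)) => [x [_ [a tr pa]]|a _].
    by exists a => //; split=> //; case: pa.
  have [[pa ba]|na] := pselect (prim a /\ forall i, (`|(a 0%R i)%R| <= t ^ al)%N); last first.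
    by apply: atmost0 => x [_ [pa ba _]]; apply: na.
  apply: atmost_sub (hA t (M + 3)%N (M + 4)%N 0%N M a ttA _ (leqnn _) (leq0n _) _ _ pa _ _).
  + by move=> x [[[ox bx] _] [_ _ ax]].
  + by lia.
  + by lia.
  + by lia.
  + by move=> i; apply: leq_trans (ba i) _; apply: up; rewrite /al /M /w; lia.
  + by left.
- apply: (@atmost_leq _ ((2 * t ^ (24 * w)).+1 ^ 4 * (cB * t ^ (52 * w + 2 + 3)))).
    have V := vectors_pow (24 * w)%N t1.
    apply: leq_trans (leq_mul V (leqnn _)) _.
    apply: leq_trans (_ : 81 * cB * t ^ (4 * (24 * w)) * t ^ (52 * w + 2 + 3) <= _)%N.
      by move: (t ^ (4 * (24 * w)))%N (t ^ (52 * w + 2 + 3))%N => u v; apply: eq_leq; ring.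
    by apply: fin; rewrite MM; lia.
  apply: (atmost_rel (@atmost_vectors _) (Q := fun a x => ~ triv a /\ pl (24 * w)%N a x)).
    by move=> x [_ [a ntr pa]]; exists a => //; case: pa.
  move=> a ba; have [[pa ntr]|na] := pselect (prim a /\ ~ triv a); last first.
    by apply: atmost0 => x [_ [ntr [pa _ _]]]; apply: na.
  apply: atmost_sub (hB t (52 * w + 2)%N ((52 * w + 2) * 120 - M.+1 * 41 - 1)%N 0%N M a ttB _ (leqnn _) (leq0n _) _ _ pa _ _ ntr).
  + by move=> x [[[ox bx] _] [_ [_ _ ax]]].
  + by lia.
  + by rewrite /M; lia.
  + by rewrite /M; lia.
  + by move=> i; apply: leq_trans (ba i) _; apply: up; rewrite /M; lia.
  + by left.
- apply: (@atmost_leq _ ((2 * t ^ al).+1 ^ 4 * (cB * t ^ (49 * w + 2 + 3)))).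
    have V := vectors_pow al t1.
    apply: leq_trans (leq_mul V (leqnn _)) _.
    apply: leq_trans (_ : 81 * cB * t ^ (4 * al) * t ^ (49 * w + 2 + 3) <= _)%N.
      by move: (t ^ (4 * al))%N (t ^ (49 * w + 2 + 3))%N => u v; apply: eq_leq; ring.
    by apply: fin; rewrite MM /al; lia.
  apply: (atmost_rel (@atmost_vectors _) (Q := fun a x => ~ triv a /\ pl al a x /\
     exists m, (t ^ (24 * w) < `|(a 0%R m)%R|)%N)).
    by move=> x [_ [a ntr [pa hm]]]; exists a => //; case: pa.
  move=> a ba; have [[pa [ntr hm]]|na] := pselect (prim a /\ ~ triv a /\
      exists m, (t ^ (24 * w) < `|(a 0%R m)%R|)%N); last first.
    by apply: atmost0 => x [_ [ntr [[pa _ _] hm]]]; apply: na.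
  apply: atmost_sub (hB t (49 * w + 2)%N ((49 * w + 2) * 120 - M.+1 * 41 - 1)%N (8 * w)%N M a ttB _ (leqnn _) _ _ _ pa _ _ ntr).
  + by move=> x [[[ox bx] _] [_ [[_ _ ax] _]]].
  + by lia.
  + by rewrite /M; lia.
  + by rewrite /M; lia.
  + by rewrite /M; lia.
  + by move=> i; apply: leq_trans (ba i) _; apply: up; rewrite /al /M /w; lia.
  + by right; rewrite mulnA.
Qed.
End CubicBox.

(** Removes the common power of p from the first two coefficients, but no more than the power p^k
    which the last two are known to carry. *)
Lemma peel_prime (p k : nat) (a0 a1 : int) : (0 < p)%N -> exists j c0 c1,
  [/\ (j <= k)%N, a0 = (p ^ j)%N%:Z * c0, a1 = (p ^ j)%N%:Z * c1 &
   j = k \/ ~ ((p%:Z %| c0)%Z /\ (p%:Z %| c1)%Z)].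
Proof.
move=> p0; elim: k => [|k [j [c0 [c1 [jk e0 e1 hj]]]]].
  by exists 0%N, a0, a1; split=> //; rewrite ?mul1r //; left.
have [hk|nh] := pselect (j = k /\ (p%:Z %| c0)%Z /\ (p%:Z %| c1)%Z).
  have [ej [/dvdzP[x0 ex0] /dvdzP[x1 ex1]]] := hk.
  exists k.+1, x0, x1; split=> //; last by left.
    by rewrite e0 ej ex0 expnSr PoszM; ring.
  by rewrite e1 ej ex1 expnSr PoszM; ring.
exists j, c0, c1; split=> //; first exact: leqW.
by right; case: hj => [ej|//] h; apply: nh.
Qed.

Lemma dotZl k a x : dot (k *: a) x = k * dot a x.
Proof. by rewrite !dotE !mxE; ring. Qed.

Lemma quartic_exponents w : (20 <= w)%N ->
  let xi := ((508 * w + 2) * 592 - (1000 * w).+1 * 150 - 1)%N in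
  ((508 * w + 2).+1 * 593 < 2 * xi)%N /\
  (xi + (1000 * w).+1 * 150 + 1 <= (508 * w + 2) * 592)%N.
Proof. by move=> w20 xi; rewrite /xi; lia. Qed.

Section QuarticBox.
Variables (d : nat) (f1 f2 : {poly int}).
Hypotheses (d4 : (4 <= d)%N) (sf1 : sepform d f1) (sf2 : sepform d f2) (niso : noniso d f1 f2).

(** With M = 1000 w, the first two coefficients are at most t^al and the last two are q times
    integers up to t^be, q being a power of p between t^la and t^(la + 1). Siegel's lemma asks for 2
    al + 2 be >= al + M + 1. About t^(1488 w) planes with t^(508 w) points each stay below t^(2 M -
    b). The value of [la] makes q large enough that a plane whose coefficients are all divisible by
    q falls, after division, in the range of [small_planes_count]. *)
Lemma quartic_box b (M := (1000 * (b + 20))%N) : exists C t0, forall t, (t0 <= t)%N ->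
  atmost (C * t ^ (2 * M - b)) (fun x => onS d f1 f2 x /\ in_box (t ^ M) x).
Proof.
rewrite {}/M.
have d2 : (2 <= d)%N by apply: leq_trans d4.
have [s1 _] := sf1; have [s2 [Dz Dz0 [u [v bez]]]] := sf2.
have w20 : (20 <= b + 20)%N by rewrite leq_addl.
pose w := (b + 20)%N; pose M := (1000 * w)%N; pose K := (2000 * w)%N.
have [tA hA] := plane_lines_bound d2 sf1 sf2 niso K.
have [tB hB] := small_planes_count d2 sf1 sf2 niso K.
(* The value 148 makes 2 D / (s - 1) = 300 / 591 smaller than 508 / 1000. *)
have [tC hC] := @plane_good_bound d f1 f2 d2 sf1 sf2 K 148 u v Dz d4 isT bez.
pose Kg := (1 + (M + M * d))%N.
have [tG hG] := good_prime Kg.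
set cA := lines_const d in hA hB; set cC := aux_const d 4 148 in hC.
pose cst := (`|Dz| * `|(f2`_d)%R| * bf_norm f1)%N.
clearbody cA cC.
exists (cA + 81 * cA * 2 + 2 * 81 * cC)%N, (tA + tB + tC + tG + cst + 10)%N.
rewrite -/w -/M => t tt; have t1 : (1 <= t)%N by lia.
have [ttA ttB ttC ttG] : [/\ tA <= t, tB <= t, tC <= t & tG <= t]%N by split; lia.
have tcst : (cst <= t)%N by lia.
have t10 : (10 <= t)%N by lia.
have up A B : (A <= B)%N -> (t ^ A <= t ^ B)%N by move=> AB; rewrite leq_pexp2l.
pose al := (488 * w + 1)%N; pose be := (256 * w)%N; pose la := (232 * w)%N.
pose ga := (256 * w + 1)%N.
have la0 : (0 < la)%N by rewrite /la /w; lia.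
pose q p := (p ^ up_log p (t ^ la))%N.
pose S x := onS d f1 f2 x /\ in_box (t ^ M) x.
pose P0 (x : 'rV[int]_4) := x 0 o1 = 0.
pose Pb x := exists a, [/\ prim a, forall i, (`|(a 0%R i)%R| <= t ^ ga)%N & dot a x = 0].
pose keyv (k : nat * ((int * int) * (int * int))) :=
  row4 k.2.1.1 k.2.1.2 ((q k.1)%:Z * k.2.2.1) ((q k.1)%:Z * k.2.2.2).
pose good (p : nat) (a : 'rV[int]_4) := [/\ ~~ (p%:Z %| Dz)%Z, ~~ (p%:Z %| f2`_d)%Z &
  [/\ (p%:Z %| a 0%R o2)%Z, (p%:Z %| a 0%R o3)%Z, ~~ (p%:Z %| a 0%R o0)%Z &
  ~~ (p%:Z %| bf d f1 (- a 0%R o1) (a 0%R o0))%Z]].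
pose Q k x := dot (keyv k) x = 0 /\ exists g a, [/\ prime k.1, g != 0, keyv k = g *: a, good k.1 a &
   forall i, (`|(a 0%R i)%R| <= t ^ al)%N].
pose R (k : nat * ((int * int) * (int * int))) := (k.1 <= t)%N /\
  (((`|k.2.1.1| <= t ^ al)%N /\ (`|k.2.1.2| <= t ^ al)%N) /\
   ((`|k.2.2.1| <= t ^ be)%N /\ (`|k.2.2.2| <= t ^ be)%N)).
have cover x : S x -> (P0 x \/ Pb x) \/ exists2 k, R k & Q k x.
  move=> [[px sx mx] bx].
  have [x10|x10] := eqVneq (x 0 o1) 0; first by left; left.
  pose m := bf d f1 (x 0 o0) (x 0 o1).
  (* Avoiding [Dz] and the leading coefficient keeps [f2] separable of degree d modulo p; avoiding
     x1 and m is what makes the plane through [x] good at p. *)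
  have [p [pp pt np]] : exists p, [/\ prime p, (p <= t)%N &
      ~~ (p %| `|Dz| * `|(f2`_d)%R| * (`|(x 0 o1)%R| * `|m|))%N].
    apply: hG => //; apply/andP; split.
      by rewrite !muln_gt0 !absz_gt0 Dz0 (sepform_lead sf2) x10 mx.
    have hm : (`|m| <= bf_norm f1 * (t ^ M) ^ d)%N by apply: bf_bound; rewrite ?s1.
    apply: leq_trans (leq_mul (leqnn _) (leq_mul (bx o1) hm)) _.
    apply: leq_trans (_ : cst * (t ^ M * (t ^ M) ^ d) <= _)%N.
      by apply: eq_leq; rewrite /cst; ring.
    by rewrite -expnM -expnD /Kg add1n expnS leq_mul.
  have [q0 /andP[q1 q2]] := up_log_between pp pt la0; rewrite -/(q p) in q1 q2.
  have qpos : (0 < q p)%N by rewrite expn_gt0 prime_gt0.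
  have [|||a0 [a1 [b2 [b3 [an [ha0 ha1] [hb2 hb3] ax]]]]] :=
      @siegel_plane (q p) (t ^ al) (t ^ be) (t ^ (al + M + 1)) (t ^ M) x _ _ _ qpos bx.
  - apply: leq_ltn_trans (_ : (t ^ al) ^ 2 * (t ^ be) ^ 2 < _)%N.
      by rewrite -!expnM -expnD; apply: up; rewrite /al /be /M; lia.
    by rewrite ltn_mul // ltn_exp2r.
  - apply: leq_trans (leq_mul q2 (leqnn _)) _; rewrite -expnD; apply: up.
    by rewrite /la /be /al; lia.
  - by rewrite -expnD addn1 expnS ltn_pmul2r ?expn_gt0 ?t1 //; lia.
  have [j [c0 [c1 [jk e0 e1 hj]]]] := peel_prime (up_log p (t ^ la)) a0 a1 (prime_gt0 pp).
  pose kj := (up_log p (t ^ la) - j)%N.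
  pose a' := row4 c0 c1 ((p ^ kj)%N%:Z * b2) ((p ^ kj)%N%:Z * b3).
  have qe : q p = (p ^ j * p ^ kj)%N by rewrite /q -expnD subnKC.
  have pj0 : (p ^ j)%N%:Z != 0 by rewrite eqz_nat -lt0n expn_gt0 prime_gt0.
  have ea : row4 a0 a1 ((q p)%:Z * b2) ((q p)%:Z * b3) = (p ^ j)%N%:Z *: a'.
    by apply/rowP; apply: ord4P; rewrite !mxE /= ?e0 ?e1 ?qe ?PoszM ?mulrA.
  have an' : a' != 0 by apply: contraNneq an => z; rewrite ea z scaler0.
  have ax' : dot a' x = 0.
    by move/eqP: ax; rewrite ea dotZl mulf_eq0 (negPf pj0) => /eqP.
  (* If all of q divides the first two coefficients, dividing it out leaves coefficients up to t^ga,
     the case [Pb]. Otherwise the last two coefficients keep a factor p after the division. *)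
  have [ej|ej] := eqVneq j (up_log p (t ^ la)).
    left; right; have [g [a'' [g0 ea' pa'' ba'']]] := primitive_part an'.
    exists a''; split=> //; last first.
      have : g * dot a'' x = 0 by rewrite -ax' ea' !dotE !mxE; ring.
      by move/eqP; rewrite mulf_eq0 (negPf g0) => /eqP.
    move=> i; apply: leq_trans (ba'' i) _.
    have small (c : int) : (`|((p ^ j)%N%:Z * c)%R| <= t ^ al)%N -> (`|c| <= t ^ ga)%N.
      rewrite abszM absz_nat ej -/(q p) => h; have tl : (0 < t ^ la)%N by rewrite expn_gt0 t1.
      rewrite -(@leq_pmul2l (t ^ la)) // -expnD; apply: leq_trans (leq_mul q1 (leqnn _)) _.
      by apply: leq_trans h _; apply: up; rewrite /la /ga /al; lia.
    have kj0 : (p ^ kj)%N = 1%N by rewrite /kj ej subnn.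
    move: i; apply: ord4P; rewrite mxE /= ?kj0 ?mul1r.
    + by apply: small; rewrite -e0.
    + by apply: small; rewrite -e1.
    + by apply: leq_trans hb2 _; apply: up; rewrite /be /ga; lia.
    + by apply: leq_trans hb3 _; apply: up; rewrite /be /ga; lia.
  have {}nj : ~ ((p%:Z %| c0)%Z /\ (p%:Z %| c1)%Z) by case: hj ej => [->|//]; rewrite eqxx.
  right; exists (p, ((a0, a1), (b2, b3))); first by [].
  have kj1 : (0 < kj)%N by rewrite /kj subn_gt0 ltn_neqAle ej.
  have pk : (p%:Z %| (p ^ kj)%N%:Z)%Z by rewrite dvdzE !absz_nat dvdn_exp.
  have pdvd z : (p%:Z %| z)%Z = (p %| `|z|)%N by rewrite dvdzE absz_nat.
  move: np; rewrite !Euclid_dvdM // !negb_or -!pdvd => /andP[/andP[nD nl] /andP[nx nm]].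
  have px' : (p%:Z %| c0 * x 0%R o0 + c1 * x 0%R o1)%Z.
    have -> : c0 * x 0 o0 + c1 * x 0 o1 = - ((p ^ kj)%N%:Z * (b2 * x 0 o2 + b3 * x 0 o3)).
      by apply/eqP; rewrite -addr_eq0 -ax' dotE !mxE /=; apply/eqP; ring.
    by rewrite rpredN dvdz_mulr.
  have pmul (y z : int) : (p%:Z %| y * z)%Z = (p%:Z %| y)%Z || (p%:Z %| z)%Z.
    by rewrite !pdvd abszM Euclid_dvdM.
  (* As p divides c0 x0 + c1 x1 but not x1, a factor p of [c0] would also divide [c1]. *)
  have nc0 : ~~ (p%:Z %| c0)%Z.
    apply/negP => h0; apply: nj; split=> //.
    have : (p%:Z %| c1 * x 0%R o1)%Z.
      have -> : c1 * x 0 o1 = (c0 * x 0 o0 + c1 * x 0 o1) - c0 * x 0 o0 by ring.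
      by apply: rpredB => //; apply: dvdz_mulr.
    by rewrite pmul (negPf nx) orbF.
  split=> //; exists (p ^ j)%N%:Z, a'; split=> //.
  - split=> //; split; rewrite ?mxE /= ?dvdz_mulr //.
    apply/negP => h.
    (* Modulo p one has c0 x0 = - c1 x1, so c0^d m is congruent to x1^d f1(-c1, c0). *)
    have : (p%:Z %| (c0 ^+ d) * m)%Z.
      rewrite /m -bf_hom (dvdz_congr0 (b := bf d f1 (x 0 o1 * - c1) (x 0 o1 * c0))).
        by rewrite bf_hom dvdz_mull.
      apply: bf_cong; last by rewrite [c0 * _]mulrC subrr dvdz0.
      by have -> : c0 * x 0 o0 - x 0 o1 * - c1 = c0 * x 0 o0 + c1 * x 0 o1 by ring.
    rewrite pmul (negPf nm) orbF pdvd abszX Euclid_dvdX // -pdvd (negPf nc0).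
    by [].
  - have big (c : int) : (`|((p ^ j)%N%:Z * c)%R| <= t ^ al)%N -> (`|c| <= t ^ al)%N.
      by rewrite abszM absz_nat; apply: leq_trans; rewrite leq_pmull // expn_gt0 prime_gt0.
    have qb (c : int) : (`|c| <= t ^ be)%N -> (`|((p ^ kj)%N%:Z * c)%R| <= t ^ al)%N.
      move=> hc; rewrite abszM absz_nat; have h1 : (p ^ kj <= t ^ la.+1)%N.
        by apply: leq_trans q2; rewrite qe leq_pmull // expn_gt0 prime_gt0.
      by apply: leq_trans (leq_mul h1 hc) _; rewrite -expnD; apply: up; rewrite /la /be /al; lia.
    apply: ord4P; rewrite mxE /=.
    + by apply: big; rewrite -e0.
    + by apply: big; rewrite -e1.
    + exact: qb.
    + exact: qb.
have fin A B c : (A + B <= 2 * M - b)%N -> (c * t ^ A * t ^ B <= c * t ^ (2 * M - b))%N.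
  by move=> le; rewrite -mulnA -expnD leq_mul // up.
have MM : (2 * M - b = 1999 * w + 20)%N by rewrite /M /w; lia.
rewrite (mulnDl (cA + 81 * cA * 2)) (mulnDl cA).
apply: (@atmost_sub _ _ _ (fun x => ((S x /\ P0 x) \/ (S x /\ Pb x)) \/ (S x /\ exists2 k, R k & Q k x))).
  move=> x Sx; case: (cover x Sx) => [[h|h]|h]; [left; left | left; right | right]; by split.
apply: atmostU; first apply: atmostU.
- have pu : prim (unitv o1) by move=> k /(_ o1); rewrite mxE /= => /dvdzP[y /(congr1 absz)]; rewrite abszM => /esym/eqP; rewrite muln_eq1 => /andP[_ /eqP].
  apply: (@atmost_leq _ (cA * t ^ (M + 3 + 3))).
    by rewrite leq_mul // up // MM /M; lia.
  apply: atmost_sub (hA t (M + 3)%N (M + 4)%N 0%N M (unitv o1) ttA _ _ (leq0n _) _ _ pu _ _).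
  + by move=> x [[ox bx] x0]; split=> //; rewrite dot_unitv.
  + by lia.
  + by rewrite /M /K; lia.
  + by lia.
  + by lia.
  + by move=> i; apply: leq_trans (unitv_bound _ _) _; rewrite expn_gt0 t1.
  + by left.
- apply: (@atmost_leq _ (81 * cA * (t ^ (12 * (83 * w) + (1000 * w + 3) + 3) + t ^ (4 * ga + (973 * w + 2) + 3)))).
    apply: leq_trans (_ : 81 * cA * (t ^ (2 * M - b) + t ^ (2 * M - b)) <= _)%N.
      by apply: leq_mul => //; apply: leq_add; apply: up; rewrite MM /ga; lia.
    by apply: eq_leq; move: (t ^ _)%N; clear => x; ring.
  apply: atmost_sub (hB t M ga (83 * w)%N (1000 * w + 3)%N (1000 * w + 4)%N (973 * w + 2)%N
     (2 * (973 * w + 2) - M - 1)%N ttB _ _ _ _ _ _ _ _ _ _).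
  + by move=> x [[ox bx] h].
  + by rewrite /M /K; lia.
  + by rewrite /ga /K /w; lia.
  + by rewrite /M; lia.
  + by lia.
  + by lia.
  + by rewrite /K; lia.
  + by lia.
  + by rewrite /M; lia.
  + by rewrite /M; lia.
  + by rewrite /M; lia.
- have hR : atmost (t.+1 * ((3 * t ^ al * (3 * t ^ al)) * (3 * t ^ be * (3 * t ^ be)))) R.
    have z A : atmost (3 * t ^ A) (fun c : int => (`|c| <= t ^ A)%N).
      by apply: atmost_leq (@atmost_int (t ^ A)); have := expn_gt0 t A; rewrite t1; lia.
    have zt : atmost t.+1 (fun k => (k <= t)%N).
      by rewrite -[X in atmost X](size_iota 0); apply: atmost_seq => k; rewrite mem_iota /= add0n ltnS.
    exact: (atmost_prod zt (atmost_prod (atmost_prod (z al) (z al)) (atmost_prod (z be) (z be)))).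
  apply: (@atmost_leq _ (t.+1 * ((3 * t ^ al * (3 * t ^ al)) * (3 * t ^ be * (3 * t ^ be))) *
       (cC * t ^ (508 * w + 2 + 3)))).
    apply: leq_trans (_ : 2 * 81 * cC * t ^ (1 + (2 * al + 2 * be)) * t ^ (508 * w + 2 + 3) <= _)%N.
      have t2 : (t.+1 <= 2 * t)%N by move: t1; clear; lia.
      apply: leq_trans (leq_mul (leq_mul t2 (leqnn _)) (leqnn _)) _.
      have -> : (2 * t * ((3 * t ^ al * (3 * t ^ al)) * (3 * t ^ be * (3 * t ^ be))) =
                 2 * 81 * t ^ (1 + (2 * al + 2 * be)))%N.
        have sq n : (t ^ (2 * n) = t ^ n * t ^ n)%N by rewrite -expnD addnn mul2n.
        rewrite (expnD t 1) expn1 (expnD t (2 * al)) !sq.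
        by move: (t ^ al)%N (t ^ be)%N; clear => x y; lia.
      by apply: eq_leq; move: (t ^ _)%N (t ^ _)%N; clear => x y; ring.
    by apply: fin; rewrite MM /al /be; lia.
  apply: (atmost_rel hR (Q := Q)) => [x [_ [k Rk Qk]]|k Rk]; first by exists k.
  have [[x0 [_ [_ [g [a [pp g0 ek gd ba]]]]]]|no] := pselect (exists x, (S x /\ exists2 k, R k & Q k x) /\ Q k x); last first.
    by apply: atmost0 => x h; apply: no; exists x.
  have [nD nl [p2 p3 n0 nc]] := gd.
  apply: atmost_sub (hC t (508 * w + 2)%N ((508 * w + 2) * 592 - M.+1 * 150 - 1)%N M k.1 a ttC _ _ _ _ _ pp nD nl p2 p3 n0 nc).
  + move=> x [[[ox bx] _] [kx _]]; split=> //.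
    by move/eqP: kx; rewrite ek dotZl mulf_eq0 (negPf g0) => /eqP.
  + by rewrite addn2.
  + by rewrite leq_mul.
  + exact: (proj1 (quartic_exponents w20)).
  + exact: (proj2 (quartic_exponents w20)).
  + by move=> i; apply: leq_trans (ba i) _; apply: up; rewrite /al /K /w; clear; lia.
Qed.
End QuarticBox.

(** * From primitive points to values *)

Lemma atmost_iota (T : eqType) n c (P : nat -> T -> Prop) :
  (forall j, (j < n)%N -> atmost c (P j)) -> atmost (n * c) (fun x => exists2 j, (j < n)%N & P j x).
Proof.
move=> h; rewrite -[X in (X * _)%N](size_iota 0 n); apply: (atmost_keys (Q := P)) => [x [j jn Pj]|j].
  by exists j => //; rewrite mem_iota.
by rewrite mem_iota add0n; exact: h.
Qed.

Lemma trunc_log_between t M n : (1 < t)%N -> (0 < n)%N -> (n <= t ^ M)%N ->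
  exists2 j, (j < M.+1)%N & (t ^ j <= n <= t ^ j.+1)%N.
Proof.
move=> t1 n0 nM; exists (trunc_log t n).
  rewrite ltnS -(leq_exp2l _ _ t1); apply: leq_trans nM; exact: trunc_logP.
by rewrite trunc_logP //= ltnW // trunc_log_ltn.
Qed.

(** The factors 75 and 1000 are those of the exponent budgets in [cubic_box] and [quartic_box]; the
    summand 20 absorbs the additive constants. *)
Definition box_exponent d b := (if d == 3 then 75 * (b + 20) else 1000 * (b + 20))%N.

Lemma box_exponent_gt d b : (b < box_exponent d b)%N.
Proof. by rewrite /box_exponent; case: ifP; lia. Qed.

Section Values.
Variables (d : nat) (f1 f2 : {poly int}).
Hypotheses (d3 : (3 <= d)%N) (sf1 : sepform d f1) (sf2 : sepform d f2) (niso : noniso d f1 f2).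

Lemma primitive_box b : exists C t0, forall t, (t0 <= t)%N ->
  atmost (C * t ^ (2 * box_exponent d b - b)) (fun x => onS d f1 f2 x /\ in_box (t ^ box_exponent d b) x).
Proof.
rewrite /box_exponent; have [e|d4] := eqVneq d 3; last by apply: quartic_box; rewrite // ltn_neqAle eq_sym d4.
by subst d; apply: cubic_box.
Qed.

(** Splitting by the size t^j of [k], one counts triples (k, u, v): up to a constant t^(j + 1) times
    t^(2 (M - j)), which saves about t^b over the box since j >= b. *)
Lemma content_count t M b : (1 < t)%N -> (b <= M)%N ->
  atmost (M.+1 * (9 * t ^ (2 * M - b + 1)))
    (fun m : int => exists k : nat, [/\ (t ^ b < k)%N & exists u v : int,
       [/\ m = bf d f1 (k%:Z * u) (k%:Z * v), m != 0,
           (k * `|u| <= t ^ M)%N & (k * `|v| <= t ^ M)%N]]).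
Proof.
move=> t1 bM; pose P j (m : int) := (b <= j)%N /\ exists k : nat, [/\ (k <= t ^ j.+1)%N &
  exists u v : int, [/\ m = bf d f1 (k%:Z * u) (k%:Z * v), 0 < k,
    `|u| <= t ^ (M - j) & `|v| <= t ^ (M - j)]%N].
apply: (@atmost_sub _ _ _ (fun m => exists2 j, (j < M.+1)%N & P j m)).
  move=> m [k [kb [u [v [em m0 hu hv]]]]].
  have k0 : (0 < k)%N by apply: leq_trans kb.
  have kM : (k <= t ^ M)%N.
    have [u0|un] := eqVneq u 0; last first.
      by apply: leq_trans hu; rewrite leq_pmulr // absz_gt0.
    have [v0|vn] := eqVneq v 0; last first.
      by apply: leq_trans hv; rewrite leq_pmulr // absz_gt0.
    by move: m0; rewrite em u0 v0 !mulr0 bf00 ?eqxx // (leq_trans _ d3).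
  have [j jM /andP[j1 j2]] := trunc_log_between t1 k0 kM; exists j => //.
  have key (z : int) : (k * `|z| <= t ^ M)%N -> (`|z| <= t ^ (M - j))%N.
    move=> hz; rewrite -(@leq_pmul2l (t ^ j)) ?expn_gt0 ?(ltnW t1) // -expnD subnKC //.
    by apply: leq_trans hz; rewrite leq_mul.
  split; last by exists k; split=> //; exists u, v; split=> //; apply: key.
  by rewrite -ltnS -(ltn_exp2l _ _ t1); apply: leq_trans kb j2.
apply: atmost_iota => j jM.
have [bj|bj] := leqP b j; last by apply: atmost0 => m []; rewrite leqNgt bj.
have z A : atmost (3 * t ^ A) (fun c : int => (`|c| <= t ^ A)%N).
  by apply: atmost_leq (@atmost_int (t ^ A)); have := expn_gt0 t A; rewrite (ltnW t1); lia.
have zk : atmost (t ^ j.+1) (fun k => (0 < k <= t ^ j.+1)%N).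
  rewrite -[X in atmost X](size_iota 1); apply: atmost_seq => k.
  by rewrite mem_iota add1n ltnS.
apply: (atmost_leq (n := t ^ j.+1 * ((3 * t ^ (M - j)) * (3 * t ^ (M - j))))).
  have -> : (t ^ j.+1 * ((3 * t ^ (M - j)) * (3 * t ^ (M - j))) = 9 * (t ^ (j.+1 + (M - j) + (M - j))))%N.
    by rewrite !expnD; move: (t ^ _)%N (t ^ _)%N; clear => x y; ring.
  by rewrite leq_mul // leq_exp2l //; move: jM bj; clear; lia.
apply: (atmost_image (f := fun k : nat * (int * int) => bf d f1 (k.1%:Z * k.2.1) (k.1%:Z * k.2.2)) _
  (atmost_prod zk (atmost_prod (z _) (z _)))) => m.
by move=> [_ [k [kj [u [v [-> k0 hu hv]]]]]]; exists (k, (u, v)) => //=; rewrite k0.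
Qed.

(** Contents above t^(b + 1) are left to [content_count]. Smaller ones multiply the number of
    primitive points by t^(b + 1), which is why [primitive_box] is used with the saving 2 (b +
    1). *)
Lemma box_values b (M := box_exponent d (b.+1 + b.+1)) : exists C t0, forall t, (t0 <= t)%N ->
  atmost (C * t ^ (2 * M - b)) (fun m : int => m != 0 /\
    exists x, [/\ in_box (t ^ M) x, surf d f1 f2 x = 0 & m = bf d f1 (x 0 o0) (x 0 o1)]).
Proof.
have [C [t0 h]] := primitive_box (b.+1 + b.+1); rewrite -/M in h.
have bM : (b.+1 + b.+1 < M)%N by apply: box_exponent_gt.
exists (C + M.+1 * 9)%N, (t0 + 2)%N => t tt; have t1 : (1 < t)%N by lia.
have bM' : (b.+1 <= M)%N by lia.
rewrite mulnDl -[X in (_ + X)%N]mulnA.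
have -> : (2 * M - b = 2 * M - b.+1 + 1)%N by lia.
apply: atmost_sub (atmostU _ (content_count t1 bM')); last first.
  apply: (@atmost_leq _ (t ^ b.+1 * (C * t ^ (2 * M - (b.+1 + b.+1))))).
    by rewrite mulnCA leq_mul // -expnD leq_exp2l //; lia.
  have zk : atmost (t ^ b.+1) (fun k => (0 < k <= t ^ b.+1)%N).
    rewrite -[X in atmost X](size_iota 1); apply: atmost_seq => k.
    by rewrite mem_iota add1n ltnS.
  have ht : atmost (C * t ^ (2 * M - (b.+1 + b.+1))) (fun x => onS d f1 f2 x /\ in_box (t ^ M) x).
    by apply: h; apply: leq_trans tt; apply: leq_addr.
  apply: (atmost_image (Q := fun m => exists k : nat * 'rV[int]_4, [/\ (0 < k.1 <= t ^ b.+1)%N,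
     onS d f1 f2 k.2 /\ in_box (t ^ M) k.2 & m = k.1%:Z ^+ d * bf d f1 (k.2 0 o0) (k.2 0 o1)]) _ (atmost_prod zk ht)).
  by move=> m [k [k1 k2 ->]]; exists k.
move=> m [m0 [x [bx sx em]]].
have xn : x != 0.
  by apply: contraNneq m0 => x0; rewrite em x0 !mxE bf00 // (leq_trans _ d3).
have [g [y [g0 ex py by_]]] := primitive_part xn.
have gs i : x 0 i = g * y 0 i by rewrite ex mxE.
wlog gp : g y g0 ex py by_ gs / 0 < g.
  move=> W; have [gp|] := boolP (0 < g); first exact: (W g y).
  move=> gn; apply: (W (- g) (- y)); rewrite ?oppr_eq0 //.
  - by rewrite ex scaleNr scalerN opprK.
  - by move=> k hk; apply: py => i; have := hk i; rewrite mxE rpredN.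
  - by move=> i; rewrite mxE abszN.
  - by move=> i; rewrite gs mxE mulrNN.
  - by rewrite oppr_gt0 lt_neqAle g0 leNgt.
have eg : g = `|g|%N%:Z by rewrite gez0_abs ?ltW.
have em' : m = `|g|%N%:Z ^+ d * bf d f1 (y 0 o0) (y 0 o1) by rewrite em !gs bf_hom -eg.
have g1 : (0 < `|g|)%N by rewrite absz_gt0.
have [gb|gb] := leqP `|g| (t ^ b.+1).
  left; exists (`|g|%N, y); rewrite /= g1 gb; split=> //; split; last first.
    by move=> i; apply: leq_trans (by_ i) (bx i).
  split=> //; last by apply: contraNneq m0 => e; rewrite em' e mulr0.
  by move/eqP: sx; rewrite ex surfZ mulf_eq0 expf_eq0 (negPf g0) andbF => /eqP.
right; exists `|g|%N; split=> //; exists (y 0 o0), (y 0 o1).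
rewrite bf_hom; split=> //; by have := bx o0; have := bx o1; rewrite !gs !abszM.
Qed.
End Values.

(** * Thue's theorem *)

Definition ev (p : {poly int}) (s : rat) : rat := (map_poly intr p).[s].

Lemma evE p s : ev p s = \sum_(i < size p) (p`_i)%:~R * s ^+ i.
Proof.
rewrite /ev (horner_coef_wide (n := size p)) ?size_poly //.
by apply: eq_bigr => i _; rewrite coef_map.
Qed.

Lemma intr_absz (z : int) : `|z%:~R| = (`|z|%N)%:R :> rat.
Proof. by rewrite -intr_norm pmulrn abszE. Qed.

Lemma ev_bound (S n : nat) (p : {poly int}) s : (0 < S)%N -> `|s| <= S%:R -> (size p <= n.+1)%N ->
  `|ev p s| <= (bf_norm p * S ^ n)%:R.
Proof.
move=> S0 sS sp; rewrite evE; apply: le_trans (ler_norm_sum _ _ _) _.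
rewrite /bf_norm natrM natr_sum mulr_suml; apply: ler_sum => i _.
rewrite normrM intr_absz ler_wpM2l ?ler0n // normrX natrX.
apply: le_trans (_ : S%:R ^+ i <= _); first by rewrite lerXn2r ?nnegrE ?ler0n.
by rewrite ler_weXn2l ?ler1n // -ltnS (leq_trans (ltn_ord i)).
Qed.

Lemma bf_ev d (f : {poly int}) (x y : int) : y != 0 -> (size f <= d.+1)%N ->
  (bf d f x y)%:~R = y%:~R ^+ d * ev f (x%:~R / y%:~R).
Proof.
move=> y0 sf; rewrite /ev -(bf_y1 _ sf) -bf_hom mulr1 mulrC divfK ?intr_eq0 //.
exact: rmorph_bf.
Qed.

(** Where f is small the Bezout identity bounds f' from below, and the second-order Taylor remainder
    is dominated once s and s' are close, uniformly for |s| <= S. *)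
Lemma local_inverse d f (S : nat) : sepform d f -> (0 < S)%N ->
  exists K Z : nat, [/\ (0 < K)%N, (0 < Z)%N & forall s s', `|s| <= S%:R ->
    Z%:R * `|s - s'| <= 1 -> K%:R * `|ev f s| <= 1 ->
    `|s - s'| <= K%:R * `|ev f s - ev f s'|].
Proof.
move=> [sf [D D0 [u [v bez]]]] S0.
pose U := (bf_norm u * S ^ size u + bf_norm v * S ^ size v + 1)%N.
pose C := (\sum_(i < d) bf_norm f^`N(i.+2) * S ^ size f^`N(i.+2))%N.
exists (4 * U)%N, (4 * U * C + 1)%N; rewrite muln_gt0 /= {1}/U !addn1; split=> //.
move=> s s' sS hZ hK.
have Cn : 0 <= C%:R :> rat by rewrite ler0n.
have U1 : 1 <= U%:R :> rat by rewrite ler1n /U addn1.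
have hb p : `|ev p s| <= (bf_norm p * S ^ size p)%:R by apply: ev_bound.
have f'0 : 1 <= U%:R * `|ev f s| + U%:R * `|ev f^`() s|.
  have e : ev u s * ev f s + ev v s * ev f^`() s = D%:~R.
    by have := congr1 (ev^~ s) bez; rewrite /ev rmorphD !rmorphM /= hornerD !hornerM map_polyC hornerC.
  have : 1 <= `|D%:~R : rat| by rewrite intr_absz ler1n absz_gt0.
  rewrite -e => h; apply: le_trans h _; apply: le_trans (ler_normD _ _) _.
  rewrite !normrM lerD // ler_wpM2r //; apply: le_trans (hb _) _; rewrite ler_nat /U.
    by rewrite -addnA leq_addr.
  by rewrite -addnA addnCA leq_addr.
set h := s' - s.
have nh : `|s - s'| = `|h| by rewrite distrC.
rewrite nh in hZ *.
have h1 : `|h| <= 1.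
  by apply: le_trans hZ; rewrite -[X in X <= _]mul1r ler_wpM2r // ler1n.
have [r er rC] : exists2 r, ev f s' = ev f s + ev f^`() s * h + h ^+ 2 * r & `|r| <= C%:R.
  exists (\sum_(i < d) ev f^`N(i.+2) s * h ^+ i).
    rewrite {1}/ev -[s'](subrK s) -/h addrC.
    rewrite (nderiv_taylor_wide (n := d.+2)) ?(leq_trans (size_poly _ _)) ?sf //; last exact: mulrC.
    rewrite 2!big_ord_recl /= nderivn0 expr0 mulr1 nderivn1 expr1 /ev -deriv_map addrA.
    rewrite mulr_sumr; congr (_ + _); apply: eq_bigr => i _.
    by rewrite !nderivn_map /= !exprS expr0; ring.
  rewrite /C natr_sum; apply: le_trans (ler_norm_sum _ _ _) _; apply: ler_sum => i _.
  rewrite normrM -[X in _ <= X]mulr1 ler_pM // normrX exprn_ile1 //.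
have hr : 4 * U%:R * C%:R * `|h| <= 1.
  by move: hZ; rewrite -addn1 natrD !natrM; apply: le_trans; rewrite ler_wpM2r // lerDl.
rewrite er opprD addrA opprD addrA subrr add0r -opprD normrN.
have -> : ev f^`() s * h + h ^+ 2 * r = h * (ev f^`() s + h * r) by ring.
rewrite natrM normrM.
have f2 : 1 <= 2 * U%:R * `|ev f^`() s| by move: hK f'0; rewrite natrM; lra.
have rr : 4 * U%:R * `|h * r| <= 1.
  apply: le_trans hr; rewrite normrM -!mulrA ler_wpM2l // ler_wpM2l // 1?(le_trans _ U1) //.
  by rewrite mulrC ler_wpM2r.
have tr : `|ev f^`() s| <= `|ev f^`() s + h * r| + `|h * r|.
  by rewrite -{1}[ev f^`() s](addrK (h * r)); exact: ler_normB.
have k1 : 1 <= 4 * U%:R * `|ev f^`() s + h * r|.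
  have := ler_wpM2l (ltW (lt_le_trans (ltr0Sn _ 1) (ler_peMr (ltW (ltr0Sn _ 1)) U1))) tr.
  by move: f2 rr; lra.
by rewrite mulrCA -[X in X <= _]mulr1 ler_wpM2l.
Qed.

(** When |x| exceeds 2 |y| times the norm of f, the leading term is at least twice the rest. So
    there is no cusp in the direction y = 0, and slopes may be taken to be bounded. *)
Lemma steep_or_large d f (x y : int) : sepform d f -> (0 < d)%N ->
  (`|x| <= 2 * bf_norm f * `|y|)%N \/ (`|y| <= `|x| /\ `|x| ^ d <= 2 * `|bf d f x y|)%N.
Proof.
move=> sf d0; have [sz _] := sf; have ld := sepform_lead sf.
have n1 : (0 < bf_norm f)%N.
  by rewrite /bf_norm sz big_ord_recr /= addn_gt0 absz_gt0 ld orbT.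
have [|lt] := leqP `|x| (2 * bf_norm f * `|y|); [by left | right].
have yx : (`|y| <= `|x|)%N.
  by apply: leq_trans (ltnW lt); rewrite leq_pmull // muln_gt0.
split=> //.
have hr : (`|(\sum_(i < d) f`_i * (x ^+ i * y ^+ (d - i)))%R| <= bf_norm f * (`|x| ^ d.-1 * `|y|))%N.
  apply: leq_trans (absz_sum _ _ _) _; rewrite /bf_norm sz big_ord_recr /= mulnDl.
  apply: leq_trans (leq_addr _ _); rewrite big_distrl; apply: leq_sum => i _ /=.
  rewrite !abszM !abszX leq_mul //; have id := ltn_ord i.
  have -> : (d - i = (d - i).-1.+1)%N by lia.
  rewrite expnSr mulnA leq_mul //.
  have -> : (d.-1 = i + (d - i).-1)%N by lia.
  by rewrite expnD leq_mul // leqXn.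
have e : bf d f x y = \sum_(i < d) f`_i * (x ^+ i * y ^+ (d - i)) + f`_d * x ^+ d.
  rewrite /bf big_ord_recr /= subnn expr0 mulr1 intz; congr (_ + _).
  by apply: eq_bigr => i _; rewrite intz.
have l1 : (`|x| ^ d <= `|(f`_d * x ^+ d)%R|)%N by rewrite abszM abszX leq_pmull // absz_gt0.
have l2 : (2 * (bf_norm f * (`|x| ^ d.-1 * `|y|)) <= `|x| ^ d)%N.
  have -> : (2 * (bf_norm f * (`|x| ^ d.-1 * `|y|)) = `|x| ^ d.-1 * (2 * bf_norm f * `|y|))%N.
    by move: (bf_norm f) (`|x| ^ d.-1)%N `|y|%N; clear => a b c; ring.
  by rewrite -[X in (_ <= _ ^ X)%N](prednK d0) expnSr leq_mul // ltnW.
move: hr l1 l2; rewrite e; move: (\sum_(_ < _) _) (f`_d * _) (_ * (_ * _))%N (`|x| ^ d)%N.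
by clear => A B m n; lia.
Qed.

Lemma bin_leq2X m i : ('C(m, i) <= 2 ^ m)%N.
Proof.
elim: m i => [|m IH] [|i]; rewrite ?bin0 ?bin0n ?expn_gt0 //.
by rewrite binS expnS mul2n -addnn leq_add.
Qed.

(** Quotient and remainder of c^m X^m by f, where c is the leading coefficient: one factor c at each
    step keeps the division integral. *)
Fixpoint power_reduction (d : nat) (f : {poly int}) m : {poly int} * {poly int} :=
  if m is m'.+1 then let: (q, r) := power_reduction d f m' in
    (f`_d *: ('X * q) + (r`_d.-1)%:P, f`_d *: ('X * r) - r`_d.-1 *: f)
  else (0, 1).

Lemma power_reductionE d (f : {poly int}) m : (f`_d ^+ m) *: 'X^m =
  (power_reduction d f m).1 * f + (power_reduction d f m).2.
Proof.
elim: m => [|m IH] /=; first by rewrite !expr0 scale1r mul0r add0r.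
case: (power_reduction d f m) IH => q r /= IH; rewrite !exprS -scalerA.
have -> : f`_d ^+ m *: ('X * 'X^m) = 'X * (q * f + r) by rewrite scalerAr IH.
by rewrite -!mul_polyC; ring.
Qed.

Lemma power_reduction_bound d (f : {poly int}) (S : nat) : (0 < d)%N -> size f = d.+1 -> (0 < S)%N ->
  exists2 K, (`|(f`_d)%R| <= K /\ 0 < K)%N & forall m,
  [/\ (size (power_reduction d f m).2 <= d)%N,
    forall i, (`|((power_reduction d f m).2`_i)%R| <= K ^ m)%N &
    forall s, `|s| <= S%:R -> `|ev (power_reduction d f m).1 s| <= (K ^ m)%:R].
Proof.
move=> d0 sf S0; pose c := `|(f`_d)%R|%N; exists (c * S + bf_norm f + 1 + c)%N.
  by split; [rewrite leq_addl | rewrite addn1 addSn].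
set K := (_ + c)%N.
have K1 : (c + bf_norm f <= K)%N by rewrite /K; move: (c * S)%N; lia.
have K2 : (c * S + 1 <= K)%N by rewrite /K; lia.
have nf i : (`|(f`_i)%R| <= bf_norm f)%N.
  have [lt|ge] := ltnP i (size f); last by rewrite nth_default.
  by rewrite /bf_norm (bigD1 (Ordinal lt)) //= leq_addr.
elim=> [|m] /=.
  split; first by rewrite size_poly1.
  - by move=> i; rewrite coef1; case: (i == 0%N).
  - by move=> s _; rewrite /ev rmorph0 horner0 normr0.
case: (power_reduction d f m) => q r /= [sr hr hq]; split.
- apply/leq_sizeP => j dj; rewrite coefB !coefZ coefXM.
  case: j dj => [|j]; first by rewrite leqn0 (gtn_eqF d0).
  rewrite leq_eqVlt => /orP[/eqP e|lt]; first by rewrite e /=; ring.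
  have r0 : r`_j = 0 by apply: nth_default; apply: leq_trans sr _.
  have f0 : f`_j.+1 = 0 by apply: nth_default; rewrite sf.
  by rewrite /= r0 f0 !mulr0 subr0.
- move=> i; rewrite expnS; apply: leq_trans (leq_mul K1 (leqnn _)).
  rewrite coefB !coefZ coefXM mulnDl.
  have h1 : (`|(f`_d * (if i == 0%N then 0 else r`_i.-1))%R| <= c * K ^ m)%N.
    by rewrite abszM leq_mul //; case: ifP.
  have h2 : (`|(r`_d.-1 * f`_i)%R| <= bf_norm f * K ^ m)%N.
    by rewrite abszM mulnC leq_mul.
  by move: h1 h2; set A := (_ * _)%R; set B := (_ * _)%R; move: (_ * _)%N (_ * _)%N; clearbody A B; clear; lia.
- move=> s sS; rewrite expnS; apply: (@le_trans _ _ ((c * S + 1) * K ^ m)%:R); last first.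
    by rewrite ler_nat leq_mul.
  have -> : ev (f`_d *: ('X * q) + (r`_d.-1)%:P) s = (f`_d)%:~R * (s * ev q s) + (r`_d.-1)%:~R.
    by rewrite /ev rmorphD /= map_polyZ rmorphM /= map_polyX map_polyC hornerD hornerZ hornerM hornerX hornerC.
  rewrite mulnDl mul1n natrD; apply: le_trans (ler_normD _ _) _; apply: lerD.
    rewrite normrM intr_absz -/c -mulnA natrM ler_wpM2l // normrM natrM.
    by apply: ler_pM => //; apply: hq.
  by rewrite intr_absz ler_nat.
Qed.

(** A(X) - Y B(X) vanishes to order 4 k in X at X = Y = alpha for every root alpha of f.
    Divisibility by f of one derivative amounts to d remainder coefficients, hence 4 k d conditions
    on 2 (n + 1) unknowns. The degree n = (3 d - 2) k leaves enough unknowns to bound the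
    coefficients by C^k and is still below 4 k (d - 1), as the Wronskian argument requires. *)
Lemma thue_polynomials d (f : {poly int}) (S : nat) : (3 <= d)%N -> size f = d.+1 -> f`_d != 0 -> (0 < S)%N ->
  exists2 C, (0 < C)%N & forall k, (0 < k)%N -> exists A B : {poly int},
  let n := ((3 * d - 2) * k)%N in
  [/\ (size A <= n.+1)%N /\ (size B <= n.+1)%N,
    forall i, (`|(A`_i)%R| <= C ^ k)%N /\ (`|(B`_i)%R| <= C ^ k)%N,
    A != 0 \/ B != 0 &
    forall i, (i < 4 * k)%N -> (exists Q, f`_d ^+ n.+1 *: (A^`N(i) - 'X * B^`N(i)) = Q * f) /\
      forall s, `|s| <= S%:R ->
        `|ev A^`N(i) s - s * ev B^`N(i) s| <= (C ^ k)%:R * `|ev f s|].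
Proof.
move=> d3 sf ld S0; have d0 : (0 < d)%N by apply: ltnW (ltnW d3).
have [K [cK K0] hK] := power_reduction_bound d0 sf S0.
pose G0 := (4 * K)%N; exists (G0 ^ (3 * d * (2 * d + 1)))%N.
  by rewrite expn_gt0 muln_gt0 K0.
move=> k k0; pose n := ((3 * d - 2) * k)%N; pose N := n.+1.
have Nk : (N <= 3 * d * k)%N.
  rewrite /N /n; have -> : (3 * d * k = (3 * d - 2) * k + 2 * k)%N by rewrite -mulnDl subnK //; lia.
  by rewrite -addn1 leq_add2l; lia.
pose G := (2 * N * 2 ^ n * K ^ N)%N.
have GG : (G <= G0 ^ (3 * d * k))%N.
  apply: leq_trans (_ : G0 ^ N <= _)%N; last by rewrite leq_pexp2l // muln_gt0 K0.
  have -> : (G = N * 2 ^ N * K ^ N)%N.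
    by rewrite /G /N (expnS 2); move: (2 ^ n)%N (K ^ _)%N; clear => x y; ring.
  by rewrite /G0 expnMn leq_mul // (expnMn 2 2) leq_mul // ltnW // ltn_expl.
have G1 : (0 < G)%N by rewrite /G !muln_gt0 !expn_gt0 K0.
(* [G] bounds the sum of the absolute coefficients of a condition. Siegel's count needs (G (X +
   1))^(4 k d) < (X + 1)^(2 N), and this choice of [X] turns G^(4 k d) into X^(2 k). *)
pose X := (G ^ (2 * d))%N; pose m := (G * X).+1.
have GX : (G * X = 2 * N * (2 ^ n * K ^ N * X))%N by rewrite /G !mulnA.
(* The boolean is [false] for the coefficients of A and [true] for those of B, which carry a sign
   and one more factor X. *)
pose I := (bool * 'I_N)%type; pose J := ('I_(4 * k) * 'I_d)%type.
pose ex i (x : I) := (x.2 - i + x.1)%N.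
have exN i x : (ex i x <= N)%N by have := ltn_ord x.2; rewrite /ex /N; case: (x.1); lia.
pose ee i (x : I) : int := (-1) ^+ x.1 * ('C(x.2, i))%:Z * f`_d ^+ (N - ex i x).
pose L (j : J) (x : I) : int := ee j.1 x * (power_reduction d f (ex j.1 x)).2`_j.2.
have eeb i (x : I) z : (`|z| <= K ^ ex i x)%N -> (`|(ee i x * z)%R| <= 2 ^ n * K ^ N)%N.
  move=> hz; rewrite /ee !abszM !abszX abszN1 exp1n mul1n absz_nat -mulnA leq_mul //.
    by apply: leq_trans (bin_leq2X _ _) _; rewrite leq_pexp2l // -ltnS.
  have -> : (K ^ N = K ^ (N - ex i x) * K ^ ex i x)%N by rewrite -expnD subnK.
  by rewrite leq_mul // leqXn.
have sumb (F : I -> nat) b : (forall x, (F x <= b)%N) -> (\sum_x F x <= 2 * N * b)%N.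
  move=> h; apply: leq_trans (leq_sum _ (fun x _ => h x)) _.
  by rewrite sum_nat_const card_prod card_bool card_ord.
have [||q [[x0 qx0] qX hq]] := @small_solution _ _ (fun _ : J => m) (fun _ : I => X) L.
- by [].
- rewrite !prod_nat_const !card_prod card_bool !card_ord.
  have dk : (d * k <= k * (2 * d - 4) + 4 * k + 4 * (d * k) + 0)%N by nia.
  apply: (@leq_ltn_trans ((G * X.+1) ^ (4 * k * d))).
    by rewrite leqXn // /m mulnS; move: (G * X)%N G1; clear; lia.
  rewrite expnMn.
  have e1 : (G ^ (4 * k * d) = X ^ (2 * k))%N.
    by rewrite /X -expnM; congr (_ ^ _)%N; ring.
  rewrite e1; apply: leq_ltn_trans (_ : X.+1 ^ (2 * k) * X.+1 ^ (4 * k * d) < _)%N.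
    by rewrite leq_mul // leqXn.
  rewrite -expnD ltn_exp2l ?expn_gt0 ?G1 //; last by rewrite ltnS expn_gt0 G1.
  have dk' : (3 * k <= d * k)%N by rewrite leq_mul.
  rewrite /N /n mulnBl; move: dk'; rewrite -!mulnA [(k * d)%N]mulnC; move: (d * k)%N; clear; lia.
have zero i r : (i < 4 * k)%N -> (r < d)%N ->
    \sum_x (ee i x * (power_reduction d f (ex i x)).2`_r) * q x = 0.
  move=> ik rd; have := hq (Ordinal ik, Ordinal rd); rewrite /L /=; set s := \sum_(_ | _) _ => ms.
  apply/eqP; rewrite -absz_eq0; apply/negPn/negP; rewrite -lt0n => s0.
  move: ms; rewrite dvdzE absz_nat => /(dvdn_leq s0); rewrite leqNgt; apply/negP; rewrite negbK.
  rewrite ltnS /s; apply: leq_trans (absz_sum _ _ _) _; rewrite GX; apply: sumb => x.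
  rewrite abszM leq_mul // ?qX //; apply: eeb; by have [_ + _] := hK (ex i x); apply.
pose A := \sum_(y < N) q (false, y) *: 'X^y; pose B := \sum_(y < N) q (true, y) *: 'X^y : {poly int}.
have XG : (X <= (G0 ^ (3 * d * (2 * d + 1))) ^ k)%N.
  rewrite /X; apply: leq_trans (leqXn _ GG) _; rewrite -!expnM leq_pexp2l ?muln_gt0 ?K0 //.
  by rewrite -(mulnA (3 * d) k) -(mulnA (3 * d) (2 * d + 1)) leq_mul // mulnC leq_mul // leq_addr.
have coefAB b i : (`|((\sum_(y < N) q (b, y) *: 'X^y : {poly int})`_i)%R| <= X)%N.
  have -> : \sum_(y < N) q (b, y) *: 'X^y = \poly_(y < N) (if insub y is Some o then q (b, o) else 0) :> {poly int}.
    by rewrite poly_def; apply: eq_bigr => y _; rewrite valK.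
  by rewrite coef_poly; case: ifP => // iN; case: insubP => // o _ _; apply: qX.
exists A, B; split.
- by split; rewrite /A /B; apply: (size_sum_leq N) || (apply: leq_trans (size_sum _ _ _) _; apply/bigmax_leqP => y _; apply: leq_trans (size_scale_leq _ _) _; rewrite size_polyXn).
- by move=> i; split; apply: leq_trans (coefAB _ _) XG.
- have coefq b (y : 'I_N) : (\sum_(z < N) q (b, z) *: 'X^z : {poly int})`_y = q (b, y).
    rewrite coef_sum (bigD1 y) //= coefZ coefXn eqxx mulr1 big1 ?addr0 // => z zy.
    by rewrite coefZ coefXn eq_sym (negPf (_ : val z != val y)) ?mulr0.
  case: x0 qx0 => [[] y] qy; [right | left]; apply: contraNneq qy => e; rewrite -coefq.
    by rewrite -/B e coef0.
  by rewrite -/A e coef0.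
move=> i ik; pose Q := \sum_x (ee i x * q x) *: (power_reduction d f (ex i x)).1.
have sumI (F : I -> {poly int}) : \sum_x F x = \sum_y F (false, y) + \sum_y F (true, y).
  rewrite (eq_bigr (fun p : I => F (p.1, p.2))); last by case.
  by rewrite -(pair_bigA _ (fun b y => F (b, y))) /= big_bool addrC.
have eQ : f`_d ^+ N *: (A^`N(i) - 'X * B^`N(i)) = Q * f.
  transitivity (\sum_x (ee i x * q x) *: (f`_d ^+ ex i x *: 'X^(ex i x)) : {poly int}).
    rewrite sumI /A /B !linear_sum /= scalerBr mulr_sumr !scaler_sumr -sumrN; congr (_ + _);
      apply: eq_bigr => y _; rewrite nderivnZ nderivnXn /ee /ex /= ?addn0 ?addn1;
      rewrite ?expr1 ?expr0 ?mul1r ?mulN1r.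
      have -> : f`_d ^+ N = f`_d ^+ (N - (y - i)) * f`_d ^+ (y - i).
        by rewrite -exprD subnK //; have := exN i (false, y); rewrite /ex addn0.
      by rewrite -scaler_nat natz !scalerA; congr (_ *: _); ring.
    have -> : f`_d ^+ N = f`_d ^+ (N - (y - i).+1) * f`_d ^+ (y - i).+1.
      by rewrite -exprD subnK //; have := exN i (true, y); rewrite /ex addn1.
    by rewrite -scaler_nat natz -!scalerAr -exprS !scalerA -scaleNr; congr (_ *: _); ring.
  under eq_bigr do rewrite power_reductionE scalerDr scalerAl.
  rewrite big_split /= -mulr_suml -/Q [X in _ + X](_ : _ = 0) ?addr0 //.
  apply/polyP => r; rewrite coef0 coef_sum.
  have [rd|rd] := ltnP r d; last first.
    by rewrite big1 // => x _; rewrite coefZ nth_default ?mulr0 //; have [h _ _] := hK (ex i x); apply: leq_trans rd.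
  by rewrite -[RHS](zero i r ik rd); apply: eq_bigr => x _; rewrite coefZ; ring.
split; first by exists Q.
move=> s sS; have := congr1 (ev^~ s) eQ; rewrite /= /ev map_polyZ rmorphB !rmorphM /= map_polyX rmorphXn /=.
rewrite hornerZ hornerD hornerN !hornerM hornerX -!/(ev _ s) => e.
have c1 : 1 <= `|(f`_d)%:~R ^+ N : rat|.
  by rewrite normrX intr_absz exprn_ege1 // ler1n absz_gt0.
have : `|ev A^`N(i) s - s * ev B^`N(i) s| <= `|ev Q s| * `|ev f s|.
  rewrite -normrM -e normrM -[X in X <= _]mul1r ler_wpM2r //.
move=> h; apply: le_trans h _; rewrite ler_wpM2r //.
apply: (@le_trans _ _ (G * X)%:R); last first.
  rewrite ler_nat; apply: leq_trans (leq_mul (leqnn _) (leqnn _)) _.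
  rewrite /X -expnS; apply: leq_trans (leqXn _ GG) _; rewrite -!expnM leq_pexp2l ?muln_gt0 ?K0 //.
  by rewrite addn1 mulnAC.
have -> : ev Q s = \sum_x (ee i x * q x)%:~R * ev (power_reduction d f (ex i x)).1 s.
  by rewrite /ev /Q rmorph_sum /= horner_sum; apply: eq_bigr => x _; rewrite map_polyZ hornerZ.
apply: le_trans (ler_norm_sum _ _ _) _.
apply: (@le_trans _ _ (\sum_(x : I) (2 ^ n * K ^ N * X)%:R)); last first.
  by rewrite -natr_sum ler_nat GX; apply: sumb.
apply: ler_sum => x _; rewrite normrM intr_absz.
apply: (@le_trans _ _ (`|(ee i x * q x)%R|%:R * (K ^ ex i x)%:R)).
  by rewrite ler_wpM2l // ; have [_ _] := hK (ex i x); apply.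
rewrite -natrM ler_nat abszM mulnAC leq_mul // ?qX //.
by have := eeb i x (K ^ ex i x)%N%:Z; rewrite abszM absz_nat; apply.
Qed.

From mathcomp Require Import separable.

(** If b = q g^l with l > 0, its derivative is q' g^l + l q g' g^(l - 1). Divisibility by g^l forces
    g to divide q g', and g is coprime to g'. *)
Lemma dvdp_pow_of_derivn (g b : {poly rat}) l : separable_poly g ->
  (forall i, (i < l)%N -> g %| b^`(i)) -> g ^+ l %| b.
Proof.
move=> sg; elim: l b => [|l IH] b h; first by rewrite expr0 dvd1p.
have g0 : g != 0 by apply: separable_poly_neq0.
case: l IH h => [|l] IH h; first by have := h 0%N isT; rewrite expr1 derivn0.
have /dvdpP[q eq] : g ^+ l.+1 %| b by apply: IH => i il; apply: h; apply: ltnW.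
have /dvdpP[r er] : g ^+ l.+1 %| b^`().
  by apply: IH => i il; rewrite -derivSn; apply: h.
have gl0 : g ^+ l != 0 by rewrite expf_neq0.
have e : l.+1%:R%:P * (g^`() * q) = g * (r - q^`()).
  apply: (mulfI gl0); move: er; rewrite eq derivM deriv_exp /= -mulr_natr -polyC_natr exprS => er.
  have {}er : q^`() * (g * g ^+ l) + q * (g ^+ l * g^`() * (l.+1%:R)%:P) = r * (g * g ^+ l) by rewrite -er; ring.
  have -> : g ^+ l * (g * (r - q^`())) = r * (g * g ^+ l) - q^`() * (g * g ^+ l) by ring.
  by rewrite -er; ring.
have : g %| g^`() * q.
  rewrite -(@dvdpZr _ (l.+1%:R)) ?pnatr_eq0 // -mul_polyC e; exact: dvdp_mulIl.
rewrite Gauss_dvdpr; last by move: sg; rewrite separable_poly.unlock.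
move=> /dvdpP[q' eq'].
by rewrite eq eq' -mulrA -exprS; exact: dvdp_mulIr.
Qed.

(** Subtract the multiple of [b] that agrees with [a] at a point z with b(z) nonzero. The Wronskian
    with [b] is still 0, but a nonzero difference would contradict this by its order of vanishing at
    z. *)
Lemma wronskian_eq0 (a b : {poly rat}) : b != 0 -> a * b^`() = a^`() * b ->
  exists c, a = c%:P * b.
Proof.
move=> b0 e; have [z bz] : exists z, b.[z] != 0.
  apply: contrapT => /forallNP h; case/eqP: b0; apply: poly_zero_inf => n.
  by have /negP := h n.+1%:R; rewrite negbK => /eqP.
pose c := a.[z] / b.[z]; exists c; apply/eqP; rewrite -subr_eq0; apply: contraT => r0.
set r := a - _ in r0.
have rz : root r z by rewrite /root /r hornerD hornerN hornerM hornerC /c divfK // subrr.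
have er : r * b^`() = r^`() * b by rewrite /r derivB derivM derivC mul0r add0r !mulrBl e; ring.
have [m [q]] := multiplicity_XsubC r z; rewrite r0 /= => nq eq.
case: m eq => [|m] eq; first by case/negP: nq; rewrite eq expr0 mulr1 in rz.
have X0 : ('X - z%:P) ^+ m != 0 by rewrite expf_neq0 // polyXsubC_eq0.
have : 'X - z%:P %| q * b.
  rewrite -(@dvdpZr _ (m.+1%:R)) ?pnatr_eq0 // -mul_polyC.
  have -> : (m.+1%:R)%:P * (q * b) = ('X - z%:P) * (q * b^`() - q^`() * b).
    apply: (mulfI X0); move: er; rewrite eq derivM deriv_exp derivXsubC mul1r /= -mulr_natr -polyC_natr exprS => er.
    have {}er : q * (('X - z%:P) * ('X - z%:P) ^+ m) * b^`() = (q^`() * (('X - z%:P) * ('X - z%:P) ^+ m) + q * (('X - z%:P) ^+ m * (m.+1%:R)%:P)) * b by exact: er.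
    transitivity (q * (('X - z%:P) * ('X - z%:P) ^+ m) * b^`() - q^`() * (('X - z%:P) * ('X - z%:P) ^+ m) * b); last by ring.
    by rewrite er; ring.
  exact: dvdp_mulIl.
by rewrite dvdp_XsubCl rootM (negPf nq) /root (negPf bz).
Qed.

Lemma separable_sepform d f : sepform d f -> separable_poly (map_poly intr f : {poly rat}).
Proof.
move=> [_ [D D0 [u [v e]]]]; rewrite separable_poly.unlock; apply/Bezout_coprimepP.
exists (map_poly intr u, map_poly intr v).
have := congr1 (map_poly (intr : int -> rat)) e; rewrite rmorphD !rmorphM /= map_polyC /= -deriv_map => ->.
by rewrite polyC_eqp1 intr_eq0.
Qed.

(** If the Wronskian vanished, either B = 0 or A = c B, and in the second case f would divide X - c
    times each of the first l derivatives of B. Omitting at most the root c, a separable polynomial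
    of degree at least d - 1 would have its l-th power dividing A or B, whose degree is too
    small. *)
Lemma thue_wronskian d (f A B : {poly int}) n l N : (0 < d)%N -> sepform d f -> 
  (size A <= n.+1)%N -> (size B <= n.+1)%N -> A != 0 \/ B != 0 -> (n < d.-1 * l)%N ->
  (forall i, (i < l)%N -> exists Q, f`_d ^+ N *: (A^`N(i) - 'X * B^`N(i)) = Q * f) ->
  A * B^`() - A^`() * B != 0.
Proof.
move=> d0 sf sA sB AB nl hf; have ld := sepform_lead sf; have [sz _] := sf.
pose m p : {poly rat} := map_poly intr p.
have sm p : size (m p) = size p by apply: size_map_inj_poly => //; apply: intr_inj.
have m0 p : (m p == 0) = (p == 0) by rewrite -!size_poly_eq0 sm.
have sepm : separable_poly (m f) by apply: separable_sepform sf.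
have dv i : (i < l)%N -> m f %| (m A)^`(i) - 'X * (m B)^`(i).
  move=> il; have [Q eQ] := hf i il.
  rewrite !nderivn_def mulrnAr -mulrnBl -scaler_nat dvdpZr ?pnatr_eq0 -?lt0n ?fact_gt0 // /m !nderivn_map.
  have c0 : (f`_d ^+ N)%:~R != 0 :> rat by rewrite intr_eq0 expf_neq0.
  rewrite -(dvdpZr _ _ c0); apply/dvdpP; exists (m Q); rewrite /m -rmorphM -eQ.
  by rewrite /= map_polyZ rmorphB rmorphM /= map_polyX.
have bound (g b : {poly rat}) : b != 0 -> (size b <= n.+1)%N -> (d <= size g)%N -> separable_poly g ->
    ~ (forall i, (i < l)%N -> g %| b^`(i)).
  move=> b0 sb dg sg h; have /(dvdp_leq b0) := dvdp_pow_of_derivn sg h.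
  have g0 : g != 0 by apply: separable_poly_neq0.
  have : (0 < size (g ^+ l))%N by rewrite size_poly_gt0 expf_neq0.
  move=> p1 p2; have := size_exp g l; have : (d.-1 * l <= (size g).-1 * l)%N.
    by rewrite leq_mul // -!subn1 leq_sub2r.
  by move: p1 p2 nl sb; move: (_ * l)%N (_ * l)%N (size (g ^+ l)) (size b); clear; lia.
apply/negP => /eqP W0.
have [B0|Bn] := eqVneq B 0.
  have {AB}A0 : A != 0 by case: AB; rewrite // B0 eqxx.
  apply: (bound (m f) (m A)); rewrite ?m0 ?sm ?sz //; move=> i il.
  by have := dv i il; rewrite B0 /m rmorph0 linear0 mulr0 subr0.
have [||c ec] := @wronskian_eq0 (m A) (m B); first by rewrite m0.
  apply/eqP; rewrite -subr_eq0 /m !deriv_map -!rmorphM -rmorphB; apply/eqP.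
  by rewrite W0 rmorph0.
have dv' i : (i < l)%N -> m f %| ('X - c%:P) * (m B)^`(i).
  move=> il; have := dv i il; rewrite ec mul_polyC derivnZ -mul_polyC -mulrBl.
  by rewrite -opprB mulNr dvdpNr.
have [fc|fc] := boolP (root (m f) c).
  have [g eg] := factor_theorem _ _ fc.
  move: sepm; rewrite eg separable_root => /andP[sg _].
  apply: (bound g (m B)); rewrite ?m0 ?sm //.
    have := sm f; rewrite eg sz size_Mmonic ?monicXsubC ?separable_poly_neq0 // size_XsubC addn2 /= => -[->].
    by [].
  move=> i il; have := dv' i il; rewrite eg mulrC dvdp_mul2l // polyXsubC_eq0 //.
apply: (bound (m f) (m B)); rewrite ?m0 ?sm ?sz //; move=> i il.
by have := dv' i il; rewrite Gauss_dvdpr // coprimep_XsubC.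
Qed.

(** If A - s1 B vanishes to order J + 1 at x0 / y0, then (y0 X - x0)^J divides the Wronskian. It is
    a primitive polynomial, so by Gauss's lemma the quotient is integral and leading coefficients
    can be compared. With [wronskian_lead_bound] this limits J. *)
Lemma thue_order (A B : {poly int}) (x0 y0 : int) (s1 : rat) J :
  let W := A * B^`() - A^`() * B in
  y0 != 0 -> coprimez x0 y0 ->
  (forall j, (j <= J)%N -> ev A^`N(j) (x0%:~R / y0%:~R) = s1 * ev B^`N(j) (x0%:~R / y0%:~R)) ->
  (y0 ^+ J %| lead_coef W)%Z.
Proof.
move=> W y00 cop h; pose m p : {poly rat} := map_poly intr p.
set s0 := _ / _ in h; pose p := m A - s1%:P * m B.
have sX : separable_poly ('X - s0%:P) by rewrite separable_poly.unlock derivXsubC coprimep1.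
have /dvdpP[r er] : ('X - s0%:P) ^+ J.+1 %| p.
  apply: dvdp_pow_of_derivn => // i iJ.
  rewrite nderivn_def -scaler_nat dvdpZr ?pnatr_eq0 -?lt0n ?fact_gt0 // dvdp_XsubCl /root.
  rewrite /p mul_polyC nderivnB nderivnZ hornerD hornerN hornerZ !nderivn_map.
  by have := h i iJ; rewrite /ev => ->; rewrite subrr.
have dW : ('X - s0%:P) ^+ J %| m W.
  have -> : m W = p * (m B)^`() - p^`() * m B.
    rewrite /m /W rmorphB !rmorphM /= /p derivB derivM derivC !deriv_map /m; ring.
  apply: dvdp_sub; first by rewrite er exprS; apply: dvdp_mulr; rewrite mulrA dvdp_mulIr.
  apply: dvdp_mulr; rewrite er derivM deriv_exp derivXsubC mul1r /= dvdp_add //.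
    by rewrite exprS mulrA dvdp_mulIr.
  by rewrite -mulr_natr mulrCA dvdp_mulr.
pose L : {poly int} := y0 *: 'X - x0%:P.
have eL : m L = y0%:~R *: ('X - s0%:P).
  rewrite /m /L rmorphB /= map_polyZ map_polyX map_polyC /= scalerBr -[y0%:~R *: s0%:P]mul_polyC -polyCM.
  by rewrite mulrC divfK // intr_eq0.
have : L ^+ J %| W.
  by rewrite -dvdp_rat_int -/(m _) -/(m W) /m rmorphXn /= -/(m L) eL exprZn dvdpZl // expf_neq0 // intr_eq0.
case/dvdpP_int => q eq.
have cL : `|zcontents L|%N = 1%N.
  have : (zcontents L %| y0)%Z /\ (zcontents L %| x0)%Z.
    have := dvdzz (zcontents L); rewrite dvdz_contents => /polyOverP hc.
    have := hc 0%N; have := hc 1%N; rewrite /L !coefB !coefZ !coefX !coefC /= mulr1 mulr0 subr0 sub0r.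
    by move=> -> ; rewrite rpredN => ->.
  case=> d1 d2; have : (zcontents L %| gcdz x0 y0)%Z by rewrite dvdz_gcd d1 d2.
  by rewrite (eqP cop) dvdz1 => /eqP.
have cX : `|zcontents (L ^+ J)|%N = 1%N.
  elim: (J) => [|j IH]; first by rewrite expr0 zcontents_monic ?monic1.
  by rewrite exprS zcontentsM abszM cL IH.
have lL : lead_coef L = y0.
  rewrite /L lead_coefDl ?lead_coefZ ?lead_coefX ?mulr1 // size_polyN size_scale // size_polyX.
  by rewrite (leq_ltn_trans (size_polyC_leq1 _)).
have e1 : zcontents (L ^+ J) * lead_coef (zprimitive (L ^+ J)) = y0 ^+ J.
  by rewrite -lead_coefZ -zpolyEprim lead_coef_exp lL.
rewrite eq lead_coefM; apply: dvdz_mulr; rewrite dvdzE -e1 abszM cX mul1n.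
exact: dvdnn.
Qed.

Lemma nderivnK (p : {poly rat}) j i : (p^`N(j))^`N(i) = p^`N(j + i) *+ 'C(j + i, j).
Proof.
have f0 : ((j`! * i`!)%N)%:R != 0 :> rat by rewrite pnatr_eq0 -lt0n muln_gt0 !fact_gt0.
apply: (scalerI f0); rewrite !scaler_nat -mulrnA -{2}[(j + i)%N]addnC mulnC.
have -> : ('C(i + j, j) * (i`! * j`!) = (i + j)`!)%N.
  by rewrite [(i`! * _)%N]mulnC -[RHS](bin_fact (leq_addl i j)) addnK.
rewrite [(j + i)%N]addnC -nderivn_def mulrnA -nderivn_def.
rewrite -[RHS]/(iter (i + j) (@deriv _) p) iterD -[iter j _ p]/(p^`(j)) [p^`(j)]nderivn_def.
by rewrite -[iter i _ _]/((p^`N(j) *+ j`!)^`(i)) derivnMn.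
Qed.

Lemma coef_nderivn_bound (A : {poly int}) n X m i : (size A <= n.+1)%N ->
  (forall i, (`|(A`_i)%R| <= X)%N) -> (`|((A^`N(m))`_i)%R| <= X * 2 ^ n)%N.
Proof.
move=> sA hA; rewrite coef_nderivn -mulr_natr natz abszM absz_nat.
have [mi|mi] := leqP (m + i) n; last first.
  by rewrite nth_default ?mul0n // (leq_trans sA).
by rewrite leq_mul // (leq_trans (bin_leq2X _ _)) // leq_pexp2l.
Qed.

Lemma bf_norm_bound (p : {poly int}) N X : (size p <= N)%N -> (forall i, (`|(p`_i)%R| <= X)%N) ->
  (bf_norm p <= N * X)%N.
Proof.
move=> sp h; rewrite /bf_norm; apply: leq_trans (leq_sum _ (fun (i : 'I_(size p)) _ => h i)) _.
by rewrite sum_nat_const card_ord leq_mul.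
Qed.

Lemma size_nderivn (R : nzRingType) (p : {poly R}) j n : (size p <= n)%N -> (size p^`N(j) <= n - j)%N.
Proof.
move=> sp; apply/leq_sizeP => i hi; rewrite coef_nderivn nth_default ?mul0rn //.
by apply: leq_trans sp _; rewrite -leq_subLR.
Qed.

(* The Taylor expansion is taken at the better approximation s1, which plays the role of the root. *)
Lemma thue_value_bound (A B : {poly int}) (n l X S : nat) (Phi s0 s1 : rat) j :
  (size A <= n.+1)%N -> (size B <= n.+1)%N ->
  (forall i, (`|(A`_i)%R| <= X)%N /\ (`|(B`_i)%R| <= X)%N) ->
  (0 < S)%N -> `|s1| <= S%:R -> `|s0 - s1| <= 1 -> (j <= l)%N ->
  (forall i, (i < l)%N -> `|ev A^`N(i) s1 - s1 * ev B^`N(i) s1| <= Phi) -> 0 <= Phi ->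
  `|ev A^`N(j) s0 - s1 * ev B^`N(j) s0| <=
    (n.+1 * 2 ^ n)%:R * (Phi + (2 * S * (n.+1 * (X * 2 ^ n) * S ^ n))%:R * `|s0 - s1| ^+ (l - j)).
Proof.
move=> sA sB hAB S0 s1S h1 jl hT Phi0.
pose a : {poly rat} := map_poly intr A - s1 *: map_poly intr B.
have aE i z : (a^`N(i)).[z] = ev A^`N(i) z - s1 * ev B^`N(i) z.
  by rewrite /a nderivnB nderivnZ hornerD hornerN hornerZ !nderivn_map.
set h := s0 - s1 in h1 *; set T := (2 * S * _)%N.
have T1 m : `|(a^`N(m)).[s1]| <= T%:R.
  have sz (P : {poly int}) : (size P <= n.+1)%N -> (forall i, (`|(P`_i)%R| <= X)%N) ->
      `|ev P^`N(m) s1| <= (n.+1 * (X * 2 ^ n) * S ^ n)%:R.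
    move=> sP hP; have sm : (size P^`N(m) <= n.+1)%N.
      by apply: leq_trans (size_nderivn m sP) _; apply: leq_subr.
    apply: le_trans (ev_bound S0 s1S sm) _; rewrite ler_nat leq_mul //.
    by apply: bf_norm_bound => // i; apply: coef_nderivn_bound.
  rewrite aE; apply: le_trans (ler_normB _ _) _.
  have h2 := sz A sA (fun i => proj1 (hAB i)); have h3 := sz B sB (fun i => proj2 (hAB i)).
  rewrite normrM /T natrM [(2 * S)%N]mul2n -addnn natrD mulrDl; apply: lerD.
    by apply: le_trans h2 _; rewrite ler_peMl ?ler0n // ler1n.
  exact: ler_pM.
rewrite -aE -[s0](subrK s1) -/h addrC.
have sa : (size a^`N(j) <= n.+1 - j)%N.
  apply: size_nderivn; apply: leq_trans (size_polyD _ _) _; rewrite geq_max size_polyN.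
  by rewrite !(leq_trans (size_poly _ _)) // (leq_trans (size_scale_leq _ _)) // (leq_trans (size_poly _ _)).
rewrite (nderiv_taylor_wide _ sa); last exact: mulrC.
apply: le_trans (ler_norm_sum _ _ _) _.
set V := Phi + _; have V0 : 0 <= V by rewrite addr_ge0 // mulr_ge0 ?ler0n // exprn_ge0.
apply: (@le_trans _ _ (\sum_(i < n.+1 - j) (2 ^ n)%:R * V)); last first.
  rewrite sumr_const card_ord -[X in X <= _]mulr_natl mulrA -natrM ler_wpM2r // ler_nat leq_mul //.
  exact: leq_subr.
apply: ler_sum => i _; rewrite nderivnK hornerMn -mulr_natl -mulrA normrM ger0_norm ?ler0n //.
have ji : (j + i <= n)%N by have := ltn_ord i; rewrite ltn_subRL ltnS.
apply: ler_pM => //; first by rewrite ler_nat (leq_trans (bin_leq2X _ _)) // leq_pexp2l.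
have hi1 : `|h ^+ i| <= 1 by rewrite normrX exprn_ile1.
rewrite normrM /V; have [ij|ij] := ltnP (j + i) l.
  apply: le_trans (_ : Phi <= _); last by rewrite lerDl mulr_ge0 ?ler0n // exprn_ge0.
  by rewrite -[X in _ <= X]mulr1; apply: ler_pM => //; rewrite aE; apply: hT.
apply: le_trans (_ : T%:R * `|h| ^+ (l - j) <= _); last by rewrite lerDr.
apply: ler_pM => //; rewrite normrX; apply: ler_wiXn2l => //.
by rewrite leq_subLR.
Qed.

Lemma coefM_bound (p q : {poly int}) a b i :
  (forall i, (`|(p`_i)%R| <= a)%N) -> (forall i, (`|(q`_i)%R| <= b)%N) ->
  (`|((p * q)`_i)%R| <= i.+1 * (a * b))%N.
Proof.
move=> hp hq; rewrite coefM; apply: leq_trans (absz_sum _ _ _) _.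
apply: leq_trans (_ : \sum_(j < i.+1) a * b <= _)%N; last by rewrite sum_nat_const card_ord.
by apply: leq_sum => j _; rewrite abszM leq_mul.
Qed.

Lemma wronskian_lead_bound (A B : {poly int}) n X : (size A <= n.+1)%N -> (size B <= n.+1)%N ->
  (forall i, (`|(A`_i)%R| <= X)%N /\ (`|(B`_i)%R| <= X)%N) ->
  (`|lead_coef (A * B^`() - A^`() * B)| <= 4 ^ n.+1 * X ^ 2)%N.
Proof.
move=> sA sB h; pose W := A * B^`() - A^`() * B.
have dX (P : {poly int}) : (size P <= n.+1)%N -> (forall i, (`|(P`_i)%R| <= X)%N) ->
    (size P^`() <= n)%N /\ forall i, (`|((P^`())`_i)%R| <= X * n)%N.
  move=> sP hP; split; first by apply: leq_trans (size_poly _ _) _; rewrite -subn1 leq_subLR.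
  move=> i; rewrite coef_deriv -mulr_natr natz abszM absz_nat.
  have [lt|ge] := ltnP i n; first by rewrite leq_mul.
  by rewrite nth_default ?mul0n // (leq_trans sP).
have [s1 h1] := dX A sA (fun i => proj1 (h i)); have [s2 h2] := dX B sB (fun i => proj2 (h i)).
have sW : (size W <= 2 * n + 1)%N.
  apply: leq_trans (size_polyD _ _) _; rewrite geq_max size_polyN.
  have e : (2 * n + 1 = n.+1 + n)%N by clear; lia.
  apply/andP; split; apply: leq_trans (size_polyMleq _ _) _; apply: leq_trans (leq_pred _) _.
    by rewrite e leq_add.
  by rewrite e addnC leq_add.
have [W0|Wn] := eqVneq W 0; first by rewrite -/W W0 lead_coef0.
rewrite -/W lead_coefE; set i := (size W).-1.
have iW : (i.+1 <= 2 * n + 1)%N by rewrite /i prednK // size_poly_gt0.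
have := coefM_bound i (fun i => proj1 (h i)) h2; have := coefM_bound i h1 (fun i => proj2 (h i)).
rewrite /W coefB => b1 b2.
apply: leq_trans (_ : 2 * (i.+1 * (X * n * X)) <= _)%N.
  move: b1 b2; have -> : (i.+1 * (X * (X * n)) = i.+1 * (X * n * X))%N by ring.
  by move: (_`_i) (_`_i) (_ * _)%N; clear; lia.
have n2 : (n < 2 ^ n)%N by rewrite ltn_expl.
apply: leq_trans (_ : 2 * (2 * n + 1) * n * X ^ 2 <= _)%N.
  apply: leq_trans (_ : 2 * i.+1 * n * X ^ 2 <= _)%N; first by apply: eq_leq; ring.
  by rewrite leq_mul // leq_mul // leq_mul.
rewrite leq_mul // (_ : 4 = 2 * 2)%N // expnMn !expnS; move: (2 ^ n)%N n2; clear; nia.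
Qed.

(** The case where the value at the better approximation is the main error. The exponents of q0
    compare as 4 (8 d - 9) >= 8 (3 d - 2) + 1, true from d = 3 on. *)
Lemma thue_exponents1 d k q0 q1 M : (3 <= d)%N -> (0 < k)%N -> (0 < q0)%N -> (q0 ^ (4 * k) <= q1)%N ->
  (q1 ^ (8 * d - 1) <= M ^ k * q0 ^ (8 * ((3 * d - 2) * k)) * q1 ^ 8)%N -> (q0 <= M)%N.
Proof.
move=> d3 k0 q00 h1 h2.
have q10 : (0 < q1)%N by apply: leq_trans h1; rewrite expn_gt0 q00.
have e1 : (8 * d - 1 = (8 * d - 9) + 8)%N by lia.
move: h2; rewrite e1 expnD leq_pmul2r ?expn_gt0 ?q10 // => h2.
have : (q0 ^ (8 * ((3 * d - 2) * k)) * q0 ^ k <= q0 ^ (8 * ((3 * d - 2) * k)) * M ^ k)%N.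
  rewrite [(_ * M ^ k)%N]mulnC; apply: leq_trans h2; rewrite -expnD.
  apply: leq_trans (_ : q0 ^ (4 * k * (8 * d - 9)) <= _)%N; last by rewrite expnM leqXn.
  rewrite leq_pexp2l //.
  have e : (4 * k * (8 * d - 9) = 4 * (8 * (d * k)) - 36 * k)%N by rewrite mulnBr; congr (_ - _)%N; ring.
  have e' : (8 * ((3 * d - 2) * k) = 3 * (8 * (d * k)) - 16 * k)%N.
    by rewrite !mulnBl mulnBr; congr (_ - _)%N; ring.
  have dk : (3 * k <= d * k)%N by rewrite leq_mul.
  by rewrite e e'; move: dk; move: (d * k)%N; clear; lia.
by rewrite leq_pmul2l ?expn_gt0 ?q00 // leq_exp2r.
Qed.

(** The case where the Taylor term is the main error. At d = 3 the margin in the exponent of q0 is 2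
    k, which has to pay for the 32 coming from the bound on q1^8; hence k >= 16. *)
Lemma thue_exponents2 d k j q0 q1 M : (3 <= d)%N -> (16 <= k)%N -> (0 < q0)%N ->
  (8 * d * j <= k)%N -> (q1 <= q0 ^ (4 * k + 4))%N ->
  ((q0 ^ (8 * d - 1)) ^ (4 * k - j) <= M ^ k * q0 ^ (8 * ((3 * d - 2) * k)) * q1 ^ 8)%N -> (q0 <= M)%N.
Proof.
move=> d3 k16 q00 jk h1 h2; pose n := ((3 * d - 2) * k)%N.
have : (q0 ^ (8 * n + (4 * k + 4) * 8) * q0 ^ k <= q0 ^ (8 * n + (4 * k + 4) * 8) * M ^ k)%N.
  apply: leq_trans (_ : M ^ k * q0 ^ (8 * n) * (q0 ^ (4 * k + 4)) ^ 8 <= _)%N; last first.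
    by rewrite -(expnM q0 (4 * k + 4)) -mulnA -expnD mulnC.
  apply: leq_trans (leq_trans h2 _); last by rewrite leq_mul // leqXn.
  rewrite -expnD -expnM leq_pexp2l // /n.
  have e : (8 * d * k = (8 * d - 24) * k + 24 * k)%N by rewrite -mulnDl subnK //; lia.
  have -> : ((8 * d - 1) * (4 * k - j) = (8 * d * (4 * k) + j) - (8 * d * j + 4 * k))%N.
    have j4 : (j <= 4 * k)%N.
      apply: leq_trans (_ : 8 * d * j <= _)%N; first by rewrite leq_pmull // muln_gt0; lia.
      by apply: leq_trans jk _; rewrite leq_pmull.
    have : (8 * d * j <= 8 * d * (4 * k))%N by rewrite leq_mul.
    rewrite mulnBl mul1n mulnBr; move: j4; move: (8 * d * (4 * k))%N (8 * d * j)%N (4 * k)%N; clear; lia.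
  have -> : (8 * d * (4 * k) = 4 * (8 * d * k))%N by ring.
  have -> : (8 * ((3 * d - 2) * k) = 3 * (8 * d * k) - 16 * k)%N by rewrite !mulnBl mulnBr; congr (_ - _)%N; ring.
  by move: jk e k16; move: (8 * d * j)%N (8 * d * k)%N ((8 * d - 24) * k)%N; clear; lia.
by rewrite leq_pmul2l ?expn_gt0 ?q00 // leq_exp2r //; apply: leq_trans k16.
Qed.

Lemma thue_degree d k : (3 <= d)%N -> (0 < k)%N ->
  ((3 * d - 2) * k < 3 * d * k)%N /\ ((3 * d - 2) * k < d.-1 * (4 * k))%N.
Proof.
move=> d3 k0; rewrite mulnA !ltn_pmul2r //; split; first by lia.
by rewrite -subn1 mulnBl; lia.
Qed.
Lemma eighth_power (a : rat) (A W c : nat) : 0 <= a -> 1 <= A%:R * a -> a ^+ 8 * W%:R <= c%:R ->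
  (W <= A ^ 8 * c)%N.
Proof.
move=> a0 h1 h2; rewrite -(ler_nat rat) natrM natrX.
apply: le_trans (_ : (A%:R * a) ^+ 8 * W%:R <= _).
  by rewrite -[X in X <= _]mul1r ler_wpM2r ?ler0n // exprn_ege1.
by rewrite exprMn -mulrA ler_wpM2l // exprn_ge0 // ler0n.
Qed.

Section Thue.
Variables (d : nat) (f : {poly int}).
Hypotheses (d3 : (3 <= d)%N) (sf : sepform d f).

(** The hypothesis is |F(x, y)| <= (c |y|)^(1/8); division by |y|^d gives the bound for f(x / y).
    Eighth powers avoid roots. *)
Lemma small_value c (x y : int) : y != 0 -> (`|bf d f x y| ^ 8 <= c * `|y|)%N ->
  `|ev f (x%:~R / y%:~R)| ^+ 8 * (`|y| ^ (8 * d - 1))%:R <= c%:R.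
Proof.
move=> y0 h; have [sz _] := sf; have q0 : (0 < `|y|)%N by rewrite absz_gt0.
rewrite -(@ler_pM2r _ (`|y|%:R)) ?ltr0n // -mulrA -natrM -expnSr -natrM.
have -> : (8 * d - 1).+1 = (d * 8)%N by lia.
apply: le_trans (_ : (`|bf d f x y| ^ 8)%:R <= _); last by rewrite ler_nat.
rewrite expnM !natrX -!intr_absz bf_ev ?sz // normrM exprMn mulrC normrX //.
Qed.

(** Choose k with q0^(4 k) close to q1. For some j <= k / (8 d), the j-th divided derivative of A -
    s1 B is nonzero at s0, and it has denominator at most q0^n q1. Taylor expansion bounds it by
    |f(s1)| and |s0 - s1|^(4 k - j), both too small for this when q0 is large. *)
Lemma thue_pair (S c : nat) : (0 < S)%N -> (0 < c)%N -> exists Q E Z : nat, (0 < Z)%N /\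
  forall x0 y0 x1 y1 : int, coprimez x0 y0 -> (Q < `|y0|)%N -> (`|y0| ^ E <= `|y1|)%N ->
    `|x0%:~R / y0%:~R : rat| <= S%:R -> `|x1%:~R / y1%:~R : rat| <= S%:R ->
    Z%:R * `|x0%:~R / y0%:~R - x1%:~R / y1%:~R : rat| <= 1 ->
    (`|bf d f x0 y0| ^ 8 <= c * `|y0|)%N -> (`|bf d f x1 y1| ^ 8 <= c * `|y1|)%N -> False.
Proof.
move=> S0 c0; have [sz _] := sf; have ld := sepform_lead sf.
have d0 : (0 < d)%N by apply: ltnW (ltnW d3).
have d81 : (0 < 8 * d - 1)%N by lia.
have [K [Z [K0 Z0 hK]]] := local_inverse sf S0.
have [C C0 hC] := thue_polynomials d3 sz ld S0.
pose D := (4 ^ (3 * d) * S ^ (3 * d) * C)%N.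
have D0 : (0 < D)%N by rewrite !muln_gt0 !expn_gt0 S0 C0.
pose c' := ((2 * K) ^ 8 * c)%N.
have c'0 : (0 < c')%N by rewrite muln_gt0 expn_gt0 muln_gt0 K0 c0.
pose M := (2 ^ 8 * D ^ 16 * c' ^ 4)%N.
pose C1 := (4 ^ (3 * d) * C ^ 2)%N.
exists (M + C1 ^ (16 * d) + K ^ 8 * c)%N, (4 * (8 * d + 16))%N, Z; split=> //.
move=> x0 y0 x1 y1 cop hQ hE s0S s1S hZ h0 h1.
set q0 := `|y0|%N in hQ hE h0 *; set q1 := `|y1|%N in hE h1 *.
have [MQ CQ KQ] : [/\ M < q0, C1 ^ (16 * d) < q0 & K ^ 8 * c < q0]%N.
  split; apply: leq_ltn_trans hQ; first by rewrite -addnA leq_addr.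
    by rewrite addnAC leq_addl.
  by rewrite leq_addl.
have q01 : (1 < q0)%N.
  by apply: leq_ltn_trans MQ; rewrite /M muln_gt0 muln_gt0 !expn_gt0 D0 c'0.
have q00 : (0 < q0)%N by apply: ltnW.
have y00 : y0 != 0 by rewrite -absz_gt0.
have q10 : (0 < q1)%N by apply: leq_trans hE; rewrite expn_gt0 q00.
have y10 : y1 != 0 by rewrite -absz_gt0.
(* So q1 lies between q0^(4 k) and q0^(4 k + 4). At most [mu] + 1 derivatives are tried: k <= 16 d
   mu makes q0^mu exceed the bound C1^k on the Wronskian, while 8 d mu <= k keeps the order of
   vanishing close to 4 k. *)
pose E := trunc_log q0 q1; pose k := (E %/ 4)%N; pose mu := (k %/ (8 * d))%N.
have E1 : (q0 ^ E <= q1)%N by apply: trunc_logP.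
have E2 : (q1 < q0 ^ E.+1)%N by apply: trunc_log_ltn.
have kE : (8 * d + 16 <= k)%N.
  rewrite /k leq_divRL // mulnC; rewrite -ltnS -(ltn_exp2l _ _ q01); exact: leq_ltn_trans hE E2.
have k0 : (0 < k)%N by apply: leq_trans kE; rewrite addnS.
have k16 : (16 <= k)%N by apply: leq_trans kE; apply: leq_addl.
have q1l : (q0 ^ (4 * k) <= q1)%N.
  by apply: leq_trans E1; rewrite leq_pexp2l // mulnC leq_trunc_div.
have q1u : (q1 <= q0 ^ (4 * k + 4))%N.
  apply: leq_trans (ltnW E2) _; rewrite leq_pexp2l //.
  by have := ltn_pmod E (isT : (0 < 4)%N); have := divn_eq E 4; rewrite -/k; clear; lia.
have muk : (8 * d * mu <= k)%N by rewrite mulnC leq_trunc_div.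
have mu1 : (k <= 16 * d * mu)%N.
  have d80 : (0 < 8 * d)%N by rewrite muln_gt0.
  have m1 : (1 <= mu)%N by rewrite /mu divn_gt0 //; apply: leq_trans kE; apply: leq_addr.
  have := ltn_ceil k d80; rewrite -/mu mulSn => lt; apply: leq_trans (ltnW lt) _.
  apply: leq_trans (_ : mu * (8 * d) + mu * (8 * d) <= _)%N; first by rewrite leq_add2r leq_pmull.
  by apply: eq_leq; ring.
have [A [B [[sA sB] hAB AB hf]]] := hC k k0.
set n := ((3 * d - 2) * k)%N in sA sB hf.
have [nk nl] := thue_degree d3 k0; rewrite -/n in nk nl.
have wn : A * B^`() - A^`() * B != 0.
  by apply: (thue_wronskian (N := n.+1) d0 sf sA sB AB nl) => i /hf[].
set s0 := _ / _ in s0S hZ; set s1 := _ / _ in s1S hZ.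
pose P j := ev A^`N(j) s0 - s1 * ev B^`N(j) s0.
have [j jmu Pj] : exists2 j, (j <= mu)%N & P j != 0.
  apply: contrapT => nex; have : (y0 ^+ mu %| lead_coef (A * B^`() - A^`() * B))%Z.
    apply: (thue_order (x0 := x0) (s1 := s1)) => // j jm; apply/eqP; rewrite -subr_eq0.
    by apply: contraT => Pj; case: nex; exists j.
  rewrite dvdzE abszX => /dvdn_leq; rewrite absz_gt0 lead_coef_eq0 => /(_ wn).
  apply/negP; rewrite -ltnNge.
  apply: leq_ltn_trans (wronskian_lead_bound sA sB hAB) _.
  apply: (@leq_ltn_trans (C1 ^ k)).
    rewrite /C1 expnMn -!expnM [(2 * k)%N]mulnC leq_mul // leq_pexp2l //.
  apply: (@leq_ltn_trans ((C1 ^ (16 * d)) ^ mu)).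
    by rewrite -expnM leq_pexp2l // muln_gt0 !expn_gt0 C0.
  by rewrite ltn_exp2r // lt0n; apply: contraTneq mu1 => ->; rewrite muln0 -ltnNge.
set h := s0 - s1 in hZ.
have W0 := small_value y00 h0; have W1 := small_value y10 h1.
rewrite -/s0 -/q0 in W0; rewrite -/s1 -/q1 in W1.
have f0K : K%:R * `|ev f s0| <= 1.
  rewrite -(@ler_pXn2r _ 8) ?nnegrE ?mulr_ge0 ?ler0n // expr1n exprMn.
  rewrite -(@ler_pM2r _ (q0 ^ (8 * d - 1))%:R) ?ltr0n ?expn_gt0 ?q00 // mul1r -mulrA.
  apply: le_trans (ler_wpM2l _ W0) _; first by rewrite exprn_ge0 // ler0n.
  rewrite -natrX -natrM ler_nat; apply: leq_trans (ltnW KQ) _.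
  by rewrite -[X in (X <= _)%N]expn1 leq_pexp2l.
have hh := hK s0 s1 s0S hZ f0K.
have W1' : `|ev f s1| ^+ 8 * (q0 ^ (8 * d - 1))%:R <= c%:R.
  apply: le_trans W1; rewrite ler_wpM2l ?exprn_ge0 // ler_nat leqXn //.
  by apply: leq_trans q1l; rewrite -[X in (X <= _)%N]expn1 leq_pexp2l // muln_gt0.
have hW : `|h| ^+ 8 * (q0 ^ (8 * d - 1))%:R <= c'%:R.
  have [m [m0 mW hm]] : exists m : rat, [/\ 0 <= m, m ^+ 8 * (q0 ^ (8 * d - 1))%:R <= c%:R &
      `|h| <= (2 * K)%:R * m].
    have tri : `|h| <= K%:R * (`|ev f s0| + `|ev f s1|).
      by apply: le_trans hh _; rewrite ler_wpM2l ?ler0n // ler_normB.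
    have [le|le] := leP `|ev f s0| `|ev f s1|.
      exists `|ev f s1|; split; [exact: normr_ge0 | exact: W1' |]; apply: le_trans tri _; rewrite natrM -mulrA mulrCA ler_wpM2l ?ler0n //.
      by rewrite mulr_natl mulr2n lerD2r.
    exists `|ev f s0|; split; [exact: normr_ge0 | exact: W0 |]; apply: le_trans tri _; rewrite natrM -mulrA mulrCA ler_wpM2l ?ler0n //.
    by rewrite mulr_natl mulr2n lerD2l ltW.
  apply: le_trans (_ : ((2 * K)%:R * m) ^+ 8 * (q0 ^ (8 * d - 1))%:R <= _).
    by rewrite ler_wpM2r ?ler0n // lerXn2r // nnegrE ?mulr_ge0 ?ler0n.
  by rewrite exprMn -mulrA /c' [(_ * c)%:R]natrM (natrX _ (2 * K)) ler_wpM2l // exprn_ge0 // ler0n.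
have h1' : `|h| <= 1.
  apply: le_trans hZ; rewrite -[X in X <= _]mul1r ler_wpM2r // ler1n //.
have jl : (j <= 4 * k)%N.
  apply: leq_trans jmu _; apply: leq_trans (leq_div _ _) _; exact: leq_pmull.
have j8 : (8 * d * j <= k)%N by apply: leq_trans muk; rewrite leq_mul.
have up : `|P j| <= (D ^ (2 * k))%:R * (`|ev f s1| + `|h| ^+ (4 * k - j)).
  have Phi0 : 0 <= (C ^ k)%:R * `|ev f s1| by rewrite mulr_ge0 ?ler0n.
  have := thue_value_bound sA sB hAB S0 s1S h1' jl (fun i il => proj2 (hf i il) s1 s1S) Phi0.
  move/le_trans; apply.
  have CD : (C ^ k <= D ^ k)%N by rewrite leqXn // /D leq_pmull // muln_gt0 !expn_gt0 S0.
  have n2 : (n.+1 <= 2 ^ n)%N by rewrite ltn_expl.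
  have n4 : (n.+1 * 2 ^ n <= (4 ^ (3 * d)) ^ k)%N.
    apply: leq_trans (_ : 4 ^ n <= _)%N; first by rewrite (expnMn 2 2 n) leq_mul.
    by rewrite -expnM leq_pexp2l // ltnW.
  have UD : (n.+1 * 2 ^ n <= D ^ k)%N.
    by apply: leq_trans n4 _; rewrite leqXn // /D -mulnA leq_pmulr // muln_gt0 expn_gt0 S0.
  have TD : (2 * S * (n.+1 * (C ^ k * 2 ^ n) * S ^ n) <= D ^ k)%N.
    have -> : (2 * S * (n.+1 * (C ^ k * 2 ^ n) * S ^ n) = (2 * n.+1 * 2 ^ n) * (S * S ^ n) * C ^ k)%N by ring.
    rewrite /D !expnMn leq_mul // leq_mul //; last by rewrite -expnS -expnM leq_pexp2l.
    apply: leq_trans (_ : 4 ^ n.+1 <= _)%N; last by rewrite -expnM leq_pexp2l.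
    rewrite (expnMn 2 2 n.+1) !expnS; apply: leq_trans (_ : 2 * 2 ^ n * 2 ^ n <= _)%N; first by rewrite leq_mul // leq_mul.
    by rewrite leq_mul // leq_pmull.
  rewrite [(2 * k)%N]mul2n -addnn expnD [(D ^ k * _)%:R]natrM -mulrA; apply: ler_pM.
  - exact: ler0n.
  - by rewrite addr_ge0 // mulr_ge0 ?ler0n ?exprn_ge0.
  - by rewrite ler_nat.
  by rewrite mulrDr lerD // ler_wpM2r ?exprn_ge0 // ler_nat.
have low : 1 <= (q0 ^ n * q1)%:R * `|P j|.
  pose Nj := bf n A^`N(j) x0 y0 * y1 - bf n B^`N(j) x0 y0 * x1.
  have sN (p : {poly int}) : (size p <= n.+1)%N -> (size p^`N(j) <= n.+1)%N.
    by move=> sp; apply: leq_trans (size_nderivn j sp) _; apply: leq_subr.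
  have e : Nj%:~R = y0%:~R ^+ n * y1%:~R * P j.
    rewrite /Nj rmorphB !rmorphM /= !bf_ev ?sN // -/s0 /P.
    have -> : x1%:~R = s1 * y1%:~R by rewrite /s1 divfK // intr_eq0.
    by ring.
  have Nn : Nj != 0 by rewrite -(intr_eq0 rat) e !mulf_neq0 ?expf_neq0 ?intr_eq0.
  rewrite natrM natrX -!intr_absz -normrX -!normrM -e intr_absz ler1n absz_gt0 //.
pose V := (2 * (q0 ^ n * q1 * D ^ (2 * k)))%N.
have V' : (V = q0 ^ n * q1 * D ^ (2 * k) * 2)%N by rewrite /V mulnC.
have V8 : (V ^ 8 * c' ^ (4 * k) <= M ^ k * q0 ^ (8 * n) * q1 ^ 8)%N.
  have e : (V ^ 8 = 2 ^ 8 * (q0 ^ (8 * n) * q1 ^ 8 * D ^ (16 * k)))%N.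
    by rewrite /V (expnMn 2) !expnMn -!expnM (mulnC n 8) (_ : 2 * k * 8 = 16 * k)%N //; ring.
  have -> : (M ^ k = (2 ^ 8) ^ k * D ^ (16 * k) * c' ^ (4 * k))%N by rewrite /M (expnMn (2 ^ 8 * D ^ 16)) (expnMn (2 ^ 8)) -(expnM D) -(expnM c').
  have t8 : (2 ^ 8 <= (2 ^ 8) ^ k)%N by rewrite -[X in (X <= _)%N]expn1 leq_pexp2l.
  rewrite e; move: t8; move: ((2 ^ 8) ^ k)%N => t t8.
  apply: leq_trans (_ : t * (q0 ^ (8 * n) * q1 ^ 8 * D ^ (16 * k)) * c' ^ (4 * k) <= _)%N.
    by rewrite leq_mul // leq_mul.
  by apply: eq_leq; move: (q0 ^ _)%N (q1 ^ _)%N (D ^ _)%N (c' ^ _)%N => a b e' g; ring.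
(* The larger of the two error terms decides which exponent comparison is used. *)
have [alt|alt] := leP `|ev f s1| (`|h| ^+ (4 * k - j)).
  have a1 : 1 <= V%:R * `|h| ^+ (4 * k - j).
    apply: le_trans low _; apply: le_trans (ler_wpM2l _ up) _; first by rewrite ler0n.
    rewrite mulrA -natrM V' [(_ * 2)%:R]natrM -[X in _ <= X]mulrA ler_wpM2l ?ler0n //.
    by rewrite mulr_natl mulr2n lerD2r.
  have a2 : (`|h| ^+ (4 * k - j)) ^+ 8 * ((q0 ^ (8 * d - 1)) ^ (4 * k - j))%:R <= (c' ^ (4 * k))%:R.
    rewrite exprAC [((q0 ^ _) ^ _)%:R]natrX -exprMn.
    apply: le_trans (_ : c'%:R ^+ (4 * k - j) <= _).
      by rewrite lerXn2r // nnegrE ?ler0n ?mulr_ge0 ?ler0n ?exprn_ge0.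
    by rewrite -natrX ler_nat leq_pexp2l // leq_subr.
  have a3 := eighth_power (exprn_ge0 _ (normr_ge0 _)) a1 a2.
  have := thue_exponents2 d3 k16 q00 j8 q1u (leq_trans a3 V8).
  by rewrite leqNgt MQ.
have a1 : 1 <= V%:R * `|ev f s1|.
  apply: le_trans low _; apply: le_trans (ler_wpM2l _ up) _; first by rewrite ler0n.
  rewrite mulrA -natrM V' [(_ * 2)%:R]natrM -[X in _ <= X]mulrA ler_wpM2l ?ler0n //.
  by rewrite mulr_natl mulr2n lerD2l ltW.
have a3 := eighth_power (normr_ge0 _) a1 W1.
have a4 : (V ^ 8 * c <= V ^ 8 * c' ^ (4 * k))%N.
  rewrite leq_mul //; apply: leq_trans (_ : c' ^ 1 <= _)%N.
    by rewrite expn1 /c' leq_pmull // expn_gt0 muln_gt0 K0.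
  by rewrite leq_pexp2l // muln_gt0.
have := thue_exponents1 d3 k0 q00 q1l (leq_trans a3 (leq_trans a4 V8)).
by rewrite leqNgt MQ.
Qed.
End Thue.

(** * The gap principle *)

Lemma floor_close (x y : rat) : Num.floor x = Num.floor y -> `|x - y| < 1.
Proof.
move=> e; have := floor_le x; have := floorD1_gt x; have := floor_le y; have := floorD1_gt y.
by rewrite e rmorphD /= ltr_norml; lra.
Qed.

Lemma floor_bound (x : rat) n : `|x| <= n%:R -> (`|Num.floor x| <= n.+1)%N.
Proof.
rewrite ler_norml => /andP[l u].
have h1 : (- n.+1%:Z <= Num.floor x)%R.
  by rewrite floor_ge_int // rmorphN /= -pmulrn -natr1; lra.
have h2 : (Num.floor x <= n.+1%:Z)%R.
  rewrite -(ler_int rat); apply: le_trans (floor_le x) _.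
  by rewrite -pmulrn -natr1; lra.
by move: h1 h2; move: (Num.floor x); clear; lia.
Qed.

Lemma atmost1 (T : eqType) (P : T -> Prop) : (forall x y, P x -> P y -> x = y) -> atmost 1 P.
Proof.
move=> h [|x [|y s]] //= us hs; have e : x = y by apply: h; apply: hs; rewrite !inE eqxx ?orbT.
by move: us; rewrite e inE eqxx.
Qed.

Lemma spread_count (T : eqType) (P : T -> Prop) (sl : T -> rat) (W n : nat) :
  (forall x y, P x -> P y -> `|sl x - sl y| * W%:R <= n%:R) ->
  (forall x y, P x -> P y -> x != y -> 1 <= `|sl x - sl y| * W%:R) ->
  atmost (2 * n + 3) P.
Proof.
move=> hn hs; have [[x0 P0]|no] := pselect (exists x0, P x0); last first.
  by apply: atmost0 => x Px; apply: no; exists x.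
pose key x := Num.floor ((sl x - sl x0) * W%:R).
have -> : (2 * n + 3 = (2 * n.+1).+1 * 1)%N by lia.
apply: (atmost_fibers (f := key) (@atmost_int n.+1)) => [x Px|k _].
  by apply: floor_bound; rewrite normrM (ger0_norm (ler0n _ _)); apply: hn.
apply: atmost1 => x y [Px kx] [Py ky]; apply/eqP; apply: contraT => xy.
have := floor_close (etrans kx (esym ky)); have -> : (sl x - sl x0) * W%:R - (sl y - sl x0) * W%:R = (sl x - sl y) * W%:R by ring.
by rewrite normrM (ger0_norm (ler0n _ _)) ltNge hs.
Qed.

Lemma bounded_by_keys (T : Type) (P : int -> T -> Prop) (v : T -> nat) (s : seq int) :
  (forall i, exists H, forall x, P i x -> (v x <= H)%N) ->
  exists H, forall i x, i \in s -> P i x -> (v x <= H)%N.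
Proof.
move=> h; elim: s => [|i s [H hH]]; first by exists 0%N.
have [H' hH'] := h i; exists (H + H')%N => k x; rewrite inE => /orP[/eqP -> /hH' le|ks Pk].
  by apply: leq_trans le _; apply: leq_addl.
by apply: leq_trans (hH k x ks Pk) _; apply: leq_addr.
Qed.

Lemma slope_bound (S : nat) (x y : int) : y != 0 -> (`|x| <= S * `|y|)%N ->
  `|x%:~R / y%:~R : rat| <= S%:R.
Proof.
move=> y0 h; rewrite normrM normfV !intr_absz ler_pdivrMr ?ltr0n ?absz_gt0 //.
by rewrite -natrM ler_nat.
Qed.

Lemma coprime_parallel (u v u' v' : int) : coprimez u v -> coprimez u' v' -> v != 0 -> v' != 0 ->
  (0 < v) = (0 < v') -> u * v' = u' * v -> u = u' /\ v = v'.
Proof.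
move=> c c' v0 v0' sg e.
have d1 : (v %| v')%Z.
  by rewrite -(Gauss_dvdzr (m := v) (n := u)) 1?coprimez_sym // e dvdz_mull.
have d2 : (v' %| v)%Z.
  by rewrite -(Gauss_dvdzr (m := v') (n := u')) 1?coprimez_sym // -e dvdz_mull.
have ev' : v = v'.
  have : `|v|%N = `|v'|%N by apply/eqP; rewrite eqn_dvd -!dvdzE d1 d2.
  by move: v0 v0' sg; clear; lia.
split=> //; apply: (mulIf v0'); by rewrite e ev'.
Qed.

(** * Points in the cusps *)

Section Cusps.
Variables (d : nat) (f : {poly int}).
Hypotheses (d3 : (3 <= d)%N) (sf : sepform d f).

Lemma bf_norm_gt0 : (0 < bf_norm f)%N.
Proof.
have [sz _] := sf; have ld := sepform_lead sf.
by rewrite /bf_norm sz big_ord_recr /= addn_gt0 absz_gt0 ld orbT.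
Qed.

(** Slopes are bounded by [steep_or_large] and fall into finitely many cells of width 1 / Z. Given
    one solution p with |p.2| > Q in a cell, [thue_pair] bounds |p'.2| by |p.2|^E for every other.
    The bound is not effective, as it depends on a solution known only to exist. *)
Lemma thue_finite : exists H, forall x y : int, coprimez x y ->
  (`|bf d f x y| ^ 8 <= maxn `|x| `|y|)%N -> (maxn `|x| `|y| <= H)%N.
Proof.
have d0 : (0 < d)%N by apply: ltnW (ltnW d3).
pose S := (2 * bf_norm f)%N; have S0 : (0 < S)%N by rewrite muln_gt0 bf_norm_gt0.
have [Q [E [Z [Z0 hT]]]] := thue_pair d3 sf S0 S0.
pose good (p : int * int) := [/\ coprimez p.1 p.2, (`|bf d f p.1 p.2| ^ 8 <= S * `|p.2|)%N,
   (`|p.1| <= S * `|p.2|)%N & (Q < `|p.2|)%N].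
pose cell (p : int * int) := Num.floor (p.1%:~R / p.2%:~R * Z%:R : rat).
pose P i p := good p /\ cell p = i.
have [|H hH] := @bounded_by_keys _ P (fun p => `|p.2|%N) (int_range (S * Z).+1).
  move=> i; have [[p [gp cp]]|no] := pselect (exists p, P i p); last first.
    by exists 0%N => p Pp; case: no; exists p.
  exists (`|p.2| ^ E)%N => p' [gp' cp']; rewrite leqNgt; apply/negP => lt.
  have [cop h s q] := gp; have [cop' h' s' q'] := gp'.
  have nz (r : int * int) : (Q < `|r.2|)%N -> r.2 != 0.
    by move=> qr; rewrite -absz_gt0; apply: leq_trans qr.
  apply: (hT p.1 p.2 p'.1 p'.2 cop q (ltnW lt)) => //; try by apply: slope_bound => //; apply: nz.
  have := ltW (floor_close (etrans cp (esym cp'))); rewrite -mulrBl normrM mulrC.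
  by rewrite (ger0_norm (ler0n _ _)).
exists (256 + S * Q + S * H)%N => x y cop hF.
have [le|[yx le]] := steep_or_large x y sf d0; last first.
  move: hF; rewrite (maxn_idPl yx) => hF.
  have lex : (`|x| <= 256)%N; last by apply: leq_trans lex _; rewrite -addnA leq_addr.
  rewrite leqNgt; apply/negP => gt.
  have x1 : (0 < `|x|)%N by apply: leq_trans gt.
  have : (`|x| * `|x| <= 256 * `|x|)%N.
    apply: leq_trans (_ : (`|x| ^ d) ^ 8 <= _)%N.
      by rewrite mulnn -expnM leq_pexp2l //; lia.
    apply: leq_trans (leqXn 8 le) _; rewrite expnMn leq_mul //.
  by rewrite leq_pmul2r // leqNgt gt.
have mx : (maxn `|x| `|y| <= S * `|y|)%N by rewrite geq_max le leq_pmull.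
apply: leq_trans mx _.
have [yQ|yQ] := leqP `|y| Q.
  by apply: leq_trans (_ : S * Q <= _)%N; [rewrite leq_mul | rewrite addnAC leq_addl].
apply: leq_trans (leq_addl _ _); rewrite leq_mul //.
have y0 : y != 0 by rewrite -absz_gt0; apply: leq_trans yQ.
apply: (hH (cell (x, y)) (x, y)); last first.
  by split=> //; split=> //; apply: leq_trans hF _; rewrite geq_max le leq_pmull.
rewrite mem_int_range; apply: floor_bound; rewrite normrM (ger0_norm (ler0n _ _)) natrM.
by rewrite ler_wpM2r ?ler0n //; apply: slope_bound.
Qed.

(** A primitive point of height about t^j; [i] records the size t^i of a content by which it is
    multiplied, whose d-th power scales the value. *)
Definition cusp_point t L i j (p : int * int) := [/\ coprimez p.1 p.2,
  (t ^ j <= maxn `|p.1| `|p.2| <= t ^ j.+1)%N & (t ^ (d * i) * `|bf d f p.1 p.2| <= t ^ L)%N].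

(** On this scale f(s) is at most about t^(d M - a - d i - d j), so by [local_inverse] the slopes of
    one cell are that close, while distinct slopes are at least t^(-(2 j + 2)) apart. The count is
    the quotient; a truncated exponent 0 means boundedly many points. *)
Lemma scale_count : exists C t0, forall t M a i j, (t0 <= t)%N -> (d < a)%N -> (a <= d * M)%N ->
  (M <= i + j + 1)%N ->
  atmost (C * t ^ (d * M + 2 * j + 2 - (a + d * i + d * j))) (cusp_point t (d * M - a) i j).
Proof.
have d0 : (0 < d)%N by apply: ltnW (ltnW d3).
have [sz _] := sf.
pose S := (2 * bf_norm f)%N; have S0 : (0 < S)%N by rewrite muln_gt0 bf_norm_gt0.
have [K [Z [K0 Z0 hK]]] := local_inverse sf S0.
exists ((2 * (S * Z).+1).+1 * 2 * (4 * K * S ^ d + 3))%N, (K * S ^ d + 3)%N.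
move=> t M a i j tt da aM Mij; set L := (d * M - a)%N; set e := (_ - (a + d * i + d * j))%N.
have t3 : (3 <= t)%N by apply: leq_trans tt; apply: leq_addl.
have t0 : (0 < t)%N by apply: leq_trans t3.
have tK : (K * S ^ d <= t)%N by apply: leq_trans tt; apply: leq_addr.
have La : (t ^ L * t ^ a = t ^ (d * M))%N by rewrite -expnD /L subnK.
have LM : (t ^ (d * M) <= t ^ (d * i + d * j) * t ^ d)%N.
  by rewrite -expnD leq_pexp2l // -mulnDr -mulnSr leq_mul // -addn1.
(* The other alternative of [steep_or_large] would give t^a <= 2 t^d, against d < a and t >= 3. *)
have steep p : cusp_point t L i j p -> (`|p.1| <= S * `|p.2|)%N.
  move=> [_ /andP[hj _] hF]; have [//|[yx le]] := steep_or_large p.1 p.2 sf d0.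
  move: hj; rewrite (maxn_idPl yx) => hj.
  have h1 : (t ^ (d * i + d * j) <= 2 * t ^ L)%N.
    rewrite expnD [(d * j)%N]mulnC (expnM t j); apply: leq_trans (leq_mul (leqnn _) (leqXn d hj)) _.
    by apply: leq_trans (leq_mul (leqnn _) le) _; rewrite mulnCA leq_mul.
  have : (t ^ (d * i + d * j) * t ^ a <= 2 * (t ^ (d * i + d * j) * t ^ d))%N.
    by apply: leq_trans (leq_mul h1 (leqnn _)) _; rewrite -mulnA La leq_mul.
  rewrite mulnCA leq_pmul2l ?expn_gt0 ?t0 // -(subnK da) addnS -addSn expnD leq_pmul2r ?expn_gt0 ?t0 //.
  rewrite expnS => h; have : (t * 1 <= 2)%N by apply: leq_trans h; rewrite leq_mul // expn_gt0 t0.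
  by rewrite muln1 leqNgt t3.
have nz p : cusp_point t L i j p -> p.2 != 0.
  move=> cp; have s := steep p cp; have [_ /andP[hj _] _] := cp; apply: contraTneq hj => e0.
  by move: s; rewrite e0 muln0 leqn0 => /eqP ->; rewrite -ltnNge /= maxn0 expn_gt0 t0.
pose sl (p : int * int) : rat := p.1%:~R / p.2%:~R.
have fs p : cusp_point t L i j p ->
    `|ev f (sl p)| * (t ^ (a + d * i + d * j))%:R <= (S ^ d * t ^ (d * M))%:R.
  move=> cp; have s := steep p cp; have p0 := nz p cp; have [_ /andP[hj _] hF] := cp.
  have v0 : (0 < `|p.2|)%N by rewrite absz_gt0.
  have hv : (t ^ j <= S * `|p.2|)%N by apply: leq_trans hj _; rewrite geq_max s leq_pmull.
  rewrite -(@ler_pM2r _ (`|p.2| ^ d)%:R) ?ltr0n ?expn_gt0 ?v0 //.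
  have eF : `|ev f (sl p)| * (`|p.2| ^ d)%:R = `|bf d f p.1 p.2|%:R.
    by rewrite -intr_absz bf_ev ?sz // normrM normrX intr_absz natrX mulrC.
  rewrite mulrAC eF -!natrM ler_nat.
  have -> : (a + d * i + d * j = d * i + (a + d * j))%N by rewrite addnCA addnA.
  rewrite expnD mulnA [(`|bf d f p.1 p.2| * _)%N]mulnC.
  apply: leq_trans (leq_mul hF (leqnn _)) _.
  rewrite expnD mulnA La mulnC [(d * j)%N]mulnC (expnM t j) mulnAC -expnMn leq_mul // leqXn //.
have fsK p : cusp_point t L i j p -> K%:R * `|ev f (sl p)| <= 1.
  move=> cp; have h := fs p cp.
  rewrite -(@ler_pM2r _ (t ^ (a + d * i + d * j))%:R) ?ltr0n ?expn_gt0 ?t0 // mul1r -mulrA.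
  apply: le_trans (ler_wpM2l (ler0n _ K) h) _; rewrite -natrM ler_nat mulnA.
  apply: leq_trans (leq_mul tK LM) _; rewrite -!expnD -expnS leq_pexp2l //.
  by rewrite addnC -addSn -addnA leq_add2r.
(* The sign of the second coordinate belongs to the key because p and -p have the same slope. *)
pose key p := (Num.floor (sl p * Z%:R), 0 < p.2).
pose R (k : int * bool) := (`|k.1| <= (S * Z).+1)%N /\ True.
have hR : atmost ((2 * (S * Z).+1).+1 * 2) R.
  apply: (atmost_prod (Q := fun _ : bool => True) (@atmost_int _)).
  by rewrite -[X in atmost X]/(size [:: true; false]); apply: atmost_seq => -[].
rewrite -mulnA; apply: (atmost_fibers (f := key) hR) => [p cp|k _].
  split=> //; apply: floor_bound; rewrite normrM (ger0_norm (ler0n _ _)) natrM ler_wpM2r ?ler0n //.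
  by apply: slope_bound; [apply: nz | apply: steep].
apply: (@atmost_leq _ (2 * (2 * K * S ^ d * t ^ e) + 3)).
  rewrite mulnDl leq_add //; last by rewrite leq_pmulr // expn_gt0 t0.
  by apply: eq_leq; ring.
apply: (@spread_count _ _ sl (t ^ (2 * j + 2))) => p p' [cp kp] [cp' kp'].
  have cell : `|sl p - sl p'| <= K%:R * `|ev f (sl p) - ev f (sl p')|.
    apply: hK; first by apply: slope_bound; [apply: nz | apply: steep].
      have := ltW (floor_close (congr1 fst (etrans kp (esym kp')))); rewrite /= -mulrBl normrM mulrC.
      by rewrite (ger0_norm (ler0n _ _)).
    exact: fsK.
  have small q : cusp_point t L i j q -> `|ev f (sl q)| * (t ^ (2 * j + 2))%:R <= (S ^ d * t ^ e)%:R.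
    move=> cq; rewrite -(@ler_pM2r _ (t ^ (a + d * i + d * j))%:R) ?ltr0n ?expn_gt0 ?t0 // mulrAC.
    apply: le_trans (ler_wpM2r (ler0n _ _) (fs q cq)) _; rewrite -!natrM ler_nat -!mulnA leq_mul //.
    by rewrite -!expnD leq_pexp2l // addnA [(e + _)%N]addnC -leq_subLR.
  apply: le_trans (ler_wpM2r (ler0n _ _) cell) _; rewrite -mulrA.
  apply: le_trans (_ : K%:R * ((S ^ d * t ^ e)%:R + (S ^ d * t ^ e)%:R) <= _).
    rewrite ler_wpM2l ?ler0n //; apply: le_trans (ler_wpM2r (ler0n _ _) (ler_normB _ _)) _.
    by rewrite mulrDl lerD // small.
  by rewrite -natrD -natrM ler_nat; apply: eq_leq; ring.
move=> pp'; have p0 := nz p cp; have p0' := nz p' cp'.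
have [c1 /andP[_ hp] _] := cp; have [c2 /andP[_ hp'] _] := cp'.
have e1 : sl p - sl p' = (p.1 * p'.2 - p'.1 * p.2)%:~R / (p.2 * p'.2)%:~R.
  rewrite /sl rmorphB !rmorphM /=; field; by rewrite !intr_eq0 p0 p0'.
have n0 : p.1 * p'.2 - p'.1 * p.2 != 0.
  rewrite subr_eq0; apply: contraNneq pp' => ep.
  have [] := coprime_parallel c1 c2 p0 p0' (congr1 snd (etrans kp (esym kp'))) ep.
  by case: (p) (p') => [? ?] [? ?] /= -> ->.
rewrite e1 normrM normfV !intr_absz mulrAC ler_pdivlMr ?ltr0n ?absz_gt0 ?mulf_neq0 // mul1r -natrM ler_nat.
apply: leq_trans (_ : t ^ (2 * j + 2) <= _)%N; last by rewrite leq_pmull // absz_gt0.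
rewrite abszM (_ : 2 * j + 2 = j.+1 + j.+1)%N ?expnD; last by clear; lia.
apply: leq_mul; [apply: leq_trans hp | apply: leq_trans hp']; exact: leq_maxr.
Qed.
End Cusps.

(** At most t^(i + 1) contents are combined with the points of a scale. As i + j + 1 >= M and d >=
    2, the worst case is i = 0, j = M - 1. In the first alternative the number of points is bounded
    and only the contents count. *)
Lemma cusp_exponents d M a i j : (2 <= d)%N -> (M <= i + j + 1)%N -> (i <= M)%N ->
  (d * M + 2 * j + 2 <= a + d * i + d * j)%N \/
  (i.+1 + (d * M + 2 * j + 2 - (a + d * i + d * j)) <= 2 * M + d + 1 - a)%N.
Proof.
move=> d2 Mij iM; have [|lt] := leqP (d * M + 2 * j + 2) (a + d * i + d * j); [by left | right].
have [r er] : exists r, (i + j + 1 = M + r)%N by exists (i + j + 1 - M)%N; rewrite subnKC.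
have ed : (d * i + d * j + d = d * M + d * r)%N by rewrite -!mulnDr -mulnSr -er addn1.
have dr : (2 * r <= d * r)%N by rewrite leq_mul.
by move: lt ed dr; move: (d * M)%N (d * i)%N (d * j)%N (d * r)%N; move: er; clear; lia.
Qed.

Section CuspValues.
Variables (d : nat) (f : {poly int}).
Hypotheses (d3 : (3 <= d)%N) (sf : sepform d f).

Lemma cusp_values M a : (d < a)%N -> (a <= d * M)%N -> exists C t0, forall t, (t0 <= t)%N ->
  atmost (C * (t ^ (2 * M + d + 1 - a) + t ^ M.+1)) (fun m : int =>
    [/\ m != 0, (`|m| <= t ^ (d * M - a))%N &
     exists x y, m = bf d f x y /\ (t ^ M < maxn `|x| `|y|)%N]).
Proof.
move=> da aM; have d0 : (0 < d)%N by apply: ltnW (ltnW d3).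
have [H hH] := thue_finite d3 sf; have [C [t0 hC]] := scale_count d3 sf.
(* By [thue_finite] a point of height above [H] has height below the eighth power of its value,
   hence below t^J: only J + 1 scales occur. *)
pose J := (d * M * 8)%N; set L := (d * M - a)%N.
pose c1 := ((2 * H).+1 * (2 * H).+1)%N; pose c2 := (M.+1 * (J.+1 * C))%N.
exists (c1 + c2)%N, (t0 + 2)%N => t tt.
have t1 : (1 < t)%N by apply: leq_trans tt; apply: leq_addl.
have tt0 : (t0 <= t)%N by apply: leq_trans tt; apply: leq_addr.
set B := (t ^ (2 * M + d + 1 - a) + t ^ M.+1)%N.
have kr n : atmost n (fun k => (0 < k <= n)%N).
  by rewrite -[X in atmost X](size_iota 1); apply: atmost_seq => k; rewrite mem_iota add1n ltnS.
pose val (k : nat * (int * int)) : int := k.1%:Z ^+ d * bf d f k.2.1 k.2.2.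
pose P1 (m : int) := exists2 k : nat * (int * int), (0 < k.1 <= t ^ M)%N /\
  ((`|k.2.1| <= H)%N /\ (`|k.2.2| <= H)%N) & m = val k.
pose P2 i j (m : int) := (M <= i + j + 1)%N /\ exists2 k : nat * (int * int),
   (0 < k.1 <= t ^ i.+1)%N /\ cusp_point d f t L i j k.2 & m = val k.
apply: (@atmost_sub _ _ _ (fun m => P1 m \/ exists2 i, (i < M.+1)%N & exists2 j, (j < J.+1)%N & P2 i j m)).
  move=> m [m0 mL [x [y [em big]]]].
  have [g0|gn] := eqVneq (gcdz x y) 0.
    by move/eqP: g0; rewrite gcdz_eq0 => /andP[/eqP x0 /eqP y0]; rewrite em x0 y0 bf00 ?eqxx in m0.
  have [u eu] := dvdzP (dvdz_gcdl x y); have [v ev] := dvdzP (dvdz_gcdr x y).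
  pose k := `|gcdz x y|%N.
  have ek : gcdz x y = k%:Z by rewrite /k gez0_abs // lez0_nat.
  have cop : coprimez u v.
    have := mulz_gcdl u v (gcdz x y); rewrite -eu -ev => e.
    rewrite /coprimez; apply/eqP; apply: (mulfI gn); rewrite mulr1 {1}ek.
    by rewrite -[k%:Z]/(`|k%:Z|%N%:Z) -ek; move: e; lia.
  have k0 : (0 < k)%N by rewrite absz_gt0.
  have xk : x = k%:Z * u by rewrite mulrC -ek.
  have yk : y = k%:Z * v by rewrite mulrC -ek.
  have em' : m = val (k, (u, v)).
    by rewrite em xk yk bf_hom.
  have F0 : (0 < `|bf d f u v|)%N.
    by rewrite absz_gt0; apply: contraNneq m0 => e; rewrite em' /val /= e mulr0.
  have kF : (k ^ d * `|bf d f u v| <= t ^ L)%N by move: mL; rewrite em' /val /= abszM abszX absz_nat.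
  have kM : (k <= t ^ M)%N.
    rewrite -(@leq_exp2r _ _ d) // -expnM mulnC; apply: leq_trans (leq_trans kF _).
      by rewrite leq_pmulr.
    by rewrite leq_pexp2l ?(ltnW t1) // leq_subr.
  have [hs|hb] := leqP (maxn `|u| `|v|) H.
    left; exists (k, (u, v)) => //=; rewrite k0 kM; split=> //.
    by move: hs; rewrite geq_max => /andP[].
  have h0 : (0 < maxn `|u| `|v|)%N by apply: leq_ltn_trans hb.
  have hJ : (maxn `|u| `|v| <= t ^ J)%N.
    have lt8 : (maxn `|u| `|v| < `|bf d f u v| ^ 8)%N.
      by rewrite ltnNge; apply/negP => le; have := hH u v cop le; rewrite leqNgt hb.
    apply: leq_trans (ltnW lt8) _; rewrite /J expnM leqXn //.
    apply: leq_trans (_ : t ^ L <= _)%N; last by rewrite leq_pexp2l ?(ltnW t1) // leq_subr.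
    by apply: leq_trans kF; rewrite leq_pmull // expn_gt0 k0.
  have [i iM /andP[i1 i2]] := trunc_log_between t1 k0 kM.
  have [j jJ /andP[j1 j2]] := trunc_log_between t1 h0 hJ.
  right; exists i => //; exists j => //; split.
    have : (t ^ M < t ^ (i.+1 + j.+1))%N.
      apply: leq_trans big _; rewrite expnD; apply: leq_trans (leq_mul i2 j2).
      by rewrite xk yk !abszM absz_nat geq_max !leq_mul ?leq_maxl ?leq_maxr.
    by rewrite ltn_exp2l // addSn addnS addn1.
  exists (k, (u, v)) => //=; rewrite k0 i2; split=> //; split=> //=; first by rewrite j1 j2.
  by apply: leq_trans kF; rewrite leq_mul // mulnC expnM leqXn.
have B1 : (t ^ M <= B)%N.
  by apply: leq_trans (_ : t ^ M.+1 <= _)%N; rewrite ?leq_pexp2l ?(ltnW t1) // leq_addl.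
rewrite mulnDl; apply: atmostU.
  apply: (@atmost_leq _ (t ^ M * ((2 * H).+1 * (2 * H).+1))); first by rewrite mulnC leq_mul.
  apply: atmost_image (atmost_prod (kr (t ^ M)%N) (atmost_prod (@atmost_int H) (@atmost_int H))) => m.
  by move=> [k Pk ->]; exists k.
rewrite /c2 -mulnA -[(J.+1 * C * _)%N]mulnA; apply: atmost_iota => i iM; apply: atmost_iota => j jJ.
have [Mij|no] := leqP M (i + j + 1); last by apply: atmost0 => m [le _]; rewrite leqNgt no in le.
have hc := hC t M a i j tt0 da aM Mij.
apply: (@atmost_leq _ (t ^ i.+1 * (C * t ^ (d * M + 2 * j + 2 - (a + d * i + d * j))))).
  rewrite mulnCA leq_mul // -expnD.
  have [e0|le] := cusp_exponents a (ltnW d3) Mij iM.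
    apply: leq_trans (leq_addl _ _); rewrite (eqP e0) addn0 leq_pexp2l ?(ltnW t1) //.
  by apply: leq_trans (leq_addr _ _); rewrite leq_pexp2l ?(ltnW t1).
apply: atmost_image (atmost_prod (kr (t ^ i.+1)%N) hc) => m.
by move=> [_ [k Pk ->]]; exists k.
Qed.
End CuspValues.

Section CommonValues.
Variables (d : nat) (f1 f2 : {poly int}).
Hypotheses (d3 : (3 <= d)%N) (sf1 : sepform d f1) (sf2 : sepform d f2) (niso : noniso d f1 f2).

(* With a = b + d + 1 the cusps contribute no more than the box, and 2 a < d b makes the resulting exponent (2M - b)/(dM - a) smaller than 2/d. *)
Lemma common_values_count b (M := box_exponent d (b.+1 + b.+1)) : (0 < b)%N ->
  exists C t0, forall t, (t0 <= t)%N ->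
  atmost (C * t ^ (2 * M - b)) (fun m : int => [/\ (`|m| <= t ^ (d * M - (b + d + 1)))%N,
    exists x y, m = bf d f1 x y & exists x y, m = bf d f2 x y]).
Proof.
move=> b0; have bM : (b.+1 + b.+1 < M)%N by apply: box_exponent_gt.
have da : (d < b + d + 1)%N by rewrite addn1 ltnS leq_addl.
have dM : (3 * (M - 1) + d <= d * M)%N.
  have M1 : (M = (M - 1) + 1)%N by lia.
  by rewrite {2}M1 mulnDr muln1 leq_add2r leq_mul.
have aM : (b + d + 1 <= d * M)%N by move: bM dM; move: (d * M)%N; clearbody M; clear -M b d; lia.
have [C [tB hB]] := box_values d3 sf1 sf2 niso b; rewrite -/M in hB.
have [C1 [t1 h1]] := cusp_values d3 sf1 da aM; have [C2 [t2 h2]] := cusp_values d3 sf2 da aM.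
exists (1 + C + C1 * 2 + C2 * 2)%N, (tB + t1 + t2 + 1)%N => t tt.
have t0 : (0 < t)%N by apply: leq_trans tt; rewrite addn1.
have cusp c : (c * (t ^ (2 * M + d + 1 - (b + d + 1)) + t ^ M.+1) <= c * 2 * t ^ (2 * M - b))%N.
  have -> : (2 * M + d + 1 - (b + d + 1) = 2 * M - b)%N by clear; lia.
  have le : (t ^ M.+1 <= t ^ (2 * M - b))%N by rewrite leq_pexp2l //; clear -bM; lia.
  by rewrite -mulnA leq_mul // (mul2n (t ^ _)) -addnn leq_add.
rewrite !mulnDl mul1n.
apply: (@atmost_sub _ _ _ (fun m : int => ((m = 0 \/ (m != 0 /\
    exists x, [/\ in_box (t ^ M) x, surf d f1 f2 x = 0 & m = bf d f1 (x 0 o0) (x 0 o1)])) \/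
    [/\ m != 0, (`|m| <= t ^ (d * M - (b + d + 1)))%N &
     exists x y, m = bf d f1 x y /\ (t ^ M < maxn `|x| `|y|)%N]) \/
    [/\ m != 0, (`|m| <= t ^ (d * M - (b + d + 1)))%N &
     exists x y, m = bf d f2 x y /\ (t ^ M < maxn `|x| `|y|)%N])).
  move=> m [mN [x [y exy]] [z [w ezw]]].
  have [m0|mn] := eqVneq m 0; first by left; left; left.
  have [h|h] := ltnP (t ^ M) (maxn `|x| `|y|); first by left; right; split=> //; exists x, y.
  have [h'|h'] := ltnP (t ^ M) (maxn `|z| `|w|); first by right; split=> //; exists z, w.
  left; left; right; split=> //; exists (row4 x y z w).
  move: h h'; rewrite !geq_max => /andP[hx hy] /andP[hz hw].
  split; last by rewrite !mxE.
    by apply: ord4P; rewrite mxE.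
  by rewrite /surf !mxE /= -exy -ezw subrr.
have le3 : [/\ tB <= t, t1 <= t & t2 <= t]%N by clear -tt; split; lia.
have [l1 l2 l3] := le3.
apply: atmostU; last exact: atmost_leq (cusp C2) (h2 t l3).
apply: atmostU; last exact: atmost_leq (cusp C1) (h1 t l2).
apply: atmostU; last exact: hB t l1.
apply: (@atmost_leq _ 1); first by rewrite expn_gt0 t0.
by apply: atmost1 => x y -> ->.
Qed.

(** The inequality amounts to 2 (b + d + 1) < d b. For b = 2 d + 3 this is 3 d + 8 < 2 d^2, which
    holds from d = 3 on. *)
Lemma exponent_lt b (M := box_exponent d (b.+1 + b.+1)) : b = (2 * d + 3)%N ->
  (d * (2 * M - b) < 2 * (d * M - (b + d + 1)))%N.
Proof.
move=> eb; have bM : (b.+1 + b.+1 < M)%N by apply: box_exponent_gt.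
have dM : (3 * (M - 1) + d <= d * M)%N.
  have M1 : (M = (M - 1) + 1)%N by lia.
  by rewrite {2}M1 mulnDr muln1 leq_add2r leq_mul.
rewrite mulnBr [(d * (2 * M))%N]mulnCA; have dd : (3 * d <= d * d)%N by rewrite leq_mul.
move: bM dM dd; rewrite eb mulnDr [(d * (2 * d))%N]mulnCA; move: (d * M)%N (d * d)%N; clearbody M; clear -d3 ; lia.
Qed.
End CommonValues.

From mathcomp Require Import algC.

(** * Forms as univariate polynomials *)

Definition smooth_form d (f : {poly int}) := forall p q : algC,
  bfx d f p q = 0 -> bfy d f p q = 0 -> p = 0 /\ q = 0.

(** The unimodular substitution of r X + Y for Y. It preserves the set of values and the isomorphism
    class, and makes the coefficient F(1, r) of X^d nonzero for a suitable r, as [sepform]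
    demands. *)
Definition shear_form d (f : {poly int}) (r : nat) : {poly int} := bf d f 'X (r%:R * 'X + 1).

Lemma poly_eq_inf (F : numFieldType) (p q : {poly F}) : (forall x, p.[x] = q.[x]) -> p = q.
Proof.
move=> h; apply/eqP; rewrite -subr_eq0; apply/eqP; apply: poly_zero_inf => n.
by rewrite hornerD hornerN h subrr.
Qed.

Lemma horner_bf (R : comNzRingType) d f (p q : {poly R}) x : (bf d f p q).[x] = bf d f p.[x] q.[x].
Proof. by rewrite -!/(horner_eval x _) rmorph_bf. Qed.

Lemma size_shear d f r : (size (shear_form d f r) <= d.+1)%N.
Proof.
apply: leq_trans (size_sum _ _ _) _; apply/bigmax_leqP => i _.
have s1 n : (size (((r%:R * 'X + 1) ^+ n)%R : {poly int}) <= n.+1)%N.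
  elim: n => [|n IH]; first by rewrite expr0 size_poly1.
  rewrite exprS; apply: leq_trans (size_polyMleq _ _) _.
  have : (size ((r%:R * 'X + 1)%R : {poly int}) <= 2)%N.
    by rewrite -[1]/(1%:P) size_MXaddC; case: ifP => // _; rewrite ltnS -polyC_natr size_polyC_leq1.
  by move: IH; move: (size _) (size _); clear; lia.
have si := ltn_ord i.
rewrite mulrzl -scaler_int; apply: leq_trans (size_scale_leq _ _) _.
apply: leq_trans (size_polyMleq _ _) _; rewrite size_polyXn.
by have := s1 (d - i)%N; move: (size _) => s; move: si; move: (nat_of_ord i); clear; lia.
Qed.

Lemma bf_shear (K : numFieldType) d f r (x y : K) :
  bf d (shear_form d f r) x y = bf d f x (r%:R * x + y).
Proof.
have ev1 (z : K) : bf d (shear_form d f r) z 1 = bf d f z (r%:R * z + 1).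
  rewrite bf_y1 ?size_shear // /shear_form rmorph_bf /= rmorphD rmorphM rmorph_nat rmorph1 /= map_polyX.
  by rewrite horner_bf hornerD hornerM hornerX hornerC -[r%:R]polyC_natr hornerC.
have evn0 (z y' : K) : y' != 0 -> bf d (shear_form d f r) z y' = bf d f z (r%:R * z + y').
  move=> y0; have e := bf_hom d (shear_form d f r) y' (z / y') 1.
  have e2 := bf_hom d f y' (z / y') (r%:R * (z / y') + 1).
  rewrite ev1 -e2 mulr1 mulrC divfK // in e; rewrite e; congr bf; by field.
have [y0|] := eqVneq y 0; last exact: evn0.
have e : bf d (shear_form d f r) x%:P 'X = bf d f x%:P (r%:R * x%:P + 'X).
  apply/eqP; rewrite -subr_eq0; apply/eqP; apply: poly_zero_inf => n.
  rewrite hornerD hornerN !horner_bf !hornerD hornerM !hornerC hornerX -[r%:R]polyC_natr hornerC.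
  by rewrite evn0 ?subrr // pnatr_eq0.
have := congr1 (fun p => p.[y]) e; rewrite /= !horner_bf hornerD hornerM !hornerC hornerX.
by rewrite -[r%:R]polyC_natr hornerC.
Qed.

(** Reading a directional derivative off as a coefficient lets the chain rule for a shear follow
    from the equality of values. *)
Lemma bf_linear_part (K : comNzRingType) d f (x y a b : K) :
  (bf d f (x%:P + 'X * a%:P) (y%:P + 'X * b%:P))`_1 = a * bfx d f x y + b * bfy d f x y.
Proof.
have [p ->] := bf_taylor d f x%:P y%:P a%:P b%:P 'X.
rewrite !coefD coefXM expr2 -mulrA coefXM /= coefXM /= addr0.
have cC z : (z%:P : {poly K}) = polyC z by [].
rewrite -[bf d f x%:P y%:P](rmorph_bf (polyC : {rmorphism K -> {poly K}})).
rewrite -(rmorph_bfx (polyC : {rmorphism K -> {poly K}})) -(rmorph_bfy (polyC : {rmorphism K -> {poly K}})).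
by rewrite -!rmorphM -rmorphD !coefC add0r.
Qed.

Lemma smooth_shear d f r : smooth_form d f -> smooth_form d (shear_form d f r).
Proof.
move=> sm p q hx hy.
have e a b : a * bfx d (shear_form d f r) p q + b * bfy d (shear_form d f r) p q =
    a * bfx d f p (r%:R * p + q) + (r%:R * a + b) * bfy d f p (r%:R * p + q) :> algC.
  rewrite -!bf_linear_part; apply: (congr1 (fun P : {poly algC} => P`_1)).
  apply: poly_eq_inf => z.
  rewrite !horner_bf !hornerD !hornerM !hornerX !hornerC bf_shear; congr bf; ring.
have h1 := e 0 1; have h2 := e 1 0.
rewrite hx hy !(mulr0, mul0r, addr0, add0r, mul1r) in h1.
rewrite hx hy -h1 !(mulr0, mul0r, addr0, add0r, mul1r) in h2.
have [p0 q0] := sm _ _ (esym h2) (esym h1).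
by split=> //; move: q0; rewrite p0 mulr0 add0r.
Qed.

(** For a common root rho of g and g', both partial derivatives would vanish at (rho, 1) by Euler's
    identity. So g and g' are coprime over the rationals, and clearing denominators in a Bezout
    identity gives the constant. *)
Lemma smooth_sepform d (g : {poly int}) : (0 < d)%N -> (size g <= d.+1)%N -> g`_d != 0 -> smooth_form d g -> sepform d g.
Proof.
move=> d0 sg gd sm; have sz : size g = d.+1.
  by apply/eqP; rewrite eqn_leq sg ltnNge; apply: contra gd => h; rewrite nth_default.
split=> //; pose m : {poly rat} := map_poly intr g; pose mc : {poly algC} := map_poly intr g.
have mE : mc = map_poly ratr m.
  by rewrite /mc /m -map_poly_comp; apply: eq_map_poly => z /=; rewrite ratr_int.
have cop : coprimep m m^`().
  rewrite -(coprimep_map (ratr : {rmorphism rat -> algC})) /= -deriv_map -mE.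
  apply/negPn/negP; rewrite coprimep_def => /closed_rootP[rho].
  rewrite root_gcd => /andP[/eqP r1 /eqP r2].
  have h1 : bfx d g rho 1 = 0 by rewrite bfx_y1 // -deriv_map.
  have h2 := euler_bf d g rho 1; rewrite h1 bf_y1 // r1 !mulr0 add0r mul1r in h2.
  by have [_ /eqP] := sm _ _ h1 h2; rewrite oner_eq0.
have /Bezout_eq1_coprimepP[[u v] /= e] := cop.
have [U [a a0 eU]] := rat_poly_scale u; have [V [b b0 eV]] := rat_poly_scale v.
exists (a * b); first by rewrite mulf_neq0.
exists (b%:P * U), (a%:P * V).
apply: (@map_inj_poly _ _ (intr : int -> rat)); [exact: intr_inj | by [] |].
rewrite rmorphD !rmorphM /= !map_polyC /= -deriv_map -/m.
have a0' : a%:~R != 0 :> rat by rewrite intr_eq0.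
have b0' : b%:~R != 0 :> rat by rewrite intr_eq0.
have eU' : map_poly intr U = a%:~R *: u by rewrite eU scalerA divff // scale1r.
have eV' : map_poly intr V = b%:~R *: v by rewrite eV scalerA divff // scale1r.
rewrite eU' eV' -!mul_polyC.
transitivity ((a%:~R)%:P * (b%:~R)%:P * (u * m + v * m^`())); first by ring.
by rewrite e mulr1 -polyCM rmorphM.
Qed.

Lemma shear_sepform d (f : {poly int}) : (0 < d)%N -> (size f <= d.+1)%N -> smooth_form d f ->
  exists r, sepform d (shear_form d f r).
Proof.
move=> d0 sf sm; have [[r hr]|no] := pselect (exists r : nat, bf d f 1 r%:R != 0 :> rat).
  exists r; apply: smooth_sepform; rewrite ?size_shear //; last exact: smooth_shear.
  have := bf_shear d f r (1 : rat) 0; rewrite bf_y0 expr1n mulr1 addr0 mulr1 => e.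
  by rewrite -(intr_eq0 rat) e.
have f0 : f = 0.
  have h : bf d f 1 'X = 0 :> {poly rat}.
    apply: poly_zero_inf => n; rewrite horner_bf hornerX hornerC; apply/eqP.
    by apply: contrapT => /negP h; apply: no; exists n.+1.
  apply/polyP => i; rewrite coef0; have [id|di] := ltnP i d.+1; last first.
    by rewrite nth_default // (leq_trans sf).
  have := congr1 (fun p : {poly rat} => p`_(d - i)) h; rewrite /= /bf coef_sum coef0 (bigD1 (Ordinal id)) //=.
  rewrite big1 ?addr0 => [|j ji]; rewrite expr1n mul1r mulrzl -scaler_int coefZ coefXn.
    by rewrite eqxx mulr1 => /eqP; rewrite intr_eq0 => /eqP.
  have jd := ltn_ord j; have ne : (d - i)%N != (d - j)%N.
    apply: contraNneq ji => e; apply/eqP/val_inj => /=; move: e jd id; clear; move: (nat_of_ord j); lia.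
  by rewrite (negPf ne) mulr0.
have [] := sm 1 0; rewrite f0 ?/bfx ?/bfy; try by apply: big1 => i _; rewrite coef0 mul0r.
by move=> /eqP; rewrite oner_eq0.
Qed.

From mathcomp Require mpoly.

Lemma det_mx2 (R : comPzRingType) (A : 'M[R]_2) : \det A = A 0 0 * A 1 1 - A 0 1 * A 1 0.
Proof.
rewrite (expand_det_row A 0) 2!big_ord_recl big_ord0 addr0 /cofactor /= !det_mx11 !mxE.
by rewrite expr0 mul1r expr1 mulN1r mulrN; congr (A _ _ * A _ _ - A _ _ * A _ _); apply: val_inj.
Qed.

Section Forms.
Import mpoly.
Definition mon (i j : nat) : 'X_{1.. 2} := [multinom [tuple i; j]].

Lemma monE i j k : mon i j k = nth 0%N [:: i; j] k.
Proof. by rewrite multinomE (tnth_nth 0%N). Qed.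

Lemma mon_eta (m : 'X_{1.. 2}) : m = mon (m ord0) (m ord_max).
Proof.
apply/mnmP => i; rewrite monE /=.
by case: i => -[|[|i]] hi //=; congr (m _); apply: val_inj.
Qed.

Lemma mdeg_mon i j : mdeg (mon i j) = (i + j)%N.
Proof. by rewrite mdegE big_ord_recl big_ord1 !monE. Qed.

Definition dehom d (F : {mpoly int[2]}) : {poly int} := \poly_(i < d.+1) F@_(mon i (d - i)).

Lemma coef_dehom d F i : (i <= d)%N -> (dehom d F)`_i = F@_(mon i (d - i)).
Proof. by move=> id; rewrite coef_poly ltnS id. Qed.

Lemma homog_expand (R : comNzRingType) d (G : {mpoly R[2]}) :
  (forall m, mdeg m != d -> G@_m = 0) ->
  G = \sum_(i < d.+1) G@_(mon i (d - i)) *: 'X_[mon i (d - i)].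
Proof.
move=> h; apply/mpolyP => m; rewrite raddf_sum /=.
have [md|md] := eqVneq (mdeg m) d; last first.
  rewrite h // big1 // => i _; rewrite mcoeffZ mcoeffX.
  rewrite (_ : (mon _ _ == m) = false) ?mulr0 //; apply: contraNF md => /eqP <-.
  by rewrite mdeg_mon subnKC // -ltnS.
have em := mon_eta m; have sm : (m ord0 + m ord_max = d)%N by rewrite -md {3}em mdeg_mon.
have lt : (m ord0 < d.+1)%N by rewrite ltnS -sm leq_addr.
have em' : m = mon (m ord0) (d - m ord0) by rewrite {1}em -sm addKn.
rewrite (bigD1 (Ordinal lt)) //= -em' mcoeffZ mcoeffX eqxx mulr1 big1 ?addr0 // => i ni.
rewrite mcoeffZ mcoeffX (_ : (mon _ _ == m) = false) ?mulr0 //; apply: contraNF ni => /eqP e.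
by apply/eqP/val_inj => /=; rewrite -e monE.
Qed.

Lemma meval_form (R : comNzRingType) d F (x y : R) : F \is d.-homog ->
  (map_mpoly intr F).@[tnth [tuple x; y]] = bf d (dehom d F) x y.
Proof.
move=> hF; rewrite (@homog_expand _ d (map_mpoly intr F)); last first.
  move=> m md; rewrite mcoeff_map_mpoly /= memN_msupp_eq0 ?rmorph0 //.
  by apply: contra md => mF; have /dhomogP/(_ m mF) /= := hF; move=> ->.
rewrite raddf_sum /=; apply: eq_bigr => i _; rewrite mevalZ mcoeff_map_mpoly mevalX.
rewrite coef_dehom -1?ltnS // big_ord_recl big_ord1 !monE /=.
by rewrite !(tnth_nth 0).
Qed.

Lemma form_values_bf d F m : F \is d.-homog ->
  form_values F m <-> exists x y : int, m = bf d (dehom d F) x y.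
Proof.
move=> hF; have e x y : F.@[tnth [tuple x; y]] = bf d (dehom d F) x y.
  rewrite -(meval_form _ _ hF); congr (_.@[_]); apply/mpolyP => k.
  by rewrite mcoeff_map_mpoly /= intz.
by split=> -[x [y ->]]; exists x, y; rewrite e.
Qed.

Lemma bin_smooth d F : (2 <= d)%N -> Bin d F -> smooth_form d (dehom d F).
Proof.
move=> d2 /andP[hF disc] p q hx hy.
have [//|nz] := pselect (p = 0 /\ q = 0).
case/negP: disc; apply/eqP; rewrite /form_disc.
suff -> : form_resultant d.-1 d.-1 (form_rat F)^`M(0) (form_rat F)^`M(1) = 0 by rewrite mulr0 mul0r.
rewrite /form_resultant; set A := col_mx _ _.
have Fz m : mdeg m != d -> (form_rat F)@_m = 0.
  move=> md; rewrite mcoeff_map_mpoly /= memN_msupp_eq0 ?rmorph0 //.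
  by apply: contra md => mF; have /dhomogP/(_ m mF) /= := hF; move=> ->.
have Fc i : (i <= d)%N -> (form_rat F)@_(mon i (d - i)) = ((dehom d F)`_i)%:~R.
  by move=> id; rewrite coef_dehom // mcoeff_map_mpoly.
have addU0 i j : (mon i j + U_(0%R))%MM = mon i.+1 j.
  apply/mnmP => k; rewrite mnmDE mnm1E !monE.
  by case: k => -[|[|k]] hk //=; rewrite ?addn0 ?addn1.
have addU1 i j : (mon i j + U_(1%R))%MM = mon i j.+1.
  apply/mnmP => k; rewrite mnmDE mnm1E !monE.
  by case: k => -[|[|k]] hk //=; rewrite ?addn0 ?addn1.
pose c0 k := form_coef d.-1 (form_rat F)^`M(0) k; pose c1 k := form_coef d.-1 (form_rat F)^`M(1) k.
have c0E k : (k < d)%N -> c0 k = ((dehom d F)`_(d - k))%:~R *+ (d - k).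
  move=> kd; rewrite /c0 /form_coef -/(mon _ _) mcoeff_mderiv addU0 !monE /=.
  have e : (d.-1 - k).+1 = (d - k)%N by lia.
  by rewrite e -Fc ?leq_subr // subKn // ltnW.
have c1E k : (k < d)%N -> c1 k = ((dehom d F)`_(d.-1 - k))%:~R *+ k.+1.
  move=> kd; rewrite /c1 /form_coef -/(mon _ _) mcoeff_mderiv addU1 !monE /=.
  have e : k.+1 = (d - (d.-1 - k))%N by lia.
  by rewrite {1}e Fc //; lia.
have c0z k : (d <= k)%N -> c0 k = 0.
  by move=> kd; rewrite /c0 /form_coef -/(mon _ _) mcoeff_mderiv addU0 Fz ?mul0rn // mdeg_mon; lia.
have c1z k : (d <= k)%N -> c1 k = 0.
  by move=> kd; rewrite /c1 /form_coef -/(mon _ _) mcoeff_mderiv addU1 Fz ?mul0rn // mdeg_mon; lia.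
have s0 : \sum_(k < d) ratr (c0 k) * (p ^+ (d.-1 - k) * q ^+ k) = 0.
  rewrite -[RHS]hx /bfx [RHS]big_ord_recl /= !mul0r mulr0 add0r [RHS](reindex_inj rev_ord_inj) /=.
  apply: eq_bigr => k _; have kd := ltn_ord k; rewrite c0E // rmorphMn /= ratr_int.
  rewrite /bump /= add1n; have -> : (d - k.+1).+1 = (d - k)%N by lia.
  have -> : (0 + (d - k.+1) = d.-1 - k)%N by lia.
  have -> : (d - (d - k))%N = k by lia.
  by rewrite -mulr_natr; ring.
have s1 : \sum_(k < d) ratr (c1 k) * (p ^+ (d.-1 - k) * q ^+ k) = 0.
  rewrite -[RHS]hy /bfy [RHS]big_ord_recr /= subnn !mul0r !mulr0 addr0 [RHS](reindex_inj rev_ord_inj) /=.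
  apply: eq_bigr => k _; have kd := ltn_ord k; rewrite c1E // rmorphMn /= ratr_int.
  have -> : (d - k.+1 = d.-1 - k)%N by lia.
  have -> : (d - (d.-1 - k) = k.+1)%N by lia.
  by rewrite -mulr_natr /=; ring.
pose n := (d.-1 + d.-1)%N.
(* Since (p, q) is a common zero of both partial derivatives, the monomials of degree n - 1 at (p, q) form a kernel vector of the Sylvester matrix. *)
pose w : 'cV[algC]_n := \col_j (p ^+ (n.-1 - j) * q ^+ j).
have block (c : nat -> rat) : (forall k, (d <= k)%N -> c k = 0) ->
    \sum_(k < d) ratr (c k) * (p ^+ (d.-1 - k) * q ^+ k) = 0 -> forall i : 'I_(d.-1),
    \sum_(j < n) ratr (if (i <= j)%N then c (j - i)%N else 0) * w j 0 = 0.
  move=> cz s i; have id := ltn_ord i.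
  have e : \sum_(j < n) ratr (if (i <= j)%N then c (j - i)%N else 0) * w j 0 =
      \sum_(0 <= j < n) ratr (if (i <= j)%N then c (j - i)%N else 0) * (p ^+ (n.-1 - j) * q ^+ j).
    by rewrite big_mkord; apply: eq_bigr => j _; rewrite mxE.
  have il : (i <= n)%N by rewrite /n; lia.
  have dl : (i + d <= n)%N by rewrite /n; lia.
  rewrite e (big_cat_nat (leq0n i) il) /= big_nat_cond big1 ?add0r; last first.
    by move=> j /andP[/andP[_ ji] _]; rewrite leqNgt ji /= rmorph0 mul0r.
  rewrite (big_cat_nat (leq_addr d i) dl) /= [X in _ + X]big_nat_cond [X in _ + X]big1 ?addr0; last first.
    move=> j /andP[/andP[ij _] _]; rewrite (leq_trans (leq_addr d i) ij) cz ?rmorph0 ?mul0r //.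
    by rewrite leq_subRL // (leq_trans (leq_addr d i) ij).
  rewrite -{1}[nat_of_ord i]add0n big_addn addnC addnK big_mkord.
  transitivity (p ^+ (d.-1.-1 - i) * q ^+ i * \sum_(k < d) ratr (c k) * (p ^+ (d.-1 - k) * q ^+ k)); last by rewrite s mulr0.
  rewrite mulr_sumr; apply: eq_bigr => k _; have kd := ltn_ord k.
  rewrite leq_addl addnK; have -> : (n.-1 - (k + i) = (d.-1.-1 - i) + (d.-1 - k))%N by rewrite /n; lia.
  by rewrite !exprD; ring.
have n0 : (0 < n)%N by rewrite /n; lia.
have wn : w != 0.
  have [p0|pn] := eqVneq p 0.
    have qn : q != 0 by apply: contra_notN nz => /eqP q0.
    have lt : (n.-1 < n)%N by rewrite prednK.
    apply: contraNneq qn => /matrixP/(_ (Ordinal lt) 0); rewrite !mxE /= subnn expr0 mul1r => /eqP.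
    by rewrite expf_eq0 => /andP[].
  apply: contraNneq pn => /matrixP/(_ (Ordinal n0) 0); rewrite !mxE /= expr0 mulr1 => /eqP.
  by rewrite expf_eq0 => /andP[].
apply/eqP; rewrite -(fmorph_eq0 (ratr : {rmorphism rat -> algC})) -det_map_mx -det_tr.
apply/det0P; exists w^T; first by rewrite -trmx0 (inj_eq trmx_inj).
rewrite -trmx_mul -[RHS]trmx0; congr trmx; apply/matrixP => i j; rewrite ord1 !mxE.
rewrite -(splitK i); case: (split i) => i' /=.
  rewrite -[RHS](block c0 c0z s0 i'); apply: eq_bigr => k _; rewrite !mxE.
  have -> : split (lshift d.-1 i') = inl i' := unsplitK (inl i').
  by rewrite mxE.
rewrite -[RHS](block c1 c1z s1 i'); apply: eq_bigr => k _; rewrite !mxE.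
have -> : split (rshift d.-1 i') = inr i' := unsplitK (inr i').
by rewrite mxE.
Qed.

(* Kronecker's substitution X = s, Y = s^K. *)
Lemma mpoly2_eq0 (F : numFieldType) (H : {mpoly F[2]}) :
  (forall x y, H.@[tnth [tuple x; y]] = 0) -> H = 0.
Proof.
move=> h; pose K := msize H; pose e (m : 'X_{1.. 2}) := (m ord0 + K * m ord_max)%N.
have mK m : m \in msupp H -> (m ord0 < K)%N.
  move/msize_mdeg_lt; apply: leq_ltn_trans; rewrite mdegE big_ord_recl; exact: leq_addr.
pose P : {poly F} := \sum_(m <- msupp H) H@_m *: 'X^(e m).
have P0 : P = 0.
  apply: poly_zero_inf => n; rewrite -[RHS](h n.+1%:R (n.+1%:R ^+ K)) mevalE /P horner_sum.
  apply: eq_bigr => m _; rewrite hornerZ hornerXn big_ord_recl big_ord1 !(tnth_nth 0) /= exprD exprM.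
  by congr (_ * (_ * _ ^+ m _)); apply: val_inj.
apply/mpolyP => m; rewrite mcoeff0; apply/eqP; rewrite mcoeff_eq0; apply/negP => mH.
have := congr1 (fun p : {poly F} => p`_(e m)) P0; rewrite coef0 coef_sum (bigD1_seq m) ?msupp_uniq //=.
rewrite coefZ coefXn eqxx mulr1 big_seq_cond big1 ?addr0 => [/eqP|m' /andP[mH' ne]].
  by rewrite mcoeff_eq0 mH.
rewrite coefZ coefXn (_ : (e m == e m') = false) ?mulr0 //; apply: contraNF ne => /eqP ee.
have h0 := mK m mH; have h1 := mK m' mH'.
have e0 : m ord0 = m' ord0.
  have em (z : 'X_{1.. 2}) : (e z %% K = z ord0 %% K)%N by rewrite /e addnC mulnC modnMDl.
  by have := congr1 (modn^~ K) ee; rewrite /= !em !modn_small.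
have e1 : m ord_max = m' ord_max.
  have K0 : (0 < K)%N by apply: leq_ltn_trans h0.
  by move: ee; rewrite /e e0 => /eqP; rewrite eqn_add2l eqn_pmul2l // => /eqP.
by rewrite (mon_eta m') (mon_eta m) e0 e1.
Qed.

(** Equal values at all rational points mean equal polynomials, by [mpoly2_eq0]. *)
Lemma noniso_forms d F1 F2 : F1 \is d.-homog -> F2 \is d.-homog -> ~ form_isomorphic F1 F2 ->
  noniso d (dehom d F1) (dehom d F2).
Proof.
move=> h1 h2 nis a b c e det h; apply: nis.
pose g : 'M[rat]_2 := \matrix_(i, j) nth 0 [:: nth 0 [:: a; b] j; nth 0 [:: c; e] j] i.
exists g; first by rewrite unitmxE unitfE det_mx2 !mxE.
apply/eqP; rewrite -subr_eq0; apply/eqP; apply: mpoly2_eq0 => x y.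
rewrite mevalB /form_act comp_mpoly_meval (meval_form _ _ h2) -h -(meval_form _ _ h1).
apply/eqP; rewrite subr_eq0; apply/eqP; rewrite /form_rat; apply: meval_eq => i.
rewrite tnth_mktuple raddf_sum /= big_ord_recl big_ord1 !mevalZ !mevalXU !(tnth_nth 0) !mxE.
by case: i => -[|[|i]] hi.
Qed.
End Forms.

Section SepformsOfForms.
Variable d : nat.
Hypothesis d3 : (3 <= d)%N.

Lemma bf_shear_int (f : {poly int}) r (x y : int) :
  bf d (shear_form d f r) x y = bf d f x (r%:R * x + y).
Proof.
apply: (@intr_inj rat); rewrite !rmorph_bf bf_shear; congr bf.
by rewrite rmorphD rmorphM /= rmorph_nat.
Qed.

Lemma values_shear (f : {poly int}) r m : (exists x y : int, m = bf d f x y) ->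
  exists x y : int, m = bf d (shear_form d f r) x y.
Proof.
by move=> [x [y ->]]; exists x, (y - r%:R * x); rewrite bf_shear_int addrC subrK.
Qed.

Lemma noniso_shear (f1 f2 : {poly int}) r1 r2 : noniso d f1 f2 ->
  noniso d (shear_form d f1 r1) (shear_form d f2 r2).
Proof.
move=> nis a b c e det h; apply: (nis (a - b * r2%:R) b (r1%:R * (a - b * r2%:R) + c - e * r2%:R) (r1%:R * b + e)).
  by apply: contraNneq det => <-; apply/eqP; ring.
move=> x y; have := h x (y - r2%:R * x); rewrite !bf_shear => e1.
have -> : bf d f2 x y = bf d f2 x (r2%:R * x + (y - r2%:R * x)) by congr bf; ring.
by rewrite -e1; congr bf; ring.
Qed.

Lemma common_form_values_count F1 F2 b (M := box_exponent d (b.+1 + b.+1)) : (0 < b)%N ->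
  Bin d F1 -> Bin d F2 -> ~ form_isomorphic F1 F2 ->
  exists C t0, forall t, (t0 <= t)%N ->
  atmost (C * t ^ (2 * M - b)) (fun m : int => [/\ (`|m| <= t ^ (d * M - (b + d + 1)))%N,
    form_values F1 m & form_values F2 m]).
Proof.
move=> b0 B1 B2 nis; have d0 : (0 < d)%N by apply: leq_trans d3.
have d2 : (2 <= d)%N by apply: leq_trans d3.
have sz F : (size (dehom d F) <= d.+1)%N by apply: size_poly.
have [r1 sf1] := shear_sepform d0 (sz F1) (bin_smooth d2 B1).
have [r2 sf2] := shear_sepform d0 (sz F2) (bin_smooth d2 B2).
move: B1 B2 => /andP[h1 _] /andP[h2 _].
have ni := noniso_shear (r1 := r1) (r2 := r2) (noniso_forms h1 h2 nis).
have [C [t0 hC]] := common_values_count d3 sf1 sf2 ni b0.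
exists C, t0 => t tt; apply: atmost_sub (hC t tt) => m [mt v1 v2]; split=> //.
  by apply: values_shear; apply/(form_values_bf m h1).
by apply: values_shear; apply/(form_values_bf m h2).
Qed.
End SepformsOfForms.

From mathcomp Require Import all_classical all_reals all_analysis.
Import numFieldNormedType.Exports.
Local Open Scope ring_scope.
Local Open Scope classical_set_scope.

(** * The asymptotic bound *)

Lemma calN_leq F1 F2 N n : atmost n (fun m : int => [/\ (`|m| <= N)%N, form_values F1 m & form_values F2 m]) ->
  (calN F1 F2 N <= n)%N.
Proof.
rewrite /calN; set A := _ `&` _ => h.
have AE m : A m -> [/\ (`|m| <= N)%N, form_values F1 m & form_values F2 m].
  by move=> [[v1 v2] mN]; split=> //; move: mN; rewrite /= -lez_nat abszE.
have fA : finite_set A.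
  apply: (@sub_finite_set _ _ [set` int_range N]); last exact: finite_seq.
  by move=> m /AE[mN _ _]; rewrite /= mem_int_range.
apply: (h (finmap.enum_fset (fset_set A))); first exact: finmap.fset_uniq.
by move=> m mA; apply: AE; move: mA; rewrite [_ \in _](in_fset_set fA) inE.
Qed.

(** An integral substitute for the e-th root, which transfers bounds known at the powers t^e to
    every N. *)
Lemma root_between (R : realType) e N : (0 < e)%N -> (0 < N)%N ->
  exists2 k, (N <= k.+1 ^ e)%N & k%:R <= N%:R `^ (e%:R^-1) :> R.
Proof.
move=> e0 N0; have ex : exists k, (N <= k.+1 ^ e)%N.
  by exists N; apply: leq_trans (leqnSn N) _; rewrite -[X in (X <= _)%N]expn1 leq_pexp2l.
exists (ex_minn ex); case: ex_minnP => // k hk min.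
case: k hk min => [|k] hk min; first exact: powR_ge0.
have lt : (k.+1 ^ e <= N)%N.
  by rewrite leqNgt; apply/negP => lt; have := min k (ltnW lt); rewrite ltnn.
have -> : k.+1%:R = (k.+1%:R ^+ e) `^ (e%:R^-1) :> R.
  by rewrite -powR_mulrn // -powRrM mulfV ?powRr1 // pnatr_eq0 -lt0n.
by rewrite ge0_ler_powR ?invr_ge0 ?nnegrE ?exprn_ge0 // -natrX ler_nat.
Qed.

Theorem theorem1p1 (R : realType) (d : nat) (hd : (3 <= d)%N) :
  exists2 theta : R, theta < 2 / d%:R &
    forall eps : R, 0 < eps ->
    forall F1 F2 : mpoly.mpoly 2 int,
      Bin d F1 -> Bin d F2 -> ~ form_isomorphic F1 F2 ->
      (fun N : nat => (calN F1 F2 N)%:R : R)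
        =O_\oo (fun N : nat => N%:R `^ (theta + eps)).
Proof.
(* [b] and [M] depend on [d] alone, which makes the exponent independent of the forms; only [C] and
   [t0] depend on them. *)
pose b := (2 * d + 3)%N; have b0 : (0 < b)%N by rewrite addn_gt0 orbT.
pose M := box_exponent d (b.+1 + b.+1).
pose g := (2 * M - b)%N; pose e := (d * M - (b + d + 1))%N.
have eg : (d * g < 2 * e)%N by apply: exponent_lt.
have e0 : (0 < e)%N by move: eg; case: (e).
have d0 : (0 < d)%N by apply: leq_trans hd.
exists (g%:R / e%:R); first by rewrite ltr_pdivrMr ?ltr0n // mulrAC ltr_pdivlMr ?ltr0n // -!natrM ltr_nat mulnC.
move=> eps eps0 F1 F2 B1 B2 nis.
have [C [t0 hC]] := common_form_values_count hd b0 B1 B2 nis; rewrite -/M -/g -/e in hC.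
apply/eqO_exP; exists ((C * (t0 + 2) ^ g)%N%:R + 1); first by rewrite ltr_pwDr // ler0n.
exists 1%N => // N /= N1; have [k Nk kN] := root_between R e0 N1.
set x := _ `^ _ in kN.
have N1' : 1 <= N%:R :> R by rewrite ler1n.
have x1 : 1 <= x by rewrite -(powRr0 N%:R) ler_powR // invr_ge0 ler0n.
(* Adding [t0] makes the count available for every N >= 1 and enlarges [T] by a constant factor
   only. *)
pose T := (t0 + k.+1)%N.
have Tx : T%:R <= (t0 + 2)%:R * x.
  rewrite /T -addn1 addnA !natrD mulrDl; have := ler_peMr (ler0n R t0) x1; move: kN x1; lra.
have cN : (calN F1 F2 N <= C * T ^ g)%N.
  apply: calN_leq; apply: atmost_sub (hC T (leq_addr _ _)) => m [mN v1 v2]; split=> //.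
  apply: leq_trans mN _; apply: leq_trans Nk _; apply: leqXn; exact: leq_addl.
have xg : x ^+ g = N%:R `^ (g%:R / e%:R).
  by rewrite -powR_mulrn ?powR_ge0 // /x -powRrM mulrC.
rewrite ger0_norm ?ler0n // (ger0_norm (powR_ge0 _ _)).
apply: le_trans (_ : (C * T ^ g)%:R <= _); first by rewrite ler_nat.
apply: le_trans (_ : (C * (t0 + 2) ^ g)%:R * x ^+ g <= _).
  rewrite !natrM -mulrA ler_wpM2l ?ler0n // !natrX -exprMn lerXn2r // nnegrE ?ler0n //.
  by rewrite mulr_ge0 ?ler0n // (le_trans _ x1).
apply: ler_pM; rewrite ?ler0n ?exprn_ge0 ?(le_trans _ x1) ?lerDl //.
by rewrite xg ler_powR // lerDl ltW.
Qed.
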